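(* Let $m$ be a positive integer, let $\mathbb D\subset\mathbb C$ be the unit disk or $\mathbb C$ itself, and let $$\eta=\lambda^{-1}\begin{pmatrix}0&\hat B_1\\-\hat B_1^tI_{1,1}&0\end{pmatrix}dz,\qquad \hat B_1=\begin{pmatrix}h_{11}&ih_{11}&\cdots&h_{m1}&ih_{m1}\\ \hat h_{11}&i\hat h_{11}&\cdots&\hat h_{m1}&i\hat h_{m1}\end{pmatrix},$$ be a normalized potential on $\mathbb D$, where $h_{j1}\,dz,\hat h_{j1}\,dz$ ($j=1,\dots,m$) are meromorphic $1$-forms on $\mathbb D$. Let $\mathcal F=Y\wedge\hat Y$ be the corresponding isotropic harmonic map into $SO^+(1,2m+1)/(SO^+(1,1)\times SO(2m))$. Then $[Y]$ and $[\hat Y]$ are a pair of H-totally isotropic adjoint Willmore surfaces in $S^{2m}$ on the points where they are immersed. Moreover, $\mathcal F$ is a harmonic map of finite uniton number at most $2$.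
   Context: **Light cone model.** $\mathbb R^{2m+2}_1$ is $\mathbb R^{2m+2}$ with $\langle x,w\rangle=-x_1w_1+\sum_{j\ge2}x_jw_j$, extended complex bilinearly; $I_{1,1}=\mathrm{diag}(-1,1)$. $S^{2m}$ is identified with the projectivized forward light cone $\{[x]:\langle x,x\rangle=0,\ x_1>0\}$. For a conformal immersion $y:M\to S^{2m}$ of a Riemann surface and a local complex coordinate $z$, the canonical lift $Y$ is the lift of $y$ to the forward light cone with $|dY|^2=|dz|^2$. Put $V=\mathrm{Span}_{\mathbb R}\{Y,\mathrm{Re}\,Y_z,\mathrm{Im}\,Y_z,Y_{z\bar z}\}$ (a Lorentzian rank-4 bundle), $V^\perp$ its orthogonal complement (the normal bundle), $D$ the connection on $V^\perp$ induced by projection. $N\in\Gamma(V)$ is determined by $\langle N,Y_z\rangle=\langle N,Y_{\bar z}\rangle=\langle N,N\rangle=0$, $\langle N,Y\rangle=-1$. The conformal Hopf differential $\kappa\in\Gamma(V^\perp_{\mathbb C})$ and Schwarzian $s$ are defined by $Y_{zz}=-\frac s2Y+\kappa$. $y$ is Willmore (a critical point of $2i\int\langle\kappa,\bar\kappa\rangle dz\wedge d\bar z$) iff $D_{\bar z}D_{\bar z}\kappa+\frac{\bar s}2\kappa=0$. **H-totally isotropic.** $y$ is totally isotropic if $\langle\partial_z^jY,\partial_z^lY\rangle=0$ for all $j,l\ge1$. Then locally there is an isotropic frame $E_1,\dots,E_m$ with $\langle E_j,E_l\rangle=0$, $\langle E_j,\bar E_l\rangle=2\delta_{jl}$, $Y_z\in\mathrm{Span}_{\mathbb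 C}\{E_1\}\bmod Y$, $\partial_z^jY\in\mathrm{Span}_{\mathbb C}\{E_j\}\bmod\mathrm{Span}_{\mathbb C}\{Y,E_1,\dots,E_{j-1}\}$ for $j=2,\dots,m$, and $\{E_j,\bar E_j\}_{j=2}^m$ a basis of $V^\perp_{\mathbb C}$. $y$ is H-totally isotropic if moreover $D_{\bar z}E_j\in\mathrm{Span}_{\mathbb C}\{E_2,\dots,E_m\}$ for all $j=2,\dots,m$. **Adjoint transform.** With $Y$ the canonical lift of a Willmore surface $y$ and $\mu$ a complex function, put $\hat Y=N+\bar\mu Y_z+\mu Y_{\bar z}+\frac12|\mu|^2Y$. The map $[\hat Y]$ is an adjoint transform of $y$ if $\mu_z-\frac{\mu^2}2-s=0$ and $\langle D_{\bar z}\kappa+\frac{\bar\mu}2\kappa,\,D_{\bar z}\kappa+\frac{\bar\mu}2\kappa\rangle=0$. A pair of adjoint Willmore surfaces is a pair of Willmore surfaces each of which is an adjoint transform of the other. **Harmonic map of a normalized potential (DPW).** $G=SO^+(1,2m+1)$, $K=SO^+(1,1)\times SO(2m)$, $\sigma=\mathrm{Ad}(\mathrm{diag}(-I_2,I_{2m}))$, $\mathfrak g=\mathfrak k\oplus\mathfrak p$. A normalized potential on $\mathbb D$ is a meromorphic $1$-form $\eta=\lambda^{-1}\eta_{-1}(z)dz$ with $\eta_{-1}$ taking values in $\mathfrak p^{\mathbb C}$, such that $F_-^{-1}dF_-=\eta$, $F_-(0,\lambda)=I$ has a meromorphic solution $F_-(z,\lambda)$. On an open subset $\mathbb D_{\mathfrak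 I}\ni 0$ of $\mathbb D$ one has the Iwasawa decomposition $F_-=F\cdot F_+$, with $F=F(z,\bar z,\lambda)$, $\lambda\in S^1$, a $\sigma$-twisted loop in $G$, $F(0,0,\lambda)=I$, and $F_+$ a $\sigma$-twisted loop in $G^{\mathbb C}=SO^+(1,2m+1,\mathbb C)$ extending holomorphically to $|\lambda|\le1$, with $F_+|_{\lambda=0}$ in the subgroup $\mathfrak B$ of $K^{\mathbb C}$ from the Iwasawa decomposition $K^{\mathbb C}=K\mathfrak B$. Then $F$ is the extended frame of a harmonic map $\mathcal F:\mathbb D_{\mathfrak I}\to G/K$. Writing $F=(e_0,\hat e_0,\psi_1,\hat\psi_1,\dots,\psi_m,\hat\psi_m)$, one sets $Y=\frac{\sqrt2}2(e_0-\hat e_0)$, $\hat Y=\frac{\sqrt2}2(e_0+\hat e_0)$, so that $\mathcal F=Y\wedge\hat Y$; this is the corresponding isotropic harmonic map. **Finite uniton number.** For a harmonic map $f:M\to G$ with $A=f^{-1}df=A'+A''$ (types $(1,0)$, $(0,1)$), an extended solution is a map $\Phi(z,\lambda)$ into based loops in $G$ ($\Phi(\cdot,1)=I$) with $\Phi^{-1}d\Phi=\frac12(1-\lambda^{-1})A'+\frac12(1-\lambda)A''$. Let $\Omega^k_{alg}G$ be the set of based loops $\gamma$ in $G$ with finite Fourier expansion and $\mathrm{Ad}(\gamma)=\sum_{|j|\le k}\lambda^jT_j$. $f$ has finite uniton number at most $k$ if it has an extended solution $\Phi$ with $\Phi(M)\subset\Omega^k_{alg}G$. A harmonic map $\mathcal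 F$ into $G/K$ has finite uniton number at most $k$ if its composition with the Cartan map $G/K\to G$, $gK\mapsto g\sigma(g)^{-1}$, does.
   Formalization: ''H-totally isotropic'' asks for the adapted isotropic frame with the H-condition only near the points of a dense subset of the immersed points, not around every one; around every point the claim fails (m=3, h=(1/2,1/2,z²/2), ĥ=(1/2,-1/2,z²/2), at z=0). *)

(* Defs.v *)
From HB Require Import structures.
From mathcomp Require Import all_boot all_order all_algebra complex.
From mathcomp Require Import boolp classical_sets reals topology normedtype derive.
Set Implicit Arguments.
Unset Strict Implicit.
Unset Printing Implicit Defensive.
Import Order.TTheory GRing.Theory Num.Theory numFieldNormedType.Exports.
Local Open Scope ring_scope.
Local Open Scope classical_set_scope.

(* R[i] seen as a numClosedFieldType, so that it carries the topology that
   numFieldNormedType puts on every numFieldType.  There 'i, z^* and `|z| are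
   the imaginary unit, conjugation and modulus of R[i]. *)
Definition Cx (R : realType) : numClosedFieldType := R[i].

Section Calculus.
Variable R : realType.
Local Notation C := (Cx R).

Definition re_along (v : C) (f : C -> C) (z : C) (t : R) : R :=
  complex.Re (f (z + (t%:C)%C * v)).
Definition im_along (v : C) (f : C -> C) (z : C) (t : R) : R :=
  complex.Im (f (z + (t%:C)%C * v)).

(* Real directional derivative.  The derivative 'D_v of the library is not used
   for f : C -> C: over the field C its increments are complex, so it only
   exists for holomorphic functions. *)
Definition dir_derivable (v : C) (f : C -> C) (z : C) : Prop :=
  derivable (re_along v f z) 0 1 /\ derivable (im_along v f z) 0 1.
Definition dir_derive (v : C) (f : C -> C) (z : C) : C :=
  Complex ((re_along v f z)^`() 0) ((im_along v f z)^`() 0).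

Fixpoint Cn (n : nat) (U : set C) (f : C -> C) : Prop :=
  (forall z, U z -> {for z, continuous f}) /\
  match n with
  | 0%N => True
  | k.+1 =>
      (forall z, U z -> dir_derivable 1 f z /\ dir_derivable 'i f z) /\
      Cn k U (dir_derive 1 f) /\ Cn k U (dir_derive 'i f)
  end.
Definition smooth (U : set C) (f : C -> C) : Prop := forall n, Cn n U f.

Definition dz (f : C -> C) (z : C) : C :=
  (dir_derive 1 f z - 'i * dir_derive 'i f z) / 2.
Definition dzb (f : C -> C) (z : C) : C :=
  (dir_derive 1 f z + 'i * dir_derive 'i f z) / 2.

Definition holomorphic (U : set C) (f : C -> C) : Prop :=
  smooth U f /\ forall z, U z -> dzb f z = 0.
Definition holomorphic_at (f : C -> C) (z : C) : Prop :=
  exists U : set C, [/\ open U, U z & holomorphic U f].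
Definition pole_at (f : C -> C) (p : C) : Prop :=
  exists (n : nat) (g : C -> C),
    [/\ (0 < n)%N, holomorphic_at g p, g p != 0 &
        \forall w \near p, w != p -> f w = g w / (w - p) ^+ n].
(* The value of f at a pole is irrelevant. *)
Definition meromorphic (D : set C) (f : C -> C) : Prop :=
  forall z, D z -> holomorphic_at f z \/ pole_at f z.

Section Entrywise.
Variables p q : nat.
Implicit Type M : C -> 'M[C]_(p, q).

Definition mxsmooth (U : set C) M : Prop :=
  forall i j, smooth U (fun w => M w i j).
Definition mxholomorphic (U : set C) M : Prop :=
  forall i j, holomorphic U (fun w => M w i j).
Definition mxholomorphic_at M (z : C) : Prop :=
  forall i j, holomorphic_at (fun w => M w i j) z.
Definition mxmeromorphic (D : set C) M : Prop :=
  forall i j, meromorphic D (fun w => M w i j).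
Definition mxdir (v : C) M (z : C) : 'M[C]_(p, q) :=
  \matrix_(i, j) dir_derive v (fun w => M w i j) z.
Definition mxdz M (z : C) : 'M[C]_(p, q) :=
  \matrix_(i, j) dz (fun w => M w i j) z.
Definition mxdzb M (z : C) : 'M[C]_(p, q) :=
  \matrix_(i, j) dzb (fun w => M w i j) z.
Definition mxconj (A : 'M[C]_(p, q)) : 'M[C]_(p, q) := map_mx (fun x => x^*) A.

End Entrywise.

Definition circle : set C := [set lam | `|lam| = 1].

End Calculus.

Section LightCone.
Variable R : realType.
Local Notation C := (Cx R).

(* diag(-1, 1, ..., 1) *)
Definition mink (n : nat) : 'M[C]_n.+1 :=
  diag_mx (\row_j (if j == ord0 then -1 else 1)).

Variable n : nat.
Implicit Types (U : set C) (y yh : C -> 'cV[C]_n.+1)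
  (L xi kappa N : C -> 'cV[C]_n.+2).

Definition ip (x w : 'cV[C]_n.+2) : C := (x^T *m mink n.+1 *m w) ord0 ord0.

(* Points of S^n are written as vectors of R^{n+1}, [x] being
   (x_2, ..., x_{n+2}) / x_1. *)
Definition sphere_point (x : 'cV[C]_n.+2) : 'cV[C]_n.+1 :=
  \col_j (x (lift ord0 j) ord0 / x ord0 ord0).
Definition on_cone_over (p : 'cV[C]_n.+1) (x : 'cV[C]_n.+2) : Prop :=
  [/\ x \is a mxOver Num.real, ip x x = 0, 0 < x ord0 ord0 & sphere_point x = p].

Definition immersed_at y (z : C) : Prop :=
  \rank (row_mx (mxdir 1 y z) (mxdir 'i y z)) = 2.
Definition conformal_immersion U y : Prop :=
  mxsmooth U y /\
  forall z, U z -> immersed_at y z /\ (mxdz y z)^T *m mxdz y z = 0.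

(* |dL|^2 = |dz|^2 means <L_z, L_z> = 0 and <L_z, L_zb> = 1/2. *)
Definition canonical_lift U y L : Prop :=
  mxsmooth U L /\
  forall z, U z -> [/\ on_cone_over (y z) (L z),
    ip (mxdz L z) (mxdz L z) = 0 & ip (mxdz L z) (mxdzb L z) = 1 / 2].

(* The columns L, L_z, L_zb, L_{z zb} span the complexification of V. *)
Definition V_basis L (z : C) : 'M[C]_(n.+2, (1 + 1) + (1 + 1)) :=
  row_mx (row_mx (L z) (mxdz L z)) (row_mx (mxdzb L z) (mxdz (mxdzb L) z)).
Definition in_V L (z : C) (x : 'cV[C]_n.+2) : Prop :=
  exists c, x = V_basis L z *m c.
Definition in_Vperp L (z : C) (x : 'cV[C]_n.+2) : Prop :=
  (V_basis L z)^T *m mink n.+1 *m x = 0.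
(* Orthogonal projection onto the complexified V^perp, through the Gram matrix
   of the basis of V. *)
Definition Vperp_proj L (z : C) (x : 'cV[C]_n.+2) : 'cV[C]_n.+2 :=
  let B := V_basis L z in
  x - B *m invmx (B^T *m mink n.+1 *m B) *m (B^T *m mink n.+1 *m x).
(* D_{zb} *)
Definition nabla_zb L xi (z : C) : 'cV[C]_n.+2 := Vperp_proj L z (mxdzb xi z).

Definition hopf_schwarzian U L kappa (s : C -> C) : Prop :=
  forall z, U z -> in_Vperp L z (kappa z) /\
    mxdz (mxdz L) z = - (s z / 2) *: L z + kappa z.

Definition N_section U L N : Prop :=
  forall z, U z -> [/\ N z \is a mxOver Num.real, in_V L z (N z),
    ip (N z) (mxdz L z) = 0 /\ ip (N z) (mxdzb L z) = 0,
    ip (N z) (N z) = 0 & ip (N z) (L z) = -1].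

(* Willmore is expressed by the Willmore equation, i.e. the Euler-Lagrange
   equation of the integral of 2i <kappa, conj kappa> dz /\ dzb. *)
Definition willmore_surface U y : Prop :=
  conformal_immersion U y /\
  exists L kappa s,
    [/\ canonical_lift U y L, hopf_schwarzian U L kappa s &
        forall z, U z ->
          nabla_zb L (nabla_zb L kappa) z + ((s z)^* / 2) *: kappa z = 0].

Definition adjoint_transform U y yh : Prop :=
  exists L kappa s N (mu : C -> C),
    [/\ canonical_lift U y L, hopf_schwarzian U L kappa s, N_section U L N,
        smooth U mu &
        forall z, U z ->
          let zeta := nabla_zb L kappa z + ((mu z)^* / 2) *: kappa z in
          [/\ on_cone_over (yh z)
                (N z + (mu z)^* *: mxdz L z + mu z *: mxdzb L z
                 + (`|mu z| ^+ 2 / 2) *: L z),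
              dz mu z - mu z ^+ 2 / 2 - s z = 0 &
              ip zeta zeta = 0]].

Definition totally_isotropic U L : Prop :=
  forall z, U z -> forall j l : nat, (0 < j)%N -> (0 < l)%N ->
    ip (iter j (@mxdz R n.+2 1) L z) (iter l (@mxdz R n.+2 1) L z) = 0.

(* Only E 1, ..., E m matter. *)
Definition isotropic_frame (m : nat) (O : set C) L
    (E : nat -> C -> 'cV[C]_n.+2) : Prop :=
  (forall j, (1 <= j <= m)%N -> mxsmooth O (E j)) /\
  forall z, O z ->
    [/\ forall j l, (1 <= j <= m)%N -> (1 <= l <= m)%N ->
          ip (E j z) (E l z) = 0 /\
          ip (E j z) (mxconj (E l z)) = (if j == l then 2 else 0),
        forall j, (1 <= j <= m)%N ->
          exists (a b : C) (c : nat -> C),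
            iter j (@mxdz R n.+2 1) L z
            = a *: E j z + b *: L z + \sum_(1 <= k < j) c k *: E k z,
        forall j, (2 <= j <= m)%N ->
          in_Vperp L z (E j z) /\ in_Vperp L z (mxconj (E j z)),
        forall x, in_Vperp L z x ->
          exists c d : nat -> C,
            x = \sum_(2 <= k < m.+1) (c k *: E k z + d k *: mxconj (E k z)) &
        forall c d : nat -> C,
          \sum_(2 <= k < m.+1) (c k *: E k z + d k *: mxconj (E k z)) = 0 ->
          forall k, (2 <= k <= m)%N -> c k = 0 /\ d k = 0].

Definition H_condition (m : nat) (O : set C) L
    (E : nat -> C -> 'cV[C]_n.+2) : Prop :=
  forall z, O z -> forall j, (2 <= j <= m)%N ->
    exists c : nat -> C,
      nabla_zb L (E j) z = \sum_(2 <= k < m.+1) c k *: E k z.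

(* The local frames are asked for near the points of a dense open subset of U
   only: a continuous isotropic frame adapted to the flag of the derivatives of
   L may fail to exist around the (nowhere dense) points where the dimension of
   this flag drops, for instance at an umbilic point when m >= 3. *)
Definition H_totally_isotropic (m : nat) U y : Prop :=
  exists L, [/\ canonical_lift U y L, totally_isotropic U L &
    U `<=` closure [set z0 | exists (O : set C) (E : nat -> C -> 'cV[C]_n.+2),
      [/\ open O, O z0, O `<=` U, isotropic_frame m O L E & H_condition m O L E]]].

End LightCone.

Section Groups.
Variable R : realType.
Local Notation C := (Cx R).

(* SO^+(1, n+1) *)
Definition SOp (n : nat) (A : 'M[C]_n.+2) : Prop :=
  [/\ A \is a mxOver Num.real, A^T *m mink R n.+1 *m A = mink R n.+1,
      \det A = 1 & 0 < A ord0 ord0].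
(* SO^+(1, n+1, C), the identity component of O(1, n+1, C) *)
Definition SOC (n : nat) (A : 'M[C]_n.+2) : Prop :=
  A^T *m mink R n.+1 *m A = mink R n.+1 /\ \det A = 1.

Section UnitonNumber.
Variable n : nat.
Implicit Types (M : set C) (f : C -> 'M[C]_n.+2).

Definition mc_z f (z : C) : 'M[C]_n.+2 := invmx (f z) *m mxdz f z.
Definition mc_zb f (z : C) : 'M[C]_n.+2 := invmx (f z) *m mxdzb f z.

(* Harmonic maps into SO^+(1, n+1): d * (f^-1 df) = 0. *)
Definition harmonic_in_G M f : Prop :=
  [/\ mxsmooth M f, forall z, M z -> SOp (f z) &
      forall z, M z -> mxdzb (mc_z f) z + mxdz (mc_zb f) z = 0].

Definition extended_solution M f (Phi : C -> C -> 'M[C]_n.+2) : Prop :=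
  (forall lam : C, circle lam -> mxsmooth M (Phi^~ lam)) /\
  forall z, M z -> Phi z 1 = 1%:M /\
    forall lam : C, circle lam ->
      [/\ SOp (Phi z lam),
          invmx (Phi z lam) *m mxdz (Phi^~ lam) z
            = ((1 - lam^-1) / 2) *: mc_z f z &
          invmx (Phi z lam) *m mxdzb (Phi^~ lam) z
            = ((1 - lam) / 2) *: mc_zb f z].

Definition algebraic_loop (k : nat) (gam : C -> 'M[C]_n.+2) : Prop :=
  [/\ gam 1 = 1%:M,
      forall lam : C, circle lam -> SOp (gam lam),
      exists (d : nat) (c : nat -> 'M[C]_n.+2), forall lam : C, circle lam ->
        gam lam = \sum_(j < (2 * d).+1) lam ^ (j%:Z - d%:Z) *: c j &
      exists T : nat -> {linear 'M[C]_n.+2 -> 'M[C]_n.+2},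
        forall lam : C, circle lam ->
        forall X, X^T *m mink R n.+1 + mink R n.+1 *m X = 0 ->
        gam lam *m X *m invmx (gam lam)
          = \sum_(j < (2 * k).+1) lam ^ (j%:Z - k%:Z) *: T j X].

Definition finite_uniton_G (k : nat) M f : Prop :=
  harmonic_in_G M f /\
  exists Phi, extended_solution M f Phi /\
    forall z, M z -> algebraic_loop k (Phi z).

End UnitonNumber.

Section DPW.
Variable m : nat.
Local Notation dim := (m.*2.+2).
Implicit Types (A : 'M[C]_dim) (D DI : set C)
  (eta : C -> 'M[C]_dim) (Fm F Fp : C -> C -> 'M[C]_dim).

Definition sigma A : 'M[C]_dim :=
  let S : 'M[C]_(2 + m.*2) := block_mx (- 1%:M) 0 0 1%:M in S *m A *m S.

(* K^C = SO^+(1, 1, C) x SO(2m, C) and K = SO^+(1, 1) x SO(2m) *)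
Definition KC A : Prop :=
  SOC A /\ exists (a : 'M[C]_2) (b : 'M[C]_(m.*2)),
    A = block_mx a 0 0 b /\ \det a = 1.
Definition K A : Prop := SOp A /\ KC A.

(* Any subgroup that can serve as the second factor in K^C = K B. *)
Definition iwasawa_subgroup (B : set 'M[C]_dim) : Prop :=
  [/\ B `<=` KC, B 1%:M,
      (forall A A', B A -> B A' -> B (A *m A')) /\
      (forall A, B A -> B (invmx A)),
      forall A, KC A -> exists k b, [/\ K k, B b & A = k *m b] &
      forall A, K A -> B A -> A = 1%:M].

(* A map to G/K, given by a frame F, composed with gK |-> g sigma(g)^-1. *)
Definition cartan (F : C -> 'M[C]_dim) (z : C) : 'M[C]_dim :=
  F z *m invmx (sigma (F z)).
Definition finite_uniton_number_at_most (k : nat) DI (F : C -> 'M[C]_dim) :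
  Prop := finite_uniton_G k DI (cartan F).

(* Column k of B_1 belongs to the pair of index k / 2. *)
Definition pair_index (k : 'I_(m.*2)) : 'I_m :=
  Ordinal (etrans (ltn_half_double k m) (ltn_ord k)).
Definition B1 (h hh : 'I_m -> C -> C) (z : C) : 'M[C]_(2, m.*2) :=
  \matrix_(r, k) ((if odd k then 'i else 1)
                  * (if r == ord0 then h else hh) (pair_index k) z).
Definition eta_m1 (h hh : 'I_m -> C -> C) (z : C) : 'M[C]_dim :=
  (block_mx 0 (B1 h hh z) (- ((B1 h hh z)^T *m mink R 1)) 0 : 'M_(2 + m.*2)).

(* Fm is the meromorphic solution of Fm^-1 dFm = lam^-1 eta dz, Fm(0) = I. *)
Definition normalized_potential D eta Fm : Prop :=
  mxmeromorphic D eta /\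
  forall lam : C, circle lam ->
    [/\ mxmeromorphic D (Fm^~ lam), Fm 0 lam = 1%:M &
        forall z, D z -> mxholomorphic_at (Fm^~ lam) z ->
          mxholomorphic_at eta z ->
          mxdz (Fm^~ lam) z = lam^-1 *: (Fm z lam *m eta z)].

Definition iwasawa_decomposition (B : set 'M[C]_dim) DI Fm F Fp : Prop :=
  [/\ forall lam : C, circle lam ->
        [/\ mxholomorphic DI (Fm^~ lam), mxsmooth DI (F^~ lam) &
            F 0 lam = 1%:M],
      forall (z lam : C), DI z -> circle lam ->
        [/\ SOp (F z lam), F z (- lam) = sigma (F z lam) &
            Fm z lam = F z lam *m Fp z lam],
      forall z lam, DI z -> `|lam| <= 1 ->
        SOC (Fp z lam) /\ Fp z (- lam) = sigma (Fp z lam),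
      forall z, DI z ->
        mxholomorphic [set lam | `|lam| < 1] (Fp z) /\
        forall i j, {within [set lam : C | `|lam| <= 1],
                       continuous (fun lam => Fp z lam i j)} &
      forall z, DI z -> B (Fp z 0)].

Definition col0 (A : 'M[C]_dim) : 'cV[C]_dim := col ord0 A.
Definition col1 (A : 'M[C]_dim) : 'cV[C]_dim := col (lift ord0 ord0) A.
Definition Y_of (A : 'M[C]_dim) : 'cV[C]_dim :=
  (sqrtC 2 / 2) *: (col0 A - col1 A).
Definition Yhat_of (A : 'M[C]_dim) : 'cV[C]_dim :=
  (sqrtC 2 / 2) *: (col0 A + col1 A).

End DPW.
End Groups.

(* Main.v *)
(* The potential is an eigenvector of a circle symmetry: let rot(lam) act by lam on
   the isotropic vectors with entries 1, i in one pair of coordinates and by 1/lam on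
   their conjugates.  Then rot(lam) eta rot(lam)^-1 is lam times eta, so that
   Fm(z, lam) = rot(lam)^-1 Fm(z, 1) rot(lam).  In the Iwasawa decomposition the
   uniqueness argument (a disc algebra function that is real on the circle is
   constant) transfers the symmetry to Fp, and evaluation at lam = 0 shows that the
   isotropic m-plane N0 of the conjugate vectors is mapped by Fp(z, 1) into
   vectors whose first two entries are 0.  Hence V = Fm(z, 1) N0 = F(z, 1) Fp(z, 1) N0
   is holomorphic, spans a maximal isotropic subbundle of the complexified orthogonal
   complement of Y and Yh, and its derivative is orthogonal to V.

   This is all that is needed. Let W be the conjugate of the span of V, so that W
   is preserved by both d/dz and d/dzbar modulo Y and Yh. It contains the
   component of Y_z orthogonal to Y and Yh (and likewise that of Yh_z), so by
   induction all z-derivatives of Y lie in W modulo Y and Yh. Total isotropy, the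
   Willmore equation, the equations of an adjoint transform and the frames E_j
   follow from the structure equations of W. The data are symmetric in Y and Yh.
   Finally, with pi_0, pi_W, pi_V the projections onto the spans of Y and Yh, of W
   and of V, the loop pi_0 + lam pi_W + pi_V / lam is, up to conjugation by a
   constant, an extended solution of the Cartan embedding; its adjoint action has
   degree 2 in lam. *)

(* Smoothness is given by iterated partial derivatives alone, so the symmetry of mixed derivatives
   and the derivative in an arbitrary direction come from the mean value theorem. Reality on the
   circle is pushed into the disc by a maximum principle. The rotation symmetry of [Fm] comes from a
   product that is flat off the poles; its local constants are matched across the poles along a
   segment of the star-shaped [D].

   The lift [Y_of] need not be canonical. Multiplying [Y] by a positive function and [Yh] by its
   inverse keeps the pair adapted with the same [V], and changes only the scale of q and the
   coefficient w in Y_z = q - w Y. Hence the canonical lift can be chosen last; then mu = 2 w and s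
   = 2 w_z - 2 w ^ 2. The Willmore equation reduces to two first order equations, D_zb kappa = -
   conj w kappa + theta / 2 and D_zb theta = conj w theta modulo V, whose opposite signs cancel
   theta.

   The values of the extended solution lie in [SOp] because each is a square, taken at a square root
   of lam. *)
Require Import Defs.
From mathcomp Require Import all_boot all_order all_algebra complex.
From mathcomp Require Import boolp classical_sets reals topology normedtype derive.
From mathcomp Require Import functions realfun ring lra.
Set Implicit Arguments.
Unset Strict Implicit.
Unset Printing Implicit Defensive.
Import Order.TTheory GRing.Theory Num.Theory numFieldNormedType.Exports.
Local Open Scope ring_scope.
Local Open Scope classical_set_scope.

(** * Calculus on the complex plane *)

Section ComplexParts.
Variable R : realType.
Local Notation C := (Cx R).
Local Notation Re := (@complex.Re R).
Local Notation Im := (@complex.Im R).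
Implicit Types x y : C.

Lemma conjE x : x^* = Complex (Re x) (- Im x).
Proof. by case: x. Qed.
Lemma Cadd_def x y : x + y = Complex (Re x + Re y) (Im x + Im y).
Proof. by case: x; case: y. Qed.
Lemma Cmul_def x y :
  x * y = Complex (Re x * Re y - Im x * Im y) (Re x * Im y + Im x * Re y).
Proof. by case: x; case: y. Qed.
Lemma Copp_def x : - x = Complex (- Re x) (- Im x).
Proof. by case: x. Qed.
Lemma Cinv_def x : x^-1 = Complex (Re x / (Re x ^+ 2 + Im x ^+ 2)) (- Im x / (Re x ^+ 2 + Im x ^+ 2)).
Proof. by case: x => a b; rewrite /= mulNr. Qed.
Lemma Cnorm_def x : `|x| = (Num.sqrt (Re x ^+ 2 + Im x ^+ 2))%:C%C.
Proof. by case: x. Qed.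
Lemma ReaddE x y : Re (x + y) = Re x + Re y. Proof. by rewrite Cadd_def. Qed.
Lemma ImaddE x y : Im (x + y) = Im x + Im y. Proof. by rewrite Cadd_def. Qed.
Lemma RemulE x y : Re (x * y) = Re x * Re y - Im x * Im y. Proof. by rewrite Cmul_def. Qed.
Lemma ImmulE x y : Im (x * y) = Re x * Im y + Im x * Re y. Proof. by rewrite Cmul_def. Qed.
Lemma ReoppE x : Re (- x) = - Re x. Proof. by rewrite Copp_def. Qed.
Lemma ImoppE x : Im (- x) = - Im x. Proof. by rewrite Copp_def. Qed.
Lemma ReconjE x : Re (x^*) = Re x. Proof. by rewrite conjE. Qed.
Lemma ImconjE x : Im (x^*) = - Im x. Proof. by rewrite conjE. Qed.
Lemma ReiE : Re ('i : C) = 0. Proof. by []. Qed.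
Lemma ImiE : Im ('i : C) = 1. Proof. by []. Qed.
Lemma ReCE (t : R) : Re (t%:C)%C = t. Proof. by []. Qed.
Lemma ImCE (t : R) : Im (t%:C)%C = 0. Proof. by []. Qed.
Lemma Ceq x y : Re x = Re y -> Im x = Im y -> x = y.
Proof. by case: x; case: y => a b c d /= -> ->. Qed.
Lemma CReIm x : x = (Re x)%:C%C + 'i * (Im x)%:C%C.
Proof. by apply: Ceq; rewrite !(ReaddE, RemulE, ImaddE, ImmulE) /=; ring. Qed.

Lemma le_Re_norm x : (`|Re x|)%:C%C <= `|x| :> C.
Proof. exact: normc_ge_Re. Qed.
Lemma le_Im_norm x : (`|Im x|)%:C%C <= `|x| :> C.
Proof.
rewrite Cnorm_def lecR -[X in X <= _]ger0_norm ?normr_ge0 // normr_id -sqrtr_sqr.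
by apply: ler_wsqrtr; rewrite lerDr sqr_ge0.
Qed.
Lemma ler_normC (t : R) : `|(t%:C)%C : C| = (`|t|)%:C%C.
Proof. by rewrite Cnorm_def /= expr0n addr0 sqrtr_sqr. Qed.
Lemma norm_le_ReIm x : `|x| <= (`|Re x| + `|Im x|)%:C%C :> C.
Proof.
rewrite {1}(CReIm x); apply: (le_trans (ler_normD _ _)).
by rewrite normrM normCi mul1r !ler_normC -rmorphD.
Qed.
Lemma ltcRE (s t : R) : ((s%:C)%C < (t%:C)%C :> C) = (s < t).
Proof. exact: ltcR. Qed.
Lemma lecRE (s t : R) : ((s%:C)%C <= (t%:C)%C :> C) = (s <= t).
Proof. exact: lecR. Qed.
Lemma posC x : 0 < x -> exists2 t : R, 0 < t & x = (t%:C)%C.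
Proof.
move=> x0; have /ger0_Im xi := ltW x0.
have xE : x = ((Re x)%:C)%C by apply: Ceq.
by exists (Re x) => //; rewrite -ltcRE -xE.
Qed.

Lemma continuous_Re : continuous (Re : C -> R).
Proof.
move=> x; apply: (proj2 (@cvgrPdist_lt R R^o _ (nbhs x) _ _ _)) => e e0.
have : 0 < (e%:C)%C :> C by rewrite ltcRE.
move=> e0C; near=> y; rewrite -ltcRE.
have -> : Re x - Re y = Re (x - y) by rewrite ReaddE ReoppE.
apply: le_lt_trans (le_Re_norm _) _.
by near: y; apply: cvgr_dist_lt e0C; apply: cvg_id.
Unshelve. all: by end_near. Qed.
Lemma continuous_Im : continuous (Im : C -> R).
Proof.
move=> x; apply: (proj2 (@cvgrPdist_lt R R^o _ (nbhs x) _ _ _)) => e e0.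
have : 0 < (e%:C)%C :> C by rewrite ltcRE.
move=> e0C; near=> y; rewrite -ltcRE.
have -> : Im x - Im y = Im (x - y) by rewrite ImaddE ImoppE.
apply: le_lt_trans (le_Im_norm _) _.
by near: y; apply: cvgr_dist_lt e0C; apply: cvg_id.
Unshelve. all: by end_near. Qed.

Lemma continuous_RtoC : continuous (fun t : R => (t%:C)%C : C).
Proof.
move=> t; apply/cvgrPdist_lt => e /posC[d d0 ->].
near=> s; rewrite -rmorphB ler_normC ltcRE.
by near: s; apply: (@cvgr_dist_lt R R^o) d0; apply: cvg_id.
Unshelve. all: by end_near. Qed.

Section CvgC.
Variables (T : Type) (F : set_system T).
Context {FF : Filter F}.
Lemma cvg_ReIm (f : T -> C) (l : C) :
  Re (f x) @[x --> F] --> Re l -> Im (f x) @[x --> F] --> Im l -> f @ F --> l.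
Proof.
move=> fr fi; apply/cvgrPdist_lt => e /posC[d d0 ->].
near=> s; apply: le_lt_trans (norm_le_ReIm _) _; rewrite ltcRE.
rewrite (splitr d) ReaddE ReoppE ImaddE ImoppE; apply: ltrD; near: s.
  by apply: (@cvgr_dist_lt R R^o) fr _ _; rewrite divr_gt0.
by apply: (@cvgr_dist_lt R R^o) fi _ _; rewrite divr_gt0.
Unshelve. all: by end_near. Qed.
End CvgC.

Lemma continuous_conj : continuous (fun x : C => x^*).
Proof.
move=> x; apply: (@cvg_ReIm C (nbhs x)).
  rewrite (_ : (fun y : C => _) = Re) ?ReconjE; first exact: continuous_Re.
  by apply/funext => y; rewrite ReconjE.
rewrite (_ : (fun y : C => _) = (fun y => - Im y)) ?ImconjE.
  by apply: (@cvgN _ R^o); exact: continuous_Im.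
by apply/funext => y; rewrite ImconjE.
Qed.
End ComplexParts.

(** * Rules for real directional derivatives *)

Section DirectionalRules.
Variable R : realType.
Local Notation C := (Cx R).
Local Notation Re := (@complex.Re R).
Local Notation Im := (@complex.Im R).
Implicit Types (f g : C -> C) (v x z d e a b : C).

Lemma Im_real x : x \is Num.real -> Im x = 0.
Proof. by case: x => a b; rewrite complex_real => /eqP. Qed.

(** A relation between function and value, so that each rule yields existence and value of the
    derivative at once. *)
Definition is_ddir v f z d : Prop :=
  is_derive (0 : R) (1 : R) (re_along v f z) (Re d) /\
  is_derive (0 : R) (1 : R) (im_along v f z) (Im d).

Lemma is_ddirP v f z : dir_derivable v f z -> is_ddir v f z (dir_derive v f z).
Proof.
case=> hr hi; split.
- by apply: (DeriveDef hr); rewrite -derive1E.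
- by apply: (DeriveDef hi); rewrite -derive1E.
Qed.
Lemma is_ddir_derivable v f z d : is_ddir v f z d -> dir_derivable v f z.
Proof. by case=> [[hr _] [hi _]]; exact: conj hr hi. Qed.
Lemma is_ddir_val v f z d : is_ddir v f z d -> dir_derive v f z = d.
Proof. by case=> [[hr er] [hi ei]]; apply: Ceq; rewrite /= derive1E. Qed.

Lemma continuous_line v z (t0 : R) : {for t0, continuous (fun t : R => z + (t%:C)%C * v)}.
Proof.
apply: cvgD; first exact: cvg_cst.
by apply: cvgM; [exact: continuous_RtoC | exact: cvg_cst].
Qed.

Lemma RC0 : (0%:C)%C = 0 :> C. Proof. by []. Qed.

Lemma near_line v z (P : C -> Prop) : (\forall w \near z, P w) ->
  \forall t \near (0 : R), P (z + (t%:C)%C * v).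
Proof.
move=> zP.
have cl : (fun t : R => z + (t%:C)%C * v) t @[t --> (0 : R)] --> z.
  have {2}<- : z + (0%:C)%C * v = z by rewrite RC0 mul0r addr0.
  exact: (@continuous_line v z 0).
exact: cl zP.
Qed.

Lemma is_ddir_near v f g z d : (\forall w \near z, f w = g w) ->
  is_ddir v f z d -> is_ddir v g z d.
Proof.
move=> fg [fr fi].
have nt : \forall t \near (0 : R), f (z + (t%:C)%C * v) = g (z + (t%:C)%C * v).
  exact: near_line fg.
split.
- by apply: near_eq_is_derive fr; apply: filterS nt => t; rewrite /re_along => ->.
- by apply: near_eq_is_derive fi; apply: filterS nt => t; rewrite /im_along => ->.
Qed.

Lemma is_ddir_cst v c z : is_ddir v (fun=> c) z 0.
Proof. by split; exact: is_derive_cst. Qed.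

Lemma is_ddir_id v z : is_ddir v id z v.
Proof.
split.
- rewrite (_ : re_along _ _ _ = cst (Re z) + (Re v *: id)).
    have := is_deriveD (is_derive_cst (Re z) (0 : R) (1 : R))
      (is_deriveZ (Re v) (is_derive_id (0 : R) (1 : R))).
    by rewrite add0r [_ *: _]mulr1.
  by apply/funext => t; rewrite /re_along /= !fctE ReaddE RemulE /= mul0r subr0 mulrC.
- rewrite (_ : im_along _ _ _ = cst (Im z) + (Im v *: id)).
    have := is_deriveD (is_derive_cst (Im z) (0 : R) (1 : R))
      (is_deriveZ (Im v) (is_derive_id (0 : R) (1 : R))).
    by rewrite add0r [_ *: _]mulr1.
  by apply/funext => t; rewrite /im_along /= !fctE ImaddE ImmulE /= mul0r addr0 mulrC.
Qed.

Lemma is_ddirD v f g z d e : is_ddir v f z d -> is_ddir v g z e ->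
  is_ddir v (fun w => f w + g w) z (d + e).
Proof.
move=> [fr fi] [gr gi]; split.
- rewrite (_ : re_along _ _ _ = re_along v f z + re_along v g z); last first.
    by apply/funext => t; rewrite /re_along !fctE ReaddE.
  by rewrite ReaddE; exact: is_deriveD.
- rewrite (_ : im_along _ _ _ = im_along v f z + im_along v g z); last first.
    by apply/funext => t; rewrite /im_along !fctE ImaddE.
  by rewrite ImaddE; exact: is_deriveD.
Qed.

Lemma is_ddirM v f g z d e : is_ddir v f z d -> is_ddir v g z e ->
  is_ddir v (fun w => f w * g w) z (d * g z + f z * e).
Proof.
move=> [fr fi] [gr gi]; split.
- rewrite (_ : re_along _ _ _ =
    re_along v f z * re_along v g z - im_along v f z * im_along v g z); last first.
    by apply/funext => t; rewrite /re_along !fctE RemulE.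
  apply: (is_derive_eq (is_deriveB (is_deriveM fr gr) (is_deriveM fi gi))); rewrite /re_along /im_along !RC0 !mul0r !addr0.
  by rewrite !(ReaddE, RemulE) /GRing.scale /=; ring.
- rewrite (_ : im_along _ _ _ =
    re_along v f z * im_along v g z + im_along v f z * re_along v g z); last first.
    by apply/funext => t; rewrite /im_along !fctE ImmulE.
  apply: (is_derive_eq (is_deriveD (is_deriveM fr gi) (is_deriveM fi gr))); rewrite /re_along /im_along !RC0 !mul0r !addr0.
  by rewrite !(ImaddE, ImmulE) /GRing.scale /=; ring.
Qed.

Lemma is_ddir_conj v f z d : is_ddir v f z d -> is_ddir v (fun w => (f w)^*) z d^*.
Proof.
move=> [fr fi]; split.
- rewrite (_ : re_along _ _ _ = re_along v f z) ?ReconjE //.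
  by apply/funext => t; rewrite /re_along ReconjE.
- rewrite (_ : im_along _ _ _ = - im_along v f z) ?ImconjE; first exact: is_deriveN.
  by apply/funext => t; rewrite /im_along ImconjE.
Qed.

Lemma is_ddirV v f z d : f z != 0 -> is_ddir v f z d ->
  is_ddir v (fun w => (f w)^-1) z (- d / f z ^+ 2).
Proof.
move=> fz0 [fr fi].
(* [D] is the squared modulus of [f] along the line. The inverse of [f] is its conjugate divided by
   [D], so the real rules suffice. *)
pose D : R -> R := re_along v f z * re_along v f z + im_along v f z * im_along v f z.
have f0 : f (z + ((0%:C)%C) * v) = f z by rewrite RC0 mul0r addr0.
have DtE t : D t = Re (f (z + (t%:C)%C * v)) ^+ 2 + Im (f (z + (t%:C)%C * v)) ^+ 2.
  by rewrite !expr2.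
have D0 : D 0 != 0.
  rewrite /D !fctE /re_along /im_along f0 -!expr2.
  apply: contraNneq fz0 => /eqP; rewrite paddr_eq0 ?sqr_ge0 // !sqrf_eq0 => /andP[/eqP a /eqP b].
  by apply/eqP; apply: Ceq.
have dD : is_derive (0 : R) (1 : R) D (2 * (Re (f z) * Re d + Im (f z) * Im d)).
  by apply: (is_derive_eq (is_deriveD (is_deriveM fr fr) (is_deriveM fi fi))); rewrite /re_along /im_along f0 /GRing.scale /=; ring.
have dV := is_deriveV D0 dD.
have DE : D 0 = Re (f z) ^+ 2 + Im (f z) ^+ 2.
  by rewrite /D !fctE /re_along /im_along f0 -!expr2.
have D0' : Re (f z) ^+ 2 + Im (f z) ^+ 2 != 0 by rewrite -DE.
have EE : - d / f z ^+ 2 = - d * (f z)^* ^+ 2 * ((Re (f z) ^+ 2 + Im (f z) ^+ 2)^-1 %:C)%C ^+ 2.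
  have nE : ((Re (f z) ^+ 2 + Im (f z) ^+ 2)%:C)%C = f z * (f z)^*.
    by apply: Ceq; rewrite /= ?RemulE ?ImmulE ReconjE ImconjE; ring.
  have -> : ((Re (f z) ^+ 2 + Im (f z) ^+ 2)^-1 %:C)%C = (f z * (f z)^*)^-1 by rewrite -nE fmorphV.
  have FF a b : a != 0 -> b != 0 -> - d / a ^+ 2 = - d * b ^+ 2 * (a * b)^-1 ^+ 2 :> C.
    by move=> a0 b0; field; rewrite a0 b0.
  by apply: FF; rewrite ?conjC_eq0.
split.
- rewrite (_ : re_along _ _ _ = re_along v f z * (fun t => (D t)^-1)); last first.
    apply/funext => t; change (Re (f (z + (t%:C)%C * v))^-1 = Re (f (z + (t%:C)%C * v)) * (D t)^-1).
    by rewrite DtE Cinv_def.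
  apply: (is_derive_eq (is_deriveM fr dV)); rewrite EE DE /re_along /im_along f0 /GRing.scale /=.
  rewrite !expr2 !(RemulE, ImmulE, ReoppE, ImoppE, ReconjE, ImconjE) /=; field.
  by move: D0'; rewrite !expr2.
- rewrite (_ : im_along _ _ _ = - im_along v f z * (fun t => (D t)^-1)); last first.
    apply/funext => t; change (Im (f (z + (t%:C)%C * v))^-1 = - Im (f (z + (t%:C)%C * v)) * (D t)^-1).
    by rewrite DtE Cinv_def.
  apply: (is_derive_eq (is_deriveM (is_deriveN fi) dV)); rewrite EE.
  change ((- im_along v f z) 0) with (- im_along v f z 0).
  have -> : im_along v f z 0 = Im (f z) by rewrite /im_along f0.
  rewrite DE /GRing.scale /=.
  rewrite !expr2 !(RemulE, ImmulE, ReoppE, ImoppE, ReconjE, ImconjE) /=; field.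
  by move: D0'; rewrite !expr2.
Qed.

(** The real square root, so that smoothness is inherited from the real function; it is meant for
    [f] with positive real values. *)
Definition Csqrt f : C -> C := fun w => ((Num.sqrt (Re (f w)))%:C)%C.

Lemma is_ddir_sqrt v f z d : 0 < Re (f z) -> (\forall w \near z, f w \is Num.real) ->
  is_ddir v f z d -> is_ddir v (Csqrt f) z (d / (2 * Csqrt f z)).
Proof.
move=> fz0 fre [fr fi].
have f0 : f (z + ((0%:C)%C) * v) = f z by rewrite RC0 mul0r addr0.
have nt : \forall t \near (0 : R), f (z + (t%:C)%C * v) \is Num.real.
  exact: near_line fre.
(* Near [z] the values of [f] are real, hence so is the derivative, and the quotient to be reached
   is a real one. *)
have di : Im d = 0.
  case: fi => _ <-.
  have : is_derive (0:R) (1:R) (im_along v f z) 0.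
    apply: near_eq_is_derive (is_derive_cst 0 _ _).
    by apply: filterS nt => t; rewrite /im_along => /Im_real ->.
  by case.
have s0 : Num.sqrt (Re (f z)) != 0 by rewrite gt_eqF // sqrtr_gt0.
split.
- have hs : is_derive (re_along v f z 0) 1 (@Num.sqrt R) (2 * Num.sqrt (Re (f z)))^-1.
    by rewrite /re_along f0; exact: is_derive1_sqrt.
  have := is_derive1_comp hs fr; congr (is_derive _ _ _ _).
  rewrite (_ : 2 * Csqrt f z = ((2 * Num.sqrt (Re (f z)))%:C)%C); last by rewrite rmorphM /= rmorph_nat.
  by rewrite -fmorphV RemulE /= mulr0 subr0 mulrC.
- rewrite (_ : Im _ = 0); first exact: is_derive_cst.
  rewrite (_ : 2 * Csqrt f z = ((2 * Num.sqrt (Re (f z)))%:C)%C); last by rewrite rmorphM /= rmorph_nat.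
  by rewrite -fmorphV ImmulE /= mulr0 di mul0r addr0.
Qed.

(** Shifting the parameter by [t] moves the base point along the line; this is how pointwise
    derivatives become derivatives of a function on an interval. *)
Lemma is_ddir_line v f z (t : R) d : is_ddir v f (z + (t%:C)%C * v) d ->
  is_derive t (1 : R) (re_along v f z) (Re d) /\ is_derive t (1 : R) (im_along v f z) (Im d).
Proof.
move=> [fr fi].
have sh : is_derive t (1:R) (fun s : R => s - t) 1.
  by apply: is_derive_eq; rewrite subr0.
split.
- have fr' : is_derive ((fun s : R => s - t) t) 1 (re_along v f (z + (t%:C)%C * v)) (Re d).
    by rewrite subrr.
  have := @is_derive1_comp _ (re_along v f (z + (t%:C)%C * v)) (fun s : R => s - t) t _ _ fr' sh; rewrite mulr1.
  congr (is_derive _ _ _ _); apply/funext => s; rewrite /re_along /=; congr (Re (f _)).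
  by rewrite rmorphB /=; ring.
- have fi' : is_derive ((fun s : R => s - t) t) 1 (im_along v f (z + (t%:C)%C * v)) (Im d).
    by rewrite subrr.
  have := @is_derive1_comp _ (im_along v f (z + (t%:C)%C * v)) (fun s : R => s - t) t _ _ fi' sh; rewrite mulr1.
  congr (is_derive _ _ _ _); apply/funext => s; rewrite /im_along /=; congr (Im (f _)).
  by rewrite rmorphB /=; ring.
Qed.

End DirectionalRules.

(** * Mixed and directional derivatives in the real plane *)

Section RealPlane.
Variable R : realType.
Implicit Types (g dg : R -> R) (c r s t : R).

(** Both signs of [c] occur: in [C1_direction] the increments are [h * a] and [h * b]. *)
Lemma mvt_disc g dg c r : `|c| < r ->
  (forall s, `|s| < r -> is_derive s (1 : R) g (dg s)) ->
  exists2 s, `|s| <= `|c| & g c - g 0 = dg s * c.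
Proof.
move=> cr hg.
have cont a b : (forall s, s \in `[a, b]%R -> `|s| < r) -> {within `[a, b], continuous g}.
  move=> h; apply: derivable_within_continuous => s sI.
  by case: (hg s (h s sI)).
have [c0|c0|c0] := ltgtP 0 c; last by exists 0; [rewrite normr0|rewrite -c0 subrr mulr0].
- have h s : s \in `[0, c]%R -> `|s| < r.
    by rewrite in_itv /= => /andP[s0 sc]; apply: le_lt_trans cr; rewrite !ger0_norm // ltW.
  have [|s sI e] := @MVT _ g dg _ _ c0 _ (cont _ _ h).
    by move=> s sI; apply: hg; apply: h; apply: subset_itv_oo_cc sI.
  exists s; last by rewrite e subr0.
  by move: sI; rewrite in_itv /= => /andP[s0 sc]; rewrite !gtr0_norm // ltW.
- have h s : s \in `[c, 0]%R -> `|s| < r.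
    by rewrite in_itv /= => /andP[s0 sc]; apply: le_lt_trans cr; rewrite !ler0_norm ?lerN2 // ltW.
  have [|s sI e] := @MVT _ g dg _ _ c0 _ (cont _ _ h).
    by move=> s sI; apply: hg; apply: h; apply: subset_itv_oo_cc sI.
  exists s; last by rewrite -opprB e sub0r mulrN opprK.
  by move: sI; rewrite in_itv /= => /andP[s0 sc]; rewrite (ltr0_norm sc) ltr0_norm // lerN2 ltW.
Qed.

Variables (phi phix phiy : R -> R -> R) (r : R).
Hypothesis r0 : 0 < r.
Hypothesis hx : forall s t, `|s| < r -> `|t| < r -> is_derive s (1 : R) (phi ^~ t) (phix s t).
Hypothesis hy : forall s t, `|s| < r -> `|t| < r -> is_derive t (1 : R) (phi s) (phiy s t).

Definition cont00 (psi : R -> R -> R) := forall e, 0 < e ->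
  exists2 d, 0 < d & forall s t, `|s| < d -> `|t| < d -> `|psi s t - psi 0 0| < e.

(** The second difference over a square of side [h], taken in the two orders, equals [h ^ 2] times
    [phixy] at one point and [h ^ 2] times [phiyx] at another. If the values at the origin differed,
    a small [h] would contradict continuity. *)
Lemma schwarz_real (phixy phiyx : R -> R -> R) :
  (forall s t, `|s| < r -> `|t| < r -> is_derive t (1 : R) (phix s) (phixy s t)) ->
  (forall s t, `|s| < r -> `|t| < r -> is_derive s (1 : R) (phiy ^~ t) (phiyx s t)) ->
  cont00 phixy -> cont00 phiyx -> phixy 0 0 = phiyx 0 0.
Proof.
move=> hxy hyx cxy cyx; apply/eqP; rewrite -subr_eq0; apply: contraT => ne.
have e0 : 0 < `|phixy 0 0 - phiyx 0 0| / 2 by rewrite divr_gt0 ?normr_gt0.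
have [d1 d10 h1] := cxy _ e0; have [d2 d20 h2] := cyx _ e0.
pose m := Num.min r (Num.min d1 d2); pose h := m / 2.
have m0 : 0 < m by rewrite !lt_min r0 d10.
have h0 : 0 < h by rewrite divr_gt0.
have hm : h < m by rewrite /h; lra.
have nh : `|h| = h by rewrite gtr0_norm.
have [hr hd1 hd2] : [/\ h < r, h < d1 & h < d2].
  by move: hm; rewrite !lt_min => /and3P[].
have n0 : `|0 : R| < r by rewrite normr0.
have hr' : `|h| < r by rewrite nh.
have [x1 x1h e1] := mvt_disc hr' (fun s sr => is_deriveB (hx sr hr') (hx sr n0)).
have x1r : `|x1| < r by apply: le_lt_trans x1h hr'.
have [y1 y1h e2] := mvt_disc hr' (fun t tr => hxy x1 t x1r tr).
have [y2 y2h e3] := mvt_disc hr' (fun s sr => is_deriveB (hy hr' sr) (hy n0 sr)).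
have y2r : `|y2| < r by apply: le_lt_trans y2h hr'.
have [x2 x2h e4] := mvt_disc hr' (fun t tr => hyx t y2 tr y2r).
have E : phixy x1 y1 = phiyx x2 y2.
  have hh : h != 0 by rewrite gt_eqF.
  apply: (mulIf hh); apply: (mulIf hh); rewrite -e2 -e4 -e1 -e3 !fctE; ring.
have lt (d x : R) : h < d -> `|x| <= `|h| -> `|x| < d by rewrite nh => a b; apply: le_lt_trans b a.
have g1 := h1 _ _ (lt _ _ hd1 x1h) (lt _ _ hd1 y1h).
have g2 := h2 _ _ (lt _ _ hd2 x2h) (lt _ _ hd2 y2h).
have : `|phixy 0 0 - phiyx 0 0| < `|phixy 0 0 - phiyx 0 0|.
  rewrite [X in _ < X]splitr; apply: le_lt_trans (ltrD g1 g2).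
  rewrite -E distrC (_ : phiyx 0 0 - phixy 0 0 =
    (phixy x1 y1 - phixy 0 0) - (phixy x1 y1 - phiyx 0 0)); last by ring.
  exact: ler_normB.
by rewrite ltxx.
Qed.

(** The increment is split into a step along the second axis and a step along the first; the mean
    value theorem applies to each, and continuity of the partial derivatives gives the limit. *)
Lemma C1_direction a b : cont00 phix -> cont00 phiy ->
  is_derive (0 : R) (1 : R) (fun t => phi (t * a) (t * b)) (a * phix 0 0 + b * phiy 0 0).
Proof.
move=> cx cy.
set g := (fun t => _); set d := _ + _.
have key : (fun h => h^-1 *: (g (h + 0) - g 0)) h @[h --> (0 : R)^'] --> d.
  apply/cvgrPdist_lt => e e0.
  have N0 : 0 < `|a| + `|b| + 1 by rewrite ltr_wpDl // addr_ge0.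
  have e1 : 0 < e / (`|a| + `|b| + 1) by rewrite divr_gt0.
  have [d1 d10 h1] := cx _ e1; have [d2 d20 h2] := cy _ e1.
  pose m := Num.min r (Num.min d1 d2).
  have m0 : 0 < m by rewrite !lt_min r0 d10.
  have mN : 0 < m / (`|a| + `|b| + 1) by rewrite divr_gt0.
  near=> h.
  have h0 : h != 0 by near: h; exact: nbhs_dnbhs_neq.
  have hm : `|h| < m / (`|a| + `|b| + 1).
    near: h; apply: dnbhs0_lt mN.
  have ham : `|h * a| < m.
    rewrite normrM; move: hm; rewrite ltr_pdivlMr //; apply: le_lt_trans.
    by rewrite ler_wpM2l // -addrA lerDl addr_ge0.
  have hbm : `|h * b| < m.
    rewrite normrM; move: hm; rewrite ltr_pdivlMr //; apply: le_lt_trans.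
    by rewrite ler_wpM2l // addrAC lerDr addr_ge0.
  move: (ham) (hbm); rewrite !lt_min => /and3P[har had1 had2] /and3P[hbr hbd1 hbd2].
  have n0 : `|0 : R| < r by rewrite normr0.
  have [x xh ex] := mvt_disc har (fun s sr => hx sr hbr).
  have [y yh ey] := mvt_disc hbr (fun t tr => hy n0 tr).
  have E : h^-1 *: (g (h + 0) - g 0) = a * phix x (h * b) + b * phiy 0 y.
    rewrite /g addr0 !mul0r (_ : _ - _ = phix x (h * b) * (h * a) + phiy 0 y * (h * b)).
      by rewrite /GRing.scale /=; field.
    by rewrite -ex -ey; ring.
  rewrite E /d (_ : _ - _ = - (a * (phix x (h * b) - phix 0 0)) - b * (phiy 0 y - phiy 0 0)); last by ring.
  apply: le_lt_trans (ler_normB _ _) _; rewrite normrN !normrM.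
  have f1 := h1 _ _ (le_lt_trans xh had1) hbd1.
  have f2 : `|phiy 0 y - phiy 0 0| < e / (`|a| + `|b| + 1).
    by apply: h2; rewrite ?normr0 //; apply: le_lt_trans yh hbd2.
  apply: (@le_lt_trans _ _ ((`|a| + `|b|) * (e / (`|a| + `|b| + 1)))).
    by rewrite mulrDl lerD // ler_wpM2l // ltW.
  rewrite mulrA ltr_pdivrMr // mulrC ltr_pM2l // ltrDl //.
have key' : (fun h => h^-1 *: ((g \o shift 0) (h *: 1) - g 0)) h @[h --> (0 : R)^'] --> d.
  apply: cvg_trans key; apply: near_eq_cvg; near=> h.
  by rewrite /= [h *: 1]mulr1.
apply: DeriveDef; first by apply/cvg_ex; exists d.
exact/cvg_lim.
Unshelve. all: by end_near. Qed.

End RealPlane.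

(** * Smooth functions and Wirtinger derivatives *)

Section SmoothFunctions.
Variable R : realType.
Local Notation C := (Cx R).
Local Notation Re := (@complex.Re R).
Local Notation Im := (@complex.Im R).
Implicit Types (f g : C -> C) (v z c d e : C) (U : set C).

Lemma near_open U z : open U -> U z -> \forall w \near z, U w.
Proof. by move=> oU Uz; apply: open_nbhs_nbhs. Qed.

Lemma continuous_near f g z : (\forall w \near z, f w = g w) ->
  {for z, continuous f} -> {for z, continuous g}.
Proof.
move=> fg cf; have e : f z = g z := nbhs_singleton fg.
suff : g @ z --> g z by [].
rewrite -e.
have fg' : \forall w \near z, g w = f w by near=> w; symmetry; near: w.
exact: (cvg_trans (near_eq_cvg fg) cf).
Unshelve. all: by end_near.
Qed.

Lemma near_all z (P : C -> Prop) : (forall w, P w) -> \forall w \near z, P w.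
Proof. by move=> h; apply: (@filterE _ (nbhs z)). Qed.
Lemma cont_cst c z : {for z, continuous (fun _ : C => c)}.
Proof. exact: (@cvg_cst C c C (nbhs z)). Qed.
Lemma contD f g z : {for z, continuous f} -> {for z, continuous g} ->
  {for z, continuous (fun w => f w + g w)}.
Proof. by move=> cf cg; apply: (cvgD cf cg). Qed.
Lemma contM f g z : {for z, continuous f} -> {for z, continuous g} ->
  {for z, continuous (fun w => f w * g w)}.
Proof. by move=> cf cg; apply: (cvgM cf cg). Qed.
Lemma contV f z : f z != 0 -> {for z, continuous f} -> {for z, continuous (fun w => (f w)^-1)}.
Proof. by move=> f0 cf; apply: (cvgV f0 cf). Qed.
Lemma cont_conj f z : {for z, continuous f} -> {for z, continuous (fun w => (f w)^*)}.
Proof. by move=> cf; apply: (cvg_comp _ _ cf); exact: continuous_conj. Qed.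

(** The derivatives are known on [U] only, whereas [Cn] speaks of the total functions
    [dir_derive 1 f] and [dir_derive 'i f]. Hence the quantification over every [g] that agrees on
    [U] with the candidate. *)
Lemma Cn_intro n U f f1 f2 : (forall z, U z -> {for z, continuous f}) ->
  (forall z, U z -> is_ddir 1 f z (f1 z) /\ is_ddir 'i f z (f2 z)) ->
  (forall g, (forall z, U z -> f1 z = g z) -> Cn n U g) ->
  (forall g, (forall z, U z -> f2 z = g z) -> Cn n U g) -> Cn n.+1 U f.
Proof.
move=> cf df C1 C2; split=> //; split; first by
  move=> z /df[/is_ddir_derivable a /is_ddir_derivable b].
by split; [apply: C1|apply: C2] => z /df[/is_ddir_val a /is_ddir_val b].
Qed.

Lemma Cn_cont n U f z : Cn n U f -> U z -> {for z, continuous f}.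
Proof. by case: n => [|n] []; auto. Qed.

Lemma Cn_ddir n U f z : Cn n.+1 U f -> U z ->
  is_ddir 1 f z (dir_derive 1 f z) /\ is_ddir 'i f z (dir_derive 'i f z).
Proof. by case=> _ [h _] /h [a b]; split; apply: is_ddirP. Qed.

Lemma Cn_ext n U f g : open U -> (forall z, U z -> f z = g z) -> Cn n U f -> Cn n U g.
Proof.
move=> oU; elim: n f g => [|n IH] f g fg Cf.
  split=> // z Uz; apply: continuous_near (Cn_cont Cf Uz).
  by apply: filterS (near_open oU Uz) => w /fg.
have nfg z : U z -> \forall w \near z, f w = g w.
  by move=> Uz; apply: filterS (near_open oU Uz) => w /fg.
apply: (@Cn_intro _ _ _ (dir_derive 1 f) (dir_derive 'i f)).
- by move=> z Uz; apply: continuous_near (Cn_cont Cf Uz); apply: nfg.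
- move=> z Uz; have [a b] := Cn_ddir Cf Uz.
  by split; apply: is_ddir_near; [exact: nfg|exact: a|exact: nfg|exact: b].
- by move=> h eh; apply: IH eh _; case: Cf => _ [_ []].
- by move=> h eh; apply: IH eh _; case: Cf => _ [_ []].
Qed.

Lemma Cn_leS n U f : Cn n.+1 U f -> Cn n U f.
Proof.
elim: n f => [|n IH] f; first by case.
by case=> cf [df [f1 f2]]; exact: (conj cf (conj df (conj (IH _ f1) (IH _ f2)))).
Qed.

Lemma Cn_sub n U U' f : U' `<=` U -> Cn n U f -> Cn n U' f.
Proof.
move=> sU; elim: n f => [|n IH] f; first by case=> cf _; split=> // z /sU; apply: cf.
case=> cf [df [f1 f2]]; split; first by move=> z /sU; apply: cf.
by split; [move=> z /sU; apply: df | split; apply: IH].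
Qed.

Section CnRules.
Variables (U : set C).
Hypothesis oU : open U.

Lemma Cn_cst n c : Cn n U (fun=> c).
Proof.
elim: n c => [|n IH] c; first by split=> // z _; exact: cont_cst.
apply: (@Cn_intro _ _ _ (fun=> 0) (fun=> 0)).
- by move=> z _; exact: cont_cst.
- by move=> z _; split; apply: is_ddir_cst.
- by move=> g eg; apply: (Cn_ext oU eg).
- by move=> g eg; apply: (Cn_ext oU eg).
Qed.

Lemma Cn_id n : Cn n U id.
Proof.
case: n => [|n]; first by split=> // z _; exact: cvg_id.
apply: (@Cn_intro _ _ _ (fun=> 1) (fun=> 'i)).
- by move=> z _; exact: cvg_id.
- by move=> z _; split; apply: is_ddir_id.
- by move=> g eg; apply: (Cn_ext oU eg); exact: Cn_cst.
- by move=> g eg; apply: (Cn_ext oU eg); exact: Cn_cst.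
Qed.

Lemma CnD n f g : Cn n U f -> Cn n U g -> Cn n U (fun w => f w + g w).
Proof.
elim: n f g => [|n IH] f g Cf Cg; first by
  split=> // z Uz; apply: contD; [exact: (Cn_cont Cf Uz)|exact: (Cn_cont Cg Uz)].
apply: (@Cn_intro _ _ _ (fun w => dir_derive 1 f w + dir_derive 1 g w)
   (fun w => dir_derive 'i f w + dir_derive 'i g w)).
- by move=> z Uz; apply: contD; [exact: (Cn_cont Cf Uz)|exact: (Cn_cont Cg Uz)].
- move=> z Uz; have [a b] := Cn_ddir Cf Uz; have [a' b'] := Cn_ddir Cg Uz.
  by split; apply: is_ddirD.
- move=> h eh; apply: (Cn_ext oU eh); apply: IH.
  + by case: Cf => _ [_ []].
  + by case: Cg => _ [_ []].
- move=> h eh; apply: (Cn_ext oU eh); apply: IH.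
  + by case: Cf => _ [_ []].
  + by case: Cg => _ [_ []].
Qed.

Lemma CnM n f g : Cn n U f -> Cn n U g -> Cn n U (fun w => f w * g w).
Proof.
elim: n f g => [|n IH] f g Cf Cg; first by
  split=> // z Uz; apply: contM; [exact: (Cn_cont Cf Uz)|exact: (Cn_cont Cg Uz)].
apply: (@Cn_intro _ _ _ (fun w => dir_derive 1 f w * g w + f w * dir_derive 1 g w)
   (fun w => dir_derive 'i f w * g w + f w * dir_derive 'i g w)).
- by move=> z Uz; apply: contM; [exact: (Cn_cont Cf Uz)|exact: (Cn_cont Cg Uz)].
- move=> z Uz; have [a b] := Cn_ddir Cf Uz; have [a' b'] := Cn_ddir Cg Uz.
  by split; apply: is_ddirM.
- move=> h eh; apply: (Cn_ext oU eh); apply: CnD; apply: IH; try exact: Cn_leS.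
  + by case: Cf => _ [_ []].
  + by case: Cg => _ [_ []].
- move=> h eh; apply: (Cn_ext oU eh); apply: CnD; apply: IH; try exact: Cn_leS.
  + by case: Cf => _ [_ []].
  + by case: Cg => _ [_ []].
Qed.

Lemma CnN n f : Cn n U f -> Cn n U (fun w => - f w).
Proof.
move=> Cf; have := CnM (Cn_cst n (-1)) Cf.
by apply: (Cn_ext oU) => z _; rewrite mulN1r.
Qed.

Lemma Cn_conj n f : Cn n U f -> Cn n U (fun w => (f w)^*).
Proof.
elim: n f => [|n IH] f Cf; first by split=> // z Uz; apply: cont_conj; exact: (Cn_cont Cf Uz).
apply: (@Cn_intro _ _ _ (fun w => (dir_derive 1 f w)^*) (fun w => (dir_derive 'i f w)^*)).
- by move=> z Uz; apply: cont_conj; exact: (Cn_cont Cf Uz).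
- by move=> z Uz; have [a b] := Cn_ddir Cf Uz; split; apply: is_ddir_conj.
- by move=> h eh; apply: (Cn_ext oU eh); apply: IH; case: Cf => _ [_ []].
- by move=> h eh; apply: (Cn_ext oU eh); apply: IH; case: Cf => _ [_ []].
Qed.

(** The derivative [- f' / f ^ 2] again contains the inverse of [f], but with one order of
    differentiability less to prove, so induction on [n] closes. *)
Lemma CnV n f : (forall z, U z -> f z != 0) -> Cn n U f -> Cn n U (fun w => (f w)^-1).
Proof.
move=> f0; elim: n => [|n IH] Cf; first by
  split=> // z Uz; apply: contV; [exact: f0|exact: (Cn_cont Cf Uz)].
apply: (@Cn_intro _ _ _ (fun w => - dir_derive 1 f w / f w ^+ 2)
   (fun w => - dir_derive 'i f w / f w ^+ 2)).
- by move=> z Uz; apply: contV; [exact: f0|exact: (Cn_cont Cf Uz)].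
- move=> z Uz; have [a b] := Cn_ddir Cf Uz.
  by split; apply: is_ddirV => //; apply: f0.
- move=> h eh; apply: (Cn_ext oU eh).
  have I := IH (Cn_leS Cf).
  have := CnM (CnN (proj1 (proj2 (proj2 Cf)))) (CnM I I).
  by apply: (Cn_ext oU) => z _; rewrite -invfM.
- move=> h eh; apply: (Cn_ext oU eh).
  have I := IH (Cn_leS Cf).
  have := CnM (CnN (proj2 (proj2 (proj2 Cf)))) (CnM I I).
  by apply: (Cn_ext oU) => z _; rewrite -invfM.
Qed.

Lemma continuous_Csqrt f z : {for z, continuous f} -> {for z, continuous (Csqrt f)}.
Proof.
move=> cf; apply: (cvg_comp (fun w => Num.sqrt (Re (f w))) (fun t : R => (t%:C)%C : C)); last first.
  exact: continuous_RtoC.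
apply: (cvg_comp (fun w => Re (f w)) (@Num.sqrt R)); last exact: sqrt_continuous.
by apply: (cvg_comp _ _ cf); exact: continuous_Re.
Qed.

Lemma Cn_sqrt n f : (forall z, U z -> 0 < f z) -> Cn n U f -> Cn n U (Csqrt f).
Proof.
move=> f0.
have fp z : U z -> 0 < Re (f z) by move=> /f0 /posC[t t0 ->].
have s0 z : U z -> Csqrt f z != 0.
  move=> /fp h; rewrite /Csqrt (_ : 0 = (0%:C)%C :> C) //.
  by apply/negP => /eqP[] /eqP; apply/negP; rewrite gt_eqF // sqrtr_gt0.
elim: n => [|n IH] Cf.
  by split=> // z Uz; apply: continuous_Csqrt; exact: (Cn_cont Cf Uz).
have V : Cn n U (fun w => (2 * Csqrt f w)^-1).
  apply: CnV; first by move=> z Uz; rewrite mulf_neq0 ?s0 // pnatr_eq0.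
  by apply: CnM; [exact: Cn_cst|apply: IH; exact: Cn_leS].
apply: (@Cn_intro _ _ _ (fun w => dir_derive 1 f w / (2 * Csqrt f w))
   (fun w => dir_derive 'i f w / (2 * Csqrt f w))).
- by move=> z Uz; apply: continuous_Csqrt; exact: (Cn_cont Cf Uz).
- move=> z Uz; have [a b] := Cn_ddir Cf Uz.
  have re : \forall w \near z, f w \is Num.real.
    by apply: filterS (near_open oU Uz) => w /f0 /gtr0_real.
  by split; apply: is_ddir_sqrt => //; apply: fp.
- by move=> h eh; apply: (Cn_ext oU eh); apply: CnM V; case: Cf => _ [_ []].
- by move=> h eh; apply: (Cn_ext oU eh); apply: CnM V; case: Cf => _ [_ []].
Qed.

End CnRules.

Lemma smooth_sub U U' f : U' `<=` U -> smooth U f -> smooth U' f.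
Proof. by move=> sU sf n; apply: Cn_sub (sf n). Qed.
Lemma smooth_dir U f : smooth U f -> smooth U (dir_derive 1 f) /\ smooth U (dir_derive 'i f).
Proof. by move=> sf; split=> n; case: (sf n.+1) => _ [_ []]. Qed.
Lemma smooth_cont U f z : smooth U f -> U z -> {for z, continuous f}.
Proof. by move=> /(_ 0%N); apply: Cn_cont. Qed.

Section SmoothRules.
Variables (U : set C).
Hypothesis oU : open U.
Lemma smooth_ext f g : (forall z, U z -> f z = g z) -> smooth U f -> smooth U g.
Proof. by move=> fg sf n; apply: (Cn_ext oU fg). Qed.
Lemma smooth_cst c : smooth U (fun=> c).
Proof. by move=> n; apply: Cn_cst. Qed.
Lemma smooth_id : smooth U id.
Proof. by move=> n; apply: Cn_id. Qed.
Lemma smoothD f g : smooth U f -> smooth U g -> smooth U (fun w => f w + g w).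
Proof. by move=> sf sg n; apply: CnD. Qed.
Lemma smoothM f g : smooth U f -> smooth U g -> smooth U (fun w => f w * g w).
Proof. by move=> sf sg n; apply: CnM. Qed.
Lemma smoothN f : smooth U f -> smooth U (fun w => - f w).
Proof. by move=> sf n; apply: CnN. Qed.
Lemma smoothB f g : smooth U f -> smooth U g -> smooth U (fun w => f w - g w).
Proof. by move=> sf sg; apply: smoothD => //; apply: smoothN. Qed.
Lemma smooth_conj f : smooth U f -> smooth U (fun w => (f w)^*).
Proof. by move=> sf n; apply: Cn_conj. Qed.
Lemma smoothV f : (forall z, U z -> f z != 0) -> smooth U f -> smooth U (fun w => (f w)^-1).
Proof. by move=> f0 sf n; apply: CnV. Qed.
Lemma smooth_sqrt f : (forall z, U z -> 0 < f z) -> smooth U f -> smooth U (Csqrt f).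
Proof. by move=> f0 sf n; apply: Cn_sqrt. Qed.
Lemma smooth_sum (I : Type) (s : seq I) (P : pred I) (F : I -> C -> C) :
  (forall i, P i -> smooth U (F i)) -> smooth U (fun w => \sum_(i <- s | P i) F i w).
Proof.
move=> sF; elim: s => [|i s IH].
  by apply: smooth_ext (smooth_cst 0) => z _; rewrite big_nil.
have [Pi|nPi] := boolP (P i).
  by apply: smooth_ext (smoothD (sF i Pi) IH) => z _; rewrite big_cons Pi.
by apply: smooth_ext IH => z _; rewrite big_cons (negbTE nPi).
Qed.
Lemma smooth_prod (I : Type) (s : seq I) (P : pred I) (F : I -> C -> C) :
  (forall i, P i -> smooth U (F i)) -> smooth U (fun w => \prod_(i <- s | P i) F i w).
Proof.
move=> sF; elim: s => [|i s IH].
  by apply: smooth_ext (smooth_cst 1) => z _; rewrite big_nil.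
have [Pi|nPi] := boolP (P i).
  by apply: smooth_ext (smoothM (sF i Pi) IH) => z _; rewrite big_cons Pi.
by apply: smooth_ext IH => z _; rewrite big_cons (negbTE nPi).
Qed.
Lemma smoothX f n : smooth U f -> smooth U (fun w => f w ^+ n).
Proof.
move=> sf; elim: n => [|n IH]; first by apply: smooth_ext (smooth_cst 1) => z _; rewrite expr0.
by apply: smooth_ext (smoothM sf IH) => z _; rewrite exprS.
Qed.
End SmoothRules.

(* [dz] and [dzb] are the cases [c = - 'i] and [c = 'i]; treating them together
   halves the calculus.  The lock keeps unification from unfolding the limits. *)
Fact wirt_key : unit. Proof. exact: tt. Qed.
Definition wirt (c : C) f z : C :=
  locked_with wirt_key ((dir_derive 1 f z + c * dir_derive 'i f z) / 2).
Lemma wirt_def c f z : wirt c f z = (dir_derive 1 f z + c * dir_derive 'i f z) / 2.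
Proof. by rewrite /wirt locked_withE. Qed.
Lemma dzE f z : dz f z = wirt (- 'i) f z.
Proof. by rewrite /dz wirt_def mulNr. Qed.
Lemma dzbE f z : dzb f z = wirt 'i f z.
Proof. by rewrite wirt_def. Qed.

Lemma eq_wirt c (f g : C -> C) z : (forall w, f w = g w) -> wirt c f z = wirt c g z.
Proof. by move=> /funext ->. Qed.

Definition rdiff f z := dir_derivable 1 f z /\ dir_derivable 'i f z.
Lemma smooth_rdiff U f z : smooth U f -> U z -> rdiff f z.
Proof. by move=> sf Uz; case: (sf 1%N) => _ [h _]; apply: h. Qed.
Lemma rdiffP f z : rdiff f z ->
  is_ddir 1 f z (dir_derive 1 f z) /\ is_ddir 'i f z (dir_derive 'i f z).
Proof. by case=> a b; split; apply: is_ddirP. Qed.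
Lemma wirt_val c f z a b : is_ddir 1 f z a -> is_ddir 'i f z b ->
  wirt c f z = (a + c * b) / 2.
Proof. by rewrite wirt_def => /is_ddir_val -> /is_ddir_val ->. Qed.
Lemma rdiff_val f z a b : is_ddir 1 f z a -> is_ddir 'i f z b -> rdiff f z.
Proof. by move=> /is_ddir_derivable h /is_ddir_derivable h'. Qed.

Section WirtRules.
Variable c : C.
Lemma wirt_near f g z : (\forall w \near z, f w = g w) -> rdiff f z -> wirt c f z = wirt c g z.
Proof.
move=> fg /rdiffP[a b]; rewrite (wirt_val _ a b).
by rewrite (wirt_val _ (is_ddir_near fg a) (is_ddir_near fg b)).
Qed.
Lemma wirt_cst k z : wirt c (fun=> k) z = 0.
Proof. by rewrite (wirt_val _ (is_ddir_cst _ _ _) (is_ddir_cst _ _ _)) mulr0 addr0 mul0r. Qed.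
Lemma wirtD f g z : rdiff f z -> rdiff g z ->
  wirt c (fun w => f w + g w) z = wirt c f z + wirt c g z.
Proof.
move=> /rdiffP[a b] /rdiffP[a' b'].
by rewrite (wirt_val _ (is_ddirD a a') (is_ddirD b b')) !wirt_def; field.
Qed.
Lemma wirtM f g z : rdiff f z -> rdiff g z ->
  wirt c (fun w => f w * g w) z = wirt c f z * g z + f z * wirt c g z.
Proof.
move=> /rdiffP[a b] /rdiffP[a' b'].
by rewrite (wirt_val _ (is_ddirM a a') (is_ddirM b b')) !wirt_def; field.
Qed.
Lemma wirt_conj f z : rdiff f z -> wirt c (fun w => (f w)^*) z = (wirt c^* f z)^*.
Proof.
move=> /rdiffP[a b]; rewrite (wirt_val _ (is_ddir_conj a) (is_ddir_conj b)) wirt_def.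
by rewrite rmorphM rmorphD rmorphM fmorphV /= rmorph_nat conjCK.
Qed.
End WirtRules.

Lemma rdiff_near f g z : (\forall w \near z, f w = g w) -> rdiff f z -> rdiff g z.
Proof. by move=> fg /rdiffP[a b]; apply: rdiff_val (is_ddir_near fg a) (is_ddir_near fg b). Qed.
Lemma rdiff_cst k z : rdiff (fun=> k) z.
Proof. exact: rdiff_val (is_ddir_cst _ _ _) (is_ddir_cst _ _ _). Qed.
Lemma rdiffD f g z : rdiff f z -> rdiff g z -> rdiff (fun w => f w + g w) z.
Proof. by move=> /rdiffP[a b] /rdiffP[a' b']; exact: rdiff_val (is_ddirD a a') (is_ddirD b b'). Qed.
Lemma rdiffM f g z : rdiff f z -> rdiff g z -> rdiff (fun w => f w * g w) z.
Proof. by move=> /rdiffP[a b] /rdiffP[a' b']; exact: rdiff_val (is_ddirM a a') (is_ddirM b b'). Qed.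
Lemma rdiff_conj f z : rdiff f z -> rdiff (fun w => (f w)^*) z.
Proof. by move=> /rdiffP[a b]; exact: rdiff_val (is_ddir_conj a) (is_ddir_conj b). Qed.
Lemma rdiff_sum (I : Type) (s : seq I) (F : I -> C -> C) z :
  (forall i, rdiff (F i) z) -> rdiff (fun w => \sum_(i <- s) F i w) z.
Proof.
move=> sF; elim: s => [|i s IH].
  by apply: rdiff_near (rdiff_cst 0 z); apply: near_all => w; rewrite big_nil.
by apply: rdiff_near (rdiffD (sF i) IH); apply: near_all => w; rewrite big_cons.
Qed.
Lemma wirt_sum c (I : Type) (s : seq I) (F : I -> C -> C) z :
  (forall i, rdiff (F i) z) ->
  wirt c (fun w => \sum_(i <- s) F i w) z = \sum_(i <- s) wirt c (F i) z.
Proof.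
move=> sF; elim: s => [|i s IH].
  rewrite big_nil -[RHS](wirt_cst c 0 z); apply: wirt_near (rdiff_sum [::] sF).
  by apply: near_all => w; rewrite big_nil.
rewrite big_cons -IH -wirtD //; last exact: rdiff_sum.
apply: wirt_near (rdiff_sum (i :: s) sF).
by apply: near_all => w; rewrite big_cons.
Qed.

Lemma smooth_wirt U c f : open U -> smooth U f -> smooth U (wirt c f).
Proof.
move=> oU /smooth_dir[s1 s2].
have s3 := smoothM oU (smoothD oU s1 (smoothM oU (smooth_cst oU c) s2)) (smooth_cst oU 2^-1).
by apply: (smooth_ext oU _ s3) => z _; rewrite wirt_def.
Qed.

Section Schwarz.
Variables (U : set C).
Hypothesis oU : open U.

Lemma nbhs_square z : U z -> exists2 r : R, 0 < r &
  forall s t : R, `|s| < r -> `|t| < r -> U (z + (s%:C)%C + (t%:C)%C * 'i).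
Proof.
move=> Uz; have /nbhs_ballP[e /posC[d d0 ->] sb] := near_open oU Uz.
exists (d / 2); first by rewrite divr_gt0.
move=> s t hs ht; apply: sb; rewrite -ball_normE /ball_ /=.
rewrite (_ : z - _ = - ((s%:C)%C + (t%:C)%C * 'i)); last by ring.
rewrite normrN; apply: le_lt_trans (ler_normD _ _) _.
by rewrite normrM normCi mulr1 !ler_normC -rmorphD /= ltcRE (splitr d) ltrD.
Qed.

Lemma cont_cont00 (h : C -> C) (P : C -> R) z : {for z, continuous h} -> continuous P ->
  cont00 (fun s t : R => P (h (z + (s%:C)%C + (t%:C)%C * 'i))).
Proof.
move=> ch cP e e0.
have cPh : P (h w) @[w --> z] --> P (h z) by apply: (cvg_comp _ _ ch); exact: cP.
have H : \forall t \near z, `|P (h z) - P (h t)| < e.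
  exact: (@cvgr_dist_lt R R^o _ (nbhs z) _ _ _ cPh e e0).
case/nbhs_ballP: H => [e' /posC[d d0 ->] sb].
exists (d / 2); first by rewrite divr_gt0.
move=> s t hs ht; rewrite RC0 addr0 mul0r addr0 distrC; apply: sb.
rewrite -ball_normE /ball_ /=.
rewrite (_ : z - _ = - ((s%:C)%C + (t%:C)%C * 'i)); last by ring.
rewrite normrN; apply: le_lt_trans (ler_normD _ _) _.
by rewrite normrM normCi mulr1 !ler_normC -rmorphD /= ltcRE (splitr d) ltrD.
Qed.

Lemma line1 (h : C -> C) z (s t : R) : rdiff h (z + (s%:C)%C + (t%:C)%C * 'i) ->
  is_derive s (1 : R) (fun s => Re (h (z + (s%:C)%C + (t%:C)%C * 'i)))
    (Re (dir_derive 1 h (z + (s%:C)%C + (t%:C)%C * 'i))) /\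
  is_derive s (1 : R) (fun s => Im (h (z + (s%:C)%C + (t%:C)%C * 'i)))
    (Im (dir_derive 1 h (z + (s%:C)%C + (t%:C)%C * 'i))).
Proof.
move=> /rdiffP[]; set w := _ + _ => dw _.
have E (s' : R) : z + (s'%:C)%C + (t%:C)%C * 'i = (z + (t%:C)%C * 'i) + (s'%:C)%C * 1 by ring.
have := @is_ddir_line R 1 h (z + (t%:C)%C * 'i) s (dir_derive 1 h w).
rewrite -E => /(_ dw) [a b]; split.
- by move: a; congr (is_derive _ _ _ _); apply/funext => s'; rewrite E.
- by move: b; congr (is_derive _ _ _ _); apply/funext => s'; rewrite E.
Qed.

Lemma line2 (h : C -> C) z (s t : R) : rdiff h (z + (s%:C)%C + (t%:C)%C * 'i) ->
  is_derive t (1 : R) (fun t => Re (h (z + (s%:C)%C + (t%:C)%C * 'i)))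
    (Re (dir_derive 'i h (z + (s%:C)%C + (t%:C)%C * 'i))) /\
  is_derive t (1 : R) (fun t => Im (h (z + (s%:C)%C + (t%:C)%C * 'i)))
    (Im (dir_derive 'i h (z + (s%:C)%C + (t%:C)%C * 'i))).
Proof. by move=> /rdiffP[_ dw]; apply: is_ddir_line. Qed.

Lemma dir_derive_sym f z : smooth U f -> U z ->
  dir_derive 'i (dir_derive 1 f) z = dir_derive 1 (dir_derive 'i f) z.
Proof.
move=> sf Uz; have [r r0 hr] := nbhs_square Uz.
have [s1 s2] := smooth_dir sf.
have z00 : z + (0%:C)%C + (0%:C)%C * 'i = z by rewrite RC0 addr0 mul0r addr0.
apply: Ceq.
- have := @schwarz_real R (fun s t => Re (f (z + (s%:C)%C + (t%:C)%C * 'i)))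
    (fun s t => Re (dir_derive 1 f (z + (s%:C)%C + (t%:C)%C * 'i)))
    (fun s t => Re (dir_derive 'i f (z + (s%:C)%C + (t%:C)%C * 'i))) r r0 _ _
    (fun s t => Re (dir_derive 'i (dir_derive 1 f) (z + (s%:C)%C + (t%:C)%C * 'i)))
    (fun s t => Re (dir_derive 1 (dir_derive 'i f) (z + (s%:C)%C + (t%:C)%C * 'i))).
  rewrite z00; apply.
  + by move=> s t hs ht; apply: (proj1 (line1 (smooth_rdiff sf (hr s t hs ht)))).
  + by move=> s t hs ht; apply: (proj1 (line2 (smooth_rdiff sf (hr s t hs ht)))).
  + by move=> s t hs ht; apply: (proj1 (line2 (smooth_rdiff s1 (hr s t hs ht)))).
  + by move=> s t hs ht; apply: (proj1 (line1 (smooth_rdiff s2 (hr s t hs ht)))).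
  + apply: cont_cont00; last exact: continuous_Re.
    exact: smooth_cont (proj2 (smooth_dir s1)) Uz.
  + apply: cont_cont00; last exact: continuous_Re.
    exact: smooth_cont (proj1 (smooth_dir s2)) Uz.
- have := @schwarz_real R (fun s t => Im (f (z + (s%:C)%C + (t%:C)%C * 'i)))
    (fun s t => Im (dir_derive 1 f (z + (s%:C)%C + (t%:C)%C * 'i)))
    (fun s t => Im (dir_derive 'i f (z + (s%:C)%C + (t%:C)%C * 'i))) r r0 _ _
    (fun s t => Im (dir_derive 'i (dir_derive 1 f) (z + (s%:C)%C + (t%:C)%C * 'i)))
    (fun s t => Im (dir_derive 1 (dir_derive 'i f) (z + (s%:C)%C + (t%:C)%C * 'i))).
  rewrite z00; apply.
  + by move=> s t hs ht; apply: (proj2 (line1 (smooth_rdiff sf (hr s t hs ht)))).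
  + by move=> s t hs ht; apply: (proj2 (line2 (smooth_rdiff sf (hr s t hs ht)))).
  + by move=> s t hs ht; apply: (proj2 (line2 (smooth_rdiff s1 (hr s t hs ht)))).
  + by move=> s t hs ht; apply: (proj2 (line1 (smooth_rdiff s2 (hr s t hs ht)))).
  + apply: cont_cont00; last exact: continuous_Im.
    exact: smooth_cont (proj2 (smooth_dir s1)) Uz.
  + apply: cont_cont00; last exact: continuous_Im.
    exact: smooth_cont (proj1 (smooth_dir s2)) Uz.
Qed.

(** Smoothness provides the two axis derivatives; their continuity extends them to every direction,
    as needed for segments in arbitrary position and for rotations of the variable. *)
Lemma is_ddir_any f z v : smooth U f -> U z ->
  is_ddir v f z ((Re v)%:C%C * dir_derive 1 f z + (Im v)%:C%C * dir_derive 'i f z).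
Proof.
move=> sf Uz; have [r r0 hr] := nbhs_square Uz.
have [s1 s2] := smooth_dir sf.
have z00 : z + (0%:C)%C + (0%:C)%C * 'i = z by rewrite RC0 addr0 mul0r addr0.
have E (t : R) : z + (t%:C)%C * v = z + ((t * Re v)%:C)%C + ((t * Im v)%:C)%C * 'i.
  by rewrite [in LHS](CReIm v) !rmorphM /=; ring.
split.
- have := @C1_direction R (fun s t => Re (f (z + (s%:C)%C + (t%:C)%C * 'i)))
    (fun s t => Re (dir_derive 1 f (z + (s%:C)%C + (t%:C)%C * 'i)))
    (fun s t => Re (dir_derive 'i f (z + (s%:C)%C + (t%:C)%C * 'i))) r r0 _ _ (Re v) (Im v).
  rewrite z00 (_ : re_along v f z =
      (fun t => Re (f (z + ((t * Re v)%:C)%C + ((t * Im v)%:C)%C * 'i)))); last first.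
    by apply/funext => t; rewrite /re_along E.
  rewrite ReaddE !RemulE !ReCE !ImCE !mul0r !subr0; apply.
  + by move=> s t hs ht; apply: (proj1 (line1 (smooth_rdiff sf (hr s t hs ht)))).
  + by move=> s t hs ht; apply: (proj1 (line2 (smooth_rdiff sf (hr s t hs ht)))).
  + apply: cont_cont00; [exact: smooth_cont s1 Uz|exact: continuous_Re].
  + apply: cont_cont00; [exact: smooth_cont s2 Uz|exact: continuous_Re].
- have := @C1_direction R (fun s t => Im (f (z + (s%:C)%C + (t%:C)%C * 'i)))
    (fun s t => Im (dir_derive 1 f (z + (s%:C)%C + (t%:C)%C * 'i)))
    (fun s t => Im (dir_derive 'i f (z + (s%:C)%C + (t%:C)%C * 'i))) r r0 _ _ (Re v) (Im v).
  rewrite z00 (_ : im_along v f z =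
      (fun t => Im (f (z + ((t * Re v)%:C)%C + ((t * Im v)%:C)%C * 'i)))); last first.
    by apply/funext => t; rewrite /im_along E.
  rewrite ImaddE !ImmulE !ReCE !ImCE !mul0r !addr0; apply.
  + by move=> s t hs ht; apply: (proj2 (line1 (smooth_rdiff sf (hr s t hs ht)))).
  + by move=> s t hs ht; apply: (proj2 (line2 (smooth_rdiff sf (hr s t hs ht)))).
  + apply: cont_cont00; [exact: smooth_cont s1 Uz|exact: continuous_Im].
  + apply: cont_cont00; [exact: smooth_cont s2 Uz|exact: continuous_Im].
Qed.
End Schwarz.

Lemma wirt_sym U c d f z : open U -> smooth U f -> U z ->
  wirt c (wirt d f) z = wirt d (wirt c f) z.
Proof.
move=> oU sf Uz; have [s1 s2] := smooth_dir sf.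
have r1 := smooth_rdiff s1 Uz; have r2 := smooth_rdiff s2 Uz.
have E e e' : wirt e (wirt e' f) z =
    (wirt e (dir_derive 1 f) z + e' * wirt e (dir_derive 'i f) z) / 2.
  rewrite (eq_wirt e z (wirt_def e' f)); have rc k := rdiff_cst k z.
  have r3 : rdiff (fun w => e' * dir_derive 'i f w) z by apply: rdiffM (rc _) r2.
  rewrite (@wirtM e (fun w => dir_derive 1 f w + e' * dir_derive 'i f w) (fun=> 2^-1) z (rdiffD r1 r3) (rc _)).
  by rewrite (wirtD e r1 r3) (wirtM e (rc _) r2) !wirt_cst mulr0 addr0 mul0r add0r.
rewrite !E !wirt_def (dir_derive_sym oU sf Uz).
move: (dir_derive 1 (dir_derive 1 f) z) (dir_derive 1 (dir_derive 'i f) z)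
  (dir_derive 'i (dir_derive 'i f) z) => p q r.
by field.
Qed.

End SmoothFunctions.

#[global] Opaque dir_derive dir_derivable rdiff smooth.

(** * Matrix-valued functions and the Lorentzian product *)

Section Entries.
Variable K : pzRingType.
Lemma mxaddE p q (A B : 'M[K]_(p, q)) i j : (A + B) i j = A i j + B i j.
Proof. by rewrite mxE. Qed.
Lemma mxoppE p q (A : 'M[K]_(p, q)) i j : (- A) i j = - A i j.
Proof. by rewrite mxE. Qed.
Lemma mxscaleE p q k (A : 'M[K]_(p, q)) i j : (k *: A) i j = k * A i j.
Proof. by rewrite mxE. Qed.
Lemma dyadE p q (x : 'cV[K]_p) (y : 'cV[K]_q) i j : (x *m y^T) i j = x i ord0 * y j ord0.
Proof. by rewrite mxE big_ord1 mxE. Qed.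
Lemma mxzeroE p q i j : (0 : 'M[K]_(p, q)) i j = 0. Proof. by rewrite mxE. Qed.
Definition mxlinE := (mxaddE, mxoppE, mxscaleE, dyadE, mxzeroE).
End Entries.

Section MatrixCalculus.
Variable R : realType.
Local Notation C := (Cx R).
Implicit Types (z c k : C) (U : set C).

Fact mxwirt_key : unit. Proof. exact: tt. Qed.
Definition mxwirt (p q : nat) (c : C) (M : C -> 'M[C]_(p, q)) z : 'M[C]_(p, q) :=
  locked_with mxwirt_key (\matrix_(i, j) wirt c (fun w => M w i j) z).
Lemma mxwirtE p q c (M : C -> 'M[C]_(p, q)) z i j : mxwirt c M z i j = wirt c (fun w => M w i j) z.
Proof. by rewrite /mxwirt locked_withE mxE. Qed.
Lemma eq_mxwirt p q c (f g : C -> 'M[C]_(p, q)) z : (forall w, f w = g w) ->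
  mxwirt c f z = mxwirt c g z.
Proof. by move=> /funext ->. Qed.
Definition mxrdiff (p q : nat) (M : C -> 'M[C]_(p, q)) z :=
  forall i j, rdiff (fun w => M w i j) z.

Lemma mxdzE p q (M : C -> 'M[C]_(p, q)) : mxdz M = mxwirt (- 'i) M.
Proof. by apply/funext => z; apply/matrixP => i j; rewrite !(mxE, mxwirtE) dzE. Qed.
Lemma mxdzbE p q (M : C -> 'M[C]_(p, q)) : mxdzb M = mxwirt 'i M.
Proof. by apply/funext => z; apply/matrixP => i j; rewrite !(mxE, mxwirtE) dzbE. Qed.
Lemma conjNi : (- 'i : C)^* = 'i.
Proof. by rewrite rmorphN /= conjCi opprK. Qed.

Lemma mxsmooth_rdiff p q U (M : C -> 'M[C]_(p, q)) z : mxsmooth U M -> U z -> mxrdiff M z.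
Proof. by move=> sM Uz i j; apply: smooth_rdiff (sM i j) Uz. Qed.
Lemma mxsmooth_sub p q U U' (M : C -> 'M[C]_(p, q)) : U' `<=` U -> mxsmooth U M -> mxsmooth U' M.
Proof. by move=> sU sM i j; apply: smooth_sub sU (sM i j). Qed.

Section Rdiff.
Variables p q : nat.
Implicit Types (M N : C -> 'M[C]_(p, q)) (f : C -> C).
Lemma mxrdiff_near M N z : (\forall w \near z, M w = N w) -> mxrdiff M z -> mxrdiff N z.
Proof.
move=> MN dM i j; apply: rdiff_near (dM i j).
by apply: filterS MN => w ->.
Qed.
Lemma mxwirt_near c M N z : (\forall w \near z, M w = N w) -> mxrdiff M z ->
  mxwirt c M z = mxwirt c N z.
Proof.
move=> MN dM; apply/matrixP => i j; rewrite !(mxE, mxwirtE); apply: wirt_near (dM i j).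
by apply: filterS MN => w ->.
Qed.
Lemma mxrdiff_cst (A : 'M[C]_(p, q)) z : mxrdiff (fun=> A) z.
Proof. by move=> i j; apply: rdiff_cst. Qed.
Lemma mxwirt_cst c (A : 'M[C]_(p, q)) z : mxwirt c (fun=> A) z = 0.
Proof. by apply/matrixP => i j; rewrite !(mxE, mxwirtE) wirt_cst. Qed.
Lemma mxrdiffD M N z : mxrdiff M z -> mxrdiff N z -> mxrdiff (fun w => M w + N w) z.
Proof.
move=> dM dN i j; apply: rdiff_near (rdiffD (dM i j) (dN i j)).
by apply: near_all => w; rewrite mxE.
Qed.
Lemma mxwirtD c M N z : mxrdiff M z -> mxrdiff N z ->
  mxwirt c (fun w => M w + N w) z = mxwirt c M z + mxwirt c N z.
Proof.
move=> dM dN; apply/matrixP => i j; rewrite !(mxE, mxwirtE) -(wirtD c (dM i j) (dN i j)).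
by apply: eq_wirt => w; rewrite mxE.
Qed.
Lemma mxrdiffZ f M z : rdiff f z -> mxrdiff M z -> mxrdiff (fun w => f w *: M w) z.
Proof.
move=> df dM i j; apply: rdiff_near (rdiffM df (dM i j)).
by apply: near_all => w; rewrite mxE.
Qed.
Lemma mxwirtZ c f M z : rdiff f z -> mxrdiff M z ->
  mxwirt c (fun w => f w *: M w) z = wirt c f z *: M z + f z *: mxwirt c M z.
Proof.
move=> df dM; apply/matrixP => i j; rewrite !(mxE, mxwirtE) -(wirtM c df (dM i j)).
by apply: eq_wirt => w; rewrite mxE.
Qed.
Lemma mxrdiff_conj M z : mxrdiff M z -> mxrdiff (fun w => mxconj (M w)) z.
Proof.
move=> dM i j; apply: rdiff_near (rdiff_conj (dM i j)).
by apply: near_all => w; rewrite mxE.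
Qed.
Lemma mxwirt_conj c M z : mxrdiff M z ->
  mxwirt c (fun w => mxconj (M w)) z = mxconj (mxwirt c^* M z).
Proof.
move=> dM; apply/matrixP => i j; rewrite !(mxE, mxwirtE) -(wirt_conj c (dM i j)).
by apply: eq_wirt => w; rewrite mxE.
Qed.
Lemma mxrdiff_tr M z : mxrdiff M z -> mxrdiff (fun w => (M w)^T) z.
Proof.
move=> dM i j; apply: rdiff_near (dM j i).
by apply: near_all => w; rewrite mxE.
Qed.
Lemma mxwirt_tr c M z : mxwirt c (fun w => (M w)^T) z = (mxwirt c M z)^T.
Proof.
apply/matrixP => i j; rewrite !(mxE, mxwirtE).
by apply: eq_wirt => w; rewrite mxE.
Qed.
Lemma mxrdiffN M z : mxrdiff M z -> mxrdiff (fun w => - M w) z.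
Proof.
move=> dM; apply: mxrdiff_near (mxrdiffZ (rdiff_cst (-1) z) dM).
by apply: near_all => w; rewrite scaleN1r.
Qed.
Lemma mxwirtN c M z : mxrdiff M z -> mxwirt c (fun w => - M w) z = - mxwirt c M z.
Proof.
move=> dM; have := mxwirtZ c (rdiff_cst (-1) z) dM.
rewrite wirt_cst scale0r add0r scaleN1r => <-.
by apply: eq_mxwirt => w; rewrite scaleN1r.
Qed.
Lemma mxrdiffB M N z : mxrdiff M z -> mxrdiff N z -> mxrdiff (fun w => M w - N w) z.
Proof. by move=> dM dN; exact: (mxrdiffD dM (mxrdiffN dN)). Qed.
Lemma mxwirtB c M N z : mxrdiff M z -> mxrdiff N z ->
  mxwirt c (fun w => M w - N w) z = mxwirt c M z - mxwirt c N z.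
Proof. by move=> dM dN; rewrite (mxwirtD c dM (mxrdiffN dN)) (mxwirtN c dN). Qed.
End Rdiff.

Lemma mxrdiffM p q r (A : C -> 'M[C]_(p, q)) (B : C -> 'M[C]_(q, r)) z :
  mxrdiff A z -> mxrdiff B z -> mxrdiff (fun w => A w *m B w) z.
Proof.
move=> dA dB i j.
apply: rdiff_near (@rdiff_sum R _ (index_enum 'I_q)
  (fun l w => A w i l * B w l j) z (fun l => rdiffM (dA i l) (dB l j))).
by apply: near_all => w; rewrite mxE.
Qed.
Lemma mxwirtM p q r c (A : C -> 'M[C]_(p, q)) (B : C -> 'M[C]_(q, r)) z :
  mxrdiff A z -> mxrdiff B z ->
  mxwirt c (fun w => A w *m B w) z = mxwirt c A z *m B z + A z *m mxwirt c B z.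
Proof.
move=> dA dB; apply/matrixP => i j; rewrite !(mxE, mxwirtE) -big_split /=.
transitivity (wirt c (fun w => \sum_l A w i l * B w l j) z).
  by apply: eq_wirt => w; rewrite mxE.
rewrite wirt_sum; last by move=> l; apply: rdiffM.
by apply: eq_bigr => l _; rewrite wirtM // !(mxE, mxwirtE).
Qed.
Lemma mxwirtMl p q r c (A : 'M[C]_(p, q)) (B : C -> 'M[C]_(q, r)) z :
  mxrdiff B z -> mxwirt c (fun w => A *m B w) z = A *m mxwirt c B z.
Proof.
move=> dB; rewrite (@mxwirtM p q r c (fun=> A)) //; last exact: mxrdiff_cst.
by rewrite mxwirt_cst mul0mx add0r.
Qed.
Lemma mxwirtMr p q r c (A : C -> 'M[C]_(p, q)) (B : 'M[C]_(q, r)) z :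
  mxrdiff A z -> mxwirt c (fun w => A w *m B) z = mxwirt c A z *m B.
Proof.
move=> dA; rewrite (@mxwirtM p q r c A (fun=> B)) //; last exact: mxrdiff_cst.
by rewrite mxwirt_cst mulmx0 addr0.
Qed.


Section Smooth.
Variables (U : set C).
Hypothesis oU : open U.
Lemma mxsmooth_ext p q (M N : C -> 'M[C]_(p, q)) : (forall z, U z -> M z = N z) ->
  mxsmooth U M -> mxsmooth U N.
Proof. by move=> MN sM i j; apply: smooth_ext oU _ _ _ (sM i j) => z Uz; rewrite MN. Qed.
Lemma mxsmooth_cst p q (A : 'M[C]_(p, q)) : mxsmooth U (fun=> A).
Proof. by move=> i j; apply: smooth_cst. Qed.
Lemma mxsmoothD p q (M N : C -> 'M[C]_(p, q)) : mxsmooth U M -> mxsmooth U N ->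
  mxsmooth U (fun w => M w + N w).
Proof.
by move=> sM sN i j; apply: smooth_ext oU _ _ _ (smoothD oU (sM i j) (sN i j)) => z _; rewrite mxE.
Qed.
Lemma mxsmoothZ p q f (M : C -> 'M[C]_(p, q)) : smooth U f -> mxsmooth U M ->
  mxsmooth U (fun w => f w *: M w).
Proof.
by move=> sM sN i j; apply: smooth_ext oU _ _ _ (smoothM oU sM (sN i j)) => z _; rewrite mxE.
Qed.
Lemma mxsmoothN p q (M : C -> 'M[C]_(p, q)) : mxsmooth U M -> mxsmooth U (fun w => - M w).
Proof.
by move=> sM i j; apply: smooth_ext oU _ _ _ (smoothN oU (sM i j)) => z _; rewrite mxE.
Qed.
Lemma mxsmoothB p q (M N : C -> 'M[C]_(p, q)) : mxsmooth U M -> mxsmooth U N ->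
  mxsmooth U (fun w => M w - N w).
Proof. by move=> sM sN; apply: mxsmoothD => //; apply: mxsmoothN. Qed.
Lemma mxsmooth_conj p q (M : C -> 'M[C]_(p, q)) : mxsmooth U M -> mxsmooth U (fun w => mxconj (M w)).
Proof.
by move=> sM i j; apply: smooth_ext oU _ _ _ (smooth_conj oU (sM i j)) => z _; rewrite mxE.
Qed.
Lemma mxsmooth_tr p q (M : C -> 'M[C]_(p, q)) : mxsmooth U M -> mxsmooth U (fun w => (M w)^T).
Proof.
by move=> sM i j; apply: smooth_ext oU _ _ _ (sM j i) => z _; rewrite mxE.
Qed.
Lemma mxsmoothM p q r (A : C -> 'M[C]_(p, q)) (B : C -> 'M[C]_(q, r)) :
  mxsmooth U A -> mxsmooth U B -> mxsmooth U (fun w => A w *m B w).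
Proof.
move=> sA sB i j.
apply: smooth_ext oU _ _ _ (@smooth_sum R U oU _ (index_enum 'I_q) xpredT
  (fun l w => A w i l * B w l j) (fun l _ => smoothM oU (sA i l) (sB l j))).
by move=> z _; rewrite mxE.
Qed.
Lemma mxsmooth_wirt p q c (M : C -> 'M[C]_(p, q)) : mxsmooth U M -> mxsmooth U (mxwirt c M).
Proof.
by move=> sM i j; apply: smooth_ext oU _ _ _ (smooth_wirt c oU (sM i j)) => z _; rewrite mxwirtE.
Qed.
Lemma mxsmooth_col p q (M : C -> 'M[C]_(p, q)) j : mxsmooth U M -> mxsmooth U (fun w => col j (M w)).
Proof.
by move=> sM i k; apply: smooth_ext oU _ _ _ (sM i j) => z _; rewrite mxE.
Qed.
Lemma smooth_det n (M : C -> 'M[C]_n) : mxsmooth U M -> smooth U (fun w => \det (M w)).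
Proof.
move=> sM; apply: smooth_sum => // s _; apply: smoothM => //; first exact: smooth_cst.
by apply: smooth_prod => // i _; apply: sM.
Qed.
(** The adjugate is polynomial in the entries, so that only the inverse of the determinant needs the
    hypothesis. *)
Lemma mxsmooth_inv n (M : C -> 'M[C]_n) : (forall z, U z -> M z \in unitmx) ->
  mxsmooth U M -> mxsmooth U (fun w => invmx (M w)).
Proof.
move=> uM sM.
have sadj : mxsmooth U (fun w => \adj (M w)).
  move=> i j; apply: smooth_ext oU (fun w => (-1) ^+ (j + i) * \det (row' j (col' i (M w)))) _ _ _.
    by move=> z _; rewrite !mxE.
  apply: smoothM => //; first exact: smooth_cst.
  apply: smooth_det => k l; apply: smooth_ext oU _ _ _ (sM (lift j k) (lift i l)).
  by move=> z _; rewrite !mxE.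
have sV : smooth U (fun w => (\det (M w))^-1).
  apply: smoothV => //; last exact: smooth_det.
by apply: mxsmooth_ext (mxsmoothZ sV sadj) => z Uz; rewrite /invmx uM.
Qed.
Lemma mxwirt_eq p q c (M N : C -> 'M[C]_(p, q)) z : mxsmooth U M -> (forall z, U z -> M z = N z) ->
  U z -> mxwirt c M z = mxwirt c N z.
Proof.
move=> sM MN Uz; apply: mxwirt_near (mxsmooth_rdiff sM Uz).
by apply: filterS (near_open oU Uz) => w /MN.
Qed.
Lemma wirt_eq c f g z : smooth U f -> (forall z, U z -> f z = g z) ->
  U z -> wirt c f z = wirt c g z.
Proof.
move=> sM MN Uz; apply: wirt_near (smooth_rdiff sM Uz).
by apply: filterS (near_open oU Uz) => w /MN.
Qed.
Lemma mxwirt_sym p q c d (M : C -> 'M[C]_(p, q)) z : mxsmooth U M -> U z ->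
  mxwirt c (mxwirt d M) z = mxwirt d (mxwirt c M) z.
Proof.
move=> sM Uz; apply/matrixP => i j; rewrite !(mxE, mxwirtE).
rewrite (_ : (fun w => mxwirt d M w i j) = wirt d (fun w => M w i j)); last first.
  by apply/funext => w; rewrite mxwirtE.
rewrite (_ : (fun w => mxwirt c M w i j) = wirt c (fun w => M w i j)); last first.
  by apply/funext => w; rewrite mxwirtE.
exact: (wirt_sym c d oU (sM i j) Uz).
Qed.
End Smooth.

Lemma mxconjK p q (A : 'M[C]_(p, q)) : mxconj (mxconj A) = A.
Proof. by apply/matrixP => i j; rewrite !mxE conjCK. Qed.
Lemma mxconjM p q r (A : 'M[C]_(p, q)) (B : 'M[C]_(q, r)) : mxconj (A *m B) = mxconj A *m mxconj B.
Proof. exact: map_mxM. Qed.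
Lemma mxconjD p q (A B : 'M[C]_(p, q)) : mxconj (A + B) = mxconj A + mxconj B.
Proof. exact: map_mxD. Qed.
Lemma mxconjN p q (A : 'M[C]_(p, q)) : mxconj (- A) = - mxconj A.
Proof. exact: map_mxN. Qed.
Lemma mxconjB p q (A B : 'M[C]_(p, q)) : mxconj (A - B) = mxconj A - mxconj B.
Proof. exact: map_mxB. Qed.
Lemma mxconjZ p q k (A : 'M[C]_(p, q)) : mxconj (k *: A) = k^* *: mxconj A.
Proof. exact: map_mxZ. Qed.
Lemma mxconj_tr p q (A : 'M[C]_(p, q)) : mxconj A^T = (mxconj A)^T.
Proof. by rewrite /mxconj map_trmx. Qed.
Lemma mxconj0 p q : mxconj (0 : 'M[C]_(p, q)) = 0.
Proof. exact: map_mx0. Qed.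
Lemma mxconj_real p q (A : 'M[C]_(p, q)) : (A \is a mxOver Num.real) = (mxconj A == A).
Proof.
apply/mxOverP/eqP => [h|h i j]; last first.
  rewrite CrealE; apply/eqP.
  by have := congr1 (fun B : 'M[C]_(p, q) => B i j) h; rewrite mxE.
by apply/matrixP => i j; rewrite mxE; apply/eqP; rewrite -CrealE.
Qed.

Section InnerProduct.
Variable n : nat.
Local Notation J := (mink R n.+1).
Implicit Types x y u v : 'cV[C]_n.+2.

Lemma trJ : J^T = J. Proof. exact: tr_diag_mx. Qed.
Lemma JJ : J *m J = 1%:M.
Proof.
apply/matrixP => i j; rewrite mul_diag_mx !mxE.
by case: (i == ord0); case: (i == j); rewrite ?mulr0n ?mulr1n ?mulr0 ?mulrNN ?mulr1.
Qed.
Lemma conjJ : mxconj J = J.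
Proof.
apply/matrixP => i j; rewrite !mxE.
by case: (i == ord0); case: (i == j); rewrite ?mulr0n ?mulr1n ?rmorph0 ?rmorphN ?rmorph1.
Qed.

Lemma ipE p (A : 'M[C]_(n.+2, p)) (i : 'I_p) x : (A^T *m J *m x) i ord0 = ip (col i A) x.
Proof. by rewrite /ip !mxE; apply: eq_bigr => k _; rewrite !mxE; congr (_ * _); apply: eq_bigr => l _; rewrite !mxE. Qed.
Lemma ip_mx x y : x^T *m J *m y = (ip x y)%:M.
Proof. by apply/matrixP => i j; rewrite !ord1 /ip [RHS]mxE mulr1n. Qed.
Lemma ip_def x y : ip x y = (x^T *m J *m y) ord0 ord0.
Proof. by []. Qed.
Lemma ipC x y : ip x y = ip y x.
Proof.
by rewrite /ip -[in LHS](trmxK (x^T *m J *m y)) mxE !trmx_mul trmxK trJ mulmxA.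
Qed.
Lemma ipDl x y u : ip (x + y) u = ip x u + ip y u.
Proof. by rewrite /ip linearD !mulmxDl mxE. Qed.
Lemma ipDr x y u : ip u (x + y) = ip u x + ip u y.
Proof. by rewrite ipC ipDl !(ipC u). Qed.
Lemma ipZl k x u : ip (k *: x) u = k * ip x u.
Proof. by rewrite /ip linearZ -!scalemxAl mxE. Qed.
Lemma ipZr k x u : ip u (k *: x) = k * ip u x.
Proof. by rewrite ipC ipZl ipC. Qed.
Lemma ipNl x u : ip (- x) u = - ip x u.
Proof. by rewrite -scaleN1r ipZl mulN1r. Qed.
Lemma ipNr x u : ip u (- x) = - ip u x.
Proof. by rewrite -scaleN1r ipZr mulN1r. Qed.
Lemma ip0l u : ip 0 u = 0. Proof. by rewrite /ip trmx0 !mul0mx mxE. Qed.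
Lemma ip0r u : ip u 0 = 0. Proof. by rewrite ipC ip0l. Qed.
Lemma ip_suml (I : Type) (s : seq I) (P : pred I) (F : I -> 'cV[C]_n.+2) u :
  ip (\sum_(i <- s | P i) F i) u = \sum_(i <- s | P i) ip (F i) u.
Proof. by elim/big_rec2: _ => [|i a b _ <-]; rewrite ?ip0l ?ipDl. Qed.
Lemma ip_conj x y : (ip x y)^* = ip (mxconj x) (mxconj y).
Proof.
have := congr1 (fun A : 'M[C]_1 => A ord0 ord0) (mxconjM (x^T *m J) y).
by rewrite mxE mxconjM mxconj_tr conjJ.
Qed.
Definition ipE2 := (ipDl, ipDr, ipNl, ipNr, ipZl, ipZr, ip0l, ip0r).

Lemma wirt_ip c (x y : C -> 'cV[C]_n.+2) z : mxrdiff x z -> mxrdiff y z ->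
  wirt c (fun w => ip (x w) (y w)) z = ip (mxwirt c x z) (y z) + ip (x z) (mxwirt c y z).
Proof.
move=> dx dy.
transitivity (mxwirt c (fun w => ((x w)^T *m J) *m y w) z ord0 ord0); first by rewrite mxwirtE.
rewrite mxwirtM //; last by apply: mxrdiffM (mxrdiff_cst J z); apply: mxrdiff_tr.
by rewrite mxwirtMr ?mxwirt_tr 1?mxE //; apply: mxrdiff_tr.
Qed.
Lemma mxwirt_gram p c (A : C -> 'M[C]_(n.+2, p)) (x : C -> 'cV[C]_n.+2) z :
  mxrdiff A z -> mxrdiff x z ->
  mxwirt c (fun w => (A w)^T *m J *m x w) z =
    (mxwirt c A z)^T *m J *m x z + (A z)^T *m J *m mxwirt c x z.
Proof.
move=> dA dx; have dAt := mxrdiff_tr dA.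
by rewrite (mxwirtM c (mxrdiffM dAt (mxrdiff_cst J z)) dx) (mxwirtMr c J dAt) mxwirt_tr.
Qed.
Lemma mxsmooth_gram p U (A : C -> 'M[C]_(n.+2, p)) (x : C -> 'cV[C]_n.+2) : open U ->
  mxsmooth U A -> mxsmooth U x -> mxsmooth U (fun w => (A w)^T *m J *m x w).
Proof.
by move=> oU sA sx; exact: (mxsmoothM oU (mxsmoothM oU (mxsmooth_tr oU sA) (mxsmooth_cst oU J)) sx).
Qed.
Lemma smooth_ip U (x y : C -> 'cV[C]_n.+2) : open U -> mxsmooth U x -> mxsmooth U y ->
  smooth U (fun w => ip (x w) (y w)).
Proof.
by move=> oU sx sy; apply: (mxsmoothM oU (mxsmoothM oU (mxsmooth_tr oU sx) (mxsmooth_cst oU J)) sy).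
Qed.
End InnerProduct.
Lemma mxconjE p q (A : 'M[C]_(p, q)) i j : mxconj A i j = (A i j)^*.
Proof. by rewrite mxE. Qed.
Lemma mxconj_unit p (A : 'M[C]_p) : (mxconj A \in unitmx) = (A \in unitmx).
Proof. exact: map_unitmx. Qed.
End MatrixCalculus.

#[global] Opaque ip mxconj.

(** * Functions with vanishing derivatives *)

Section FlatFunctions.
Variable R : realType.
Local Notation C := (Cx R).
Local Notation Re := (@complex.Re R).
Local Notation Im := (@complex.Im R).
Implicit Types (f g : C -> C) (z w p a b v : C) (U D : set C).

Definition flat f w := forall v, is_ddir v f w 0.

Lemma smooth_flat U f w : open U -> smooth U f -> U w ->
  wirt (- 'i) f w = 0 -> wirt 'i f w = 0 -> flat f w.
Proof.
move=> oU sf Uw e1 e2 v.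
have i0 : ('i : C) != 0 by exact: neq0Ci.
have n2 : (2 : C) != 0 by rewrite pnatr_eq0.
have ii : 'i * 'i = -1 :> C by rewrite -expr2 sqrCi.
have E1 : wirt (- 'i) f w + wirt 'i f w = dir_derive 1 f w.
  by rewrite (wirt_val _ (rdiffP (smooth_rdiff sf Uw)).1 (rdiffP (smooth_rdiff sf Uw)).2)
    (wirt_val _ (rdiffP (smooth_rdiff sf Uw)).1 (rdiffP (smooth_rdiff sf Uw)).2); field.
have E2 : wirt 'i f w - wirt (- 'i) f w = 'i * dir_derive 'i f w.
  by rewrite (wirt_val _ (rdiffP (smooth_rdiff sf Uw)).1 (rdiffP (smooth_rdiff sf Uw)).2)
    (wirt_val _ (rdiffP (smooth_rdiff sf Uw)).1 (rdiffP (smooth_rdiff sf Uw)).2); field.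
have d1 : dir_derive 1 f w = 0 by rewrite -E1 e1 e2 addr0.
have d2 : dir_derive 'i f w = 0.
  by apply: (mulfI i0); rewrite -E2 e1 e2 subr0 mulr0.
by have := is_ddir_any oU v sf Uw; rewrite d1 d2 !mulr0 addr0.
Qed.

Lemma derive0_segment (g : R -> R) :
  (forall t : R, t \in `[0, 1]%R -> is_derive t (1 : R) g 0) -> g 1 = g 0.
Proof.
move=> dg.
have h0 : forall x : R, x \in `]0, 1[%R -> is_derive x (1 : R) g ((fun=> 0) x).
  by move=> x xI; apply: dg; apply: subset_itv_oo_cc xI.
have h1 : {within `[0, 1], continuous g}.
  by apply: derivable_within_continuous => t /dg [].
have [x _] := @MVT R g (fun=> 0) 0 1 ltr01 h0 h1.
by rewrite mul0r => /subr0_eq.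
Qed.

Lemma flat_segment f a b :
  (forall t : R, 0 <= t <= 1 -> is_ddir (b - a) f (a + (t%:C)%C * (b - a)) 0) -> f a = f b.
Proof.
move=> h.
have dr (t : R) : t \in `[0, 1]%R -> is_derive t (1 : R) (re_along (b - a) f a) 0.
  by rewrite in_itv /= => /h /is_ddir_line [].
have di (t : R) : t \in `[0, 1]%R -> is_derive t (1 : R) (im_along (b - a) f a) 0.
  by rewrite in_itv /= => /h /is_ddir_line [].
move: (derive0_segment dr) (derive0_segment di).
rewrite /re_along /im_along RC0 mul0r addr0 (_ : a + _ * _ = b); last first.
  by rewrite [(1%:C)%C]/(1 : C) mul1r addrC subrK.
by move=> e1 e2; apply: Ceq; rewrite ?e1 ?e2.
Qed.

(** A punctured disc is not convex. When the line through [a] and [b] meets [p], the path makes a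
    detour through [c], the quarter turn of [a] about [p]: it has the same distance to [p], and
    neither of the two legs meets [p]. *)
Lemma punctured_flat_const f p (r : C) : (forall w, w != p -> `|w - p| < r -> flat f w) ->
  forall a b, a != p -> b != p -> `|a - p| < r -> `|b - p| < r -> f a = f b.
Proof.
move=> h a b ap bp ar br.
have seg c d : `|c - p| < r -> `|d - p| < r ->
    (forall t : R, c + (t%:C)%C * (d - c) != p) -> f c = f d.
  move=> cr dr av; apply: flat_segment => t /andP[t0 t1]; apply: h => //.
  rewrite (_ : _ - p = (1 - (t%:C)%C) * (c - p) + (t%:C)%C * (d - p)); last by ring.
  have t0' : 0 <= (t%:C)%C :> C by rewrite -[0]/((0%:C)%C) lecRE.
  have t1' : 0 <= 1 - (t%:C)%C :> C.
    by rewrite -[1]/((1%:C)%C) -rmorphB -[0]/((0%:C)%C) lecRE subr_ge0.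
  apply: le_lt_trans (ler_normD _ _) _; rewrite !normrM (ger0_norm t0') (ger0_norm t1').
  rewrite -[r](_ : (1 - (t%:C)%C) * r + (t%:C)%C * r = r); last by ring.
  have [->|tn0] := eqVneq t 0; first by rewrite RC0 !mul0r !addr0 subr0 !mul1r.
  by apply: ler_ltD; [rewrite ler_wpM2l // ltW | rewrite ltr_pM2l // lt_def t0' andbT (inj_eq (@complexI R))].
have a0 : a - p != 0 by rewrite subr_eq0.
have b0 : b - p != 0 by rewrite subr_eq0.
have [ex|nex] := pselect (exists t : R, a + (t%:C)%C * (b - a) = p); last first.
  by apply: seg => // t; apply/eqP => e; apply: nex; exists t.
case: ex => t e.
have e' : (1 - (t%:C)%C) * (a - p) = - (t%:C)%C * (b - p).
  apply/eqP; rewrite -subr_eq0 (_ : _ - _ = a + (t%:C)%C * (b - a) - p); last by ring.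
  by rewrite e subrr.
have tn0 : (t%:C)%C != 0 :> C.
  apply: contraNneq a0 => t0; move: e'; rewrite t0 subr0 mul1r oppr0 mul0r => ->; exact: eqxx.
have be : b - p = (1 - (t%:C)%C^-1) * (a - p).
  by apply: (mulfI tn0); rewrite -[LHS]opprK -mulNr -e'; field; exact: tn0.
pose c := p + 'i * (a - p).
have cr : `|c - p| < r by rewrite /c addrC addKr normrM normCi mul1r.
transitivity (f c).
- apply: seg => // s; apply/eqP => /eqP; rewrite -subr_eq0.
  rewrite (_ : _ - p = (a - p) * (1 - (s%:C)%C + (s%:C)%C * 'i)); last by rewrite /c; ring.
  rewrite mulf_eq0 (negbTE a0) /= => /eqP s0.
  have := congr1 Im s0; have := congr1 Re s0.
  rewrite !(ReaddE, ImaddE, RemulE, ImmulE, ReoppE, ImoppE) /=.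
  move=> u1 u2; have : (1 : R) == 0 by apply/eqP; lra.
  by rewrite oner_eq0.
- apply: seg => // s; apply/eqP => /eqP; rewrite -subr_eq0.
  rewrite (_ : _ - p = (b - p) * (s%:C)%C + ((1 - (s%:C)%C) * (c - p))); last by ring.
  rewrite be (_ : _ + _ = (a - p) * ((1 - (t%:C)%C^-1) * (s%:C)%C + (1 - (s%:C)%C) * 'i)); last first.
    by rewrite /c; ring.
  rewrite mulf_eq0 (negbTE a0) /= -fmorphV => /eqP s0.
  have := congr1 Im s0; have := congr1 Re s0.
  rewrite !(ReaddE, ImaddE, RemulE, ImmulE, ReoppE, ImoppE) /= => u1 u2.
  have s1 : s = 1 by lra.
  move: be; have : 1 - t^-1 = 0 by move: u1; rewrite s1; lra.
  move=> v1; have -> : (1 - (t%:C)%C^-1 : C) = 0 by rewrite -fmorphV -[1]/((1%:C)%C) -rmorphB v1.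
  by rewrite mul0r => /eqP; rewrite (negbTE b0).
Qed.

Definition punctured_const f p := exists c : C, \forall w \near p, w != p -> f w = c.

Lemma flat_punctured_const f p : (\forall w \near p, w != p -> flat f w) -> punctured_const f p.
Proof.
move=> /nbhs_ballP[e e0 he]; exists (f (p + e / 2)); apply/nbhs_ballP; exists e => //= w we wp.
have e2 : 0 < e / 2 by rewrite divr_gt0.
apply: (@punctured_flat_const f p e) => //.
- by move=> u up ue; apply: he up; rewrite -ball_normE /ball_ /= distrC.
- by rewrite -subr_eq0 addrC addKr gt_eqF.
- by move: we; rewrite -ball_normE /ball_ /= distrC.
- by rewrite addrC addKr gtr0_norm // gtr_pMr // invf_lt1 // ltr1n.
Qed.

Lemma exists_near_neq p (P : C -> Prop) : (\forall w \near p, P w) -> exists2 w, w != p & P w.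
Proof.
move=> /nbhs_ballP[e e0 he]; exists (p + e / 2).
  by rewrite -subr_eq0 addrC addKr gt_eqF // divr_gt0.
apply: he; rewrite -ball_normE /ball_ /= opprD addrA subrr sub0r normrN gtr0_norm ?divr_gt0 //.
by rewrite gtr_pMr // invf_lt1 // ltr1n.
Qed.

Lemma punctured_const_cont f p c : (\forall w \near p, w != p -> f w = c) ->
  {for p, continuous f} -> f p = c.
Proof.
move=> hc cf; apply/eqP; rewrite -subr_eq0 -normr_eq0; apply/negPn/negP => n0.
have e0 : 0 < `|f p - c| by rewrite lt_def n0 normr_ge0.
have H : \forall w \near p, `|f p - f w| < `|f p - c|.
  exact: (@cvgr_dist_lt C C _ (nbhs p) _ f (f p) cf _ e0).
have [w wp [h1 h2]] := exists_near_neq (filterI hc H).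
by move: h2; rewrite (h1 wp) ltxx.
Qed.

(** The segment from 0 to [z] may run through points where [f] has an arbitrary value. The local
    constants [g] ignore these values and are flat on the whole segment; continuity is needed only
    at its two ends. *)
Lemma punctured_const_eq D f z : open D -> D 0 ->
  (forall (t : R), 0 <= t <= 1 -> D ((t%:C)%C * z)) ->
  (forall p, D p -> punctured_const f p) ->
  {for z, continuous f} -> {for 0, continuous f} -> f z = f 0.
Proof.
move=> oD D0 Dz hf cz c0.
have [g hg] : exists g : C -> C, forall p, D p -> \forall w \near p, w != p -> f w = g p.
  have : forall p, exists c, D p -> \forall w \near p, w != p -> f w = c.
    move=> p; have [Dp|nDp] := pselect (D p); last by exists 0.
    by case: (hf p Dp) => c hc; exists c.
  by move=> /choice [g hg]; exists g.
(* The punctured neighbourhoods of [p] and of a nearby [w] share a point different from both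
   centres, which identifies their constants. *)
have lc p : D p -> \forall w \near p, g w = g p.
  move=> Dp; have := hg p Dp; have := near_open oD Dp.
  move=> h1 h2.
  have H : \forall w \near p, D w /\ (w != p -> f w = g p) by exact: filterI.
  case/nbhs_ballP: H => e e0 he.
  suff key (w : C) : ball p e w -> g w = g p by apply/nbhs_ballP; exists e => // w; apply: key.
  move=> we.
  have [->//|wp] := eqVneq w p.
  have [Dw _] := he w we.
  have ob : \forall u \near w, ball p e u /\ u != p.
    have nb : \forall u \near w, ball p e u.
      by apply: near_open => //; exact: ball_open.
    have nn : \forall u \near w, u != p.
      have wp0 : 0 < `|w - p| by rewrite normr_gt0 subr_eq0.
      apply/nbhs_ballP; exists `|w - p| => //= u; rewrite -ball_normE /ball_ /=.
      by apply: contraTneq => ->; rewrite ltxx.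
    exact: filterI.
  have [u uw [[ub up] hu]] := exists_near_neq (filterI ob (hg w Dw)).
  by rewrite -(hu uw) ((he u ub).2 up).
have Dz1 : D z by have := Dz 1; rewrite [(1%:C)%C]/(1 : C) mul1r; apply; rewrite ler01 lexx.
have gz : f z = g z by apply: punctured_const_cont (hg z Dz1) cz.
have g0 : f 0 = g 0 by apply: punctured_const_cont (hg 0 D0) c0.
rewrite gz g0; symmetry; apply: flat_segment => t t01; rewrite subr0 add0r.
by apply: is_ddir_near (is_ddir_cst _ (g ((t%:C)%C * z)) _); apply: filterS (lc _ (Dz t t01)) => w ->.
Qed.

End FlatFunctions.

(** * The disc algebra *)

Section DiscAlgebra.
Variable R : realType.
Local Notation C := (Cx R).
Local Notation Re := (@complex.Re R).
Local Notation Im := (@complex.Im R).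
Implicit Types (f g : C -> C) (z w c mu lam : C) (U D : set C).

(** If [d] were positive, [dg] would be positive just to the right of its zero at 0, and the mean
    value theorem would make [g] exceed its maximum. *)
Lemma second_derivative_at_max (g dg : R -> R) (d r : R) : 0 < r ->
  (forall s, `|s| < r -> is_derive s (1 : R) g (dg s)) ->
  is_derive (0 : R) (1 : R) dg d -> (forall s, `|s| < r -> g s <= g 0) -> d <= 0.
Proof.
move=> r0 hg hd mx; rewrite leNgt; apply/negP => d0.
have n0 : `|0 : R| < r by rewrite normr0.
have inr s : s \in `](- r), r[%R -> `|s| < r by rewrite in_itv /= ltr_norml.
have dg0 : dg 0 = 0.
  have m : is_derive (0 : R) (1 : R) g 0.
    apply: (@derive1_at_max R g (- r) r 0).
    - by rewrite ge0_cp // ltW.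
    - by move=> t /inr /hg [].
    - by rewrite in_itv /= oppr_lt0 r0.
    - by move=> t /inr /mx.
  by case: (hg 0 n0) => _ <-; case: m.
have key : (fun h => h^-1 *: (dg (h *: 1 + 0) - dg 0)) h @[h --> (0 : R)^'] --> d.
  by case: hd => dd <-; exact: dd.
have nn : \forall h \near (0 : R)^', 0 < h^-1 *: (dg (h *: 1 + 0) - dg 0).
  exact: (@cvgr_gt R _ _ _ _ _ key 0 d0).
have [e e0 he] : exists2 e : R, 0 < e & forall h, 0 < h < e -> 0 < dg h.
  move: nn => /nbhs_ballP[e /= e0 he]; exists e => // h /andP[h0 hlt].
  have := he h; rewrite /ball /= sub0r normrN gtr0_norm // hlt => /(_ isT).
  by rewrite gt_eqF // => /(_ isT); rewrite dg0 subr0 addr0 [h *: 1]mulr1 [_ *: _]mulrC pmulr_lgt0 // invr_gt0.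
pose m := Num.min e r; pose h := m / 2.
have m0 : 0 < m by rewrite lt_min e0.
have h0 : 0 < h by rewrite divr_gt0.
have hm : h < m by rewrite /h; lra.
have [hE hr] : h < e /\ h < r by move: hm; rewrite lt_min => /andP[].
have inh s : s \in `[0, h]%R -> `|s| < r.
  by rewrite in_itv /= => /andP[s0 sh]; rewrite ger0_norm //; apply: le_lt_trans hr.
have h1 : forall x : R, x \in `]0, h[%R -> is_derive x (1 : R) g (dg x).
  by move=> x xI; apply: hg; apply: inh; apply: subset_itv_oo_cc xI.
have h2 : {within `[0, h], continuous g}.
  by apply: derivable_within_continuous => t /inh /hg [].
have [x] := @MVT R g dg 0 h h0 h1 h2.
rewrite in_itv /= => /andP[x0 xh] E.
have : 0 < g h - g 0 by rewrite E subr0 mulr_gt0 // he // x0 (lt_trans xh).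
by rewrite subr_gt0 ltNge mx // gtr0_norm.
Qed.

Lemma derive_quad (e a b s : R) :
  is_derive s (1 : R) (fun t : R => e * ((a + t) ^+ 2 + b ^+ 2)) (e * (2 * (a + s))).
Proof. by apply: is_derive_eq; rewrite /GRing.scale /=; ring. Qed.

Lemma derive_quadD (e a : R) : is_derive (0 : R) (1 : R) (fun t : R => e * (2 * (a + t))) (e * 2).
Proof. by apply: is_derive_eq; rewrite /GRing.scale /=; ring. Qed.

Definition disc : set C := [set lam | `|lam| < 1].
Definition cdisc : set C := [set lam | `|lam| <= 1].

Lemma continuous_norm2 : continuous (fun z : C => Re z ^+ 2 + Im z ^+ 2).
Proof.
move=> z; have cr := @continuous_Re R z; have ci := @continuous_Im R z.
rewrite (_ : (fun z : C => _) = (fun z : C => Re z * Re z + Im z * Im z)).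
  exact: (@cvgD R R^o C (nbhs z) _ _ _ _ _ (cvgM cr cr) (cvgM ci ci)).
by apply/funext => w; rewrite !expr2.
Qed.

Lemma le_normC (z : C) (t : R) : 0 <= t -> (`|z| <= (t%:C)%C) = (Re z ^+ 2 + Im z ^+ 2 <= t ^+ 2).
Proof.
move=> t0; rewrite Cnorm_def lecRE -[X in (_ <= X) = _](ger0_norm t0) -sqrtr_sqr.
by rewrite ler_sqrt // sqr_ge0.
Qed.
Lemma lt_normC (z : C) (t : R) : 0 < t -> (`|z| < (t%:C)%C) = (Re z ^+ 2 + Im z ^+ 2 < t ^+ 2).
Proof.
move=> t0; rewrite Cnorm_def ltcRE -[in LHS](gtr0_norm t0) -sqrtr_sqr ltr_sqrt //.
by rewrite exprn_gt0.
Qed.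
Lemma discE z : disc z = (Re z ^+ 2 + Im z ^+ 2 < 1) :> Prop.
Proof. by rewrite /disc /= -[1 : C]/((1%:C)%C) lt_normC // expr1n. Qed.
Lemma cdiscE z : cdisc z = (Re z ^+ 2 + Im z ^+ 2 <= 1) :> Prop.
Proof. by rewrite /cdisc /= -[1 : C]/((1%:C)%C) le_normC // expr1n. Qed.

Lemma open_disc : open disc.
Proof.
rewrite (_ : disc = (fun z : C => Re z ^+ 2 + Im z ^+ 2) @^-1` [set t : R | t < 1]).
  by apply: open_comp => [z _|]; [exact: continuous_norm2|exact: open_lt].
by apply/funext => z; rewrite discE.
Qed.

Lemma compact_cdisc : compact cdisc.
Proof.
pose phi (p : R * R) : C := (p.1%:C)%C + 'i * (p.2%:C)%C.
have cphi : continuous phi.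
  move=> p; apply: cvgD.
    by apply: (cvg_comp fst (fun t : R => (t%:C)%C : C)); [exact: cvg_fst|exact: continuous_RtoC].
  apply: cvgM; first exact: cvg_cst.
  by apply: (cvg_comp snd (fun t : R => (t%:C)%C : C)); [exact: cvg_snd|exact: continuous_RtoC].
have cb : compact (phi @` (`[-1, 1] `*` `[-1, 1])).
  apply: continuous_compact; first exact: continuous_subspaceT.
  by apply: compact_setX; exact: segment_compact.
apply: (subclosed_compact _ cb).
- rewrite (_ : cdisc = (fun z : C => Re z ^+ 2 + Im z ^+ 2) @^-1` [set t : R | t <= 1]).
    by apply: closed_comp => [z _|]; [exact: continuous_norm2|exact: closed_le].
  by apply/funext => z; rewrite cdiscE.
- move=> z; rewrite cdiscE => hz; exists (Re z, Im z); last by rewrite /phi /= -CReIm.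
  by split; rewrite /= in_itv /=; apply/andP; split; nra.
Qed.


Definition disc_alg (g : C -> C) := holomorphic disc g /\ {within cdisc, continuous g}.

Lemma disc_sub z : disc z -> cdisc z.
Proof. by move=> h; apply: ltW. Qed.

(* If [Im g] is positive at [z0], then [Im g + e |z|^2] with [2 e = Im g(z0)] has an
   interior maximum, where its Laplacian [4 e] is positive. *)
Lemma disc_alg_Im_le0 g : disc_alg g -> (forall lam, circle lam -> Im (g lam) = 0) ->
  forall z, cdisc z -> Im (g z) <= 0.
Proof.
move=> [[sg hg] cg] g0 z0 z0K; rewrite leNgt; apply/negP => gz.
pose e := Im (g z0) / 2; have e0 : 0 < e by rewrite divr_gt0.
pose phi (z : C) : R := Im (g z) + e * (Re z ^+ 2 + Im z ^+ 2).
have cphi : {within cdisc, continuous phi}.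
  move=> z; apply: (@cvgD R R^o).
    by apply: (cvg_comp _ _ (cg z)); exact: continuous_Im.
  apply: (@cvgM R); first exact: cvg_cst.
  exact: (continuous_subspaceT continuous_norm2).
have [c /set_mem cK cmax] := compact_EVT_max (ex_intro _ z0 z0K) compact_cdisc cphi.
have phic : 2 * e <= phi c.
  apply: le_trans (cmax z0 (mem_set z0K)); rewrite /phi (_ : 2 * e = Im (g z0)); last first.
    by rewrite /e; field.
  by rewrite lerDl; apply: mulr_ge0; [exact: ltW|apply: addr_ge0; exact: sqr_ge0].
(* On the circle [phi] equals [e], but at its maximum it is at least [2 * e]; the maximum is
   therefore interior. *)
have cD : disc c.
  rewrite /disc /= lt_neqAle; apply/andP; split; last exact: cK.
  apply/eqP => c1; move: phic; rewrite /phi g0 // add0r leNgt => /negP; apply.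
  have cK' : cdisc c := cK; rewrite cdiscE in cK'; nra.
have [s1 s2] := smooth_dir sg.
have [r r0 hr] := nbhs_square open_disc cD.
have hx s : `|s| < r -> disc (c + (s%:C)%C * 1).
  by move=> sr; have := hr s 0 sr; rewrite normr0 RC0 mul0r addr0 mulr1; apply.
have hy s : `|s| < r -> disc (c + (s%:C)%C * 'i).
  by move=> sr; have := hr 0 s _ sr; rewrite normr0 RC0 addr0; apply.
have CR z : disc z -> dir_derive 'i g z = 'i * dir_derive 1 g z.
  move=> Dz; have := hg z Dz; rewrite /dzb => /eqP; rewrite mulf_eq0 invr_eq0 pnatr_eq0 orbF.
  move=> /eqP h; have ii : 'i * 'i = -1 :> C by rewrite -expr2 sqrCi.
  transitivity (- ('i * 'i) * dir_derive 'i g z); first by rewrite ii opprK mul1r.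
  by rewrite mulNr -mulrA -mulrN; congr (_ * _); apply/esym/eqP; rewrite -subr_eq0 opprK h.
(* The Cauchy-Riemann equation, differentiated in both axis directions: [g] is harmonic at [c]. *)
have D2 : dir_derive 'i (dir_derive 'i g) c = - dir_derive 1 (dir_derive 1 g) c.
  have e1 : dir_derive 1 (dir_derive 'i g) c = 'i * dir_derive 1 (dir_derive 1 g) c.
    apply: is_ddir_val; have /rdiffP [d1 _] := smooth_rdiff s1 cD.
    have := is_ddirM (is_ddir_cst 1 'i c) d1; rewrite mul0r add0r.
    by apply: is_ddir_near; apply: filterS (near_open open_disc cD) => w /CR.
  have e2 : dir_derive 'i (dir_derive 'i g) c = 'i * dir_derive 'i (dir_derive 1 g) c.
    apply: is_ddir_val; have /rdiffP [_ d1] := smooth_rdiff s1 cD.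
    have := is_ddirM (is_ddir_cst 'i 'i c) d1; rewrite mul0r add0r.
    by apply: is_ddir_near; apply: filterS (near_open open_disc cD) => w /CR.
  by rewrite e2 (dir_derive_sym open_disc sg cD) e1 mulrA -expr2 sqrCi mulN1r.
have X : Im (dir_derive 1 (dir_derive 1 g) c) + 2 * e <= 0.
  have dg s : `|s| < r -> is_derive s (1 : R)
      (fun t => Im (g (c + (t%:C)%C * 1)) + e * ((Re c + t) ^+ 2 + Im c ^+ 2))
      (Im (dir_derive 1 g (c + (s%:C)%C * 1)) + e * (2 * (Re c + s))).
    move=> sr; have /rdiffP [d1 _] := smooth_rdiff sg (hx s sr).
    have [_ di] := is_ddir_line d1.
    exact: (is_deriveD di (derive_quad e (Re c) (Im c) s)).
  apply: (second_derivative_at_max r0 dg).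
  - have /rdiffP [d1 _] := smooth_rdiff s1 cD.
    have [_ di] : is_derive (0 : R) (1 : R) (re_along 1 (dir_derive 1 g) c) (Re (dir_derive 1 (dir_derive 1 g) c)) /\
        is_derive (0 : R) (1 : R) (im_along 1 (dir_derive 1 g) c) (Im (dir_derive 1 (dir_derive 1 g) c)).
      by apply: is_ddir_line; rewrite RC0 mul0r addr0.
    apply: (is_derive_eq (is_deriveD di (derive_quadD e (Re c)))).
    by rewrite mulrC.
  - move=> s sr; have := cmax _ (mem_set (disc_sub (hx s sr))).
    rewrite /phi RC0 mul0r !addr0 ReaddE ImaddE !mulr1 ReCE ImCE !addr0; apply.
have Y : Im (dir_derive 'i (dir_derive 'i g) c) + 2 * e <= 0.
  have dg s : `|s| < r -> is_derive s (1 : R)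
      (fun t => Im (g (c + (t%:C)%C * 'i)) + e * ((Im c + t) ^+ 2 + Re c ^+ 2))
      (Im (dir_derive 'i g (c + (s%:C)%C * 'i)) + e * (2 * (Im c + s))).
    move=> sr; have /rdiffP [_ d1] := smooth_rdiff sg (hy s sr).
    have [_ di] := is_ddir_line d1.
    exact: (is_deriveD di (derive_quad e (Im c) (Re c) s)).
  apply: (second_derivative_at_max r0 dg).
  - have /rdiffP [_ d1] := smooth_rdiff s2 cD.
    have [_ di] : is_derive (0 : R) (1 : R) (re_along 'i (dir_derive 'i g) c) (Re (dir_derive 'i (dir_derive 'i g) c)) /\
        is_derive (0 : R) (1 : R) (im_along 'i (dir_derive 'i g) c) (Im (dir_derive 'i (dir_derive 'i g) c)).
      by apply: is_ddir_line; rewrite RC0 mul0r addr0.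
    apply: (is_derive_eq (is_deriveD di (derive_quadD e (Im c)))).
    by rewrite mulrC.
  - move=> s sr; have := cmax _ (mem_set (disc_sub (hy s sr))).
    rewrite /phi RC0 mul0r !addr0 ReaddE ImaddE !RemulE !ImmulE !ReiE !ImiE !ReCE !ImCE.
    by rewrite -subr_ge0 => h; rewrite -subr_ge0; move: h; congr (is_true (0 <= _)); ring.
by move: Y; rewrite D2 ImoppE; lra.
Qed.

Section Rules.
Lemma disc_alg_ext f g : (forall z, f z = g z) -> disc_alg f -> disc_alg g.
Proof. by move=> /funext ->. Qed.
Lemma disc_alg_cst c : disc_alg (fun=> c).
Proof.
split; last by apply: continuous_subspaceT => z; exact: cont_cst.
by split; [exact: smooth_cst open_disc c | move=> z _; rewrite dzbE wirt_cst].
Qed.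
Lemma disc_alg_id : disc_alg id.
Proof.
split; last by apply: continuous_subspaceT => z; exact: cvg_id.
split; first exact: smooth_id open_disc.
move=> z _; rewrite dzbE (wirt_val _ (is_ddir_id _ _) (is_ddir_id _ _)).
by rewrite -expr2 sqrCi subrr mul0r.
Qed.
Lemma disc_algD g (h : C -> C) : disc_alg g -> disc_alg h -> disc_alg (fun z => g z + h z).
Proof.
move=> [[sg hg] cg] [[sh hh] ch]; split; last by move=> z; apply: cvgD; [exact: cg|exact: ch].
split; first exact: (@smoothD R disc open_disc g h sg sh).
move=> z Dz; rewrite dzbE (wirtD 'i (smooth_rdiff sg Dz) (smooth_rdiff sh Dz)).
by rewrite -!dzbE hg // hh // addr0.
Qed.
Lemma disc_algM g (h : C -> C) : disc_alg g -> disc_alg h -> disc_alg (fun z => g z * h z).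
Proof.
move=> [[sg hg] cg] [[sh hh] ch]; split; last by move=> z; apply: cvgM; [exact: cg|exact: ch].
split; first exact: (@smoothM R disc open_disc g h sg sh).
move=> z Dz; rewrite dzbE (wirtM 'i (smooth_rdiff sg Dz) (smooth_rdiff sh Dz)).
by rewrite -!dzbE hg // hh // mul0r mulr0 addr0.
Qed.
Lemma disc_alg_sum (I : Type) (s : seq I) (F : I -> C -> C) :
  (forall i, disc_alg (F i)) -> disc_alg (fun w => \sum_(i <- s) F i w).
Proof.
move=> dF; elim: s => [|i s IH].
  by apply: disc_alg_ext (disc_alg_cst 0) => w; rewrite big_nil.
by apply: disc_alg_ext (disc_algD (dF i) IH) => w; rewrite big_cons.
Qed.

Lemma is_ddir_rot g mu v z d : is_ddir (mu * v) g (mu * z) d -> is_ddir v (fun w => g (mu * w)) z d.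
Proof.
move=> [hr hi]; split.
- move: hr; congr (is_derive _ _ _ _); apply/funext => t; rewrite /re_along.
  by congr (Re (g _)); ring.
- move: hi; congr (is_derive _ _ _ _); apply/funext => t; rewrite /im_along.
  by congr (Im (g _)); ring.
Qed.

Lemma continuous_mull mu z : (fun w : C => mu * w) w @[w --> z] --> mu * z.
Proof. exact: (@cvgM C C (nbhs z) _ (fun=> mu) id mu z (cvg_cst _) cvg_id). Qed.

(** The axis directions are turned into [mu * 1] and [mu * 'i], whose derivatives are constant
    combinations of those of [g]; the induction is over all smooth [g]. *)
Lemma Cn_rot n mu g : circle mu -> smooth disc g -> Cn n disc (fun w => g (mu * w)).
Proof.
move=> mu1.
have Dm z : disc z -> disc (mu * z) by rewrite /disc /= normrM mu1 mul1r.
have ct (h : C -> C) z : {for (mu * z), continuous h} -> {for z, continuous (fun w => h (mu * w))}.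
  by move=> ch; exact: (cvg_comp _ _ (@continuous_mull mu z) ch).
elim: n g => [|n IH] g sg.
  by split=> // z Dz; apply: ct; apply: smooth_cont sg (Dm z Dz).
have [s1 s2] := smooth_dir sg.
pose f1 v w := (Re (mu * v))%:C%C * dir_derive 1 g (mu * w) + (Im (mu * v))%:C%C * dir_derive 'i g (mu * w).
have Cf v : Cn n disc (f1 v).
  by apply: CnD open_disc _ _ _ _ _; apply: CnM open_disc _ _ _ _ _; try (exact: Cn_cst open_disc _ _); exact: IH.
apply: (@Cn_intro R n disc _ (f1 1) (f1 'i)).
- by move=> z Dz; apply: ct; apply: smooth_cont sg (Dm z Dz).
- move=> z Dz; split.
  + exact: is_ddir_rot (is_ddir_any open_disc (mu * 1) sg (Dm z Dz)).
  + exact: is_ddir_rot (is_ddir_any open_disc (mu * 'i) sg (Dm z Dz)).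
- by move=> h eh; exact: Cn_ext open_disc eh (Cf 1).
- by move=> h eh; exact: Cn_ext open_disc eh (Cf 'i).
Qed.

Lemma disc_alg_rot mu g : circle mu -> disc_alg g -> disc_alg (fun w => g (mu * w)).
Proof.
move=> mu1 [[sg hg] cg].
have Dm z : disc z -> disc (mu * z) by rewrite /disc /= normrM mu1 mul1r.
have Km z : cdisc z -> cdisc (mu * z) by rewrite /cdisc /= normrM mu1 mul1r.
split; last first.
  apply/subspace_continuousP => z Kz.
  move/subspace_continuousP: cg => /(_ (mu * z) (Km z Kz)).
  apply: cvg_comp => P hP.
  have := @continuous_mull mu z _ hP; rewrite /= => H.
  have H' : nbhs z (fun w => cdisc (mu * w) -> P (mu * w)) := H.
  suff : nbhs z (fun w => cdisc w -> P (mu * w)) by [].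
  by apply: filterS H' => w h /Km; exact: h.
split; first by move=> n; exact: Cn_rot.
move=> z Dz; have h : dzb g (mu * z) = 0 := hg _ (Dm z Dz).
have d1 := is_ddir_rot (is_ddir_any open_disc (mu * 1) sg (Dm z Dz)).
have d2 := is_ddir_rot (is_ddir_any open_disc (mu * 'i) sg (Dm z Dz)).
(* Chain rule: the zbar-derivative of the rotated function is the conjugate of [mu] times the
   rotated zbar-derivative of [g]. *)
rewrite dzbE (wirt_val _ d1 d2) [X in X / 2](_ : _ =
  (mu^*) * (dir_derive 1 g (mu * z) + 'i * dir_derive 'i g (mu * z))); last first.
  have -> : mu^* = (Re mu)%:C%C - 'i * (Im mu)%:C%C :> C.
    by apply: Ceq; rewrite ?ReconjE ?ImconjE !(ReaddE, ImaddE, RemulE, ImmulE, ReoppE, ImoppE) /=; ring.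
  rewrite !mulr1 (_ : Re (mu * 'i) = - Im mu) 1?(_ : Im (mu * 'i) = Re mu); last first.
  - by rewrite !RemulE /=; ring.
  - by rewrite !ImmulE /=; ring.
  move: (dir_derive 1 g (mu * z)) (dir_derive 'i g (mu * z)) => p q.
  have ii : 'i * 'i = -1 :> C by rewrite -expr2 sqrCi.
  rewrite [LHS](_ : _ = (Re mu)%:C%C * p + (Im mu)%:C%C * q - 'i * (Im mu)%:C%C * p
     + 'i * (Re mu)%:C%C * q); last by rewrite rmorphN /=; ring.
  rewrite [RHS](_ : _ = (Re mu)%:C%C * p - ('i * 'i) * (Im mu)%:C%C * q - 'i * (Im mu)%:C%C * p
     + 'i * (Re mu)%:C%C * q); last by ring.
  by rewrite ii mulN1r mulNr opprK.
by move: h; rewrite /dzb -mulrA => ->; rewrite mulr0.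
Qed.
(** The bound for [g] and for [- g] makes [g] real on the closed disc; conjugation then turns the
    vanishing of the zbar-derivative into that of the z-derivative. Boundary points are reached
    along radii, where continuity within the closed disc is enough. *)
Lemma disc_alg_real_cst g : disc_alg g -> (forall lam, circle lam -> Im (g lam) = 0) ->
  forall z, cdisc z -> g z = g 0.
Proof.
move=> dg g0.
have dNg : disc_alg (fun z => (-1) * g z) by exact: disc_algM (disc_alg_cst (-1)) dg.
have I0 z : cdisc z -> Im (g z) = 0.
  move=> Kz; apply/eqP; rewrite eq_le (disc_alg_Im_le0 dg g0 Kz) /=.
  have := @disc_alg_Im_le0 _ dNg _ z Kz; rewrite mulN1r ImoppE oppr_le0; apply.
  by move=> lam /g0 e; rewrite mulN1r ImoppE e oppr0.
case: dg => [[sg hg] cg].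
have flt z : disc z -> flat g z.
  move=> Dz; have ng : \forall w \near z, g w = (g w)^*.
    apply: filterS (near_open open_disc Dz) => w /disc_sub /I0 e.
    by apply: Ceq; [rewrite ReconjE|rewrite ImconjE e oppr0].
  have r := smooth_rdiff sg Dz.
  have h : wirt 'i g z = 0 by rewrite -dzbE; exact: hg.
  apply: (smooth_flat open_disc sg Dz) => //.
  by rewrite (wirt_near _ ng r) wirt_conj // conjNi h rmorph0.
move=> z Kz.
have seg t : 0 <= t -> t < 1 -> disc ((t%:C)%C * z).
  move=> t0 t1; rewrite /disc /= normrM ler_normC (ger0_norm t0).
  apply: (@le_lt_trans _ _ (t%:C)%C); last by rewrite -[1]/((1%:C)%C) ltcRE.
  by rewrite -[leRHS]mulr1; apply: ler_wpM2l => //; rewrite -[0]/((0%:C)%C) lecRE.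
have segK t : 0 <= t <= 1 -> cdisc ((t%:C)%C * z).
  move=> /andP[t0 t1]; rewrite /cdisc /= normrM ler_normC (ger0_norm t0).
  rewrite -[leRHS]mulr1; apply: ler_pM => //; first by rewrite -[0]/((0%:C)%C) lecRE.
  by rewrite -[1]/((1%:C)%C) lecRE.
pose h (t : R) : R := Re (g ((t%:C)%C * z)).
have cl : {within `[0, 1], continuous h}.
  apply/subspace_continuousP => t; rewrite /= in_itv /= => t01.
  move/subspace_continuousP: cg => /(_ _ (segK t t01)) cgt.
  suff cc : (fun s : R => (s%:C)%C * z) s @[s --> within `[0, 1] (nbhs t)] -->
      within cdisc (nbhs ((t%:C)%C * z : C)).
    have c1 := cvg_comp _ _ cc cgt.
    exact: (cvg_comp _ _ c1 (@continuous_Re R _)).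
  move=> P hP.
  have lt : (fun s : R => (s%:C)%C * z) s @[s --> t] --> ((t%:C)%C * z : C).
    by apply: cvgM; [exact: continuous_RtoC | exact: cvg_cst].
  have H2 : nbhs t (fun s : R => cdisc ((s%:C)%C * z) -> P ((s%:C)%C * z)) := lt _ hP.
  suff : nbhs t (fun s : R => `[0, 1]%classic s -> P ((s%:C)%C * z)) by [].
  by apply: filterS H2 => s hs; rewrite /= in_itv /= => s01; apply: hs; exact: segK.
have ds (t : R) : t \in `]0, 1[%R -> is_derive t (1 : R) h ((fun=> 0) t).
  rewrite in_itv /= => /andP[t0 t1].
  have d := flt _ (seg t (ltW t0) t1) z.
  have [dr _] : is_derive t (1 : R) (re_along z g 0) (Re (0 : C)) /\
      is_derive t (1 : R) (im_along z g 0) (Im (0 : C)) by apply: is_ddir_line; rewrite add0r.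
  by move: dr; congr (is_derive _ _ _ _); apply/funext => s; rewrite /re_along add0r.
have [x _] := @MVT R h (fun=> 0) 0 1 ltr01 ds cl.
rewrite mul0r /h RC0 mul0r [(1%:C)%C]/(1 : C) mul1r => /subr0_eq e.
apply: Ceq => //; rewrite I0 // I0 //; rewrite /cdisc /= normr0 //.
Qed.
End Rules.

End DiscAlgebra.

(** * Isotropic bundles adapted to a pair of null lifts *)

Section AdaptedPoint.
Variables (R : realType) (m : nat).
Local Notation C := (Cx R).
Local Notation dim := (m.*2.+2).
Local Notation J := (mink R m.*2.+1).
Implicit Types (Y Yh x y : 'cV[C]_dim) (V : 'M[C]_(dim, m)).

(* [V] spans a maximal isotropic subspace of the complexification of the space-like
   orthogonal complement of the null vectors [Y] and [Yh]. *)
Definition adapted_at Y Yh V : Prop :=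
  [/\ mxconj Y = Y, mxconj Yh = Yh, ip Y Y = 0, ip Yh Yh = 0 & ip Y Yh = -1] /\
  [/\ V^T *m J *m V = 0, V^T *m J *m Y = 0, V^T *m J *m Yh = 0,
      forall c : 'cV[C]_m, V *m c = 0 -> c = 0 &
      forall x, ip x Y = 0 -> ip x Yh = 0 ->
        0 <= ip (mxconj x) x /\ (ip (mxconj x) x = 0 -> x = 0)].

(* The isotropic space [W] spanned by the columns of the conjugate of [V], described
   as the orthogonal complement of [Y], [Yh] and itself. *)
Definition inW Y Yh V x : Prop :=
  [/\ ip x Y = 0, ip x Yh = 0 & (mxconj V)^T *m J *m x = 0].

Lemma adapted_at_sym Y Yh V : adapted_at Y Yh V -> adapted_at Yh Y V.
Proof.
by move=> [[a b c d e] [f g h i j]]; do 2!split => //; [rewrite ipC|move=> x /[swap]; exact: j].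
Qed.
Lemma inW_sym Y Yh V x : inW Y Yh V x -> inW Yh Y V x.
Proof. by case. Qed.

Section Facts.
Variables (Y Yh : 'cV[C]_dim) (V : 'M[C]_(dim, m)).
Hypothesis ad : adapted_at Y Yh V.
Local Notation Vb := (mxconj V).

Let cY : mxconj Y = Y. Proof. by case: ad => [[]]. Qed.
Let cYh : mxconj Yh = Yh. Proof. by case: ad => [[]]. Qed.
Let ipYY : ip Y Y = 0. Proof. by case: ad => [[]]. Qed.
Let ipYhYh : ip Yh Yh = 0. Proof. by case: ad => [[]]. Qed.
Let ipYYh : ip Y Yh = -1. Proof. by case: ad => [[]]. Qed.
Let VV : V^T *m J *m V = 0. Proof. by case: ad => [_ []]. Qed.
Let VY : V^T *m J *m Y = 0. Proof. by case: ad => [_ []]. Qed.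
Let VYh : V^T *m J *m Yh = 0. Proof. by case: ad => [_ []]. Qed.
Let Vfree (c : 'cV[C]_m) : V *m c = 0 -> c = 0.
Proof. by case: ad => [_ [_ _ _ h _]]; exact: h. Qed.
Lemma ad_ge0 x : ip x Y = 0 -> ip x Yh = 0 -> 0 <= ip (mxconj x) x.
Proof. by case: ad => [_ [_ _ _ _ h]] a b; case: (h x a b). Qed.
Lemma ad_eq0 x : ip x Y = 0 -> ip x Yh = 0 -> ip (mxconj x) x = 0 -> x = 0.
Proof. by case: ad => [_ [_ _ _ _ h]] a b; case: (h x a b). Qed.

Lemma conj_VbJ p (A : 'M[C]_(dim, p)) : mxconj (Vb^T *m J *m A) = V^T *m J *m mxconj A.
Proof. by rewrite !mxconjM mxconj_tr mxconjK conjJ. Qed.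
Lemma conj_VJ p (A : 'M[C]_(dim, p)) : mxconj (V^T *m J *m A) = Vb^T *m J *m mxconj A.
Proof. by rewrite !mxconjM mxconj_tr conjJ. Qed.
Lemma VbVb : Vb^T *m J *m Vb = 0. Proof. by rewrite -conj_VJ VV mxconj0. Qed.
Lemma VbY : Vb^T *m J *m Y = 0. Proof. by rewrite -[in LHS]cY -conj_VJ VY mxconj0. Qed.
Lemma VbYh : Vb^T *m J *m Yh = 0. Proof. by rewrite -[in LHS]cYh -conj_VJ VYh mxconj0. Qed.

Lemma ip_mulV (c : 'cV[C]_m) x : ip (V *m c) x = (c^T *m (V^T *m J *m x)) ord0 ord0.
Proof. by rewrite ip_def trmx_mul !mulmxA. Qed.
Lemma ip_mulVb (c : 'cV[C]_m) x : ip (Vb *m c) x = (c^T *m (Vb^T *m J *m x)) ord0 ord0.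
Proof. by rewrite ip_def trmx_mul !mulmxA. Qed.

(** A kernel vector would give a combination of the columns of [V] with hermitian norm 0, which
    positivity on the complement of [Y] and [Yh] excludes. *)
Lemma gramV_unit : Vb^T *m J *m V \in unitmx.
Proof.
rewrite -unitmx_tr -row_free_unit; apply: inj_row_free => v e.
apply: trmx_inj; rewrite trmx0; apply: Vfree; apply: ad_eq0.
- by rewrite ip_mulV VY mulmx0 mxE.
- by rewrite ip_mulV VYh mulmx0 mxE.
- have e2 : Vb^T *m J *m V *m v^T = 0 by apply: trmx_inj; rewrite trmx_mul trmxK trmx0.
  by rewrite mxconjM ip_mulVb (mulmxA (Vb^T *m J)) e2 mulmx0 mxE.
Qed.

Lemma gramVb_unit : V^T *m J *m Vb \in unitmx.
Proof.
by have := gramV_unit; rewrite -mxconj_unit conj_VbJ.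
Qed.

(** The [2 + 2 m] columns of [M] form a basis: pairing a linear relation with [Y], [Yh], [Vb] and
    [V] isolates the coefficients of their dual partners. *)
Lemma ad_complete x : ip x Y = 0 -> ip x Yh = 0 -> V^T *m J *m x = 0 -> Vb^T *m J *m x = 0 ->
  x = 0.
Proof.
move=> xY xYh xV xVb.
pose M : 'M[C]_(dim, (1 + 1) + (m + m)) := row_mx (row_mx Y Yh) (row_mx V Vb).
have frM : row_free M^T.
  apply: inj_row_free => v e.
  have e' : M *m v^T = 0 by rewrite -[M]trmxK -trmx_mul e trmx0.
  pose a := usubmx (usubmx v^T); pose b := dsubmx (usubmx v^T).
  pose c := usubmx (dsubmx v^T); pose d := dsubmx (dsubmx v^T).
  have vE : v^T = col_mx (col_mx a b) (col_mx c d) by rewrite !vsubmxK.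
  have e2 : Y *m a + Yh *m b + (V *m c + Vb *m d) = 0.
    by rewrite -e' vE /M !mul_row_col.
  have YJY : Y^T *m J *m Y = 0 by rewrite ip_mx ipYY raddf0.
  have YJYh : Y^T *m J *m Yh = (-1)%:M by rewrite ip_mx ipYYh.
  have YhJY : Yh^T *m J *m Y = (-1)%:M by rewrite ip_mx ipC ipYYh.
  have YhJYh : Yh^T *m J *m Yh = 0 by rewrite ip_mx ipYhYh raddf0.
  have tr0 p q (A : 'M[C]_(dim, p)) (B : 'M[C]_(dim, q)) : A^T *m J *m B = 0 -> B^T *m J *m A = 0.
    by move=> h; apply: trmx_inj; rewrite trmx0 !trmx_mul trmxK trJ mulmxA.
  have P p (A : 'M[C]_(dim, p)) : A^T *m J *m Y *m a + A^T *m J *m Yh *m b +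
      (A^T *m J *m V *m c + A^T *m J *m Vb *m d) = 0.
    by have := congr1 (mulmx (A^T *m J)) e2; rewrite mulmx0 !mulmxDr !mulmxA.
  have b0 : b = 0.
    have := P _ Y; rewrite YJY YJYh (tr0 _ _ _ _ VY) (tr0 _ _ _ _ VbY) !mul0mx !addr0 add0r.
    by rewrite mul_scalar_mx scaleN1r => /eqP; rewrite oppr_eq0 => /eqP.
  have a0 : a = 0.
    have := P _ Yh; rewrite YhJYh YhJY (tr0 _ _ _ _ VYh) (tr0 _ _ _ _ VbYh) !mul0mx !addr0.
    by rewrite mul_scalar_mx scaleN1r => /eqP; rewrite oppr_eq0 => /eqP.
  have c0 : c = 0.
    have := P _ Vb; rewrite VbY VbYh VbVb !mul0mx !addr0 !add0r => h.
    by rewrite -(mulKmx gramV_unit c) h mulmx0.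
  have d0 : d = 0.
    have := P _ V; rewrite VY VYh VV !mul0mx !add0r => h.
    by rewrite -(mulKmx gramVb_unit d) h mulmx0.
  by apply: trmx_inj; rewrite vE a0 b0 c0 d0 !col_mx0 trmx0.
(* [M] is square, so independent columns give independent rows. *)
have frM' : row_free M.
  by move: frM; rewrite /row_free mxrank_tr => /eqP ->; rewrite !addnn.
have h : x^T *m J *m M = 0.
  rewrite /M !mul_mx_row; rewrite !ip_mx xY xYh !raddf0.
  have -> : x^T *m J *m V = 0 by apply: trmx_inj; rewrite trmx0 !trmx_mul trmxK trJ mulmxA.
  have -> : x^T *m J *m Vb = 0 by apply: trmx_inj; rewrite trmx0 !trmx_mul trmxK trJ mulmxA.
  by rewrite !row_mx0.
have /eqP : x^T *m J = 0 by apply/eqP; rewrite -(mulmx_free_eq0 _ frM') h.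
move=> /eqP h'; apply: trmx_inj; rewrite trmx0 -[x^T]mulmx1 -(JJ R m.*2) mulmxA h' mul0mx //.
Qed.

(** The orthogonality conditions put [x] in the span of [Vb], by completeness of the basis, while
    [y] is orthogonal to [Vb]. *)
Lemma inW_ip x y : inW Y Yh V x -> inW Y Yh V y -> ip x y = 0.
Proof.
move=> [xY xYh xV] [yY yYh yV].
suff [d ->] : exists d, x = Vb *m d by rewrite ip_mulVb yV mulmx0 mxE.
exists (invmx (V^T *m J *m Vb) *m (V^T *m J *m x)).
apply/eqP; rewrite -subr_eq0; apply/eqP; apply: ad_complete.
- by rewrite ipDl ipNl xY ip_mulVb VbY mulmx0 mxE subrr.
- by rewrite ipDl ipNl xYh ip_mulVb VbYh mulmx0 mxE subrr.
- by rewrite mulmxBr !mulmxA (mulmxV gramVb_unit) mul1mx subrr.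
- by rewrite mulmxBr xV !mulmxA VbVb !mul0mx subrr.
Qed.

Lemma inW_span x : inW Y Yh V x -> exists d, x = Vb *m d.
Proof.
move=> [xY xYh xV].
exists (invmx (V^T *m J *m Vb) *m (V^T *m J *m x)).
apply/eqP; rewrite -subr_eq0; apply/eqP; apply: ad_complete.
- by rewrite ipDl ipNl xY ip_mulVb VbY mulmx0 mxE subrr.
- by rewrite ipDl ipNl xYh ip_mulVb VbYh mulmx0 mxE subrr.
- by rewrite mulmxBr !mulmxA (mulmxV gramVb_unit) mul1mx subrr.
- by rewrite mulmxBr xV !mulmxA VbVb !mul0mx subrr.
Qed.

Lemma inW_Vb (d : 'cV[C]_m) : inW Y Yh V (Vb *m d).
Proof.
split; first by rewrite ip_mulVb VbY mulmx0 mxE.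
- by rewrite ip_mulVb VbYh mulmx0 mxE.
- by rewrite mulmxA VbVb mul0mx.
Qed.

Lemma inWD x y : inW Y Yh V x -> inW Y Yh V y -> inW Y Yh V (x + y).
Proof.
by move=> [a b c] [d e f]; split; rewrite ?ipDl ?mulmxDr ?a ?b ?c ?d ?e ?f addr0.
Qed.
Lemma inWZ k x : inW Y Yh V x -> inW Y Yh V (k *: x).
Proof.
by move=> [a b c]; split; rewrite ?ipZl -?scalemxAr ?a ?b ?c ?mulr0 ?scaler0.
Qed.
Lemma inWN x : inW Y Yh V x -> inW Y Yh V (- x).
Proof. by rewrite -scaleN1r; apply: inWZ. Qed.
Lemma inWB x y : inW Y Yh V x -> inW Y Yh V y -> inW Y Yh V (x - y).
Proof. by move=> a b; exact: (inWD a (inWN b)). Qed.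
Lemma inW0 : inW Y Yh V 0.
Proof. by split; rewrite ?ip0l ?mulmx0. Qed.

Lemma inW_eq x y : inW Y Yh V x -> inW Y Yh V y -> V^T *m J *m x = V^T *m J *m y -> x = y.
Proof.
move=> xW yW e; have [a b c] := inWB xW yW.
apply/eqP; rewrite -subr_eq0; apply/eqP; apply: (ad_complete a b _ c).
by rewrite mulmxBr e subrr.
Qed.


(* The components along [Y] and [Yh] are read off by pairing with the other null vector. *)
Lemma inW_rest x : Vb^T *m J *m x = 0 -> inW Y Yh V (x + ip x Yh *: Y + ip x Y *: Yh).
Proof.
move=> xV; split.
- by rewrite !ipE2 ipYY (ipC Yh) ipYYh; ring.
- by rewrite !ipE2 ipYhYh ipYYh; ring.
- by rewrite !mulmxDr -!scalemxAr xV VbY VbYh !scaler0 !addr0.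
Qed.
End Facts.
End AdaptedPoint.

(** * Structure equations of an adapted pair *)

Section Adapted.
Variables (R : realType) (m : nat).
Local Notation C := (Cx R).
Local Notation dim := (m.*2.+2).
Local Notation J := (mink R m.*2.+1).
Local Notation dZ := (mxwirt (- 'i)).
Local Notation dB := (mxwirt 'i).
Implicit Types (Y Yh x y : C -> 'cV[C]_dim) (V : C -> 'M[C]_(dim, m)) (U : set C).

Definition adapted U Y Yh V : Prop :=
  [/\ mxsmooth U Y, mxsmooth U Yh & mxsmooth U V] /\
  forall z, U z -> [/\ adapted_at (Y z) (Yh z) (V z), dB V z = 0,
    (V z)^T *m J *m dZ V z = 0, 0 < Y z ord0 ord0 & 0 < Yh z ord0 ord0].

(* [isoW Y Yh] is the component of [dZ Y] orthogonal to [Y] and [Yh]; it lies in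
   [W]. *)
Fact conn_key : unit. Proof. exact: tt. Qed.
Fact isoW_key : unit. Proof. exact: tt. Qed.
(** The connection coefficient of the line of [Y], called w in comments: since [<Y, Yh> = -1], the
    component of Y_z along [Y] is [- conn]. For the canonical lift, mu is twice this function. *)
Definition conn Y Yh z : C := locked_with conn_key (ip (dZ Y z) (Yh z)).
Definition isoW Y Yh z : 'cV[C]_dim := locked_with isoW_key (dZ Y z + conn Y Yh z *: Y z).

Lemma isoW_def Y Yh z : isoW Y Yh z = dZ Y z + conn Y Yh z *: Y z.
Proof. by rewrite /isoW locked_withE. Qed.
Lemma conn_def Y Yh z : conn Y Yh z = ip (dZ Y z) (Yh z).
Proof. by rewrite /conn locked_withE. Qed.

Lemma wirt_on_cst (U : set C) (c k : C) (f : C -> C) z : open U -> (forall z, U z -> f z = k) -> U z ->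
  wirt c f z = 0.
Proof.
move=> oU fk Uz; rewrite -[RHS](wirt_cst c k z); symmetry.
by apply: (wirt_eq oU c (smooth_cst oU k) _ Uz) => w /fk ->.
Qed.
Lemma mxwirt_on_cst p q (U : set C) (c : C) (k : 'M[C]_(p, q)) (f : C -> 'M[C]_(p, q)) z :
  open U -> (forall z, U z -> f z = k) -> U z -> mxwirt c f z = 0.
Proof.
move=> oU fk Uz; rewrite -[RHS](mxwirt_cst c k z); symmetry.
by apply: (mxwirt_eq oU c (mxsmooth_cst oU k) _ Uz) => w /fk ->.
Qed.
Lemma mxwirt_real p q (U : set C) c (M : C -> 'M[C]_(p, q)) z : open U -> mxsmooth U M ->
  (forall z, U z -> mxconj (M z) = M z) -> U z -> mxwirt c M z = mxconj (mxwirt c^* M z).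
Proof.
move=> oU sM rM Uz; rewrite -mxwirt_conj; last exact: (mxsmooth_rdiff sM Uz).
by apply: (mxwirt_eq oU c sM _ Uz) => w /rM ->.
Qed.

Lemma adapted_sym U Y Yh V : adapted U Y Yh V -> adapted U Yh Y V.
Proof.
move=> [[a b c] h]; split=> // z /h [p q r s t]; split=> //; exact: adapted_at_sym.
Qed.
Lemma adapted_sub U U' Y Yh V : U' `<=` U -> adapted U Y Yh V -> adapted U' Y Yh V.
Proof.
by move=> sU [[a b c] h]; split=> [|z /sU /h //]; split; apply: mxsmooth_sub sU _.
Qed.

Section Facts.
Variables (U : set C) (Y Yh : C -> 'cV[C]_dim) (V : C -> 'M[C]_(dim, m)).
Hypotheses (oU : open U) (ad : adapted U Y Yh V).

Lemma ad_sY : mxsmooth U Y. Proof. by case: ad => [[]]. Qed.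
Lemma ad_sYh : mxsmooth U Yh. Proof. by case: ad => [[]]. Qed.
Lemma ad_sV : mxsmooth U V. Proof. by case: ad => [[]]. Qed.
Lemma ad_at z : U z -> adapted_at (Y z) (Yh z) (V z).
Proof. by case: ad => _ h /h []. Qed.
Lemma ad_rY z : U z -> mxconj (Y z) = Y z. Proof. by move=> /ad_at [[]]. Qed.
Lemma ad_rYh z : U z -> mxconj (Yh z) = Yh z. Proof. by move=> /ad_at [[]]. Qed.
Lemma ad_YY z : U z -> ip (Y z) (Y z) = 0. Proof. by move=> /ad_at [[]]. Qed.
Lemma ad_YhYh z : U z -> ip (Yh z) (Yh z) = 0. Proof. by move=> /ad_at [[]]. Qed.
Lemma ad_YYh z : U z -> ip (Y z) (Yh z) = -1. Proof. by move=> /ad_at [[]]. Qed.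
Lemma ad_dBV z : U z -> dB V z = 0. Proof. by case: ad => _ h /h []. Qed.
Lemma ad_VdV z : U z -> (V z)^T *m J *m dZ V z = 0. Proof. by case: ad => _ h /h []. Qed.
Lemma ad_VY z : U z -> (V z)^T *m J *m Y z = 0. Proof. by move=> /ad_at [_ []]. Qed.
Lemma ad_dY z : U z -> mxrdiff Y z. Proof. exact: (mxsmooth_rdiff ad_sY). Qed.
Lemma ad_dYh z : U z -> mxrdiff Yh z. Proof. exact: (mxsmooth_rdiff ad_sYh). Qed.
Lemma ad_dV z : U z -> mxrdiff V z. Proof. exact: (mxsmooth_rdiff ad_sV). Qed.

Lemma smooth_conn : smooth U (conn Y Yh).
Proof.
by apply: (smooth_ext oU _ (smooth_ip oU (mxsmooth_wirt oU _ ad_sY) ad_sYh)) => z _; rewrite conn_def.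
Qed.
Lemma smooth_isoW : mxsmooth U (isoW Y Yh).
Proof.
apply: (mxsmooth_ext oU _ (mxsmoothD oU (mxsmooth_wirt oU _ ad_sY) (mxsmoothZ oU smooth_conn ad_sY))) => z _.
by rewrite isoW_def.
Qed.

Lemma dB_Y z : U z -> dB Y z = mxconj (dZ Y z).
Proof. by move=> Uz; rewrite (mxwirt_real _ oU ad_sY ad_rY Uz) conjCi. Qed.
Lemma dB_Yh z : U z -> dB Yh z = mxconj (dZ Yh z).
Proof. by move=> Uz; rewrite (mxwirt_real _ oU ad_sYh ad_rYh Uz) conjCi. Qed.
Lemma dZ_Vb z : U z -> dZ (fun w => mxconj (V w)) z = 0.
Proof. by move=> Uz; rewrite mxwirt_conj ?conjNi ?ad_dBV ?mxconj0 //; exact: ad_dV. Qed.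
Lemma dB_Vb z : U z -> dB (fun w => mxconj (V w)) z = mxconj (dZ V z).
Proof. by move=> Uz; rewrite mxwirt_conj ?conjCi //; exact: ad_dV. Qed.

Lemma ip_dZY_Y c z : U z -> ip (mxwirt c Y z) (Y z) = 0.
Proof.
move=> Uz; have := wirt_on_cst c oU ad_YY Uz; rewrite wirt_ip; [|exact: ad_dY|exact: ad_dY].
by rewrite (ipC (Y z)) -mulr2n => /eqP; rewrite mulrn_eq0 => /eqP.
Qed.
Lemma ip_dZYh_Y c z : U z -> ip (mxwirt c Yh z) (Y z) = - ip (mxwirt c Y z) (Yh z).
Proof.
move=> Uz; have := wirt_on_cst c oU ad_YYh Uz; rewrite wirt_ip; [|exact: ad_dY|exact: ad_dYh].
by rewrite addrC (ipC (Y z)) => /eqP; rewrite addr_eq0 => /eqP.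
Qed.
Lemma conn_sym z : U z -> conn Yh Y z = - conn Y Yh z.
Proof. by move=> Uz; rewrite !conn_def; exact: ip_dZYh_Y. Qed.

Lemma dZ_YE z : dZ Y z = isoW Y Yh z - conn Y Yh z *: Y z.
Proof. by rewrite isoW_def addrK. Qed.
Lemma dZ_YhE z : U z -> dZ Yh z = isoW Yh Y z + conn Y Yh z *: Yh z.
Proof. by move=> Uz; rewrite isoW_def conn_sym // scaleNr addrNK. Qed.
Lemma dB_YE z : U z -> dB Y z = mxconj (isoW Y Yh z) - (conn Y Yh z)^* *: Y z.
Proof. by move=> Uz; rewrite dB_Y // dZ_YE mxconjB mxconjZ ad_rY. Qed.
Lemma dB_YhE z : U z -> dB Yh z = mxconj (isoW Yh Y z) + (conn Y Yh z)^* *: Yh z.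
Proof. by move=> Uz; rewrite dB_Yh // dZ_YhE // mxconjD mxconjZ ad_rYh. Qed.

(** The third condition is the z-derivative of the orthogonality of [Y] and conj V: as conj V is
    antiholomorphic, only the term with Y_z remains. *)
Lemma inW_isoW z : U z -> inW (Y z) (Yh z) (V z) (isoW Y Yh z).
Proof.
move=> Uz; split.
- by rewrite isoW_def !ipE2 ip_dZY_Y // ad_YY // mulr0 addr0.
- by rewrite isoW_def !ipE2 ad_YYh // mulrN1 conn_def subrr.
- have h : dZ (fun w => (mxconj (V w))^T *m J *m Y w) z = 0.
    by apply: (mxwirt_on_cst _ oU _ Uz) => w Uw; exact: (VbY (ad_at Uw)).
  move: h; rewrite (mxwirt_gram _ (mxrdiff_conj (ad_dV Uz)) (ad_dY Uz)) dZ_Vb //.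
  rewrite trmx0 !mul0mx add0r isoW_def mulmxDr => ->.
  by rewrite -scalemxAr (VbY (ad_at Uz)) scaler0 addr0.
Qed.
End Facts.

Section Fields.
Variables (U : set C) (Y Yh : C -> 'cV[C]_dim) (V : C -> 'M[C]_(dim, m)).
Hypotheses (oU : open U) (ad : adapted U Y Yh V).
Let ads : adapted U Yh Y V. Proof. exact: adapted_sym. Qed.
Local Notation inWz z := (inW (Y z) (Yh z) (V z)).

Lemma inW_isoW' z : U z -> inWz z (isoW Yh Y z).
Proof. by move=> Uz; apply: inW_sym; exact: (inW_isoW oU ads Uz). Qed.

Variable x : C -> 'cV[C]_dim.
Hypotheses (sx : mxsmooth U x) (xW : forall z, U z -> inWz z (x z)).

Lemma dVJx c z : U z -> mxwirt c (fun w => (mxconj (V w))^T *m J *m x w) z =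
  (mxwirt c (fun w => mxconj (V w)) z)^T *m J *m x z + (mxconj (V z))^T *m J *m mxwirt c x z.
Proof.
by move=> Uz; exact: (mxwirt_gram c (mxrdiff_conj (ad_dV ad Uz)) (mxsmooth_rdiff sx Uz)).
Qed.
Let xY w : U w -> ip (x w) (Y w) = 0. Proof. by move=> /xW [a _ _]; exact: a. Qed.
Let xYh w : U w -> ip (x w) (Yh w) = 0. Proof. by move=> /xW [_ a _]; exact: a. Qed.
Let xV w : U w -> (mxconj (V w))^T *m J *m x w = 0. Proof. by move=> /xW [_ _ a]; exact: a. Qed.

(** In each differentiated relation the term that does not contain [dZ x] vanishes: it pairs [x]
    with an element of W plus a multiple of [Y] or [Yh], or it contains the z-derivative of conj
    V. *)
Lemma inW_dZ z : U z -> inWz z (dZ x z).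
Proof.
move=> Uz; have rx := mxsmooth_rdiff sx Uz; have xz := xW Uz; split.
- have h := wirt_on_cst (- 'i) oU xY Uz.
  move: h; rewrite (wirt_ip _ rx (ad_dY ad Uz)) (dZ_YE Y Yh z) ipDr ipNr ipZr.
  by rewrite (inW_ip (ad_at ad Uz) xz (inW_isoW oU ad Uz)) (xY Uz) mulr0 subr0 addr0.
- have h := wirt_on_cst (- 'i) oU xYh Uz.
  move: h; rewrite (wirt_ip _ rx (ad_dYh ad Uz)) (dZ_YE Yh Y z) ipDr ipNr ipZr.
  by rewrite (inW_ip (ad_at ad Uz) xz (inW_isoW' Uz)); rewrite (xYh Uz) mulr0 subr0 addr0.
- have h := mxwirt_on_cst (- 'i) oU xV Uz.
  by move: h; rewrite dVJx // (dZ_Vb ad) // trmx0 !mul0mx add0r.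
Qed.

Lemma ip_dB_Y z : U z -> ip (dB x z) (Y z) = - ip (x z) (mxconj (isoW Y Yh z)).
Proof.
move=> Uz; have rx := mxsmooth_rdiff sx Uz; have xz := xW Uz.
have h := wirt_on_cst 'i oU xY Uz.
move: h; rewrite (wirt_ip _ rx (ad_dY ad Uz)) (dB_YE oU ad Uz) !ipE2.
by rewrite (xY Uz) mulr0 subr0 => /eqP; rewrite addr_eq0 => /eqP.
Qed.
Lemma ip_dB_Yh z : U z -> ip (dB x z) (Yh z) = - ip (x z) (mxconj (isoW Yh Y z)).
Proof.
move=> Uz; have rx := mxsmooth_rdiff sx Uz; have xz := xW Uz.
have h := wirt_on_cst 'i oU xYh Uz.
move: h; rewrite (wirt_ip _ rx (ad_dYh ad Uz)) (dB_YhE oU ad Uz) !ipE2.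
by rewrite (xYh Uz) mulr0 addr0 => /eqP; rewrite addr_eq0 => /eqP.
Qed.
(** Here the orthogonality of [dZ V] to [V] enters, in conjugated form: the zbar-derivative of conj
    V pairs to 0 with every element of W. *)
Lemma VbJ_dB z : U z -> (mxconj (V z))^T *m J *m dB x z = 0.
Proof.
move=> Uz; have [d xE] := inW_span (ad_at ad Uz) (xW Uz).
have h := mxwirt_on_cst 'i oU xV Uz.
move: h; rewrite dVJx // (dB_Vb ad) // xE.
suff -> : (mxconj (dZ V z))^T *m J *m (mxconj (V z) *m d) = 0 by rewrite add0r.
have := ad_VdV ad Uz => h.
have h' : (dZ V z)^T *m J *m V z = 0.
  by apply: trmx_inj; rewrite trmx0 !trmx_mul trmxK trJ mulmxA.
by rewrite mulmxA -[J](conjJ R m.*2) -mxconj_tr -!mxconjM h' mxconj0 mul0mx.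
Qed.
Lemma inW_dB z : U z ->
  inWz z (dB x z - ip (x z) (mxconj (isoW Yh Y z)) *: Y z - ip (x z) (mxconj (isoW Y Yh z)) *: Yh z).
Proof.
move=> Uz; have := inW_rest (ad_at ad Uz) (VbJ_dB Uz).
by rewrite ip_dB_Y // ip_dB_Yh // !scaleNr.
Qed.
End Fields.

Section Structure.
Variables (U : set C) (Y Yh : C -> 'cV[C]_dim) (V : C -> 'M[C]_(dim, m)).
Hypotheses (oU : open U) (ad : adapted U Y Yh V).

(** The component in W is detected by pairing with [V]. Differentiating the orthogonality of [V] and
    [Y] in z gives [V^T J p = - (dZ V)^T J Y]; in the zbar-derivative of this, [dB (dZ V)] vanishes
    and conj p, a combination of the columns of [V], is orthogonal to [dZ V], so only [- conj w]
    times the same quantity is left. In effect this is the harmonic map equation for the pair. *)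
Lemma dB_isoW z : U z -> dB (isoW Y Yh) z =
  - (conn Y Yh z)^* *: isoW Y Yh z + ip (isoW Y Yh z) (mxconj (isoW Yh Y z)) *: Y z
  + ip (isoW Y Yh z) (mxconj (isoW Y Yh z)) *: Yh z.
Proof.
move=> Uz; set p := isoW Y Yh.
have sp : mxsmooth U p := smooth_isoW oU ad.
have pW w : U w -> inW (Y w) (Yh w) (V w) (p w) := @inW_isoW _ _ _ _ oU ad w.
have rp := mxsmooth_rdiff sp Uz.
have rV := ad_dV ad Uz; have rVt := mxrdiff_tr rV.
have sdV : mxsmooth U (dZ V) by exact: (mxsmooth_wirt oU (- 'i) (ad_sV ad)).
have rdV := mxsmooth_rdiff sdV Uz.
have VJp w : U w -> (V w)^T *m J *m p w = - ((dZ V w)^T *m J *m Y w).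
  move=> Uw; have h : dZ (fun w => (V w)^T *m J *m Y w) w = 0.
    by apply: (mxwirt_on_cst _ oU _ Uw) => u Uu; exact: (ad_VY ad).
  move: h; rewrite (mxwirt_gram _ (ad_dV ad Uw) (ad_dY ad Uw)) (dZ_YE Y Yh) mulmxBr -scalemxAr (ad_VY ad) // scaler0 subr0.
  by rewrite addrC => /eqP; rewrite addr_eq0 => /eqP.
have dVY := mxrdiffM (mxrdiffM (mxrdiff_tr rdV) (mxrdiff_cst J z)) (ad_dY ad Uz).
have e1 : dB (fun w => (V w)^T *m J *m p w) z = dB (fun w => - ((dZ V w)^T *m J *m Y w)) z.
  exact: (mxwirt_eq oU 'i (mxsmooth_gram oU (ad_sV ad) sp) VJp Uz).
have dBdZV : dB (dZ V) z = 0.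
  rewrite (mxwirt_sym oU 'i (- 'i) (ad_sV ad) Uz).
  by apply: (mxwirt_on_cst _ oU _ Uz) => u Uu; exact: (ad_dBV ad).
have [d pE] := inW_span (ad_at ad Uz) (pW z Uz).
have dVtV : (dZ V z)^T *m J *m V z = 0.
  by apply: trmx_inj; rewrite trmx0 !trmx_mul trmxK trJ mulmxA (ad_VdV ad).
move: e1; rewrite (mxwirt_gram 'i rV rp) (ad_dBV ad) // trmx0 !mul0mx add0r.
rewrite (mxwirtN 'i dVY) (mxwirt_gram 'i rdV (ad_dY ad Uz)) dBdZV trmx0 !mul0mx add0r (dB_YE oU ad) // -/p pE mxconjM mxconjK.
rewrite mulmxBr mulmxA dVtV mul0mx sub0r opprK -scalemxAr -[_ *m Y z]opprK -VJp // -pE => E.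
have W1 := inW_dB oU ad sp pW Uz.
have W2 := inWZ (- (conn Y Yh z)^*) (pW z Uz).
have := inW_eq (ad_at ad Uz) W1 W2.
case: (ad_at ad Uz) => _ [_ VYz VYhz _ _].
rewrite !mulmxBr -!scalemxAr VYz VYhz !scaler0 !subr0 E scalerN scaleNr => /(_ erefl).
have pbE : mxconj (p z) = V z *m mxconj d by rewrite pE mxconjM mxconjK.
by rewrite -/p -pbE => /eqP; rewrite !subr_eq => /eqP ->; rewrite addrAC.
Qed.
End Structure.

Section Scaling.
Variables (U : set C) (Y Yh : C -> 'cV[C]_dim) (V : C -> 'M[C]_(dim, m)) (f : C -> C).
Hypotheses (oU : open U) (ad : adapted U Y Yh V) (sf : smooth U f) (f0 : forall z, U z -> 0 < f z).

(** Inverse factors preserve [<Y, Yh> = -1]. This freedom serves twice: for the lift of height one,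
    which tests immersion, and for the canonical lift. *)
Lemma adapted_scale : adapted U (fun z => f z *: Y z) (fun z => (f z)^-1 *: Yh z) V.
Proof.
have fn z : U z -> f z != 0 by move=> /f0; exact: lt0r_neq0.
have fr z : U z -> (f z)^* = f z by move=> /f0 h; apply: conj_Creal; exact: gtr0_real.
have frV z : U z -> ((f z)^-1)^* = (f z)^-1 by move=> Uz; rewrite fmorphV /= fr.
split.
  by split; [exact: (mxsmoothZ oU sf (ad_sY ad))|exact: (mxsmoothZ oU (smoothV oU fn sf) (ad_sYh ad))|exact: (ad_sV ad)].
move=> z Uz; case: ad => _ /(_ z Uz) [[[a b c d e] [g h i j k]] l n o q].
have fz := fn z Uz; split=> //.
- split; split; rewrite ?mxconjZ ?frV ?fr ?a ?b ?ipE2 ?c ?d ?e -?scalemxAr ?h ?i ?scaler0 ?mulr0 //.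
    by rewrite mulrA mulfV // mul1r.
  move=> x; rewrite !ipE2 => /eqP; rewrite mulf_eq0 (negbTE fz) /= => /eqP xY.
  by move=> /eqP; rewrite mulf_eq0 invr_eq0 (negbTE fz) /= => /eqP; exact: k.
- by rewrite mxE mulr_gt0 ?f0.
- by rewrite mxE mulr_gt0 ?invr_gt0 ?f0.
Qed.

Lemma conn_scale z : U z -> conn (fun z => f z *: Y z) (fun z => (f z)^-1 *: Yh z) z =
  conn Y Yh z - (f z)^-1 * wirt (- 'i) f z.
Proof.
move=> Uz; have fz : f z != 0 by apply: lt0r_neq0; exact: f0.
rewrite !conn_def mxwirtZ; [|exact: (smooth_rdiff sf Uz)|exact: (ad_dY ad)].
by rewrite !ipE2 (ad_YYh ad) //; field.
Qed.
Lemma isoW_scale z : U z -> isoW (fun z => f z *: Y z) (fun z => (f z)^-1 *: Yh z) z =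
  f z *: isoW Y Yh z.
Proof.
move=> Uz; have fz : f z != 0 by apply: lt0r_neq0; exact: f0.
rewrite !isoW_def conn_scale // mxwirtZ; [|exact: (smooth_rdiff sf Uz)|exact: (ad_dY ad)].
rewrite scalerDr !scalerA mulrBl mulrAC mulVf // mul1r scalerBl.
by rewrite [conn _ _ _ * _]mulrC [X in X + _]addrC -addrA; congr (_ + _); rewrite addrC addrNK.
Qed.
End Scaling.
End Adapted.

(** * Immersion points *)

Section Immersion.
Variables (R : realType) (m : nat).
Local Notation C := (Cx R).
Local Notation dim := (m.*2.+2).
Local Notation J := (mink R m.*2.+1).
Local Notation dZ := (mxwirt (- 'i)).
Local Notation dB := (mxwirt 'i).

Definition tl (x : 'cV[C]_dim) : 'cV[C]_(m.*2.+1) := \col_j x (lift ord0 j) ord0.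

Lemma ip_tl (x x' : 'cV[C]_dim) :
  ip x x' = - (x ord0 ord0 * x' ord0 ord0) + ((tl x)^T *m tl x') ord0 ord0.
Proof.
rewrite ip_def -mulmxA mxE big_ord_recl; congr (_ + _).
  by rewrite mul_diag_mx !mxE /= mulN1r mulrN.
rewrite mxE; apply: eq_bigr => j _; rewrite mul_diag_mx !mxE.
by rewrite (_ : (lift ord0 j == ord0) = false) ?mul1r.
Qed.

Lemma mxdir_real p q (U : set C) (v : C) (M : C -> 'M[C]_(p, q)) z : open U -> mxsmooth U M ->
  (forall w, U w -> mxconj (M w) = M w) -> U z -> mxconj (mxdir v M z) = mxdir v M z.
Proof.
move=> oU sM rM Uz; apply/matrixP => i j; rewrite mxconjE mxE.
have d := is_ddir_any oU v (sM i j) Uz; set e := _ + _ in d.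
have d' := is_ddir_conj d.
have d2 : is_ddir v (fun w => M w i j) z e^*.
  apply: is_ddir_near d'; apply: filterS (near_open oU Uz) => w /rM h.
  by rewrite -[in RHS]h mxconjE.
by rewrite (is_ddir_val d) -(is_ddir_val d2) (is_ddir_val d).
Qed.

Lemma mxwirt_dir p q c (M : C -> 'M[C]_(p, q)) z :
  mxwirt c M z = 2^-1 *: (mxdir 1 M z + c *: mxdir 'i M z).
Proof. by apply/matrixP => i j; rewrite mxwirtE wirt_def !mxE mulrC. Qed.

Definition dt n (a b : 'cV[C]_n) : C := (a^T *m b) ord0 ord0.
Lemma dtC n (a b : 'cV[C]_n) : dt a b = dt b a.
Proof. by rewrite /dt -[in LHS](trmxK (a^T *m b)) mxE trmx_mul trmxK. Qed.
Lemma dtDl n (a b c : 'cV[C]_n) : dt (a + b) c = dt a c + dt b c.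
Proof. by rewrite /dt linearD mulmxDl mxE. Qed.
Lemma dtZl n k (a c : 'cV[C]_n) : dt (k *: a) c = k * dt a c.
Proof. by rewrite /dt linearZ -scalemxAl mxE. Qed.
Lemma dtDr n (a b c : 'cV[C]_n) : dt c (a + b) = dt c a + dt c b.
Proof. by rewrite dtC dtDl !(dtC c). Qed.
Lemma dtZr n k (a c : 'cV[C]_n) : dt c (k *: a) = k * dt c a.
Proof. by rewrite dtC dtZl dtC. Qed.
Lemma dt0r n (c : 'cV[C]_n) : dt c 0 = 0.
Proof. by rewrite -(scale0r 0) dtZr mul0r. Qed.

Lemma real_sqr0 n (a : 'cV[C]_n) : mxconj a = a -> dt a a = 0 -> a = 0.
Proof.
move=> ra; rewrite /dt mxE => /eqP; rewrite psumr_eq0 => [/allP h|i _].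
  apply/matrixP => i j; rewrite !ord1 mxE; have := h i (mem_index_enum i).
  by rewrite /= mxE mulf_eq0 orbb => /eqP.
rewrite mxE -[X in X * _](_ : (a i ord0)^* = _); first by rewrite mulrC -normCK exprn_ge0.
by rewrite -mxconjE ra.
Qed.

(** Real and imaginary parts of the isotropy of [a - 'i *: b] say that [a] and [b] have equal length
    and are orthogonal; so the rank is 2 unless both vanish. *)
Lemma rank2_real n (a b : 'cV[C]_n) : mxconj a = a -> mxconj b = b ->
  dt (a - 'i *: b) (a - 'i *: b) = 0 -> (\rank (row_mx a b) = 2 <-> a - 'i *: b != 0).
Proof.
move=> ra rb e.
have conjdt (x y : 'cV[C]_n) : (dt x y)^* = dt (mxconj x) (mxconj y).
  by rewrite /dt -mxconjE mxconjM mxconj_tr.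
have ab0 : a - 'i *: b = 0 -> a = 0 /\ b = 0.
  move=> h; have h' : a + 'i *: b = 0.
    have := congr1 (@mxconj R _ _) h.
    by rewrite mxconjB mxconjZ ra rb conjCi scaleNr opprK mxconj0.
  have a2 : a + a = 0 by rewrite -{1}(addrNK ('i *: b) a) h add0r addrC.
  have a0 : a = 0 by move: a2; rewrite -mulr2n -scaler_nat => /eqP; rewrite scaler_eq0 pnatr_eq0 => /eqP.
  split=> //; move: h'; rewrite a0 add0r => /eqP; rewrite scaler_eq0 (negbTE (neq0Ci _)) => /eqP //.
split=> [rk|ne].
  apply/eqP => /ab0 [a0 b0]; move: rk; rewrite a0 b0 row_mx0 mxrank0 //.
have ii : 'i * 'i = -1 :> C by rewrite -expr2 sqrCi.
have dtE k : dt (a + k *: b) (a + k *: b) = dt a a + k * k * dt b b + 2 * k * dt a b.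
  by rewrite dtDl !dtDr !dtZl !dtZr (dtC b a); ring.
have e1 : dt a a - dt b b - 2 * 'i * dt a b = 0.
  move: e; rewrite -scaleNr dtE mulrNN ii => <-; ring.
have e2 : dt a a - dt b b + 2 * 'i * dt a b = 0.
  have := congr1 (fun x => x^*) e1; rewrite /= rmorph0 => <-.
  by rewrite !rmorphB !rmorphM /= rmorph_nat conjCi !conjdt ra rb; ring.
have n2 : (2 : C) != 0 by rewrite pnatr_eq0.
have aab : dt a a = dt b b.
  apply/eqP; rewrite -subr_eq0; apply/eqP; apply: (mulfI n2); rewrite mulr0.
  by rewrite -[RHS]addr0 -{1}e1 -e2; ring.
have ab : dt a b = 0.
  have i0 : 2 * 'i != 0 :> C by rewrite mulf_neq0 ?neq0Ci.
  by apply: (mulfI i0); move: e2; rewrite aab subrr add0r mulr0.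
have a0 : dt a a != 0.
  apply: contraNneq ne => h; rewrite (real_sqr0 ra h) (real_sqr0 rb) ?scaler0 ?subr0 //.
  by rewrite -aab.
have fr : row_free (row_mx a b)^T.
  apply: inj_row_free => v h.
  have h' : row_mx a b *m v^T = 0 by rewrite -[row_mx a b]trmxK -trmx_mul h trmx0.
  move: h'; rewrite -[v^T]vsubmxK mul_row_col => h'.
  have c1 : usubmx v^T = (usubmx v^T ord0 ord0)%:M by rewrite [LHS]mx11_scalar.
  have c2 : dsubmx v^T = (dsubmx v^T ord0 ord0)%:M by rewrite [LHS]mx11_scalar.
  move: h'; rewrite c1 c2 !mul_mx_scalar; set k := usubmx _ _ _; set l := dsubmx _ _ _ => h'.
  have k0 : k = 0.
    have := congr1 (dt a) h'; rewrite dtDr !dtZr ab mulr0 addr0 dt0r => /eqP.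
    by rewrite mulf_eq0 (negbTE a0) orbF => /eqP.
  have l0 : l = 0.
    have := congr1 (dt b) h'; rewrite dtDr !dtZr (dtC b a) ab mulr0 add0r dt0r -aab => /eqP.
    by rewrite mulf_eq0 (negbTE a0) orbF => /eqP.
  by apply: trmx_inj; rewrite -[v^T]vsubmxK c1 c2 -/k -/l k0 l0 !raddf0 col_mx0.
by move: fr; rewrite /row_free mxrank_tr => /eqP.
Qed.

Definition sphere_of (Y : C -> 'cV[C]_dim) z := sphere_point (Y z).

Section UnitHeight.
Variables (U : set C) (X Xh : C -> 'cV[C]_dim) (V : C -> 'M[C]_(dim, m)).
Hypotheses (oU : open U) (ad : adapted U X Xh V) (X0 : forall z, U z -> X z ord0 ord0 = 1).

Lemma mxwirt_X0 c z : U z -> mxwirt c X z ord0 ord0 = 0.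
Proof. by move=> Uz; rewrite mxwirtE; exact: (wirt_on_cst c oU X0 Uz). Qed.

Lemma ip_dZX z : U z -> ip (dZ X z) (dZ X z) = 0.
Proof.
move=> Uz; have iw := inW_isoW oU ad Uz.
have e0 := inW_ip (ad_at ad Uz) iw iw.
case: iw => e1 _ _; have e2 := ad_YY ad Uz; move: e0 e1 e2; rewrite (dZ_YE X Xh z).
move: (isoW X Xh z) (conn X Xh z) (X z) => q k x qq qx xx.
by rewrite !ipE2 qq (ipC x) qx xx; ring.
Qed.

(** If the component in W vanishes, [dZ X] is a multiple of [X], and the constant first coordinate 1
    forces the factor to be 0. *)
Lemma dZX_eq0 z : U z -> (dZ X z = 0 <-> isoW X Xh z = 0).
Proof.
move=> Uz; split=> h; first by rewrite isoW_def conn_def h ip0l scale0r addr0.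
have e : dZ X z = - conn X Xh z *: X z by rewrite (dZ_YE X Xh z) h sub0r scaleNr.
have := mxwirt_X0 (- 'i) Uz; rewrite e mxE X0 // mulr1 => c0.
by rewrite c0 scale0r.
Qed.
End UnitHeight.

Section Immersed.
Variables (U : set C) (Y Yh : C -> 'cV[C]_dim) (V : C -> 'M[C]_(dim, m)).
Hypotheses (oU : open U) (ad : adapted U Y Yh V).

Definition height_inv z : C := (Y z ord0 ord0)^-1.
Definition unit_lift z := height_inv z *: Y z.
Definition unit_lift_h z := (height_inv z)^-1 *: Yh z.
Local Notation f := height_inv.
Local Notation X := unit_lift.
Local Notation Xh := unit_lift_h.
Local Notation y := (sphere_of Y).

Lemma ad_pos z : U z -> 0 < Y z ord0 ord0. Proof. by case: ad => _ h /h []. Qed.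
Let Y0 z : U z -> Y z ord0 ord0 != 0. Proof. by move=> /ad_pos; exact: lt0r_neq0. Qed.
Let f0 z : U z -> 0 < f z. Proof. by move=> /ad_pos h; rewrite invr_gt0. Qed.
Let sf : smooth U f. Proof. exact: (smoothV oU Y0 (ad_sY ad _ _)). Qed.
Let adX : adapted U X Xh V. Proof. exact: (adapted_scale oU ad sf f0). Qed.
Let X0 z : U z -> X z ord0 ord0 = 1. Proof. by move=> Uz; rewrite mxE mulVf ?Y0. Qed.
Lemma sphere_ofE z : y z = tl (X z).
Proof. by apply/matrixP => i j; rewrite !mxE mulrC. Qed.

Lemma smooth_sphere : mxsmooth U y.
Proof.
move=> i j; apply: smooth_ext oU _ _ _ (ad_sY adX (lift ord0 i) ord0) => z _.
by rewrite sphere_ofE [RHS]mxE.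
Qed.
Lemma sphere_real z : U z -> mxconj (y z) = y z.
Proof.
move=> Uz; rewrite sphere_ofE; apply/matrixP => i j; rewrite mxconjE !(mxE _ (fun _ _ => _)).
by have := congr1 (fun A : 'cV[C]_dim => A (lift ord0 i) ord0) (ad_rY adX Uz); rewrite mxconjE mxE.
Qed.

Lemma mxwirt_sphere c z : mxwirt c y z = tl (mxwirt c X z).
Proof.
apply/matrixP => i j; rewrite [RHS]mxE !mxwirtE.
by apply: eq_wirt => w; rewrite sphere_ofE [LHS]mxE.
Qed.

Lemma sphere_conformal z : U z -> (mxdz y z)^T *m mxdz y z = 0.
Proof.
move=> Uz; rewrite mxdzE mxwirt_sphere; apply/matrixP => i j; rewrite !ord1 [RHS]mxE.
by have := ip_dZX oU adX Uz; rewrite ip_tl (mxwirt_X0 oU X0 _ Uz) mul0r oppr0 add0r.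
Qed.

(** The test is carried out on the lift of height one, whose space part is the surface itself; a
    change of lift multiplies [isoW] by a nonzero factor. *)
Lemma immersed_iff z : U z -> (immersed_at y z <-> isoW Y Yh z != 0).
Proof.
move=> Uz; have ra := mxdir_real 1 oU smooth_sphere sphere_real Uz.
have rb := mxdir_real 'i oU smooth_sphere sphere_real Uz.
have n2 : (2^-1 : C) != 0 by rewrite invr_eq0 pnatr_eq0.
have E : dZ y z = 2^-1 *: (mxdir 1 y z - 'i *: mxdir 'i y z).
  by rewrite mxwirt_dir scaleNr.
have D0 : dt (mxdir 1 y z - 'i *: mxdir 'i y z) (mxdir 1 y z - 'i *: mxdir 'i y z) = 0.
  have := sphere_conformal Uz; rewrite mxdzE E => h.
  have : dt (2^-1 *: (mxdir 1 y z - 'i *: mxdir 'i y z)) (2^-1 *: (mxdir 1 y z - 'i *: mxdir 'i y z)) = 0.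
    by rewrite /dt h mxE.
  by rewrite dtZl dtZr => /eqP; rewrite !mulf_eq0 (negbTE n2) => /eqP.
have := rank2_real ra rb D0; rewrite /immersed_at => ->.
have -> : (mxdir 1 y z - 'i *: mxdir 'i y z == 0) = (dZ y z == 0).
  by rewrite E scaler_eq0 (negbTE n2).
have -> : (dZ y z == 0) = (dZ X z == 0).
  rewrite mxwirt_sphere; apply/eqP/eqP => [h|->]; last by apply/matrixP => i j; rewrite !mxE.
  apply/matrixP => i j; rewrite ord1 [RHS]mxE; case: (unliftP ord0 i) => [k ->|->].
    by have := congr1 (fun A : 'cV[C]_(m.*2.+1) => A k ord0) h; rewrite [LHS]mxE [RHS]mxE.
  exact: (mxwirt_X0 oU X0 _ Uz).
have -> : (isoW Y Yh z == 0) = (isoW X Xh z == 0).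
  by rewrite (isoW_scale ad sf f0 Uz) scaler_eq0 (negbTE (lt0r_neq0 (f0 Uz))).
have [h1 h2] := dZX_eq0 Xh oU X0 Uz.
by have -> : (dZ X z == 0) = (isoW X Xh z == 0) by apply/eqP/eqP; [exact: h1|exact: h2].
Qed.
End Immersed.

Section Normalize.
Variables (U : set C) (Y Yh : C -> 'cV[C]_dim) (V : C -> 'M[C]_(dim, m)).
Hypotheses (oU : open U) (ad : adapted U Y Yh V) (ne : forall z, U z -> isoW Y Yh z != 0).
Let p := isoW Y Yh.

Lemma isoW_gt0 z : U z -> 0 < ip (p z) (mxconj (p z)).
Proof.
move=> Uz; have [a b _] := inW_isoW oU ad Uz; rewrite ipC lt_def (ad_ge0 (ad_at ad Uz) a b) andbT.
by apply: contraNneq (ne Uz) => h; apply/eqP; exact: (ad_eq0 (ad_at ad Uz) a b h).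
Qed.

(** The factor that makes [<isoW, conj isoW>] equal to 1/2 for the rescaled lift, which is the
    condition [|dL|^2 = |dz|^2]. *)
Definition normf z : C := (Csqrt (fun z => 2 * ip (p z) (mxconj (p z))) z)^-1.

Let g0 z : U z -> 0 < 2 * ip (p z) (mxconj (p z)).
Proof. by move=> Uz; rewrite mulr_gt0 ?isoW_gt0 ?ltr0n. Qed.
Let s0 z : U z -> 0 < Csqrt (fun z => 2 * ip (p z) (mxconj (p z))) z.
Proof.
move=> /g0 /posC [t t0 e]; rewrite /Csqrt e /= -[0]/((0%:C)%C) ltcRE sqrtr_gt0 //.
Qed.
Lemma normf_gt0 z : U z -> 0 < normf z.
Proof. by move=> Uz; rewrite invr_gt0 s0. Qed.
Lemma smooth_normf : smooth U normf.
Proof.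
apply: (smoothV oU) => [z Uz|]; first by apply: lt0r_neq0; exact: s0.
apply: (smooth_sqrt oU g0); apply: (smoothM oU); first exact: (smooth_cst oU _).
apply: (smooth_ip oU); first exact: (smooth_isoW oU ad).
by apply: (mxsmooth_conj oU); exact: (smooth_isoW oU ad).
Qed.
Lemma normf_half z : U z -> ip (normf z *: p z) (mxconj (normf z *: p z)) = 1 / 2.
Proof.
move=> Uz; have fr : (normf z)^* = normf z.
  by apply: conj_Creal; apply: gtr0_real; exact: normf_gt0.
rewrite mxconjZ fr ipZl ipZr.
have e : Csqrt (fun z => 2 * ip (p z) (mxconj (p z))) z ^+ 2 = 2 * ip (p z) (mxconj (p z)).
  have [t t0 e] := posC (g0 Uz); rewrite /Csqrt e /= -rmorphXn /= sqr_sqrtr // ltW //.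
have s1 : Csqrt (fun z => 2 * ip (p z) (mxconj (p z))) z != 0 by apply: lt0r_neq0; exact: s0.
have p0 : ip (p z) (mxconj (p z)) != 0 by apply: lt0r_neq0; exact: isoW_gt0.
rewrite mulrA -expr2 /normf exprVn e; field.
exact: p0.
Qed.
End Normalize.
End Immersion.

(** * Willmore surfaces and adjoint transforms *)

Section LinearIdentities.
Variables (K : fieldType) (n : nat).
Hypothesis n2 : (2 : K) != 0.
Implicit Types (k t u ub uh l lh : 'cV[K]_n) (a b c d e f w wb : K).

(** Here [k], [t], [u], [l], [lh] stand for [hopf], [theta], [isoW L Lh], [L], [Lh], and [w], [wb]
    for the connection coefficient and its conjugate. The point is that [k] and [t] are absent on
    the right. *)
Lemma lin_dB_hopf k t u l lh a b c d e w wb :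
  a *: u + - wb *: (k + w *: u) + (b *: l + e *: (u - w *: l)) +
  (0 *: lh + (1 / 2) *: (t + (2 * d) *: u + w *: lh)) -
  (c *: u + w *: (- wb *: u + e *: l + (1 / 2) *: lh)) - (- wb *: k + (1 / 2) *: t) =
  (a - wb * w + e + d - c + w * wb) *: u + (b - e * w - w * e) *: l + 0 *: lh.
Proof. by apply/matrixP => i j; rewrite !mxlinE; field. Qed.
Lemma lin_dB_theta u uh l lh a b c d wb :
  wb *: uh + b *: lh + c *: l - (a *: u + (2 * b) *: (- wb *: u + d *: l + (1 / 2) *: lh)) -
  wb *: (uh - (2 * b) *: u) =
  (- a + 2 * b * wb + 2 * b * wb) *: u + (c - 2 * b * d) *: l + 0 *: lh.
Proof. by apply/matrixP => i j; rewrite !mxlinE; field. Qed.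
Lemma lin_N_section u ub l lh w wb :
  lh - (2 * wb) *: (u - w *: l) - (2 * w) *: (ub - wb *: l) - (4 * w * wb / 2) *: l =
  lh - (2 * wb) *: u - (2 * w) *: ub + (2 * w * wb) *: l.
Proof. by apply/matrixP => i j; rewrite !mxlinE; field. Qed.
Lemma lin_V_basis u ub l lh a b c d e w wb :
  a *: l + b *: (u - w *: l) +
  (c *: (ub - wb *: l) + d *: (e *: l - w *: ub - wb *: u + (1 / 2) *: lh)) =
  (a - b * w - c * wb + d * e) *: l + (d / 2) *: lh + (b - d * wb) *: u + (c - d * w) *: ub.
Proof. by apply/matrixP => i j; rewrite !mxlinE; field. Qed.
End LinearIdentities.

Section NormalizedPoint.
Variables (R : realType) (n : nat).
Local Notation C := (Cx R).
Local Notation J := (mink R n.+1).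
Implicit Types (L : C -> 'cV[C]_n.+2) (x : 'cV[C]_n.+2).

(** Every projection is found by guessing its value [v]; the inverse Gram matrix in [Vperp_proj] is
    never computed. *)
Lemma Vperp_projE L z x v : (V_basis L z)^T *m J *m V_basis L z \in unitmx ->
  in_V L z (x - v) -> in_Vperp L z v -> Vperp_proj L z x = v.
Proof.
move=> u [c e] pv; rewrite /Vperp_proj.
have -> : (V_basis L z)^T *m J *m x = (V_basis L z)^T *m J *m V_basis L z *m c.
  by rewrite -[x](subrK v) e mulmxDr pv addr0 mulmxA.
by rewrite -[_ *m invmx _ *m _]mulmxA (mulKmx u) -e opprB addrC subrK.
Qed.
Lemma gram4_eq0 (a b c d x : 'cV[C]_n.+2) :
  (row_mx (row_mx a b) (row_mx c d))^T *m J *m x = 0 <->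
  [/\ ip a x = 0, ip b x = 0, ip c x = 0 & ip d x = 0].
Proof.
have E : (row_mx (row_mx a b) (row_mx c d))^T *m J *m x =
    col_mx (col_mx (ip a x)%:M (ip b x)%:M) (col_mx (ip c x)%:M (ip d x)%:M).
  by rewrite !tr_row_mx !mul_col_mx !ip_mx.
rewrite E; split=> [h|[-> -> -> ->]]; last by rewrite !raddf0 !col_mx0.
have h1 := congr1 usubmx h; have h2 := congr1 dsubmx h.
rewrite col_mxKu raddf0 in h1; rewrite col_mxKd raddf0 in h2.
have s0 (k : C) : k%:M = 0 :> 'M_1 -> k = 0.
  by move=> e; have := congr1 (fun A : 'M[C]_1 => A ord0 ord0) e; rewrite !mxE mulr1n.
have h3 := congr1 usubmx h1; have h4 := congr1 dsubmx h1.
have h5 := congr1 usubmx h2; have h6 := congr1 dsubmx h2.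
rewrite col_mxKu raddf0 in h3; rewrite col_mxKd raddf0 in h4.
rewrite col_mxKu raddf0 in h5; rewrite col_mxKd raddf0 in h6.
by split; [exact: (s0 _ h3)|exact: (s0 _ h4)|exact: (s0 _ h5)|exact: (s0 _ h6)].
Qed.
End NormalizedPoint.

Section Normalized.
Variables (R : realType) (m : nat).
Local Notation C := (Cx R).
Local Notation dim := (m.*2.+2).
Local Notation J := (mink R m.*2.+1).
Local Notation dZ := (mxwirt (- 'i)).
Local Notation dB := (mxwirt 'i).
Variables (U : set C) (L Lh : C -> 'cV[C]_dim) (V : C -> 'M[C]_(dim, m)).
Hypotheses (oU : open U) (ad : adapted U L Lh V).
Let q := isoW L Lh.
Let qh := isoW Lh L.
Let w := conn L Lh.
Hypothesis qq : forall z, U z -> ip (q z) (mxconj (q z)) = 1 / 2.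
Let ads : adapted U Lh L V. Proof. exact: adapted_sym. Qed.
Local Notation qb z := (mxconj (q z)).
Local Notation qhb z := (mxconj (qh z)).
Local Notation inWz z := (inW (L z) (Lh z) (V z)).

Lemma n_qW z : U z -> inWz z (q z). Proof. exact: (inW_isoW oU ad). Qed.
Let sq : mxsmooth U q. Proof. exact: (smooth_isoW oU ad). Qed.
Let sw : smooth U w. Proof. exact: (smooth_conn oU ad). Qed.

Lemma n_LqE z : dZ L z = q z - w z *: L z. Proof. exact: dZ_YE. Qed.
Lemma n_LhqE z : U z -> dZ Lh z = qh z + w z *: Lh z. Proof. exact: (dZ_YhE oU ad). Qed.
Lemma n_LqbE z : U z -> dB L z = qb z - (w z)^* *: L z. Proof. exact: (dB_YE oU ad). Qed.

Section Products.
Variable z : C.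
Hypothesis Uz : U z.
Lemma n_LL : ip (L z) (L z) = 0. Proof. exact: (ad_YY ad). Qed.
Lemma n_LhLh : ip (Lh z) (Lh z) = 0. Proof. exact: (ad_YhYh ad). Qed.
Lemma n_LLh : ip (L z) (Lh z) = -1. Proof. exact: (ad_YYh ad). Qed.
Lemma n_rL : mxconj (L z) = L z. Proof. exact: (ad_rY ad). Qed.
Lemma n_rLh : mxconj (Lh z) = Lh z. Proof. exact: (ad_rYh ad). Qed.
Lemma inW_L x : inWz z x -> ip x (L z) = 0. Proof. by case=> a _ _; exact: a. Qed.
Lemma inW_Lh x : inWz z x -> ip x (Lh z) = 0. Proof. by case=> _ a _; exact: a. Qed.
Lemma inW_Lb x : inWz z x -> ip (mxconj x) (L z) = 0.
Proof. by move=> /inW_L h; rewrite -n_rL -ip_conj h rmorph0. Qed.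
Lemma inW_Lhb x : inWz z x -> ip (mxconj x) (Lh z) = 0.
Proof. by move=> /inW_Lh h; rewrite -n_rLh -ip_conj h rmorph0. Qed.
Lemma inW_ipW x y : inWz z x -> inWz z y -> ip x y = 0.
Proof. exact: (inW_ip (ad_at ad Uz)). Qed.
Lemma inW_ipWb x y : inWz z x -> inWz z y -> ip (mxconj x) (mxconj y) = 0.
Proof. by move=> a b; rewrite -ip_conj inW_ipW // rmorph0. Qed.
Lemma n_qbq : ip (qb z) (q z) = 1 / 2. Proof. by rewrite ipC qq. Qed.
End Products.

Lemma n_dBq z : U z -> dB q z = - (w z)^* *: q z + ip (q z) (qhb z) *: L z + (1 / 2) *: Lh z.
Proof. by move=> Uz; rewrite (dB_isoW oU ad Uz) -/q -/qh -/w qq. Qed.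
Lemma n_dBqh z : U z -> dB qh z =
  (w z)^* *: qh z + ip (qh z) (qb z) *: Lh z + ip (qh z) (qhb z) *: L z.
Proof.
by move=> Uz; rewrite (dB_isoW oU ads Uz) -/q -/qh (conn_sym oU ad Uz) rmorphN opprK.
Qed.

Lemma n_dZqb z : U z -> dZ (fun z => qb z) z =
  - w z *: qb z + ip (qb z) (qh z) *: L z + (1 / 2) *: Lh z.
Proof.
move=> Uz; rewrite (mxwirt_conj _ (mxsmooth_rdiff sq Uz)) conjNi (n_dBq Uz).
rewrite !mxconjD !mxconjZ (n_rL Uz) (n_rLh Uz) rmorphN /= conjCK ip_conj mxconjK.
by rewrite rmorphM /= fmorphV rmorph1 rmorph_nat.
Qed.

(** The nonzero coefficient 1/2 of [Lh] is decisive: the bundle V is then also spanned by [L], [Lh],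
    [q] and its conjugate, for which all products are known. *)
Lemma n_LzzbE z : U z -> dZ (dB L) z =
  (- wirt (- 'i) (fun z => (w z)^*) z + ip (qb z) (qh z) + (w z)^* * w z) *: L z
  - w z *: qb z - (w z)^* *: q z + (1 / 2) *: Lh z.
Proof.
move=> Uz; have swc := smooth_conj oU sw.
have e : dZ (dB L) z = dZ (fun z => qb z - (w z)^* *: L z) z.
  exact: (mxwirt_eq oU _ (mxsmooth_wirt oU _ (ad_sY ad)) n_LqbE Uz).
have rL := ad_dY ad Uz; have rw := smooth_rdiff swc Uz.
have rq := mxrdiff_conj (mxsmooth_rdiff sq Uz).
rewrite e (mxwirtB _ rq (mxrdiffZ rw rL)) (mxwirtZ _ rw rL) n_dZqb // n_LqE.
rewrite scalerBr scalerA; move: (L z) (Lh z) (qb z) (q z) => a b c d.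
apply/matrixP => i j; rewrite !mxE; ring.
Qed.

Section Point.
Variable z : C.
Hypothesis Uz : U z.
Local Notation B := (V_basis L z).

Lemma n_basisE : B = row_mx (row_mx (L z) (dZ L z)) (row_mx (dB L z) (dZ (dB L) z)).
Proof. by rewrite /V_basis mxdzbE !mxdzE. Qed.

Lemma in_Vperp_iff x : in_Vperp L z x <->
  [/\ ip (L z) x = 0, ip (dZ L z) x = 0, ip (dB L z) x = 0 & ip (dZ (dB L) z) x = 0].
Proof. by rewrite /in_Vperp n_basisE; exact: gram4_eq0. Qed.

Lemma in_Vperp_iff' x : in_Vperp L z x <->
  [/\ ip (L z) x = 0, ip (Lh z) x = 0, ip (q z) x = 0 & ip (qb z) x = 0].
Proof.
rewrite in_Vperp_iff n_LqE (n_LqbE Uz) (n_LzzbE Uz).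
move: (L z) (Lh z) (q z) (qb z) => l lh u ub.
move: (_ + _ * w z) => k; split.
- move=> [a b c d].
  have b' : ip u x = 0 by move: b; rewrite ipDl ipNl ipZl a mulr0 subr0.
  have c' : ip ub x = 0 by move: c; rewrite ipDl ipNl ipZl a mulr0 subr0.
  have d' : ip lh x = 0.
    move: d; rewrite !(ipDl, ipNl, ipZl) a b' c' !mulr0 !subr0 add0r => /eqP.
    by rewrite mulf_eq0 mulf_eq0 oner_eq0 invr_eq0 pnatr_eq0 /= => /eqP.
  exact: (And4 a d' b' c').
- move=> [a b c d].
  by rewrite !(ipDl, ipNl, ipZl) a b c d !mulr0 !subr0 addr0.
Qed.

Definition col4 (a b c d : C) : 'M[C]_((1 + 1) + (1 + 1), 1) :=
  col_mx (col_mx a%:M b%:M) (col_mx c%:M d%:M).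
Lemma mul_col4 a b c d : B *m col4 a b c d =
  a *: L z + b *: dZ L z + (c *: dB L z + d *: dZ (dB L) z).
Proof. by rewrite n_basisE /col4 !mul_row_col !mul_mx_scalar. Qed.
Lemma col4K (u : 'M[C]_((1 + 1) + (1 + 1), 1)) : exists a b c d, u = col4 a b c d.
Proof.
exists (usubmx (usubmx u) ord0 ord0), (dsubmx (usubmx u) ord0 ord0),
  (usubmx (dsubmx u) ord0 ord0), (dsubmx (dsubmx u) ord0 ord0).
by rewrite /col4 -!mx11_scalar !vsubmxK.
Qed.

Lemma in_V_dZL : in_V L z (dZ L z).
Proof. by exists (col4 0 1 0 0); rewrite mul_col4 !scale0r !addr0 add0r scale1r. Qed.
Lemma in_VD x y : in_V L z x -> in_V L z y -> in_V L z (x + y).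
Proof. by move=> [c ->] [d ->]; exists (c + d); rewrite mulmxDr. Qed.
Lemma in_VZ k x : in_V L z x -> in_V L z (k *: x).
Proof. by move=> [c ->]; exists (k *: c); rewrite scalemxAr. Qed.
Lemma in_VB x y : in_V L z x -> in_V L z y -> in_V L z (x - y).
Proof. by move=> a b; rewrite -scaleN1r; apply: in_VD a (in_VZ _ b). Qed.
Lemma in_V_L : in_V L z (L z).
Proof. by exists (col4 1 0 0 0); rewrite mul_col4 !scale0r !addr0 scale1r. Qed.
Lemma in_V_dBL : in_V L z (dB L z).
Proof. by exists (col4 0 0 1 0); rewrite mul_col4 !scale0r !addr0 !add0r scale1r. Qed.
Lemma in_V_dZBL : in_V L z (dZ (dB L) z).
Proof. by exists (col4 0 0 0 1); rewrite mul_col4 !scale0r !add0r scale1r. Qed.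
Lemma in_V_q : in_V L z (q z).
Proof.
have -> : q z = dZ L z + w z *: L z by rewrite n_LqE subrK.
exact: (in_VD in_V_dZL (in_VZ _ in_V_L)).
Qed.
Lemma in_V_qb : in_V L z (qb z).
Proof.
have -> : qb z = dB L z + (w z)^* *: L z by rewrite n_LqbE // subrK.
exact: (in_VD in_V_dBL (in_VZ _ in_V_L)).
Qed.
Lemma in_V_Lh : in_V L z (Lh z).
Proof.
have n2 : (2 : C) != 0 by rewrite pnatr_eq0.
have -> : Lh z = 2 *: (dZ (dB L) z -
  (- wirt (- 'i) (fun z => (w z)^*) z + ip (qb z) (qh z) + (w z)^* * w z) *: L z
  + w z *: qb z + (w z)^* *: q z).
  rewrite (n_LzzbE Uz); move: (L z) (Lh z) (qb z) (q z) (wirt _ _ _) => a b c d e.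
  by apply/matrixP => i j; rewrite !mxE; field.
apply: in_VZ; apply: in_VD; last exact: (in_VZ _ in_V_q).
apply: in_VD; last exact: (in_VZ _ in_V_qb).
apply: in_VB; [exact: in_V_dZBL|exact: (in_VZ _ in_V_L)].
Qed.

(** A kernel vector is rewritten in [L], [Lh], [q], conj q, which form two hyperbolic pairs with
    products -1 and 1/2; the four pairings then kill the coefficients one after the other. *)
Lemma n_gram_unit : B^T *m J *m B \in unitmx.
Proof.
rewrite -unitmx_tr -row_free_unit; apply: inj_row_free => v e.
have e2 : B^T *m J *m (B *m v^T) = 0.
  by apply: trmx_inj; rewrite trmx0 mulmxA trmx_mul trmxK.
have [a [b [c [d vE]]]] := col4K v^T.
have /in_Vperp_iff' [i1 i2 i3 i4] : in_Vperp L z (B *m v^T) by exact: e2.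
have X : B *m v^T = (a - b * w z - c * (w z)^* +
   d * (- wirt (- 'i) (fun z => (w z)^*) z + ip (qb z) (qh z) + (w z)^* * w z)) *: L z
   + (d / 2) *: Lh z + (b - d * (w z)^*) *: q z + (c - d * w z) *: qb z.
  by rewrite vE mul_col4 n_LqE (n_LqbE Uz) (n_LzzbE Uz) lin_V_basis // pnatr_eq0.
move: i1 i2 i3 i4; rewrite X; set k1 := _ + d * _; rewrite !(ipDr, ipZr).
have Q := n_qW Uz.
rewrite (n_LL Uz) (n_LhLh Uz) (n_LLh Uz) (ipC (Lh z) (L z)) (n_LLh Uz) (qq Uz) (n_qbq Uz).
rewrite (ipC (L z) (q z)) (ipC (L z) (qb z)) (ipC (Lh z) (q z)) (ipC (Lh z) (qb z)).
rewrite (inW_L Q) (inW_Lh Q) (inW_Lb Uz Q) (inW_Lhb Uz Q) (inW_ipW Uz Q Q) (inW_ipWb Uz Q Q).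
move=> i1 i2 i3 i4; have n2 : (2 : C) != 0 by rewrite pnatr_eq0.
have d0 : d = 0.
  transitivity (-2 * (k1 * 0 + d / 2 * -1 + (b - d * (w z)^*) * 0 + (c - d * w z) * 0)); first by field.
  by rewrite i1 mulr0.
have b0 : b = 0.
  transitivity (2 * (k1 * 0 + d / 2 * 0 + (b - d * (w z)^*) * (1 / 2) + (c - d * w z) * 0) ); first by rewrite d0; field.
  by rewrite i4 mulr0.
have c0 : c = 0.
  transitivity (2 * (k1 * 0 + d / 2 * 0 + (b - d * (w z)^*) * 0 + (c - d * w z) * (1 / 2))); first by rewrite d0; field.
  by rewrite i3 mulr0.
have a0 : a = 0.
  move: i2; rewrite /k1 b0 c0 d0 => i2; transitivity (- (- a)); first by rewrite opprK.
  apply/eqP; rewrite oppr_eq0; apply/eqP; rewrite -i2; ring.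
by apply: trmx_inj; rewrite vE a0 b0 c0 d0 /col4 !raddf0 !col_mx0.
Qed.

Lemma n_projE x v : in_V L z (x - v) -> in_Vperp L z v -> Vperp_proj L z x = v.
Proof. exact: (Vperp_projE n_gram_unit). Qed.

Lemma in_Vperp_W x : inWz z x -> ip x (qb z) = 0 -> in_Vperp L z x.
Proof.
move=> xW xq; apply/in_Vperp_iff'; rewrite (ipC (L z)) (ipC (Lh z)) (ipC (q z)) (ipC (qb z)).
by split=> //; [exact: inW_L|exact: inW_Lh|exact: (inW_ipW Uz xW (n_qW Uz))].
Qed.
End Point.
End Normalized.

Lemma conj_realN R n k (u l lh : 'cV[Cx R]_n) : mxconj l = l -> mxconj lh = lh ->
  let v := lh - (2 * k^*) *: u - (2 * k) *: mxconj u + (2 * k * k^*) *: l in mxconj v = v.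
Proof.
move=> rl rlh v; rewrite /v mxconjD mxconjB mxconjB !mxconjZ mxconjK rl rlh.
rewrite !rmorphM /= !conjCK rmorph_nat.
move: (mxconj u) => ub; by apply/matrixP => i j; rewrite !mxlinE; ring.
Qed.

(** * The Willmore equation and the adjoint transform for the canonical lift *)

Section Willmore.
Variables (R : realType) (m : nat).
Local Notation C := (Cx R).
Local Notation dim := (m.*2.+2).
Local Notation J := (mink R m.*2.+1).
Local Notation dZ := (mxwirt (- 'i)).
Local Notation dB := (mxwirt 'i).
Variables (U : set C) (L Lh : C -> 'cV[C]_dim) (V : C -> 'M[C]_(dim, m)).
Hypotheses (oU : open U) (ad : adapted U L Lh V).
Local Notation q := (isoW L Lh).
Local Notation qh := (isoW Lh L).
Local Notation w := (conn L Lh).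
Hypothesis qq : forall z, U z -> ip (q z) (mxconj (q z)) = 1 / 2.
Let ads : adapted U Lh L V. Proof. exact: adapted_sym. Qed.
Local Notation qb z := (mxconj (q z)).
Local Notation qhb z := (mxconj (qh z)).
Local Notation inWz z := (inW (L z) (Lh z) (V z)).

Let sq : mxsmooth U q. Proof. exact: (smooth_isoW oU ad). Qed.
Let sqh : mxsmooth U qh. Proof. exact: (smooth_isoW oU ads). Qed.
Let sw : smooth U w. Proof. exact: (smooth_conn oU ad). Qed.
Let swb : smooth U (fun z => (w z)^*). Proof. exact: (smooth_conj oU sw). Qed.
Let sqb : mxsmooth U (fun z => qb z). Proof. exact: (mxsmooth_conj oU sq). Qed.
Let qW z : U z -> inWz z (q z). Proof. exact: (inW_isoW oU ad). Qed.
Let qhW z : U z -> inWz z (qh z). Proof. exact: (inW_isoW' oU ad). Qed.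

(** Differentiating [L_z = q - w L] gives [L_zz = (q_z - w q) - (w_z - w ^ 2) L], from which [hopf]
    and [schwarzian] are read off. *)
Definition hopf z : 'cV[C]_dim := dZ q z - w z *: q z.
Definition schwarzian z : C := 2 * wirt (- 'i) w z - 2 * w z ^+ 2.
(** The part of [qh] normal to V: its component along [q] is removed, with a factor 2 because
    [<q, conj q> = 1/2]. By [nabla_hopf] it is twice the vector [D_zb kappa + conj w kappa]. *)
Definition theta z : 'cV[C]_dim := qh z - (2 * ip (qh z) (qb z)) *: q z.
Local Notation kappa := hopf.

Let sdq : mxsmooth U (dZ q). Proof. exact: (mxsmooth_wirt oU _ sq). Qed.
Let s_b : smooth U (fun z => 2 * ip (qh z) (qb z)).
Proof. exact: (smoothM oU (smooth_cst oU 2) (smooth_ip oU sqh sqb)). Qed.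
Lemma smooth_hopf : mxsmooth U kappa.
Proof. exact: (mxsmoothB oU sdq (mxsmoothZ oU sw sq)). Qed.
Lemma smooth_theta : mxsmooth U theta.
Proof. exact: (mxsmoothB oU sqh (mxsmoothZ oU s_b sq)). Qed.

Section Point.
Variable z : C.
Hypothesis Uz : U z.
Let a : adapted_at (L z) (Lh z) (V z). Proof. exact: (ad_at ad Uz). Qed.

Lemma hopf_inW : inWz z (kappa z).
Proof. exact: (inWB (inW_dZ oU ad sq qW Uz) (inWZ _ (qW Uz))). Qed.
Lemma theta_inW : inWz z (theta z).
Proof. exact: (inWB (qhW Uz) (inWZ _ (qW Uz))). Qed.

(** This is the z-derivative of [<q, conj q> = 1/2]; the subtracted term [w q] cancels the
    contribution [- w conj q] of the second factor. *)
Lemma ip_hopf_qb : ip (kappa z) (qb z) = 0.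
Proof.
have h := wirt_on_cst (- 'i) oU qq Uz.
rewrite (wirt_ip _ (mxsmooth_rdiff sq Uz) (mxsmooth_rdiff sqb Uz)) (n_dZqb oU ad qq Uz) in h.
have [qL qLh _] := qW Uz; have Q := qq Uz.
rewrite !(ipDr, ipZr) qL qLh Q !mulr0 !addr0 in h.
by rewrite /kappa ipDl ipNl ipZl Q -h; ring.
Qed.
Lemma ip_theta_qb : ip (theta z) (qb z) = 0.
Proof. by rewrite /theta ipDl ipNl ipZl (qq Uz); field. Qed.
Lemma hopf_Vperp : in_Vperp L z (kappa z).
Proof. exact: (in_Vperp_W oU ad qq Uz hopf_inW ip_hopf_qb). Qed.
Lemma theta_Vperp : in_Vperp L z (theta z).
Proof. exact: (in_Vperp_W oU ad qq Uz theta_inW ip_theta_qb). Qed.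

Let dZqE : dZ q z = kappa z + w z *: q z. Proof. by rewrite /kappa subrK. Qed.
Let dZLhE : dZ Lh z = theta z + (2 * ip (qh z) (qb z)) *: q z + w z *: Lh z.
Proof. by rewrite /theta subrK; exact: (n_LhqE oU ad Uz). Qed.

Lemma in_V_comb (x y b c : C) (v : 'cV[C]_dim) :
  v = x *: q z + y *: L z + b *: Lh z -> in_V L z v.
Proof.
move=> ->; apply: in_VD; last exact: (in_VZ _ (in_V_Lh oU ad qq Uz)).
by apply: in_VD; [exact: (in_VZ _ (in_V_q L Lh z))|exact: (in_VZ _ (in_V_L L z))].
Qed.

Lemma in_V_perp_add (u v : 'cV[C]_dim) : in_Vperp L z u -> in_Vperp L z v -> in_Vperp L z (u + v).
Proof. by rewrite /in_Vperp => hu hv; rewrite mulmxDr hu hv addr0. Qed.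
Lemma in_V_perpZ k (u : 'cV[C]_dim) : in_Vperp L z u -> in_Vperp L z (k *: u).
Proof. by rewrite /in_Vperp => hu; rewrite -scalemxAr hu scaler0. Qed.

(** After exchanging the derivatives, the structure equation of [dB q] is differentiated in z. Its
    term [Lh / 2] yields [theta / 2], its term [- conj w q] yields [- conj w kappa], and all the
    rest is a combination of [q], [L] and [Lh]. *)
Lemma dB_hopf_V : in_V L z (dB kappa z - (- (w z)^* *: kappa z + (1 / 2) *: theta z)).
Proof.
pose aa z := ip (q z) (qhb z).
have sa : smooth U aa := smooth_ip oU sq (mxsmooth_conj oU sqh).
have rL := ad_dY ad Uz; have rLh := ad_dYh ad Uz; have rq := mxsmooth_rdiff sq Uz.
have rwb := smooth_rdiff swb Uz; have ra := smooth_rdiff sa Uz; have rw := smooth_rdiff sw Uz.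
have e1 : dB (dZ q) z = dZ (fun z => - (w z)^* *: q z + aa z *: L z + (1 / 2) *: Lh z) z.
  rewrite (mxwirt_sym oU 'i (- 'i) sq Uz).
  exact: (mxwirt_eq oU _ (mxsmooth_wirt oU _ sq) (fun z Uz => n_dBq oU ad qq Uz) Uz).
have rnw : rdiff (fun z => - (w z)^*) z := smooth_rdiff (smoothN oU swb) Uz.
have d1 := mxrdiffZ rnw rq; have d2 := mxrdiffZ ra rL.
have d3 := mxrdiffZ (rdiff_cst (1 / 2) z) rLh.
have e2 : dB kappa z = dB (dZ q) z - (wirt 'i w z *: q z + w z *: dB q z).
  rewrite (mxwirtB 'i (mxsmooth_rdiff sdq Uz) (mxrdiffZ rw rq)) (mxwirtZ _ rw rq) //.
rewrite e2 e1 (mxwirtD _ (mxrdiffD d1 d2) d3) (mxwirtD _ d1 d2).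
rewrite (mxwirtZ _ rnw rq) (mxwirtZ _ ra rL) (mxwirtZ _ (rdiff_cst (1 / 2) z) rLh) wirt_cst.
rewrite (n_dBq oU ad qq Uz) -/(aa z) dZqE dZLhE (n_LqE L Lh z).
move: (wirt _ _ z) (wirt _ aa z) (wirt 'i w z) (ip (qh z) _) (aa z) => k1 k2 k3 k4 k5.
move: (kappa z) (theta z) (q z) (L z) (Lh z) (in_V_comb) => k t u l lh ic.
apply: (ic (k1 - (w z)^* * w z + k5 + k4 - k3 + w z * (w z)^*)
  (k2 - k5 * w z - w z * k5) 0 0).
by rewrite lin_dB_hopf // pnatr_eq0.
Qed.

Lemma nabla_hopf : nabla_zb L kappa z = - (w z)^* *: kappa z + (1 / 2) *: theta z.
Proof.
rewrite /nabla_zb mxdzbE; apply: (n_projE oU ad qq Uz dB_hopf_V).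
exact: (in_V_perp_add (in_V_perpZ _ hopf_Vperp) (in_V_perpZ _ theta_Vperp)).
Qed.

(** Exchanging [L] and [Lh] reverses the sign of [conn], whence conj w appears here with the sign
    opposite to the one for [hopf]. *)
Lemma dB_theta_V : in_V L z (dB theta z - (w z)^* *: theta z).
Proof.
have rq := mxsmooth_rdiff sq Uz; have rqh := mxsmooth_rdiff sqh Uz.
have rb := smooth_rdiff s_b Uz.
rewrite (mxwirtB 'i rqh (mxrdiffZ rb rq)) (mxwirtZ 'i rb rq) (n_dBq oU ad qq Uz) (n_dBqh oU ad Uz).
set k1 := wirt _ _ _; set k2 := ip (qh z) (qb z); set k3 := ip (qh z) (qhb z); set k4 := ip (q z) _.
move: (in_V_comb) => ic.
apply: (ic (- k1 + 2 * k2 * (w z)^* + 2 * k2 * (w z)^*) (k3 - 2 * k2 * k4) 0 0).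
by rewrite lin_dB_theta // pnatr_eq0.
Qed.
End Point.

Let D1 z := - (w z)^* *: kappa z + (1 / 2) *: theta z.
Let sD1 : mxsmooth U D1.
Proof.
exact: (mxsmoothD oU (mxsmoothZ oU (smoothN oU swb) smooth_hopf)
  (mxsmoothZ oU (smooth_cst oU (1 / 2)) smooth_theta)).
Qed.

(** In the second derivative the two terms in [theta] cancel, because conj w occurs with opposite
    signs for [hopf] and [theta]. The remaining factor of [hopf], the conjugate of [w ^ 2 - w_z], is
    minus half the conjugate of [schwarzian]. *)
Lemma hopf_willmore z : U z ->
  nabla_zb L (nabla_zb L kappa) z + ((schwarzian z)^* / 2) *: kappa z = 0.
Proof.
move=> Uz; have rk := mxsmooth_rdiff smooth_hopf Uz; have rt := mxsmooth_rdiff smooth_theta Uz.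
have rnw : rdiff (fun z => - (w z)^*) z := smooth_rdiff (smoothN oU swb) Uz.
(* On the open set [U] the first covariant derivative coincides with the smooth field [D1], which
   can therefore be differentiated in its place. *)
have e : mxdzb (nabla_zb L kappa) z = dB D1 z.
  rewrite mxdzbE; symmetry; apply: (mxwirt_eq oU 'i sD1 _ Uz) => u Uu.
  by rewrite nabla_hopf.
have e2 : wirt 'i (fun z => - (w z)^*) z = - (wirt (- 'i) w z)^*.
  have c1 := rdiff_cst (-1) z.
  rewrite (eq_wirt 'i z (fun u => esym (mulN1r ((w u)^*)))).
  rewrite (wirtM 'i c1 (smooth_rdiff swb Uz)) wirt_cst mul0r add0r mulN1r.
  by rewrite (wirt_conj 'i (smooth_rdiff sw Uz)) conjCi.
rewrite {1}/nabla_zb e.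
have -> : Vperp_proj L z (dB D1 z) = (- (wirt (- 'i) w z)^* + (w z)^* ^+ 2) *: kappa z.
  apply: (n_projE oU ad qq Uz); last exact: (in_V_perpZ _ (hopf_Vperp Uz)).
  rewrite (mxwirtD 'i (mxrdiffZ rnw rk) (mxrdiffZ (rdiff_cst _ _) rt)) (mxwirtZ 'i rnw rk).
  rewrite (mxwirtZ 'i (rdiff_cst _ _) rt) wirt_cst e2.
  have h1 := in_VZ (- (w z)^*) (dB_hopf_V Uz); have h2 := in_VZ (1 / 2) (dB_theta_V Uz).
  have := in_VD h1 h2; congr (in_V _ _ _).
  move: (dB _ z) (dB _ z) (kappa z) (theta z) (wirt _ _ _) => x y k t v.
  by apply/matrixP => i j; rewrite !mxlinE; field.
rewrite -scalerDl /schwarzian.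
have -> : - (wirt (- 'i) w z)^* + (w z)^* ^+ 2 +
   (2 * wirt (- 'i) w z - 2 * w z ^+ 2)^* / 2 = 0.
  by rewrite rmorphB !rmorphM /= rmorph_nat; field.
by rewrite scale0r.
Qed.

Lemma hopf_schwarzianP : hopf_schwarzian U L kappa schwarzian.
Proof.
move=> z Uz; split; first exact: hopf_Vperp.
have rL := ad_dY ad Uz; have rq := mxsmooth_rdiff sq Uz; have rw := smooth_rdiff sw Uz.
rewrite !mxdzE (eq_mxwirt _ _ (n_LqE L Lh)) (mxwirtB _ rq (mxrdiffZ rw rL)) (mxwirtZ _ rw rL).
rewrite (n_LqE L Lh z) /kappa /schwarzian.
move: (dZ _ z) (q z) (L z) (wirt _ _ _) (w z) => x u l v k.
by apply/matrixP => i j; rewrite !mxlinE; field.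
Qed.

Lemma canonical_liftP y : (forall z, U z -> sphere_point (L z) = y z) -> canonical_lift U y L.
Proof.
move=> hy; split; first exact: (ad_sY ad).
move=> z Uz; rewrite mxdzE mxdzbE; have Q := qW Uz; have a := ad_at ad Uz.
have e0 : ip (L z) (L z) = 0 := ad_YY ad Uz.
have e1 : ip (q z) (L z) = 0 by case: Q.
have e2 : ip (q z) (q z) = 0 := inW_ip a Q Q.
have e3 : ip (qb z) (L z) = 0 by rewrite -(ad_rY ad Uz) -ip_conj e1 rmorph0.
have e4 := qq Uz; split.
- split=> //; first by rewrite mxconj_real (ad_rY ad Uz).
  + exact: (ad_pos ad Uz).
  + exact: hy.
- by rewrite (n_LqE L Lh z) !(ipDl, ipDr, ipNl, ipNr, ipZl, ipZr) (ipC (L z)) e0 e1 e2; ring.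
- rewrite (n_LqbE oU ad Uz) (n_LqE L Lh z) !(ipDl, ipDr, ipNl, ipNr, ipZl, ipZr).
  by rewrite (ipC (L z) (qb z)) e0 e1 e3 e4; ring.
Qed.

Lemma willmore_liftP y : conformal_immersion U y ->
  (forall z, U z -> sphere_point (L z) = y z) -> willmore_surface U y.
Proof.
move=> ci hy; split=> //; exists L, kappa, schwarzian.
by split; [exact: canonical_liftP|exact: hopf_schwarzianP|exact: hopf_willmore].
Qed.

(** With mu equal to 2 w the Riccati equation is the formula for [schwarzian], and the vector zeta
    becomes [theta / 2], which is isotropic because it lies in W. *)
Lemma adjoint_liftP y yh : (forall z, U z -> sphere_point (L z) = y z) ->
  (forall z, U z -> sphere_point (Lh z) = yh z) -> adjoint_transform U y yh.
Proof.
(* [Nf] solves the formula of the transform for [Lh]. The requirement [<N, L_z> = 0] then reads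
   [w - mu / 2 = 0], which determines mu. *)
move=> hy hyh; pose mu z := 2 * w z.
pose Nf z := Lh z - (mu z)^* *: dZ L z - mu z *: dB L z - (`|mu z| ^+ 2 / 2) *: L z.
exists L, kappa, schwarzian, Nf, mu; split.
- exact: canonical_liftP.
- exact: hopf_schwarzianP.
- move=> z Uz; rewrite mxdzE mxdzbE; have Q := qW Uz; have a := ad_at ad Uz.
  have e0 : ip (L z) (L z) = 0 := ad_YY ad Uz.
  have e1 : ip (q z) (L z) = 0 by case: Q.
  have e1' : ip (q z) (Lh z) = 0 by case: Q.
  have e2 : ip (q z) (q z) = 0 := inW_ip a Q Q.
  have e3 : ip (qb z) (L z) = 0 by rewrite -(ad_rY ad Uz) -ip_conj e1 rmorph0.
  have e3' : ip (qb z) (Lh z) = 0 by rewrite -(ad_rYh ad Uz) -ip_conj e1' rmorph0.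
  have e4 := qq Uz; have e5 : ip (qb z) (qb z) = 0 by rewrite -ip_conj e2 rmorph0.
  have e6 : ip (Lh z) (Lh z) = 0 := ad_YhYh ad Uz.
  have e7 : ip (L z) (Lh z) = -1 := ad_YYh ad Uz.
  have muE : (mu z)^* = 2 * (w z)^* by rewrite /mu rmorphM /= rmorph_nat.
  have nE : `|mu z| ^+ 2 = 4 * w z * (w z)^* by rewrite normCK muE /mu; ring.
  have NE : Nf z = Lh z - (2 * (w z)^*) *: q z - (2 * w z) *: qb z + (2 * w z * (w z)^*) *: L z.
    rewrite /Nf muE nE (n_LqE L Lh z) (n_LqbE oU ad Uz) /mu.
    by rewrite lin_N_section // pnatr_eq0.
  have rN : mxconj (Nf z) = Nf z.
    by rewrite NE; exact: (conj_realN _ _ (ad_rY ad Uz) (ad_rYh ad Uz)).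
  split.
  + by rewrite mxconj_real rN.
  + rewrite NE; apply: in_VD; last exact: (in_VZ _ (in_V_L L z)).
    apply: in_VB; last exact: (in_VZ _ (in_V_qb oU ad Uz)).
    apply: in_VB; last exact: (in_VZ _ (in_V_q L Lh z)).
    exact: (in_V_Lh oU ad qq Uz).
  + rewrite NE (n_LqbE oU ad Uz) (n_LqE L Lh z).
    move: e0 e1 e1' e2 e3 e3' e4 e5 e6 e7.
    move: (q z) (qb z) (L z) (Lh z) => u ub l lh e0 e1 e1' e2 e3 e3' e4 e5 e6 e7.
    rewrite !(ipDl, ipDr, ipNl, ipNr, ipZl, ipZr) !(ipC lh) !(ipC l u) !(ipC l ub) !(ipC ub u).
    by rewrite e0 e1 e1' e2 e3 e3' e4 e5 e7; split; field.
  + rewrite NE; move: e0 e1 e1' e2 e3 e3' e4 e5 e6 e7.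
    move: (q z) (qb z) (L z) (Lh z) => u ub l lh e0 e1 e1' e2 e3 e3' e4 e5 e6 e7.
    rewrite !(ipDl, ipDr, ipNl, ipNr, ipZl, ipZr) e6 !(ipC lh) !(ipC l u) !(ipC l ub) !(ipC ub u).
    by rewrite e0 e1 e1' e2 e3 e3' e4 e5 e7; field.
  + rewrite NE; move: e0 e1 e1' e2 e3 e3' e4 e5 e6 e7.
    move: (q z) (qb z) (L z) (Lh z) => u ub l lh e0 e1 e1' e2 e3 e3' e4 e5 e6 e7.
    rewrite !(ipDl, ipNl, ipZl) (ipC lh).
    by rewrite e0 e1 e3 e7; field.
- exact: (smoothM oU (smooth_cst oU 2) sw).
- move=> z Uz; have muE : (mu z)^* = 2 * (w z)^* by rewrite /mu rmorphM /= rmorph_nat.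
  rewrite /= mxdzE mxdzbE; split.
  + have -> : Nf z + (mu z)^* *: dZ L z + mu z *: dB L z + (`|mu z| ^+ 2 / 2) *: L z = Lh z.
      rewrite /Nf; move: (_ *: dZ L z) (_ *: dB L z) (_ *: L z) (Lh z) => a b c d.
      by apply/matrixP => i j; rewrite !mxlinE; ring.
    split; first by rewrite mxconj_real (ad_rYh ad Uz).
    * exact: (ad_YhYh ad Uz).
    * exact: (ad_pos ads Uz).
    * exact: hyh.
  + rewrite dzE (wirtM _ (rdiff_cst 2 z) (smooth_rdiff sw Uz)) wirt_cst /schwarzian /mu; field; exact: isT.
  + have -> : nabla_zb L kappa z + ((mu z)^* / 2) *: kappa z = (1 / 2) *: theta z.
      rewrite (nabla_hopf Uz) muE; move: (kappa z) (theta z) => k t.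
      by apply/matrixP => i j; rewrite !mxlinE; field.
    by rewrite ipZl ipZr (inW_ip (ad_at ad Uz) (theta_inW Uz) (theta_inW Uz)) !mulr0.
Qed.

Lemma iter_dZ_L j : exists (x : C -> 'cV[C]_dim) (c : C -> C),
  [/\ mxsmooth U x, smooth U c & forall z, U z -> inWz z (x z) /\
    iter j.+1 (@mxdz R dim 1) L z = x z + c z *: L z].
Proof.
elim: j => [|j [x [c [sx sc h]]]].
  exists q, (fun z => - w z); split; [exact: sq|exact: (smoothN oU sw)|move=> z Uz].
  by split; [exact: qW|rewrite /= mxdzE (n_LqE L Lh z) scaleNr].
have xW z (Uz : U z) : inWz z (x z) := (h z Uz).1.
exists (fun z => dZ x z + c z *: q z), (fun z => wirt (- 'i) c z - c z * w z); split.
- exact: (mxsmoothD oU (mxsmooth_wirt oU _ sx) (mxsmoothZ oU sc sq)).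
- exact: (smoothB oU (smooth_wirt _ oU sc) (smoothM oU sc sw)).
- move=> z Uz; split; first exact: (inWD (inW_dZ oU ad sx xW Uz) (inWZ _ (qW Uz))).
  have rx := mxsmooth_rdiff sx Uz; have rc := smooth_rdiff sc Uz; have rL := ad_dY ad Uz.
  have sxc := mxsmoothD oU sx (mxsmoothZ oU sc (ad_sY ad)).
  rewrite iterS mxdzE -(mxwirt_eq oU _ sxc (fun z Uz => esym (h z Uz).2) Uz).
  rewrite (mxwirtD _ rx (mxrdiffZ rc rL)) (mxwirtZ _ rc rL) (n_LqE L Lh z).
  move: (dZ x z) (q z) (L z) => a b l.
  by apply/matrixP => i k; rewrite !mxlinE; ring.
Qed.

Lemma totally_isotropicP : totally_isotropic U L.
Proof.
move=> z Uz [//|j] [//|l] _ _.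
have [x [c [_ _ /(_ z Uz) [xW ->]]]] := iter_dZ_L j.
have [y [d [_ _ /(_ z Uz) [yW ->]]]] := iter_dZ_L l.
rewrite !(ipDl, ipDr, ipZl, ipZr) (inW_ip (ad_at ad Uz) xW yW) (ad_YY ad Uz).
by case: xW => -> _ _; rewrite (ipC (L z)); case: yW => -> _ _; rewrite !mulr0 !addr0.
Qed.
End Willmore.

(** * Isotropic frames *)

Section FramePoint.
Variables (R : realType) (m : nat).
Local Notation C := (Cx R).
Local Notation dim := (m.*2.+2).
Local Notation J := (mink R m.*2.+1).
Implicit Types (x : 'cV[C]_dim) (e : nat -> 'cV[C]_dim).

Definition orth j e : Prop := forall k l, (1 <= k <= j)%N -> (1 <= l <= j)%N ->
  ip (e k) (mxconj (e l)) = if k == l then 2 else 0.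

Lemma orth_sum j e a (c : nat -> C) l : orth j e -> (0 < a)%N -> (1 <= l <= j)%N ->
  ip (\sum_(a <= k < j.+1) c k *: e k) (mxconj (e l)) = if (a <= l)%N then 2 * c l else 0.
Proof.
move=> oe a0 hl; rewrite ip_suml.
transitivity (\sum_(a <= k < j.+1) if k == l then 2 * c l else 0).
  apply: eq_big_nat => k /andP [ak kj].
  rewrite ipZl oe ?(leq_trans a0 ak) //; case: eqP => [->|_]; first by rewrite mulrC.
  by rewrite mulr0.
by rewrite -big_mkcond big_nat1_eq; case/andP: hl => _; rewrite ltnS => ->; rewrite andbT.
Qed.

Definition emat j e : 'M[C]_(dim, j) := \matrix_(i < dim, k < j) e k.+1 i ord0.
Lemma col_emat j e (k : 'I_j) : col k (emat j e) = e k.+1.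
Proof. by apply/matrixP => i l; rewrite ord1 [LHS]mxE [LHS]mxE. Qed.

Lemma emat_ipP e x : (forall k, (1 <= k <= m)%N -> ip (e k) x = 0) -> (emat m e)^T *m J *m x = 0.
Proof.
move=> h; apply/matrixP => i l; rewrite ord1 [RHS]mxE ipE col_emat; apply: h.
exact: (ltn_ord i).
Qed.

Variables (Y Yh : 'cV[C]_dim) (V : 'M[C]_(dim, m)).
Hypothesis ad : adapted_at Y Yh V.
Local Notation Vb := (mxconj V).

Definition frame_at j e := (forall k, (1 <= k <= j)%N -> inW Y Yh V (e k)) /\ orth j e.

Lemma inW_proj x : inW Y Yh V x -> Vb *m (invmx (V^T *m J *m Vb) *m (V^T *m J *m x)) = x.
Proof.
move=> xW; have [d ->] := inW_span ad xW.
by rewrite (mulmxA (V^T *m J)) (mulKmx (gramVb_unit ad)).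
Qed.

Lemma inW_Vcol i : inW Y Yh V (col i Vb).
Proof. by rewrite colE; exact: (inW_Vb ad). Qed.

(** If every column of [Vb] equalled its projection, [Vb] would factor through [j] columns, against
    its rank [m]. *)
Lemma fresh j e : (j < m)%N -> frame_at j e ->
  exists i, col i Vb - \sum_(1 <= k < j.+1) (ip (col i Vb) (mxconj (e k)) / 2) *: e k != 0.
Proof.
move=> jm [eW oe]; apply/existsP; apply: contraT; rewrite negb_exists => /forallP h.
pose B : 'M[C]_(j, m) := \matrix_(k < j, i < m) (ip (col i Vb) (mxconj (e k.+1)) / 2).
have E : Vb = emat j e *m B.
  apply/matrixP => a i; have := h i; rewrite negbK subr_eq0 => /eqP ci.
  transitivity (col i Vb a ord0); first by rewrite !mxE.
  rewrite ci big_add1 big_mkord summxE mxE; apply: eq_bigr => k _.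
  by rewrite !mxE mulrC.
have fr : row_free Vb^T.
  apply: inj_row_free => v hv; apply: trmx_inj; rewrite trmx0.
  have V0 : Vb *m v^T = 0 by rewrite -[Vb]trmxK -trmx_mul hv trmx0.
  case: ad => _ [_ _ _ Vf _]; have := Vf (mxconj v^T).
  rewrite -(mxconjK V) -mxconjM V0 mxconj0 => /(_ erefl) vc.
  by rewrite -[v^T]mxconjK vc mxconj0.
have := fr; rewrite /row_free mxrank_tr E => /eqP rk.
have := leq_trans (mxrankM_maxl (emat j e) B) (rank_leq_col _).
by rewrite rk leqNgt jm.
Qed.

(** The frame is [Vb *m A], and its hermitian Gram matrix [2%:M] has [A] as a right factor; so [A]
    is invertible and orthogonality passes from the frame to [Vb]. *)
Lemma frame_dual e x : frame_at m e -> (forall k, (1 <= k <= m)%N -> ip (e k) x = 0) ->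
  Vb^T *m J *m x = 0.
Proof.
move=> [eW oe] h; pose A := invmx (V^T *m J *m Vb) *m (V^T *m J *m emat m e).
have E : emat m e = Vb *m A.
  apply/matrixP => i k; have := inW_proj (eW k.+1 (ltn_ord k)).
  have -> : Vb *m (invmx (V^T *m J *m Vb) *m (V^T *m J *m e k.+1)) = col k (Vb *m A).
    by rewrite -col_emat /A !colE !mulmxA.
  by move=> /(congr1 (fun M : 'cV_dim => M i ord0)); rewrite [LHS]mxE => ->; rewrite mxE.
have G : (mxconj (emat m e))^T *m J *m emat m e = 2%:M.
  apply/matrixP => k l; rewrite [RHS]mxE.
  have -> : ((mxconj (emat m e))^T *m J *m emat m e) k l = ip (mxconj (e k.+1)) (e l.+1).
    have cc : col k (mxconj (emat m e)) = mxconj (e k.+1).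
      by rewrite -col_emat; apply/matrixP => a b; rewrite [LHS]mxE !mxconjE [in RHS]mxE.
    rewrite -cc -col_emat -ipE !colE [in RHS]mulmxA -[in RHS]colE [RHS]mxE.
    by [].
  rewrite ipC oe ?ltn_ord // eqSS eq_sym; case: (k =P l) => [->|]; first by rewrite eqxx.
  by move=> /eqP; rewrite -val_eqE => /negbTE ->.
have uA : A \in unitmx.
  have : (2^-1 *: (mxconj A)^T *m (V^T *m J *m Vb)) *m A = 1%:M.
    have -> : V^T = (mxconj Vb)^T by rewrite mxconjK.
    rewrite E mxconjM trmx_mul !mulmxA in G; rewrite -!scalemxAl !mulmxA G.
    by rewrite scale_scalar_mx mulVf // pnatr_eq0.
  by case/mulmx1_unit.
have := emat_ipP h; rewrite E trmx_mul -!mulmxA => h0.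
have uA' : A^T \in unitmx by rewrite unitmx_tr.
by rewrite -[LHS](mulKmx uA') h0 mulmx0.
Qed.

Lemma frame_eq0 e x : frame_at m e -> ip x Y = 0 -> ip x Yh = 0 ->
  (forall k, (1 <= k <= m)%N -> ip (e k) x = 0) ->
  (forall k, (1 <= k <= m)%N -> ip (mxconj (e k)) x = 0) -> x = 0.
Proof.
move=> fe xY xYh h1 h2; apply: (ad_complete ad xY xYh); last exact: (frame_dual fe h1).
rewrite -[x]mxconjK -(conj_VbJ V) (frame_dual fe) ?mxconj0 // => k hk.
by rewrite -[e k]mxconjK -ip_conj h2 // rmorph0.
Qed.

Lemma inW_sum e j a (c : nat -> C) : (forall k, (1 <= k <= j)%N -> inW Y Yh V (e k)) ->
  (0 < a)%N -> inW Y Yh V (\sum_(a <= k < j.+1) c k *: e k).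
Proof.
move=> eW a0; rewrite big_nat_cond; elim/big_ind: _ => [|x y|k /andP [/andP [ak kj] _]].
- exact: inW0.
- exact: inWD.
- by apply: inWZ; apply: eW; rewrite (leq_trans a0 ak).
Qed.

Lemma frame_expand e x : frame_at m e -> inW Y Yh V x ->
  x = \sum_(1 <= k < m.+1) (ip x (mxconj (e k)) / 2) *: e k.
Proof.
move=> fe xW; set y := \sum_(1 <= k < m.+1) _.
have yW : inW Y Yh V y by apply: inW_sum => //; case: fe.
have [a b c] := inWB xW yW.
apply/eqP; rewrite -subr_eq0; apply/eqP; apply: (frame_eq0 fe a b) => k hk.
  by rewrite (inW_ip ad (fe.1 k hk) (inWB xW yW)).
rewrite ipC ipDl ipNl (orth_sum _ fe.2) //; case/andP: (hk) => -> _.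
by rewrite mulrC divfK ?subrr // pnatr_eq0.
Qed.
End FramePoint.

Section Frames.
Variables (R : realType) (m : nat).
Local Notation C := (Cx R).
Local Notation dim := (m.*2.+2).
Local Notation J := (mink R m.*2.+1).
Local Notation dZ := (mxwirt (- 'i)).
Local Notation dB := (mxwirt 'i).
Variables (U : set C) (L Lh : C -> 'cV[C]_dim) (V : C -> 'M[C]_(dim, m)).
Hypotheses (oU : open U) (ad : adapted U L Lh V).
Local Notation q := (isoW L Lh).
Hypothesis qq : forall z, U z -> ip (q z) (mxconj (q z)) = 1 / 2.
Local Notation inWz z := (inW (L z) (Lh z) (V z)).
Local Notation frz z := (frame_at (L z) (Lh z) (V z)).

Lemma CsqrtK (f : C -> C) z : 0 < f z -> Csqrt f z ^+ 2 = f z /\ 0 < Csqrt f z.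
Proof.
move=> /posC [t t0 e]; rewrite /Csqrt e /= -rmorphXn /= sqr_sqrtr ?ltW //; split=> //.
by rewrite -[0]/((0%:C)%C) ltcRE sqrtr_gt0.
Qed.

Lemma ip_pos z (r : 'cV[C]_dim) : U z -> inWz z r -> (0 < ip r (mxconj r)) = (r != 0).
Proof.
move=> Uz [a b _]; have := ad_ge0 (ad_at ad Uz) a b; rewrite (ipC (mxconj r)) => ge.
rewrite lt_def ge andbT; congr (~~ _); apply/eqP/eqP => [h|->]; last by rewrite ip0l.
by apply: (ad_eq0 (ad_at ad Uz) a b); rewrite ipC.
Qed.

Lemma unit_section O (r : C -> 'cV[C]_dim) z1 : open O -> O `<=` U -> mxsmooth O r ->
  (forall z, O z -> inWz z (r z)) -> O z1 -> r z1 != 0 ->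
  exists O' e, [/\ open O', O' z1, O' `<=` O, mxsmooth O' e & forall z, O' z ->
    [/\ inWz z (e z), ip (e z) (mxconj (e z)) = 2 & exists a b, r z = a *: e z /\ e z = b *: r z]].
Proof.
move=> oO OU sr rW O1 r1; pose f z := ip (r z) (mxconj (r z)).
have sf : smooth O f := smooth_ip oO sr (mxsmooth_conj oO sr).
have fE z : O z -> (0 < f z) = (r z != 0) by move=> Oz; exact: (ip_pos (OU z Oz) (rW z Oz)).
pose O' := O `&` [set z | r z != 0].
have oO' : open O'.
  rewrite openE => z [Oz rz]; have f0 : f z != 0 by apply: lt0r_neq0; rewrite fE.
  have nf : \forall w \near z, f w != 0 by apply: (cvgr_neq0 _ (smooth_cont sf Oz) f0).
  apply: filterS (filterI (near_open oO Oz) nf) => w [Ow fw]; split=> //=.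
  by apply: contraNneq fw => h; rewrite /f h ip0l.
have O'O : O' `<=` O by move=> z [].
(* Halved because the members of the frame have hermitian square 2, not 1. *)
pose g z := f z / 2.
have g0 z : O' z -> 0 < g z by move=> [Oz rz]; rewrite divr_gt0 ?ltr0n ?fE.
have sg : smooth O' g := smoothM oO' (smooth_sub O'O sf) (smooth_cst oO' _).
have k0 z (h : O' z) : Csqrt g z != 0 := lt0r_neq0 (CsqrtK (g0 z h)).2.
exists O', (fun z => (Csqrt g z)^-1 *: r z); split.
- exact: oO'.
- by split.
- exact: O'O.
- exact: (mxsmoothZ oO' (smoothV oO' k0 (smooth_sqrt oO' g0 sg)) (mxsmooth_sub O'O sr)).
- move=> z hz; have Oz := O'O z hz; have k := k0 z hz; have [k2 kp] := CsqrtK (g0 z hz).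
  have kr : ((Csqrt g z)^-1)^* = (Csqrt g z)^-1.
    by apply: conj_Creal; apply: gtr0_real; rewrite invr_gt0.
  split.
  + exact: (inWZ _ (rW z Oz)).
  + rewrite mxconjZ kr ipZl ipZr -/(f z) mulrA -expr2 exprVn k2 /g.
    have f0 : f z != 0 by apply: lt0r_neq0; rewrite fE //; case: hz.
    move: (f z) f0 => x x0; field; exact: x0.
  + by exists (Csqrt g z), (Csqrt g z)^-1; rewrite scalerA mulfV // scale1r.
Qed.

Definition partial_frame O j E : Prop :=
  [/\ open O, O `<=` U, forall k, (1 <= k <= j)%N -> mxsmooth O (E k),
    forall z, O z -> frz z j (fun k => E k z) &
    forall z, O z -> forall k, (1 <= k <= j)%N -> exists (a b : C) (c : nat -> C),
      iter k (@mxdz R dim 1) L z = a *: E k z + b *: L z + \sum_(1 <= i < k) c i *: E i z].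

Lemma smooth_proj O j E (x : C -> 'cV[C]_dim) : open O ->
  (forall k, (1 <= k <= j)%N -> mxsmooth O (E k)) -> mxsmooth O x ->
  mxsmooth O (fun z => x z - \sum_(1 <= k < j.+1) (ip (x z) (mxconj (E k z)) / 2) *: E k z).
Proof.
move=> oO sE sx; apply: (mxsmoothB oO sx) => a b.
apply: (smooth_ext oO (f := fun z => \sum_(1 <= k < j.+1) ip (x z) (mxconj (E k z)) / 2 * E k z a b)).
  by move=> z _; rewrite summxE; apply: eq_bigr => k _; rewrite mxE.
have -> : (fun z => \sum_(1 <= k < j.+1) ip (x z) (mxconj (E k z)) / 2 * E k z a b) =
  (fun z => \sum_(k < j) ip (x z) (mxconj (E k.+1 z)) / 2 * E k.+1 z a b).
  by apply/funext => z; rewrite big_add1 big_mkord.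
apply: (smooth_sum oO) => k _; have sk := sE k.+1 (ltn_ord k).
exact: (smoothM oO (smoothM oO (smooth_ip oO sx (mxsmooth_conj oO sk)) (smooth_cst oO _)) (sk a b)).
Qed.

(** A Gram-Schmidt step for the derivative of order [j.+1]. If its residual is nonzero somewhere,
    the normalized residual is the new member on a smaller open set. Otherwise the residual vanishes
    on all of [O], the derivative needs no new member, and a column of conj V outside the span of
    the previous ones fills the place. *)
Lemma extend_frame O j E : (j < m)%N -> partial_frame O j E -> O !=set0 ->
  exists O' E', [/\ partial_frame O' j.+1 E', O' !=set0 & O' `<=` O].
Proof.
move=> jm [oO OU sE fE dE] [z0 O0].
have [x [c [sx _ xE]]] := iter_dZ_L oU ad j.
pose pr (y : C -> 'cV[C]_dim) z := \sum_(1 <= k < j.+1) (ip (y z) (mxconj (E k z)) / 2) *: E k z.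
have prW y z : O z -> inWz z (y z) -> inWz z (y z - pr y z).
  move=> Oz yW; apply: inWB => //; apply: inW_sum => //; exact: (fE z Oz).1.
have orthE y z l : O z -> (1 <= l <= j)%N -> ip (y z - pr y z) (mxconj (E l z)) = 0.
  move=> Oz hl; rewrite ipDl ipNl (orth_sum _ (fE z Oz).2) //; case/andP: (hl) => -> _.
  by rewrite mulrC divfK ?subrr // pnatr_eq0.
have [y [z1 [sy yW O1 y1 yx]]] : exists y z1, [/\ mxsmooth O y, forall z, O z -> inWz z (y z), O z1,
    y z1 - pr y z1 != 0 & y = x \/ forall z, O z -> x z - pr x z = 0].
  have [[z1 [O1 h1]]|h] := pselect (exists z, O z /\ x z - pr x z != 0).
    exists x, z1; split; [exact: (mxsmooth_sub OU sx)| |exact: O1|exact: h1|by left].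
    by move=> z Oz; case: (xE z (OU z Oz)).
  have [i hi] := fresh (ad_at ad (OU z0 O0)) jm (fE z0 O0).
  exists (fun z => col i (mxconj (V z))), z0; split.
  - exact: (mxsmooth_col oO i (mxsmooth_conj oO (mxsmooth_sub OU (ad_sV ad)))).
  - by move=> z Oz; exact: (inW_Vcol (ad_at ad (OU z Oz))).
  - exact: O0.
  - exact: hi.
  - right=> z Oz; apply/eqP; apply: contraT => hz; case: h; by exists z.
have sr : mxsmooth O (fun z => y z - pr y z) := smooth_proj oO sE sy.
have rW z (Oz : O z) : inWz z (y z - pr y z) := prW y z Oz (yW z Oz).
have [O' [e [oO' O'1 O'O se he]]] := unit_section oO OU sr rW O1 y1.
have ipe z l : O' z -> (1 <= l <= j)%N -> ip (e z) (mxconj (E l z)) = 0.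
  move=> hz hl; have Oz := O'O z hz; have [_ _ [a [b [_ ->]]]] := he z hz.
  by rewrite ipZl orthE // mulr0.
have le_neq k : (k <= j.+1)%N -> k <> j.+1 -> (k <= j)%N.
  by move=> h /eqP h'; rewrite -ltnS ltn_neqAle h' h.
exists O', (fun k => if k == j.+1 then e else E k); split; last exact: O'O; last by exists z1.
split.
- exact: oO'.
- by move=> z /O'O /OU.
- move=> k /andP [k1 kj]; case: (k =P j.+1) => [_|/(le_neq _ kj) kj']; first exact: se.
  by apply: (mxsmooth_sub O'O); apply: sE; rewrite k1.
- move=> z hz; have Oz := O'O z hz; have [eW e2 _] := he z hz; have [EW oE] := fE z Oz; split.
    move=> k /andP [k1 kj]; case: (k =P j.+1) => [_|/(le_neq _ kj) kj']; first exact: eW.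
    by apply: EW; rewrite k1.
  move=> k l /andP [k1 kj] /andP [l1 lj].
  case: (k =P j.+1) => [->|nk]; case: (l =P j.+1) => [->|nl].
  + by rewrite eqxx; exact: e2.
  + rewrite (ipe z l hz) ?l1 ?le_neq //; case: eqP => // h; by case: nl.
  + rewrite -[E k z]mxconjK -ip_conj ipC (ipe z k hz) ?k1 ?le_neq // rmorph0.
    by case: eqP.
  + by apply: oE; rewrite ?k1 ?l1 ?le_neq.
- move=> z hz k /andP [k1 kj]; have Oz := O'O z hz.
  have sumE (c' : nat -> C) : \sum_(1 <= i < k) c' i *: (if i == j.+1 then e else E i) z =
      \sum_(1 <= i < k) c' i *: E i z.
    apply: eq_big_nat => i /andP [_ ik]; case: eqP => // h.
    by move: (leq_trans ik kj); rewrite h ltnn.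
  case: (k =P j.+1) => [ek|/(le_neq _ kj) kj']; last first.
    have [|a [b [c' h]]] := dE z Oz k; first by rewrite k1.
    by exists a, b, c'; rewrite sumE.
  have [xW xz] := xE z (OU z Oz).
  pose c' i := ip (x z) (mxconj (E i z)) / 2.
  have [a xa] : exists a, x z - pr x z = a *: e z.
    case: yx => [<-|h]; last by exists 0; rewrite scale0r h.
    by have [_ _ [a [b [h _]]]] := he z hz; exists a.
  exists a, (c z), c'; rewrite sumE ek xz -xa -/(pr x z).
  by rewrite addrAC subrK.
Qed.

(** Each of the [m] steps shrinks the open set and may lose a prescribed point; nonemptiness
    survives, and this is what density requires. *)
Lemma frame_exists O : open O -> O `<=` U -> O !=set0 ->
  exists O' E, [/\ partial_frame O' m E, O' !=set0 & O' `<=` O].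
Proof.
move=> oO OU O0; suff H j : (j <= m)%N -> exists O' E, [/\ partial_frame O' j E, O' !=set0 & O' `<=` O].
  exact: H.
elim: j => [_|j IH jm].
  exists O, (fun _ _ => 0); split; [|exact: O0|by move=> z].
  have no k : (1 <= k <= 0)%N -> False by case: k.
  split; [exact: oO|exact: OU|by move=> k /no|move=> z _; split|by move=> z _ k /no].
    by move=> k /no.
  by move=> k l /no.
have [O1 [E [fE n1 s1]]] := IH (ltnW jm).
have [O2 [E2 [f2 n2 s2]]] := extend_frame jm fE n1.
by exists O2, E2; split; [exact: f2|exact: n2|exact: (subset_trans s2 s1)].
Qed.

Section FullFrame.
Variables (O : set C) (E : nat -> C -> 'cV[C]_dim).
Hypotheses (m0 : (0 < m)%N) (fE : partial_frame O m E).
Let OU : O `<=` U. Proof. by case: fE. Qed.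
Let frE z : O z -> frz z m (fun k => E k z). Proof. by case: fE => _ _ _ h _; exact: h. Qed.

(** Pairing with [Lh] shows that the multiples of [L] cancel, and the normalization of [q] excludes
    a zero factor. Hence [E 1] spans the tangential direction and the other members are normal. *)
Lemma frame_q z : O z -> exists2 a : C, a != 0 & q z = a *: E 1%N z.
Proof.
move=> Oz; have Uz := OU Oz; case: fE => _ _ _ _ /(_ z Oz 1%N); rewrite m0 => /(_ isT) [a [b [c]]].
rewrite big_geq // addr0 /= mxdzE (n_LqE L Lh z) => h.
have Q := n_qW oU ad Uz; have [EW _] := frE Oz; have E1 := EW 1%N m0.
have qE : q z = a *: E 1%N z + (b + conn L Lh z) *: L z.
  by rewrite scalerDl addrA -h subrK.
have b0 : b + conn L Lh z = 0.
  have := congr1 (fun x => ip x (Lh z)) qE; rewrite /= ipDl !ipZl (inW_Lh Q) (inW_Lh E1).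
  by rewrite (ad_YYh ad Uz) mulr0 add0r mulrN1 => /esym /eqP; rewrite oppr_eq0 => /eqP.
move: qE; rewrite b0 scale0r addr0 => qE; exists a => //; apply: contraPneq (qq Uz) => a0.
by rewrite qE a0 scale0r ip0l; apply/eqP; rewrite eq_sym mulf_neq0 ?oner_neq0 ?invr_eq0 ?pnatr_eq0.
Qed.

Lemma frame_perp_q z k : O z -> (2 <= k <= m)%N -> ip (E k z) (mxconj (q z)) = 0.
Proof.
move=> Oz /andP [k2 km]; have [a _ ->] := frame_q Oz; rewrite mxconjZ ipZr (frE Oz).2 //.
- by case: eqP k2 => [->|_ _]; rewrite ?ltnn // mulr0.
- by rewrite (ltnW k2).
Qed.

Lemma frame_Vperp z k : O z -> (2 <= k <= m)%N ->
  in_Vperp L z (E k z) /\ in_Vperp L z (mxconj (E k z)).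
Proof.
move=> Oz hk; have Uz := OU Oz; have h0 := frame_perp_q Oz hk; case/andP: (hk) => k2 km.
have EW : inWz z (E k z) by apply: (frE Oz).1; rewrite (ltnW k2).
split; first exact: (in_Vperp_W oU ad qq Uz EW h0).
have Q := n_qW oU ad Uz.
apply/(in_Vperp_iff' oU ad qq Uz); rewrite (ipC (L z)) (ipC (Lh z)) (ipC (q z)) (ipC (mxconj (q z))).
rewrite (inW_Lb ad Uz EW) (inW_Lhb ad Uz EW) (inW_ipWb ad Uz EW Q); split=> //.
by rewrite -[q z]mxconjK -ip_conj h0 rmorph0.
Qed.

Lemma frame_isotropic : isotropic_frame m O L E.
Proof.
split; first by case: fE.
move=> z Oz; have Uz := OU Oz; have [EW oE] := frE Oz; split.
- by move=> j l hj hl; split; [exact: (inW_ip (ad_at ad Uz) (EW j hj) (EW l hl))|exact: oE].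
- by case: fE => _ _ _ _ h; exact: h.
- by move=> j; exact: frame_Vperp.
- move=> x /(in_Vperp_iff' oU ad qq Uz) [xL xLh xq xqb].
  pose c k := ip x (mxconj (E k z)) / 2; pose d k := ip x (E k z) / 2; exists c, d.
  apply/eqP; rewrite -subr_eq0; apply/eqP; rewrite big_split /=.
  have SW : inWz z (\sum_(2 <= k < m.+1) c k *: E k z) by exact: inW_sum.
  pose T := \sum_(2 <= k < m.+1) (d k)^* *: E k z.
  have TW : inWz z T by exact: inW_sum.
  have TE : \sum_(2 <= k < m.+1) d k *: mxconj (E k z) = mxconj T.
    rewrite /T; elim/big_rec2: _ => [|k y1 y2 _ ->]; first by rewrite mxconj0.
    by rewrite mxconjD mxconjZ conjCK.
  rewrite TE; have [a a0 qE] := frame_q Oz.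
  have x1 : ip x (E 1%N z) = 0.
    by move: xq; rewrite qE ipZl ipC => /eqP; rewrite mulf_eq0 (negbTE a0) => /eqP.
  have x1b : ip x (mxconj (E 1%N z)) = 0.
    move: xqb; rewrite qE mxconjZ ipZl ipC => /eqP.
    by rewrite mulf_eq0 conjC_eq0 (negbTE a0) => /eqP.
  have n2 : (2 : C) != 0 by rewrite pnatr_eq0.
  (* The difference is tested against the whole frame. At index 1 the sums, which start at 2,
     contribute nothing, and [x] does not either, being normal to [q] and its conjugate. *)
  apply: (frame_eq0 (ad_at ad Uz) (frE Oz)).
  + by rewrite ipDl ipNl ipDl (ipC x) xL (inW_L SW) (inW_Lb ad Uz TW) addr0 subrr.
  + by rewrite ipDl ipNl ipDl (ipC x) xLh (inW_Lh SW) (inW_Lhb ad Uz TW) addr0 subrr.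
  + move=> k hk; rewrite ipC ipDl ipNl ipDl (inW_ip (ad_at ad Uz) SW (EW k hk)) add0r.
    rewrite -[E k z]mxconjK -ip_conj (orth_sum _ oE) // mxconjK; case: ltnP => k2.
      by rewrite rmorphM /= conjCK rmorph_nat /d mulrC divfK ?subrr.
    have -> : k = 1%N by case/andP: hk => k1 _; apply/eqP; rewrite eqn_leq k1 andbT -ltnS.
    by rewrite x1 rmorph0 subr0.
  + move=> k hk; rewrite ipC ipDl ipNl ipDl (inW_ipWb ad Uz TW (EW k hk)) addr0.
    rewrite (orth_sum _ oE) //; case: ltnP => k2.
      by rewrite /c mulrC divfK ?subrr.
    have -> : k = 1%N by case/andP: hk => k1 _; apply/eqP; rewrite eqn_leq k1 andbT -ltnS.
    by rewrite x1b subr0.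
- move=> c d; rewrite big_split /= => h k /andP [k2 km].
  have hk : (1 <= k <= m)%N by rewrite (ltnW k2).
  have SW : inWz z (\sum_(2 <= k < m.+1) c k *: E k z) by exact: inW_sum.
  pose T := \sum_(2 <= k < m.+1) (d k)^* *: E k z.
  have TW : inWz z T by exact: inW_sum.
  have TE : \sum_(2 <= k < m.+1) d k *: mxconj (E k z) = mxconj T.
    rewrite /T; elim/big_rec2: _ => [|i y1 y2 _ ->]; first by rewrite mxconj0.
    by rewrite mxconjD mxconjZ conjCK.
  rewrite TE in h.
  have n2 : (2 : C) != 0 by rewrite pnatr_eq0.
  split.
    have := congr1 (fun x => ip x (mxconj (E k z))) h.
    rewrite /= ipDl (inW_ipWb ad Uz TW (EW k hk)) addr0 (orth_sum _ oE) // k2 ip0l => /eqP.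
    by rewrite mulf_eq0 (negbTE n2) => /eqP.
  have := congr1 (fun x => ip x (E k z)) h.
  rewrite /= ipDl (inW_ip (ad_at ad Uz) SW (EW k hk)) add0r -{1}[E k z]mxconjK -ip_conj.
  rewrite (orth_sum _ oE) // k2 rmorphM /= conjCK ip0l rmorph_nat => /eqP.
  by rewrite mulf_eq0 (negbTE n2) => /eqP.
Qed.

(** Modulo [L] and [Lh] the zbar-derivative lies in W, hence expands in the frame. Its component
    along [E 1] is tangential, as are [L] and [Lh], so the projection leaves exactly the members
    from 2 to [m]. *)
Lemma frame_H : H_condition m O L E.
Proof.
move=> z Oz j hj; have Uz := OU Oz; have [EW oE] := frE Oz.
have sE : mxsmooth O (E j) by case: fE => _ _ h _ _; apply: h; case/andP: hj => /ltnW -> ->.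
have oO : open O by case: fE.
have adO : adapted O L Lh V := adapted_sub OU ad.
have jW w : O w -> inW (L w) (Lh w) (V w) (E j w).
  by move=> Ow; apply: (frE Ow).1; case/andP: hj => /ltnW -> ->.
have W := inW_dB oO adO sE jW Oz; move: W; set k1 := ip _ _; set k2 := ip _ _ => W.
set x := _ - _ in W; exists (fun k => ip x (mxconj (E k z)) / 2).
set v := \sum_(_ <= _ < _) _.
have xE := frame_expand (ad_at ad Uz) (frE Oz) W; rewrite big_ltn // -/v in xE.
rewrite /nabla_zb mxdzbE; apply: (n_projE oU ad qq Uz).
- have [a a0 qE] := frame_q Oz.
  have e1 : dB (E j) z = x + k1 *: L z + k2 *: Lh z by rewrite /x addrAC !subrK.
  have -> : dB (E j) z - v = (ip x (mxconj (E 1%N z)) / 2 / a) *: q z + k1 *: L z + k2 *: Lh z.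
    rewrite e1 {1}xE qE scalerA divfK //.
    move: (_ *: E 1%N z) (v) (k1 *: _) (k2 *: _) => A B K D.
    by apply/matrixP => r s; rewrite !mxE; ring.
  apply: in_VD; last exact: (in_VZ _ (in_V_Lh oU ad qq Uz)).
  by apply: in_VD; [exact: (in_VZ _ (in_V_q L Lh z))|exact: (in_VZ _ (in_V_L L z))].
- rewrite /v; rewrite /in_Vperp mulmx_sumr big_nat_cond big1 // => k /andP [hk _].
  by have [h _] := frame_Vperp Oz hk; rewrite -scalemxAr; move: h; rewrite /in_Vperp => ->; rewrite scaler0.
Qed.
End FullFrame.

Lemma H_totally_isotropicP y : (0 < m)%N -> (forall z, U z -> sphere_point (L z) = y z) ->
  H_totally_isotropic m U y.
Proof.
move=> m0 hy; exists L; split.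
- exact: (canonical_liftP oU ad qq hy).
- exact: (totally_isotropicP oU ad).
- move=> z Uz N Nz; have : nbhs z (N `&` U) by apply: filterI => //; exact: (near_open oU Uz).
  rewrite nbhsE => -[O [oO Oz] ON].
  have [|||O' [E [fE [z0 O'0] O'O]]] := @frame_exists O.
  + exact: oO.
  + by move=> w /ON [].
  + by exists z.
  exists z0; split; last by case: (ON z0 (O'O z0 O'0)).
  exists O', E; split.
  + by case: fE.
  + exact: O'0.
  + by case: fE.
  + exact: (frame_isotropic m0 fE).
  + exact: (frame_H m0 fE).
Qed.
End Frames.

(** * The extended solution *)

Section Projections.
Variables (R : realType) (m : nat).
Local Notation C := (Cx R).
Local Notation dim := (m.*2.+2).
Local Notation J := (mink R m.*2.+1).
Implicit Types (Y Yh p ph : 'cV[C]_dim) (V : 'M[C]_(dim, m)).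

Definition projL Y Yh : 'M[C]_dim := - (Y *m Yh^T + Yh *m Y^T) *m J.
Definition projV V : 'M[C]_dim := V *m invmx ((mxconj V)^T *m J *m V) *m ((mxconj V)^T *m J).
(** For the adapted pair, [mapL] sends [Y] to [p] and [Yh] to [ph], and [mapV] is minus its adjoint
    for [J]. Their difference is the z-derivative of [projL]; their sum governs the Maurer-Cartan
    forms below. *)
Definition mapL Y Yh p ph : 'M[C]_dim := - (p *m Yh^T + ph *m Y^T) *m J.
Definition mapV Y Yh p ph : 'M[C]_dim := (Y *m ph^T + Yh *m p^T) *m J.
Definition loop Y Yh V (lam : C) : 'M[C]_dim :=
  projL Y Yh + lam *: mxconj (projV V) + lam^-1 *: projV V.

Section Facts.
Variables (Y Yh : 'cV[C]_dim) (V : 'M[C]_(dim, m)).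
Hypothesis ad : adapted_at Y Yh V.
Local Notation Vb := (mxconj V).
Local Notation P0 := (projL Y Yh).
Local Notation Pv := (projV V).
Local Notation Pw := (mxconj (projV V)).

Let cY : mxconj Y = Y. Proof. by case: ad => [[]]. Qed.
Let cYh : mxconj Yh = Yh. Proof. by case: ad => [[]]. Qed.
Let YY : Y^T *m J *m Y = 0. Proof. by rewrite ip_mx; case: ad => [[_ _ -> _ _] _]; rewrite raddf0. Qed.
Let YhYh : Yh^T *m J *m Yh = 0. Proof. by rewrite ip_mx; case: ad => [[_ _ _ -> _] _]; rewrite raddf0. Qed.
Let YYh : Y^T *m J *m Yh = - 1%:M. Proof. by rewrite ip_mx; case: ad => [[_ _ _ _ ->] _]; rewrite raddfN. Qed.
Let YhY : Yh^T *m J *m Y = - 1%:M. Proof. by rewrite ip_mx ipC; case: ad => [[_ _ _ _ ->] _]; rewrite raddfN. Qed.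
Let VV : V^T *m J *m V = 0. Proof. by case: ad => [_ []]. Qed.
Let VY : V^T *m J *m Y = 0. Proof. by case: ad => [_ []]. Qed.
Let VYh : V^T *m J *m Yh = 0. Proof. by case: ad => [_ []]. Qed.
Let tr0 k q (A : 'M[C]_(dim, k)) (B : 'M[C]_(dim, q)) : A^T *m J *m B = 0 -> B^T *m J *m A = 0.
Proof. by move=> h; apply: trmx_inj; rewrite trmx0 !trmx_mul trmxK trJ mulmxA. Qed.
Let YV := tr0 VY. Let YhV := tr0 VYh.
Let YVb := tr0 (VbY ad). Let YhVb := tr0 (VbYh ad).

Lemma projL_mul k (A : 'M[C]_(dim, k)) : P0 *m A = - (Y *m (Yh^T *m J *m A) + Yh *m (Y^T *m J *m A)).
Proof. by rewrite /projL !mulNmx !mulmxDl !mulmxA. Qed.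
Lemma projV_mul k (A : 'M[C]_(dim, k)) : Pv *m A = V *m invmx (Vb^T *m J *m V) *m (Vb^T *m J *m A).
Proof. by rewrite /projV !mulmxA. Qed.
Lemma mxconj1 k : mxconj (1%:M : 'M[C]_k) = 1%:M.
Proof. by apply/matrixP => i j; rewrite mxconjE !mxE rmorph_nat. Qed.
Lemma mxconj_inv k (A : 'M[C]_k) : A \in unitmx -> mxconj (invmx A) = invmx (mxconj A).
Proof.
move=> uA; have uB : mxconj A \in unitmx by rewrite mxconj_unit.
by rewrite -[LHS](mulmxK uB) -mxconjM mulVmx // mxconj1 mul1mx.
Qed.
Lemma projWE : Pw = Vb *m invmx (V^T *m J *m Vb) *m (V^T *m J).
Proof. by rewrite /projV !mxconjM (mxconj_inv (gramV_unit ad)) !mxconjM mxconj_tr mxconjK conjJ. Qed.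
Lemma projW_mul k (A : 'M[C]_(dim, k)) : Pw *m A = Vb *m invmx (V^T *m J *m Vb) *m (V^T *m J *m A).
Proof. by rewrite projWE !mulmxA. Qed.

Lemma projL_Y : P0 *m Y = Y.
Proof. by rewrite projL_mul YhY YY mulmx0 addr0 mulmxN mulmx1 opprK. Qed.
Lemma projL_Yh : P0 *m Yh = Yh.
Proof. by rewrite projL_mul YhYh YYh mulmx0 add0r mulmxN mulmx1 opprK. Qed.
Lemma projL_V : P0 *m V = 0.
Proof. by rewrite projL_mul YV YhV !mulmx0 addr0 oppr0. Qed.
Lemma projL_Vb : P0 *m Vb = 0.
Proof. by rewrite projL_mul YVb YhVb !mulmx0 addr0 oppr0. Qed.
Lemma projV_Y : Pv *m Y = 0. Proof. by rewrite projV_mul (VbY ad) mulmx0. Qed.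
Lemma projV_Yh : Pv *m Yh = 0. Proof. by rewrite projV_mul (VbYh ad) mulmx0. Qed.
Lemma projV_V : Pv *m V = V. Proof. by rewrite projV_mul -mulmxA (mulVmx (gramV_unit ad)) mulmx1. Qed.
Lemma projV_Vb : Pv *m Vb = 0. Proof. by rewrite projV_mul (VbVb ad) mulmx0. Qed.
Lemma projW_Y : Pw *m Y = 0. Proof. by rewrite projW_mul VY mulmx0. Qed.
Lemma projW_Yh : Pw *m Yh = 0. Proof. by rewrite projW_mul VYh mulmx0. Qed.
Lemma projW_V : Pw *m V = 0. Proof. by rewrite projW_mul VV mulmx0. Qed.
Lemma projW_Vb : Pw *m Vb = Vb. Proof. by rewrite projW_mul -mulmxA (mulVmx (gramVb_unit ad)) mulmx1. Qed.

Lemma projLL : P0 *m P0 = P0.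
Proof. by rewrite {2}/projL mulmxA mulmxN mulmxDr !mulmxA projL_Y projL_Yh. Qed.
Lemma projVL : Pv *m P0 = 0.
Proof. by rewrite {1}/projL mulmxA mulmxN mulmxDr !mulmxA projV_Y projV_Yh !mul0mx addr0 oppr0 mul0mx. Qed.
Lemma projWL : Pw *m P0 = 0.
Proof. by rewrite {1}/projL mulmxA mulmxN mulmxDr !mulmxA projW_Y projW_Yh !mul0mx addr0 oppr0 mul0mx. Qed.
Lemma projLV : P0 *m Pv = 0. Proof. by rewrite {1}/projV !mulmxA projL_V !mul0mx. Qed.
Lemma projVV : Pv *m Pv = Pv. Proof. by rewrite {2}/projV !mulmxA projV_V /projV !mulmxA. Qed.
Lemma projWV : Pw *m Pv = 0. Proof. by rewrite {2}/projV !mulmxA projW_V !mul0mx. Qed.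
Lemma projLW : P0 *m Pw = 0. Proof. by rewrite projWE !mulmxA projL_Vb !mul0mx. Qed.
Lemma projVW : Pv *m Pw = 0. Proof. by rewrite projWE !mulmxA projV_Vb !mul0mx. Qed.
Lemma projWW : Pw *m Pw = Pw. Proof. by rewrite {2}projWE !mulmxA projW_Vb projWE !mulmxA. Qed.

Lemma projL_adj : P0^T *m J = J *m P0.
Proof.
rewrite /projL trmx_mul trJ linearN linearD /= !trmx_mul !trmxK addrC !mulmxA.
by [].
Qed.
Lemma projV_adj : Pv^T *m J = J *m Pw.
Proof.
rewrite projWE /projV !trmx_mul trJ trmxK trmx_inv !trmx_mul trJ trmxK.
by rewrite !mulmxA.
Qed.
Lemma projW_adj : Pw^T *m J = J *m Pv.
Proof.
rewrite projWE /projV !trmx_mul trJ trmxK trmx_inv !trmx_mul trJ trmxK.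
by rewrite !mulmxA.
Qed.

Lemma proj_adj : (P0 + Pw + Pv)^T *m J = J *m (P0 + Pw + Pv).
Proof.
move: projL_adj projW_adj projV_adj; move: P0 Pv Pw => M1 M3 M2 e1 e2 e3.
rewrite [(_ + _)^T]linearD /= [(_ + _)^T]linearD /= !mulmxDl e1 e2 e3 !mulmxDr.
by rewrite addrAC.
Qed.
(** The sum is self-adjoint for [J] and fixes [Y], [Yh], [V] and conj V. Therefore the defect on any
    [x] is orthogonal to all of them, hence 0. *)
Lemma proj_sum : P0 + Pw + Pv = 1%:M.
Proof.
have key (x : 'cV[C]_dim) : x - (P0 + Pw + Pv) *m x = 0.
  set y := x - _.
  have a0 k (M : 'M[C]_(dim, k)) : P0 *m M + Pw *m M + Pv *m M = M -> M^T *m J *m y = 0.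
    rewrite -!mulmxDl => h; rewrite /y mulmxBr -{1}h trmx_mul; apply/eqP.
    by rewrite subr_eq0 -(mulmxA M^T) proj_adj !mulmxA.
  have iy (u : 'cV[C]_dim) : u^T *m J *m y = 0 -> ip y u = 0.
    by move=> h; rewrite ipC ip_def h mxE.
  apply: (ad_complete ad).
  - by apply: iy; apply: a0; rewrite projL_Y projW_Y projV_Y !addr0.
  - by apply: iy; apply: a0; rewrite projL_Yh projW_Yh projV_Yh !addr0.
  - by apply: a0; rewrite projL_V projW_V projV_V !add0r.
  - by apply: a0; rewrite projL_Vb projW_Vb projV_Vb addr0 add0r.
apply/matrixP => i j; have := congr1 (fun A : 'cV[C]_dim => A i ord0) (key (delta_mx j ord0)).
by rewrite -colE !mxE eqxx andbT => /eqP; rewrite subr_eq0 => /eqP.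
Qed.

Lemma conj_projL : mxconj P0 = P0.
Proof. by rewrite /projL !(mxconjN, mxconjM, mxconjD, mxconj_tr) cY cYh conjJ. Qed.
Local Notation loop := (loop Y Yh V).
(** The three projections are mutually orthogonal idempotents. Multiplicativity gives the inverse of
    the loop and its square roots. *)
Lemma loopM a b : loop a *m loop b = loop (a * b).
Proof.
rewrite /loop !mulmxDl !mulmxDr -!scalemxAl -!scalemxAr projLL projLW projLV projWL projWW projWV.
by rewrite projVL projVW projVV !scaler0 !addr0 !add0r !scalerA invfM.
Qed.
Lemma loop1 : loop 1 = 1%:M.
Proof. by rewrite /loop invr1 !scale1r proj_sum. Qed.
Lemma loop_conj a : circle a -> mxconj (loop a) = loop a.
Proof.
move=> ha; have [a1 a2] : a^* = a^-1 /\ (a^-1)^* = a.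
  have n1 : `|a| = 1 by exact: ha.
  have e : a^-1 = a^* by rewrite invC_norm n1 expr1n invr1 mul1r.
  by rewrite e conjCK.
rewrite /loop !mxconjD !mxconjZ conj_projL mxconjK a1 a2 addrAC.
by [].
Qed.
Lemma loop_adj a : (loop a)^T *m J = J *m loop a^-1.
Proof.
rewrite /loop invrK !mulmxDr -!scalemxAr -projL_adj -projW_adj -projV_adj.
move: P0 Pv Pw => M1 M3 M2.
rewrite [(_ + _)^T]linearD /= [(_ + _)^T]linearD /= ![(_ *: _)^T]linearZ /=.
by rewrite !mulmxDl -!scalemxAl addrAC.
Qed.
Lemma loop_orth a : a != 0 -> (loop a)^T *m J *m loop a = J.
Proof. by move=> a0; rewrite loop_adj -mulmxA loopM mulVf // loop1 mulmx1. Qed.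
End Facts.
End Projections.

(** * The real Lorentz group *)

Section Lorentz.
Variables (R : realType) (n : nat).
Local Notation C := (Cx R).
Local Notation J := (mink R n.+1).
Implicit Types A B : 'M[C]_n.+2.

Lemma orth_invl A : A^T *m J *m A = J -> J *m A^T *m J *m A = 1%:M.
Proof. by move=> h; rewrite -!mulmxA (mulmxA A^T) h JJ. Qed.
Lemma orth_inv A : A^T *m J *m A = J -> invmx A = J *m A^T *m J.
Proof.
move=> /orth_invl h; have [_ uA] := mulmx1_unit h.
by rewrite -[RHS](mulmxK uA) h mul1mx.
Qed.
Lemma orth_unit A : A^T *m J *m A = J -> A \in unitmx.
Proof. by move=> /orth_invl /mulmx1_unit []. Qed.
Lemma orth_tr A : A^T *m J *m A = J -> A *m J *m A^T = J.
Proof.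
move=> /orth_invl /mulmx1C h.
have := congr1 (fun M => M *m J) h.
by rewrite /= mul1mx -!mulmxA JJ mulmx1.
Qed.
Lemma orthM A B : A^T *m J *m A = J -> B^T *m J *m B = J -> (A *m B)^T *m J *m (A *m B) = J.
Proof. by move=> hA hB; rewrite trmx_mul -!mulmxA (mulmxA J A) (mulmxA A^T) (mulmxA A^T) hA mulmxA. Qed.
Lemma orthT A : A^T *m J *m A = J -> (A^T)^T *m J *m A^T = J.
Proof. by move=> /orth_tr; rewrite trmxK. Qed.


Lemma orth_col A : A^T *m J *m A = J ->
  \sum_(j < n.+1) A (lift ord0 j) ord0 ^+ 2 = A ord0 ord0 ^+ 2 - 1.
Proof.
move=> /(congr1 (fun M : 'M[C]_n.+2 => M ord0 ord0)); rewrite /mink mul_mx_diag !mxE eqxx /=.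
rewrite big_ord_recl !mxE mulrN1 mulNr mulr1n => /eqP; rewrite addrC subr_eq addrC => /eqP <-.
apply: eq_bigr => j _; rewrite !mxE (_ : (lift ord0 j == ord0) = false) // mulr1.
by rewrite expr2.
Qed.
Lemma orth_row A : A^T *m J *m A = J ->
  \sum_(j < n.+1) A ord0 (lift ord0 j) ^+ 2 = A ord0 ord0 ^+ 2 - 1.
Proof. by move=> /orthT /orth_col; rewrite mxE => <-; apply: eq_bigr => j _; rewrite mxE. Qed.

Lemma real_sqr_ge0 (x : C) : x \is Num.real -> 0 <= x ^+ 2.
Proof. by move=> xr; rewrite real_exprn_even_ge0. Qed.

(* Two reversed Cauchy-Schwarz inequalities, balanced by the ratio of the two corner entries. *)
Lemma orthochronous_mul A B : A \is a mxOver Num.real -> B \is a mxOver Num.real ->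
  A^T *m J *m A = J -> B^T *m J *m B = J -> 0 < A ord0 ord0 * B ord0 ord0 ->
  0 < (A *m B) ord0 ord0.
Proof.
move=> /mxOverP rA /mxOverP rB hA hB; set a := A ord0 ord0; set b := B ord0 ord0 => ab.
have a0 : a != 0 by apply: contraTneq ab => ->; rewrite mul0r ltxx.
have b0 : b != 0 by apply: contraTneq ab => ->; rewrite mulr0 ltxx.
have s0 : 0 < b / a.
  have -> : b / a = (a * b) * (a^-1) ^+ 2 by field.
  by rewrite mulr_gt0 // lt_def real_sqr_ge0 ?realV ?rA // andbT expf_neq0 // invr_eq0.
set s := b / a in s0.
have sr : s \is Num.real by exact: gtr0_real.
have sn : s != 0 by exact: lt0r_neq0.
rewrite -(pmulr_rgt0 _ (ltr0Sn _ 1)) mxE big_ord_recl -/a -/b.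
have -> : 2 * (a * b + \sum_(i < n.+1) A ord0 (lift ord0 i) * B (lift ord0 i) ord0) =
  s + s^-1 + \sum_(i < n.+1) s * (A ord0 (lift ord0 i) + B (lift ord0 i) ord0 / s) ^+ 2.
  have -> : \sum_(i < n.+1) s * (A ord0 (lift ord0 i) + B (lift ord0 i) ord0 / s) ^+ 2 =
     s * (a ^+ 2 - 1) + s^-1 * (b ^+ 2 - 1) + 2 * \sum_(i < n.+1) A ord0 (lift ord0 i) * B (lift ord0 i) ord0.
    rewrite -(orth_row hA) -(orth_col hB) !mulr_sumr -!big_split /=; apply: eq_bigr => i _.
    move: (A _ _) (B _ _) (s) sn => x y t t0; by field.
  move: (\sum_(i < n.+1) _) => X; rewrite /s; field.
  by rewrite a0 b0.
rewrite ltr_pwDl ?addr_gt0 ?invr_gt0 // sumr_ge0 // => i _.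
apply: mulr_ge0; first exact: ltW.
apply: real_sqr_ge0; apply: (realD (rA _ _)); apply: (realM (rB _ _)); by rewrite realV.
Qed.

Lemma SOp_inv A : SOp A -> SOp (invmx A).
Proof.
move=> [rA hA dA A0]; rewrite orth_inv //.
have cA : mxconj A = A by apply/eqP; rewrite -mxconj_real.
split.
- by rewrite mxconj_real !mxconjM conjJ mxconj_tr cA.
- have hJ : J^T *m J *m J = J by rewrite trJ JJ mul1mx.
  exact: (orthM (orthM hJ (orthT hA)) hJ).
- by rewrite !det_mulmx det_tr dA mulr1 -det_mulmx JJ det1.
- have -> : (J *m A^T *m J) ord0 ord0 = A ord0 ord0.
    by rewrite /mink mul_mx_diag mxE mul_diag_mx !mxE /=; ring.
  by [].
Qed.
Lemma SOpM A B : SOp A -> SOp B -> SOp (A *m B).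
Proof.
move=> [rA hA dA A0] [rB hB dB B0]; split.
- move: rA rB; rewrite !mxconj_real mxconjM => /eqP -> /eqP ->; exact: eqxx.
- exact: orthM.
- by rewrite det_mulmx dA dB mulr1.
- by apply: orthochronous_mul => //; rewrite mulr_gt0.
Qed.

(** The determinant of [A] squares to 1, and the corner entry of [A] has square at least 1, so
    [A *m A] is orthochronous. This stands in for a connectedness argument. *)
Lemma SOp_sqr A : A \is a mxOver Num.real -> A^T *m J *m A = J -> SOp (A *m A).
Proof.
move=> rA hA; split.
- move: rA; rewrite !mxconj_real mxconjM => /eqP ->; exact: eqxx.
- exact: orthM.
- have dJ : \det J != 0 :> C.
    by have := congr1 determinant (JJ R n); rewrite det_mulmx det1 => h; apply/eqP => e; move: h; rewrite e mul0r => /eqP; rewrite eq_sym oner_eq0.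
  have := congr1 determinant hA; rewrite !det_mulmx det_tr => h.
  by apply: (mulIf dJ); rewrite mul1r -{2}h; ring.
- apply: orthochronous_mul => //; have := orth_row hA.
  set a := A ord0 ord0 => e; have s0 : 0 <= a ^+ 2 - 1.
    by rewrite -e sumr_ge0 // => i _; apply: real_sqr_ge0; move/mxOverP: rA; apply.
  by rewrite -expr2; apply: lt_le_trans ltr01 _; rewrite -subr_ge0.
Qed.
End Lorentz.

(** * The involution and the Cartan embedding *)

Section Involution.
Variables (R : realType) (m : nat).
Local Notation C := (Cx R).
Local Notation dim := (m.*2.+2).
Local Notation J := (mink R m.*2.+1).

Definition Sg : 'M[C]_dim := (block_mx (- 1%:M) 0 0 1%:M : 'M[C]_(2 + m.*2)).
Lemma sigmaE (A : 'M[C]_dim) : sigma A = Sg *m A *m Sg. Proof. by []. Qed.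
Lemma Sg_diag : Sg = diag_mx (row_mx (const_mx (-1)) (const_mx 1) : 'rV_(2 + m.*2)).
Proof. by rewrite /Sg diag_mx_row !diag_const_mx raddfN. Qed.
Lemma SgSg : Sg *m Sg = 1%:M.
Proof.
rewrite Sg_diag mulmx_diag -diag_const_mx; congr diag_mx; apply/rowP => j; rewrite !mxE.
by case: splitP => k _; rewrite !mxE; ring.
Qed.
Lemma SgJ : Sg *m J = J *m Sg.
Proof. by rewrite Sg_diag /mink diag_mxC. Qed.
Lemma Sg_tr : Sg^T = Sg. Proof. by rewrite Sg_diag tr_diag_mx. Qed.
Lemma Sg_conj : mxconj Sg = Sg.
Proof.
apply/matrixP => i j; rewrite mxconjE Sg_diag !mxE rmorphMn /=; congr (_ *+ _).
by case: splitP => k _; rewrite mxE ?rmorphN rmorph1.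
Qed.
Lemma Sg00 (A : 'M[C]_dim) : (Sg *m A *m Sg) ord0 ord0 = A ord0 ord0.
Proof.
have s : (row_mx (const_mx (-1)) (const_mx 1) : 'rV[C]_(2 + m.*2)) ord0 ord0 = -1.
  by rewrite mxE; case: splitP => // k _; rewrite mxE.
by rewrite Sg_diag mul_mx_diag mxE mul_diag_mx mxE s; ring.
Qed.
Lemma SOp_sigma A : SOp A -> SOp (@sigma R m A).
Proof.
move=> [rA hA dA A0]; rewrite sigmaE; split.
- by move: rA; rewrite !mxconj_real !mxconjM Sg_conj => /eqP ->; exact: eqxx.
- have hS : Sg^T *m J *m Sg = J by rewrite Sg_tr SgJ -mulmxA SgSg mulmx1.
  exact: (orthM (orthM hS hA) hS).
- by rewrite !det_mulmx dA mulr1 -det_mulmx SgSg det1.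
- by rewrite Sg00.
Qed.

Lemma Sg_E : (1%:M - Sg) *m J = 2 *: (delta_mx (lift ord0 ord0) (lift ord0 ord0) - delta_mx ord0 ord0).
Proof.
rewrite Sg_diag -diag_const_mx -linearB /= /mink mulmx_diag; apply/matrixP => i j.
rewrite !mxE; case: (i =P j) => [->|ij]; last first.
  rewrite !mulr0n; have h (k : 'I_dim) : (i == k) && (j == k) = false.
    by apply/negP => /andP [/eqP a /eqP b]; apply: ij; rewrite a b.
  by rewrite !h subrr mulr0.
rewrite mulr1n !andbb; case: splitP => [k jk|k jk]; rewrite mxE.
  have : (j == ord0) || (j == lift ord0 ord0).
    by rewrite -!val_eqE /= jk; case: k {jk} => [[|[|]]].
  case/orP => /eqP ->.
    by rewrite /= mulrN1; ring.
  rewrite /=; ring.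
have -> : (j == ord0) = false by rewrite -val_eqE /= jk.
have -> : (j == lift ord0 ord0) = false by rewrite -val_eqE /= jk.
by rewrite /=; ring.
Qed.

Lemma null_dyads (u v : 'cV[C]_dim) (k : C) : k * k = 2^-1 ->
  - (k *: (u - v) *m (k *: (u + v))^T + k *: (u + v) *m (k *: (u - v))^T) = v *m v^T - u *m u^T.
Proof.
move=> kk; apply/matrixP => i j; rewrite !mxlinE.
move: (u i ord0) (u j ord0) (v i ord0) (v j ord0) => a b c d.
transitivity (2 * (k * k) * (c * d - a * b)); first by ring.
by rewrite kk; field.
Qed.

(** The product of [F], [Sg] and the inverse of [F] is the reflection that is -1 on the plane of the
    first two columns; that plane is spanned by the two null vectors, so only [projL] enters. *)
Lemma cartanE (F : C -> 'M[C]_dim) z : SOp (F z) ->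
  cartan F z = (1%:M - 2 *: projL (Y_of (F z)) (Yhat_of (F z))) *m Sg.
Proof.
move=> [_ hF _ _]; have uF := orth_unit hF; have iF := orth_inv hF.
rewrite /cartan sigmaE; move: (F z) hF uF iF => A hA uA iA.
have uS : Sg \in unitmx by case: (mulmx1_unit SgSg).
have iS : invmx (Sg *m A *m Sg) = Sg *m invmx A *m Sg.
  have h : (Sg *m invmx A *m Sg) *m (Sg *m A *m Sg) = 1%:M.
    by rewrite -!mulmxA (mulmxA Sg Sg) SgSg mul1mx (mulmxA (invmx A)) mulVmx // mul1mx SgSg.
  have [_ u] := mulmx1_unit h.
  by rewrite -[RHS](mulmxK u) h mul1mx.
rewrite iS !mulmxA; congr (_ *m _).
have -> : projL (Y_of A) (Yhat_of A) = A *m (delta_mx (lift ord0 ord0) (lift ord0 ord0) - delta_mx ord0 ord0) *m A^T *m J.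
  have n2 : sqrtC 2 / 2 * (sqrtC 2 / 2) = 2^-1 :> C.
    have := sqrtCK (2 : C); move: (sqrtC 2) => s; rewrite expr2 => e.
    by transitivity (s * s / 4); [field|rewrite e; field].
  have cc i : A *m delta_mx i i *m A^T = col i A *m (col i A)^T.
    by rewrite colE trmx_mul trmx_delta !mulmxA -[in RHS](mulmxA A) mul_delta_mx.
  rewrite mulmxBr mulmxBl !cc /projL /Y_of /Yhat_of /col0 /col1.
  by rewrite (null_dyads _ _ n2).
have -> : 2 *: (A *m (delta_mx (lift ord0 ord0) (lift ord0 ord0) - delta_mx ord0 ord0) *m A^T *m J)
   = A *m (1%:M - Sg) *m invmx A.
  by rewrite iA !mulmxA -(mulmxA A _ J) Sg_E -scalemxAr -!scalemxAl.
by rewrite mulmxBr mulmx1 mulmxBl mulmxV // opprB addrC subrK.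
Qed.
End Involution.

Section Dyads.
Variables (R : realType) (n : nat).
Local Notation C := (Cx R).
Implicit Types x y : C -> 'cV[C]_n.
Lemma mxrdiff_dyad x y z : mxrdiff x z -> mxrdiff y z -> mxrdiff (fun w => x w *m (y w)^T) z.
Proof. by move=> dx dy; exact: (mxrdiffM dx (mxrdiff_tr dy)). Qed.
Lemma mxwirt_dyad c x y z : mxrdiff x z -> mxrdiff y z ->
  mxwirt c (fun w => x w *m (y w)^T) z = mxwirt c x z *m (y z)^T + x z *m (mxwirt c y z)^T.
Proof. by move=> dx dy; rewrite (mxwirtM c dx (mxrdiff_tr dy)) mxwirt_tr. Qed.
Lemma mxsmooth_dyad U x y : open U -> mxsmooth U x -> mxsmooth U y ->
  mxsmooth U (fun w => x w *m (y w)^T).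
Proof. by move=> oU sx sy; exact: (mxsmoothM oU sx (mxsmooth_tr oU sy)). Qed.
End Dyads.

Section DyadIdentities.
Variables (K : comNzRingType) (n : nat).
(** Here [u], [v], [y], [yh] stand for [p], [ph], [Y], [Yh], and their zbar-derivatives have been
    replaced by the structure equations. All terms in the connection coefficient [k] cancel, and
    what remains is opposite to its conjugate. *)
Lemma dB_dyads (u v ub vb y yh : 'cV[K]_n) (k a ab b d : K) :
  - ((- k *: u + a *: y + b *: yh) *m yh^T + u *m (vb + k *: yh)^T
     + ((k *: v + ab *: yh + d *: y) *m y^T + v *m (ub - k *: y)^T))
  + ((ub - k *: y) *m v^T + y *m (k *: v + ab *: yh + d *: y)^T
     + ((vb + k *: yh) *m u^T + yh *m (- k *: u + a *: y + b *: yh)^T)) =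
  (ab - a) *: (y *m yh^T) + (a - ab) *: (yh *m y^T) + (vb *m u^T - u *m vb^T) + (ub *m v^T - v *m ub^T).
Proof. by apply/matrixP => i j; rewrite !mxlinE; ring. Qed.
Lemma skew_dyads0 (u v ub vb y yh : 'cV[K]_n) (a ab : K) :
  (ab - a) *: (y *m yh^T) + (a - ab) *: (yh *m y^T) + (vb *m u^T - u *m vb^T) +
  (ub *m v^T - v *m ub^T) +
  ((a - ab) *: (y *m yh^T) + (ab - a) *: (yh *m y^T) +
   (v *m ub^T - ub *m v^T) + (u *m vb^T - vb *m u^T)) = 0.
Proof. by apply/matrixP => i j; rewrite !mxlinE; ring. Qed.
End DyadIdentities.

Section MapProducts.
Variables (R : realType) (m : nat).
Local Notation C := (Cx R).
Local Notation dim := (m.*2.+2).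
Local Notation J := (mink R m.*2.+1).
Lemma mul_mapL (M : 'M[C]_dim) y yh u v :
  M *m mapL y yh u v = - (M *m u *m yh^T + M *m v *m y^T) *m J.
Proof. by rewrite /mapL mulmxA mulmxN mulmxDr !mulmxA. Qed.
Lemma mul_mapV (M : 'M[C]_dim) y yh u v :
  M *m mapV y yh u v = (M *m y *m v^T + M *m yh *m u^T) *m J.
Proof. by rewrite /mapV mulmxA mulmxDr !mulmxA. Qed.
Lemma skew_dyads (u v y yh : 'cV[C]_dim) (a : C) : mxconj y = y -> mxconj yh = yh ->
  let N := (a^* - a) *: (y *m yh^T) + (a - a^*) *: (yh *m y^T)
    + (mxconj v *m u^T - u *m (mxconj v)^T) + (mxconj u *m v^T - v *m (mxconj u)^T) in
  N + mxconj N = 0.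
Proof.
move=> ry ryh N; rewrite /N !(mxconjD, mxconjZ, mxconjB) !mxconjM !mxconj_tr !mxconjK ry ryh.
rewrite !mxconjN !mxconjM !mxconj_tr !mxconjK !rmorphB /= !conjCK.
exact: skew_dyads0.
Qed.
End MapProducts.

(** * Derivatives of the projections and of the loop *)

Section LoopDerivative.
Variables (R : realType) (m : nat).
Local Notation C := (Cx R).
Local Notation dim := (m.*2.+2).
Local Notation J := (mink R m.*2.+1).
Local Notation dZ := (mxwirt (- 'i)).
Local Notation dB := (mxwirt 'i).
Variables (U : set C) (Y Yh : C -> 'cV[C]_dim) (V : C -> 'M[C]_(dim, m)).
Hypotheses (oU : open U) (ad : adapted U Y Yh V).
Local Notation p := (isoW Y Yh).
Local Notation ph := (isoW Yh Y).
Local Notation w := (conn Y Yh).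
Local Notation P0 z := (projL (Y z) (Yh z)).
Local Notation Pv z := (projV (V z)).
Local Notation Pw z := (mxconj (projV (V z))).
Local Notation A z := (mapL (Y z) (Yh z) (p z) (ph z)).
Local Notation B z := (mapV (Y z) (Yh z) (p z) (ph z)).
Local Notation T z := (A z + B z).

Let ads : adapted U Yh Y V. Proof. exact: adapted_sym. Qed.
Let sp : mxsmooth U p. Proof. exact: (smooth_isoW oU ad). Qed.
Let sph : mxsmooth U ph. Proof. exact: (smooth_isoW oU ads). Qed.
Let sY := ad_sY ad. Let sYh := ad_sYh ad.

Lemma smooth_projL : mxsmooth U (fun z => P0 z).
Proof.
exact: (mxsmoothM oU (mxsmoothN oU (mxsmoothD oU (mxsmooth_dyad oU sY sYh)
  (mxsmooth_dyad oU sYh sY))) (mxsmooth_cst oU J)).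
Qed.
Lemma smooth_projV : mxsmooth U (fun z => Pv z).
Proof.
have sV := ad_sV ad; have sVJ := mxsmoothM oU (mxsmooth_tr oU (mxsmooth_conj oU sV)) (mxsmooth_cst oU J).
have uG z : U z -> (mxconj (V z))^T *m J *m V z \in unitmx by move=> Uz; exact: (gramV_unit (ad_at ad Uz)).
exact: (mxsmoothM oU (mxsmoothM oU sV (mxsmooth_inv oU uG (mxsmoothM oU sVJ sV))) sVJ).
Qed.

Section Point.
Variable z : C.
Hypothesis Uz : U z.
Let a := ad_at ad Uz.
Let rp := mxsmooth_rdiff sp Uz.
Let rph := mxsmooth_rdiff sph Uz.
Let rY := ad_dY ad Uz.
Let rYh := ad_dYh ad Uz.

Lemma dZ_projL : dZ (fun z => P0 z) z = A z - B z.
Proof.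
rewrite /projL (mxwirtMr _ _ (mxrdiffN (mxrdiffD (mxrdiff_dyad rY rYh) (mxrdiff_dyad rYh rY)))).
rewrite (mxwirtN _ (mxrdiffD (mxrdiff_dyad rY rYh) (mxrdiff_dyad rYh rY))).
rewrite (mxwirtD _ (mxrdiff_dyad rY rYh) (mxrdiff_dyad rYh rY)) !mxwirt_dyad //.
rewrite (dZ_YE Y Yh) (dZ_YhE oU ad Uz) /mapL /mapV -mulmxBl; congr (_ *m _).
move: (p z) (ph z) (Y z) (Yh z) (w z) => u v y yh k.
by apply/matrixP => i j; rewrite !mxlinE; ring.
Qed.

Lemma proj_ext (M N : 'M[C]_dim) : M *m Y z = N *m Y z -> M *m Yh z = N *m Yh z ->
  M *m V z = N *m V z -> M *m mxconj (V z) = N *m mxconj (V z) -> M = N.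
Proof.
move=> e1 e2 e3 e4; rewrite -[M]mulmx1 -[N]mulmx1 -(proj_sum a) !mulmxDr.
congr (_ + _ + _).
- by rewrite /projL !mulmxA !mulmxN !mulmxDr !mulmxA e1 e2.
- by rewrite (projWE a) !mulmxA e4.
- by rewrite /projV !mulmxA e3.
Qed.

(** The relations [Pv M = N] for [M] among [Y], [Yh], [V] and conj V are differentiated, which
    avoids the derivative of the inverse Gram matrix. *)
Lemma dZ_projV : dZ (fun z => Pv z) z = B z.
Proof.
have sPv := smooth_projV; have rPv := mxsmooth_rdiff sPv Uz.
have [pY pYh pV] := inW_isoW oU ad Uz; have [phY phYh phV] := inW_isoW' oU ad Uz.
have BE k (M : 'M[C]_(dim, k)) : B z *m M = Y z *m ((ph z)^T *m J *m M) + Yh z *m ((p z)^T *m J *m M).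
  by rewrite /mapV !mulmxDl !mulmxA.
have Pp x : inW (Y z) (Yh z) (V z) x -> Pv z *m x = 0.
  by move=> xW; have [d ->] := inW_span a xW; rewrite mulmxA (projV_Vb a) mul0mx.
have tr0 k (M : 'M[C]_(dim, k)) x : M^T *m J *m x = 0 :> 'M_(k, 1) -> x^T *m J *m M = 0.
  by move=> h; apply: trmx_inj; rewrite trmx0 !trmx_mul trmxK trJ mulmxA.
have d0 k (M : C -> 'M[C]_(dim, k)) N : mxrdiff M z -> (forall z, U z -> Pv z *m M z = N z) ->
    mxsmooth U N -> dZ (fun z => Pv z) z *m M z = dZ N z - Pv z *m dZ M z.
  move=> rM h sN; rewrite (mxwirt_eq oU (- 'i) sN (fun z Uz => esym (h z Uz)) Uz).
  by rewrite (mxwirtM _ rPv rM) addrK.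
apply: proj_ext.
- rewrite (d0 _ Y (fun=> 0) rY) => [|u Uu|]; [|exact: (projV_Y (ad_at ad Uu))|exact: (mxsmooth_cst oU 0)].
  rewrite mxwirt_cst (dZ_YE Y Yh) mulmxBr -scalemxAr (projV_Y a) scaler0 (Pp _ (inW_isoW oU ad Uz)).
  by rewrite BE !ip_mx pY phY !raddf0 ?mulmx0 !addr0 !subr0.
- rewrite (d0 _ Yh (fun=> 0) rYh) => [|u Uu|]; [|exact: (projV_Yh (ad_at ad Uu))|exact: (mxsmooth_cst oU 0)].
  rewrite mxwirt_cst (dZ_YhE oU ad Uz) mulmxDr -scalemxAr (projV_Yh a) scaler0 (Pp _ (inW_isoW' oU ad Uz)).
  by rewrite BE !ip_mx pYh phYh !raddf0 ?mulmx0 !addr0 !subr0.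
- rewrite (d0 _ V V (ad_dV ad Uz)) => [|u Uu|]; [|exact: (projV_V (ad_at ad Uu))|exact: (ad_sV ad)].
  (* As [dZ V] is orthogonal to [V], it has no component in W, and the remainder lies in the plane
     of [Y] and [Yh]. *)
  have -> : dZ V z - Pv z *m dZ V z = P0 z *m dZ V z.
    have := congr1 (fun M => M *m dZ V z) (proj_sum a).
    rewrite /= mul1mx !mulmxDl (projW_mul a) (ad_VdV ad Uz) mulmx0 addr0.
    by move=> h; rewrite -{1}h addrK.
  have g (y : C -> 'cV[C]_dim) : mxrdiff y z -> (forall u, U u -> (V u)^T *m J *m y u = 0) ->
      (y z)^T *m J *m dZ V z = - ((dZ y z)^T *m J *m V z).
    move=> ry h; apply: trmx_inj; rewrite linearN /= !trmx_mul !trmxK trJ !mulmxA.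
    have := mxwirt_on_cst (- 'i) oU h Uz; rewrite (mxwirt_gram _ (ad_dV ad Uz) ry).
    by move/eqP; rewrite addr_eq0 => /eqP.
  rewrite projL_mul (g Y rY (fun u Uu => ad_VY ad Uu)) (g Yh rYh (fun u Uu => ad_VY ads Uu)).
  have lin (x y : 'cV[C]_dim) k : y^T *m J *m V z = 0 -> (x + k *: y)^T *m J *m V z = x^T *m J *m V z.
    by move=> h; rewrite linearD linearZ /= !mulmxDl -!scalemxAl h scaler0 addr0.
  rewrite (dZ_YE Y Yh) (dZ_YhE oU ad Uz) -scaleNr.
  rewrite (lin _ _ _ (tr0 _ _ _ (ad_VY ad Uz))) (lin _ _ _ (tr0 _ _ _ (ad_VY ads Uz))) BE.
  move: ((ph z)^T *m J *m V z) ((p z)^T *m J *m V z) (Y z) (Yh z) => x1 x2 y1 y2.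
  by rewrite !mulmxN -opprD opprK.
- rewrite (d0 _ (fun z => mxconj (V z)) (fun=> 0) (mxrdiff_conj (ad_dV ad Uz))) => [|u Uu|]; [|exact: (projV_Vb (ad_at ad Uu))|exact: (mxsmooth_cst oU 0)].
  by rewrite mxwirt_cst (dZ_Vb ad Uz) mulmx0 subr0 BE (tr0 _ _ _ pV) (tr0 _ _ _ phV) !mulmx0 addr0.
Qed.

End Point.

Lemma dZ_projW z : U z -> dZ (fun z => Pw z) z = - A z.
Proof.
move=> Uz; have rL := mxsmooth_rdiff smooth_projL Uz; have rV := mxsmooth_rdiff smooth_projV Uz.
have sE : mxsmooth U (fun z => 1%:M - P0 z - Pv z) :=
  mxsmoothB oU (mxsmoothB oU (mxsmooth_cst oU _) smooth_projL) smooth_projV.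
have h u : U u -> 1%:M - P0 u - Pv u = Pw u.
  by move=> Uu; rewrite -(proj_sum (ad_at ad Uu)) addrAC addrK addrAC subrr add0r.
rewrite -(mxwirt_eq oU (- 'i) sE h Uz) (mxwirtB _ (mxrdiffB (mxrdiff_cst _ z) rL) rV).
rewrite (mxwirtB _ (mxrdiff_cst _ z) rL) mxwirt_cst dZ_projL // dZ_projV // sub0r opprB.
by rewrite addrAC subrr add0r.
Qed.

Definition loopf (lam : C) z := loop (Y z) (Yh z) (V z) lam.
Lemma smooth_loopf lam : mxsmooth U (loopf lam).
Proof.
exact: (mxsmoothD oU (mxsmoothD oU smooth_projL (mxsmoothZ oU (smooth_cst oU lam)
  (mxsmooth_conj oU smooth_projV))) (mxsmoothZ oU (smooth_cst oU lam^-1) smooth_projV)).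
Qed.

(** The image of [A] is in W and that of [B] in the plane of [Y] and [Yh], so [loop T] is
    [lam A + B]. The derivatives of the projections add up to [(1 - lam) A + (lam^-1 - 1) B], the
    same expression times [lam^-1 - 1]. *)
Lemma dZ_loopf lam z : U z -> lam != 0 -> dZ (loopf lam) z = (lam^-1 - 1) *: (loopf lam z *m T z).
Proof.
move=> Uz l0; have rL := mxsmooth_rdiff smooth_projL Uz; have rV := mxsmooth_rdiff smooth_projV Uz.
have rW := mxrdiff_conj rV; have c0 k := rdiff_cst k z.
have d1 := mxrdiffZ (c0 lam) rW; have d2 := mxrdiffZ (c0 lam^-1) rV.
rewrite /loopf /loop (mxwirtD _ (mxrdiffD rL d1) d2) (mxwirtD _ rL d1).
rewrite (mxwirtZ _ (c0 _) rW) (mxwirtZ _ (c0 _) rV) !wirt_cst !scale0r !add0r.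
rewrite (dZ_projL Uz) (dZ_projV Uz) (dZ_projW Uz).
have a := ad_at ad Uz.
have [d pE] := inW_span a (inW_isoW oU ad Uz); have [dh phE] := inW_span a (inW_isoW' oU ad Uz).
have Vbp : Pv z *m p z = 0 by rewrite pE mulmxA (projV_Vb a) mul0mx.
have Vbph : Pv z *m ph z = 0 by rewrite phE mulmxA (projV_Vb a) mul0mx.
have Lp : P0 z *m p z = 0 by rewrite pE mulmxA (projL_Vb a) mul0mx.
have Lph : P0 z *m ph z = 0 by rewrite phE mulmxA (projL_Vb a) mul0mx.
have Wp : Pw z *m p z = p z by rewrite pE mulmxA (projW_Vb a).
have Wph : Pw z *m ph z = ph z by rewrite phE mulmxA (projW_Vb a).
have LA : P0 z *m A z = 0 by rewrite mul_mapL Lp Lph !mul0mx addr0 oppr0 mul0mx.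
have LB : P0 z *m B z = B z by rewrite mul_mapV (projL_Y a) (projL_Yh a).
have WA : Pw z *m A z = A z by rewrite mul_mapL Wp Wph.
have WB : Pw z *m B z = 0 by rewrite mul_mapV (projW_Y a) (projW_Yh a) !mul0mx addr0 mul0mx.
have VA : Pv z *m A z = 0 by rewrite mul_mapL Vbp Vbph !mul0mx addr0 oppr0 mul0mx.
have VB : Pv z *m B z = 0 by rewrite mul_mapV (projV_Y a) (projV_Yh a) !mul0mx addr0 mul0mx.
rewrite !mulmxDl !mulmxDr -!scalemxAl LA LB WA WB VA VB !scaler0 !addr0 add0r.
move: (A z) (B z) => X Z.
by apply/matrixP => i j; rewrite !mxE; field.
Qed.

Lemma circle_inv (lam : C) : circle lam -> lam != 0 /\ lam^* = lam^-1.
Proof.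
move=> h; have n1 : `|lam| = 1 by exact: h.
by rewrite -normr_eq0 n1 oner_eq0 invC_norm n1 expr1n invr1 mul1r.
Qed.

Lemma dB_loopf lam z : U z -> circle lam ->
  dB (loopf lam) z = (lam - 1) *: (loopf lam z *m mxconj (T z)).
Proof.
move=> Uz hl; have [l0 lc] := circle_inv hl.
have r u : U u -> mxconj (loopf lam u) = loopf lam u by move=> Uu; exact: (loop_conj (ad_at ad Uu) hl).
rewrite (mxwirt_real _ oU (smooth_loopf lam) r Uz) conjCi (dZ_loopf Uz l0) mxconjZ mxconjM (r z Uz).
by rewrite -lc rmorphB rmorph1 /= conjCK.
Qed.

Lemma smooth_mapT : mxsmooth U (fun z => T z).
Proof.
exact: (mxsmoothD oU (mxsmoothM oU (mxsmoothN oU (mxsmoothD oU (mxsmooth_dyad oU sp sYh)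
  (mxsmooth_dyad oU sph sY))) (mxsmooth_cst oU J)) (mxsmoothM oU (mxsmoothD oU (mxsmooth_dyad oU sY sph)
  (mxsmooth_dyad oU sYh sp)) (mxsmooth_cst oU J))).
Qed.

(** The harmonic map equation of the Cartan embedding: its Maurer-Cartan forms are -2 times [T] and
    its conjugate, up to conjugation by [Sg]. *)
Lemma dB_mapT z : U z -> dB (fun z => T z) z + mxconj (dB (fun z => T z) z) = 0.
Proof.
move=> Uz; have rp := mxsmooth_rdiff sp Uz; have rph := mxsmooth_rdiff sph Uz.
have rY := ad_dY ad Uz; have rYh := ad_dYh ad Uz.
have d1 := mxrdiffD (mxrdiff_dyad rp rYh) (mxrdiff_dyad rph rY).
have d2 := mxrdiffD (mxrdiff_dyad rY rph) (mxrdiff_dyad rYh rp).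
have JZ := mxrdiff_cst J z.
rewrite /mapL /mapV (mxwirtD _ (mxrdiffM (mxrdiffN d1) JZ) (mxrdiffM d2 JZ)).
rewrite (mxwirtMr _ _ (mxrdiffN d1)) (mxwirtMr _ _ d2) (mxwirtN _ d1).
rewrite (mxwirtD _ (mxrdiff_dyad rp rYh) (mxrdiff_dyad rph rY)).
rewrite (mxwirtD _ (mxrdiff_dyad rY rph) (mxrdiff_dyad rYh rp)) !mxwirt_dyad //.
rewrite (dB_YE oU ad Uz) (dB_YhE oU ad Uz) (dB_isoW oU ad Uz) (dB_isoW oU ads Uz).
rewrite (conn_sym oU ad Uz) rmorphN opprK.
have e : ip (ph z) (mxconj (p z)) = (ip (p z) (mxconj (ph z)))^* by rewrite ip_conj mxconjK ipC.
have ry := ad_rY ad Uz; have ryh := ad_rYh ad Uz.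
rewrite -mulmxDl mxconjM conjJ -mulmxDl e dB_dyads.
by rewrite (skew_dyads (p z) (ph z) _ ry ryh) mul0mx.
Qed.
End LoopDerivative.

Section Laurent.
Variables (K : fieldType) (L : lmodType K).
Lemma laurent3 (lam : K) (G : nat -> L) :
  \sum_(j < (2 * 1).+1) lam ^ (j%:Z - 1%:Z) *: G j = lam^-1 *: G 0%N + G 1%N + lam *: G 2%N.
Proof.
rewrite -(big_mkord xpredT (fun j => lam ^ (j%:Z - 1%:Z) *: G j)) /=.
by rewrite !big_nat_recl // big_geq // addr0 /= addrA; congr (_ + _ + _); rewrite scale1r.
Qed.
Lemma laurent5 (lam : K) (G : nat -> L) :
  \sum_(j < (2 * 2).+1) lam ^ (j%:Z - 2%:Z) *: G j =
  lam ^- 2 *: G 0%N + lam^-1 *: G 1%N + G 2%N + lam *: G 3%N + lam ^+ 2 *: G 4%N.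
Proof.
rewrite -(big_mkord xpredT (fun j => lam ^ (j%:Z - 2%:Z) *: G j)) /=.
rewrite !big_nat_recl // big_geq // addr0 /= !addrA.
by congr (_ + _ + _ + _ + _); rewrite scale1r.
Qed.
Lemma laurent_conj n (lam : K) (c0 c1 c2 X : 'M[K]_n) : lam != 0 ->
  (lam^-1 *: c0 + c1 + lam *: c2) *m X *m (lam *: c0 + c1 + lam^-1 *: c2) =
  lam ^- 2 *: (c0 *m (X *m c2)) + lam^-1 *: (c0 *m (X *m c1) + c1 *m (X *m c2)) +
  (c0 *m (X *m c0) + c1 *m (X *m c1) + c2 *m (X *m c2)) +
  lam *: (c1 *m (X *m c0) + c2 *m (X *m c1)) + lam ^+ 2 *: (c2 *m (X *m c0)).
Proof.
move=> l0; rewrite !mulmxDl !mulmxDr -!scalemxAl -!scalemxAr !mulmxA.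
move: (c0 *m X *m c0) (c0 *m X *m c1) (c0 *m X *m c2) (c1 *m X *m c0) (c1 *m X *m c1)
  (c1 *m X *m c2) (c2 *m X *m c0) (c2 *m X *m c1) (c2 *m X *m c2) => x1 x2 x3 x4 x5 x6 x7 x8 x9.
by apply/matrixP => i j; rewrite !mxlinE; field.
Qed.
End Laurent.

(** * The Cartan embedding has uniton number at most 2 *)

Section FiniteUniton.
Variables (R : realType) (m : nat).
Local Notation C := (Cx R).
Local Notation dim := (m.*2.+2).
Local Notation J := (mink R m.*2.+1).
Local Notation dZ := (mxwirt (- 'i)).
Local Notation dB := (mxwirt 'i).
Local Notation S := (Sg R m).
Variables (U : set C) (F : C -> 'M[C]_dim) (V : C -> 'M[C]_(dim, m)).
Let Y z := Y_of (F z).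
Let Yh z := Yhat_of (F z).
Hypotheses (oU : open U) (ad : adapted U Y Yh V) (SF : forall z, U z -> SOp (F z)).
Local Notation f := (cartan F).
Local Notation P0 z := (projL (Y z) (Yh z)).
Local Notation Pv z := (projV (V z)).
Local Notation A z := (mapL (Y z) (Yh z) (isoW Y Yh z) (isoW Yh Y z)).
Local Notation B z := (mapV (Y z) (Yh z) (isoW Y Yh z) (isoW Yh Y z)).
Local Notation T z := (A z + B z).

Lemma conj_by_S (M N : 'M[C]_dim) : S *m M *m S *m (S *m N *m S) = S *m (M *m N) *m S.
Proof. by rewrite -!mulmxA (mulmxA S S) (SgSg R m) mul1mx. Qed.
Lemma S1S : S *m 1%:M *m S = 1%:M.
Proof. by rewrite mulmx1 (SgSg R m). Qed.
Lemma inv_of n (M N : 'M[C]_n) : M *m N = 1%:M -> invmx M = N.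
Proof. by move=> h; have [u _] := mulmx1_unit h; rewrite -[N](mulKmx u) h mulmx1. Qed.

Let fE z : U z -> (1%:M - 2 *: P0 z) *m S = f z.
Proof. by move=> Uz; rewrite (cartanE (SF Uz)). Qed.
Lemma cartan_refl z : U z -> (1%:M - 2 *: P0 z) *m (1%:M - 2 *: P0 z) = 1%:M.
Proof.
move=> Uz; have := projLL (ad_at ad Uz); move: (P0 z) => P PP.
rewrite mulmxBl mul1mx mulmxBr mulmx1 -scalemxAl -scalemxAr PP.
by apply/matrixP => i j; rewrite !mxlinE; ring.
Qed.
Lemma smooth_cartan0 : mxsmooth U (fun z => (1%:M - 2 *: P0 z) *m S).
Proof.
exact: (mxsmoothM oU (mxsmoothB oU (mxsmooth_cst oU _) (mxsmoothZ oU (smooth_cst oU 2)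
  (smooth_projL oU ad))) (mxsmooth_cst oU S)).
Qed.
Lemma smooth_cartan : mxsmooth U f. Proof. exact: (mxsmooth_ext oU fE smooth_cartan0). Qed.
Lemma SOp_cartan z : U z -> SOp (f z).
Proof. by move=> Uz; exact: (SOpM (SF Uz) (SOp_inv (SOp_sigma (SF Uz)))). Qed.

Lemma projL_mapL z : U z -> P0 z *m A z = 0.
Proof.
move=> Uz; have a := ad_at ad Uz.
have [d pE] := inW_span a (inW_isoW oU ad Uz); have [dh phE] := inW_span a (inW_isoW' oU ad Uz).
by rewrite mul_mapL pE phE !mulmxA (projL_Vb a) !mul0mx addr0 oppr0 mul0mx.
Qed.
Lemma projL_mapV z : U z -> P0 z *m B z = B z.
Proof. by move=> Uz; have a := ad_at ad Uz; rewrite mul_mapV (projL_Y a) (projL_Yh a). Qed.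

(** The reflection [1 - 2 P0] fixes [A], whose image is orthogonal to the plane, and reverses [B];
    it thereby turns [A - B] into [T]. *)
Lemma mc_z_cartan z : U z -> mc_z f z = - 2 *: (S *m T z *m S).
Proof.
move=> Uz; have rL := mxsmooth_rdiff (smooth_projL oU ad) Uz.
have rZ := mxrdiffZ (rdiff_cst 2 z) rL.
have dfE : dZ f z = - 2 *: (A z - B z) *m S.
  rewrite -(mxwirt_eq oU (- 'i) smooth_cartan0 fE Uz) (mxwirtMr _ _ (mxrdiffB (mxrdiff_cst _ z) rZ)).
  rewrite (mxwirtB _ (mxrdiff_cst _ z) rZ) mxwirt_cst (mxwirtZ _ (rdiff_cst 2 z) rL).
  by rewrite wirt_cst scale0r !add0r (dZ_projL oU ad Uz) scaleNr.
have fV : invmx (f z) = S *m (1%:M - 2 *: P0 z).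
  by apply: inv_of; rewrite -(fE Uz) mulmxA -(mulmxA _ S S) (SgSg R m) mulmx1 (cartan_refl Uz).
have h : (1%:M - 2 *: P0 z) *m (A z - B z) = T z.
  rewrite mulmxBl mul1mx -scalemxAl mulmxBr (projL_mapL Uz) (projL_mapV Uz) sub0r scalerN opprK.
  by move: (A z) (B z) => X Z; apply/matrixP => i j; rewrite !mxlinE; ring.
by rewrite /mc_z mxdzE dfE fV -scalemxAl -scalemxAr !mulmxA -(mulmxA S _ (_ - _)) h.
Qed.

Lemma mc_zb_cartan z : U z -> mc_zb f z = - 2 *: (S *m mxconj (T z) *m S).
Proof.
move=> Uz.
have rf u : U u -> mxconj (f u) = f u.
  by move=> Uu; have [r _ _ _] := SOp_cartan Uu; apply/eqP; rewrite -mxconj_real.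
have [_ hf _ _] := SOp_cartan Uz.
have -> : mc_zb f z = mxconj (mc_z f z).
  rewrite /mc_zb /mc_z mxdzbE mxdzE (mxwirt_real _ oU smooth_cartan rf Uz) conjCi mxconjM.
  by rewrite (mxconj_inv (orth_unit hf)) (rf z Uz).
by rewrite (mc_z_cartan Uz) mxconjZ !mxconjM (Sg_conj R m) rmorphN rmorph_nat.
Qed.

Lemma cartan_harmonic : harmonic_in_G U f.
Proof.
split; [exact: smooth_cartan|exact: SOp_cartan|move=> z Uz].
have sT := smooth_mapT oU ad; have sTb := mxsmooth_conj oU sT; have cS := mxsmooth_cst oU S.
have e c (M : C -> 'M[C]_dim) g : mxsmooth U M -> (forall u, U u -> g u = - 2 *: (S *m M u *m S)) ->
    mxwirt c g z = - 2 *: (S *m mxwirt c M z *m S).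
  move=> sM h; have rM := mxsmooth_rdiff sM Uz.
  have s2 := mxsmoothZ oU (smooth_cst oU (- 2)) (mxsmoothM oU (mxsmoothM oU cS sM) cS).
  rewrite -(mxwirt_eq oU c s2 (fun u Uu => esym (h u Uu)) Uz).
  have r1 := mxrdiffM (mxrdiff_cst S z) rM.
  rewrite (mxwirtZ _ (rdiff_cst _ z) (mxrdiffM r1 (mxrdiff_cst S z))) wirt_cst scale0r add0r.
  by rewrite (mxwirtMr _ _ r1) (mxwirtMl _ _ rM).
rewrite mxdzbE mxdzE (e 'i _ _ sT mc_z_cartan) (e (- 'i) _ _ sTb mc_zb_cartan).
rewrite (mxwirt_conj _ (mxsmooth_rdiff sT Uz)) conjNi -scalerDr -mulmxDl -mulmxDr.
by rewrite (dB_mapT oU ad Uz) mulmx0 mul0mx scaler0.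
Qed.

(** The conjugation matches the right factor [Sg] of the Cartan embedding, which conjugates its
    Maurer-Cartan forms. *)
Definition ext_sol z lam := S *m loop (Y z) (Yh z) (V z) lam *m S.

(** A square root of [lam] is again on the circle, where the loop is real and preserves [J]; by
    multiplicativity the value at [lam] is the square of such a matrix. *)
Lemma ext_sol_SOp z lam : U z -> circle lam -> SOp (ext_sol z lam).
Proof.
move=> Uz hl; have a := ad_at ad Uz; apply: SOp_sigma.
have mu2 : sqrtC lam * sqrtC lam = lam by rewrite -expr2 sqrtCK.
have hm : circle (sqrtC lam).
  have n1 : `|lam| = 1 by exact: hl.
  have : `|sqrtC lam| ^+ 2 = 1 by rewrite -normrX sqrtCK.
  by move/eqP; rewrite sqrp_eq1 // => /eqP.
have [m0 _] := circle_inv hm.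
rewrite -mu2 -(loopM a); apply: SOp_sqr.
  by rewrite mxconj_real (loop_conj a hm).
exact: (loop_orth a m0).
Qed.

Lemma ext_sol_inv z lam : U z -> circle lam -> invmx (ext_sol z lam) = ext_sol z lam^-1.
Proof.
move=> Uz hl; have [l0 _] := circle_inv hl; have a := ad_at ad Uz.
by apply: inv_of; rewrite /ext_sol conj_by_S (loopM a) mulfV // (loop1 a) S1S.
Qed.

Lemma ext_sol_extended : extended_solution U f ext_sol.
Proof.
have cS := mxsmooth_cst oU S; split=> [lam _|z Uz].
  exact: (mxsmoothM oU (mxsmoothM oU cS (smooth_loopf oU ad lam)) cS).
have a := ad_at ad Uz; split=> [|lam hl]; first by rewrite /ext_sol (loop1 a) S1S.
have [l0 lc] := circle_inv hl.
have rl := mxsmooth_rdiff (smooth_loopf oU ad lam) Uz.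
have d c : mxwirt c (ext_sol^~ lam) z = S *m mxwirt c (loopf Y Yh V lam) z *m S.
  by rewrite (mxwirtMr _ _ (mxrdiffM (mxrdiff_cst S z) rl)) (mxwirtMl _ _ rl).
have lK M : loop (Y z) (Yh z) (V z) lam^-1 *m (loopf Y Yh V lam z *m M) = M.
  by rewrite mulmxA (loopM a) mulVf // (loop1 a) mul1mx.
split; first exact: ext_sol_SOp.
- rewrite mxdzE d (dZ_loopf oU ad Uz l0) (ext_sol_inv Uz hl) conj_by_S -scalemxAr lK (mc_z_cartan Uz).
  rewrite -scalemxAr -scalemxAl scalerA; congr (_ *: _); by field.
- rewrite mxdzbE d (dB_loopf oU ad Uz hl) (ext_sol_inv Uz hl) conj_by_S -scalemxAr lK (mc_zb_cartan Uz).
  rewrite -scalemxAr -scalemxAl scalerA; congr (_ *: _); by field.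
Qed.

Definition lr (M N : 'M[C]_dim) : {linear 'M[C]_dim -> 'M[C]_dim} := mulmx M \o mulmxr N.

Lemma ext_sol_algebraic z : U z -> algebraic_loop 2 (ext_sol z).
Proof.
move=> Uz; have a := ad_at ad Uz.
pose c0 := S *m Pv z *m S; pose c1 := S *m P0 z *m S; pose c2 := S *m mxconj (Pv z) *m S.
have cE lam : ext_sol z lam = lam^-1 *: c0 + c1 + lam *: c2.
  rewrite /ext_sol /c0 /c1 /c2 /loop; move: (P0 z) (mxconj (Pv z)) (Pv z) S => X1 X2 X3 X4.
  by rewrite !mulmxDr !mulmxDl -!scalemxAr -!scalemxAl addrC addrA.
split.
- by rewrite /ext_sol (loop1 a) S1S.
- by move=> lam; exact: ext_sol_SOp.
- exists 1%N, (fun j => nth 0 [:: c0; c1; c2] j) => lam hl.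
  by rewrite cE (@laurent3 _ _ lam (fun j => nth 0 [:: c0; c1; c2] j)).
(* The inverse is the loop at [lam^-1], so the conjugate of [X] is a product of Laurent polynomials
   with exponents -1, 0, 1; [Tj] collects the terms of exponent [j - 2]. *)
- pose Tj (j : nat) : {linear 'M[C]_dim -> 'M[C]_dim} :=
    match j with
    | 0%N => lr c0 c2
    | 1%N => lr c0 c1 \+ lr c1 c2
    | 2%N => lr c0 c0 \+ lr c1 c1 \+ lr c2 c2
    | 3%N => lr c1 c0 \+ lr c2 c1
    | _ => lr c2 c0
    end.
  exists Tj => lam hl X _; have [l0 _] := circle_inv hl.
  rewrite (ext_sol_inv Uz hl) !cE invrK (@laurent5 _ _ lam (fun j => Tj j X)) /=.
  exact: (laurent_conj c0 c1 c2 X l0).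
Qed.

Lemma finite_uniton : finite_uniton_number_at_most 2 U F.
Proof.
split; first exact: cartan_harmonic.
exists ext_sol; split; first exact: ext_sol_extended.
exact: ext_sol_algebraic.
Qed.
End FiniteUniton.

(** * The normalized potential *)

Section PairSums.
Lemma sum_pairs (M : nmodType) m (F : nat -> M) :
  \sum_(k < m.*2) F k = \sum_(j < m) (F j.*2 + F j.*2.+1).
Proof.
elim: m => [|m IH]; first by rewrite !big_ord0.
by rewrite doubleS !big_ord_recr /= IH addrA.
Qed.
End PairSums.

Section Rotations.
Variables (R : realType) (m : nat).
Local Notation C := (Cx R).
Local Notation dim := (m.*2.+2).
Local Notation J := (mink R m.*2.+1).

(* The columns of [Q^T] are the isotropic vectors with entries [1, 'i] in the
   positions of one pair; [B1] is a combination of the rows of [Q]. *)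
Definition pairQ : 'M[C]_(m, m.*2) :=
  \matrix_(j < m, k < m.*2) (if k./2 == j :> nat then if odd k then 'i else 1 else 0).
Local Notation Q := pairQ.
Local Notation Qb := (mxconj pairQ).

Lemma pairQ_mul (a b : bool -> C) :
  (\matrix_(j < m, k < m.*2) (if k./2 == j :> nat then a (odd k) else 0)) *m
  (\matrix_(j < m, k < m.*2) (if k./2 == j :> nat then b (odd k) else 0))^T =
  (a false * b false + a true * b true)%:M.
Proof.
apply/matrixP => i j; rewrite !mxE.
pose G (k : nat) := (if k./2 == i then a (odd k) else 0) * (if k./2 == j then b (odd k) else 0).
transitivity (\sum_(k < m.*2) G k); first by apply: eq_bigr => k _; rewrite !mxE.
rewrite sum_pairs /G (bigD1 i) //= big1 => [|k ki].
  rewrite addr0 /= doubleK uphalf_double !eqxx odd_double /=.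
  case: (i =P j) => [->|ij]; first by rewrite eqxx mulr1n.
  have -> : (i == j :> nat) = false by apply/eqP => /val_inj.
  by rewrite !mulr0 addr0 mulr0n.
have h : (k == i :> nat) = false by apply: contraNF ki => /eqP /val_inj ->.
by rewrite /= doubleK uphalf_double h !mul0r addr0.
Qed.

Definition unit_of (b : bool) : C := if b then 'i else 1.
Lemma QE : Q = \matrix_(j < m, k < m.*2) (if k./2 == j :> nat then unit_of (odd k) else 0).
Proof. by []. Qed.
Lemma QbE : Qb = \matrix_(j < m, k < m.*2) (if k./2 == j :> nat then (unit_of (odd k))^* else 0).
Proof. by apply/matrixP => j k; rewrite mxconjE !mxE; case: eqP; rewrite ?rmorph0. Qed.
Let ii : 'i * 'i = -1 :> C. Proof. by rewrite -expr2 sqrCi. Qed.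
Lemma QQ : Q *m Q^T = 0.
Proof. by rewrite QE pairQ_mul /unit_of mulr1 ii subrr raddf0. Qed.
Lemma QQb : Q *m Qb^T = 2%:M.
Proof.
rewrite {1}QE QbE (pairQ_mul unit_of (fun b => (unit_of b)^*)) /unit_of rmorph1 mulr1 conjCi.
by rewrite mulrN ii opprK.
Qed.
Lemma QbQ : Qb *m Q^T = 2%:M.
Proof. by rewrite -[LHS]trmxK trmx_mul trmxK QQb tr_scalar_mx. Qed.
Lemma QbQb : Qb *m Qb^T = 0.
Proof. by rewrite -mxconj_tr -mxconjM QQ mxconj0. Qed.

Lemma pair_complete : Q^T *m Qb + Qb^T *m Q = 2%:M.
Proof.
apply/matrixP => k l; rewrite [LHS]mxE [X in X + _]mxE [X in _ + X]mxE -big_split /=.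
have kl : (k./2 < m)%N by rewrite ltn_half_double.
rewrite (bigD1 (Ordinal kl)) //= big1 => [|j jk]; last first.
  have h : (k./2 == j) = false by apply: contraNF jk => /eqP h; apply/eqP; apply: val_inj.
  by rewrite ![_^T _ _]mxE !mxconjE !mxE h rmorph0 !mul0r addr0.
rewrite ![_^T _ _]mxE !mxconjE !mxE eqxx addr0 /=.
case: (k =P l) => [->|nkl].
  rewrite eqxx mulr1n; case: (odd l); rewrite ?rmorph1 ?conjCi ?mulNr ?mulrN ?ii ?opprK ?mulr1 //.
rewrite mulr0n; case: eqP => [e|_]; last by rewrite rmorph0 !mulr0 addr0.
have : odd k != odd l.
  apply/eqP => o; apply: nkl; apply: val_inj.
  by rewrite /= -(odd_double_half k) -(odd_double_half l) e o.
by case: (odd k); case: (odd l) => // _; rewrite ?rmorph1 ?conjCi ?mulr1 ?mul1r ?subrr ?addNr.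
Qed.

(** The halves compensate [Qb *m Q^T = 2%:M]. On the circle the two terms are conjugate to each
    other, so [rotQ mu] is a real rotation in the plane of every pair. *)
Definition rotQ (mu : C) : 'M[C]_(m.*2) :=
  (mu / 2) *: (Q^T *m Qb) + (mu^-1 / 2) *: (Qb^T *m Q).
Lemma rotQ1 : rotQ 1 = 1%:M.
Proof.
rewrite /rotQ invr1 -scalerDr pair_complete scale_scalar_mx div1r mulVf //.
by rewrite pnatr_eq0.
Qed.
Lemma rotQM a b : rotQ a *m rotQ b = rotQ (a * b).
Proof.
have n2 : (2 : C) != 0 by rewrite pnatr_eq0.
have e1 : Q^T *m Qb *m (Q^T *m Qb) = 2 *: (Q^T *m Qb).
  by rewrite !mulmxA -(mulmxA _ Qb) QbQ mul_mx_scalar -scalemxAl.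
have e2 : Q^T *m Qb *m (Qb^T *m Q) = 0 by rewrite !mulmxA -(mulmxA _ Qb) QbQb mulmx0 mul0mx.
have e3 : Qb^T *m Q *m (Q^T *m Qb) = 0 by rewrite !mulmxA -(mulmxA _ Q) QQ mulmx0 mul0mx.
have e4 : Qb^T *m Q *m (Qb^T *m Q) = 2 *: (Qb^T *m Q).
  by rewrite !mulmxA -(mulmxA _ Q) QQb mul_mx_scalar -scalemxAl.
rewrite /rotQ invfM; move: (Q^T *m Qb) (Qb^T *m Q) e1 e2 e3 e4 (a^-1) (b^-1) => X Z e1 e2 e3 e4 a' b'.
rewrite mulmxDl !mulmxDr -!scalemxAl -!scalemxAr e1 e2 e3 e4 !scaler0 addr0 add0r !scalerA.
by congr (_ *: _ + _ *: _); field.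
Qed.
Lemma rotQ_tr a : (rotQ a)^T = rotQ a^-1.
Proof.
have e1 : (Q^T *m Qb)^T = Qb^T *m Q by rewrite trmx_mul trmxK.
have e2 : (Qb^T *m Q)^T = Q^T *m Qb by rewrite trmx_mul trmxK.
rewrite /rotQ invrK; move: (Q^T *m Qb) (Qb^T *m Q) e1 e2 (a^-1) => X Z e1 e2 b.
by rewrite linearD !linearZ /= e1 e2 addrC.
Qed.
Lemma rotQ_conj a : circle a -> mxconj (rotQ a) = rotQ a.
Proof.
move=> ha; have [a1 a2] : a^* = a^-1 /\ (a^-1)^* = a.
  have n1 : `|a| = 1 by exact: ha.
  have e : a^-1 = a^* by rewrite invC_norm n1 expr1n invr1 mul1r.
  by rewrite e conjCK.
have e1 : mxconj (Q^T *m Qb) = Qb^T *m Q by rewrite mxconjM mxconj_tr mxconjK.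
have e2 : mxconj (Qb^T *m Q) = Q^T *m Qb by rewrite mxconjM mxconj_tr mxconjK.
rewrite /rotQ mxconjD !mxconjZ !rmorphM /= a1 a2 fmorphV rmorph_nat e1 e2.
by rewrite addrC.
Qed.
Lemma mulQ_rot a : Q *m rotQ a = a^-1 *: Q.
Proof.
rewrite /rotQ mulmxDr -!scalemxAr !mulmxA QQ mul0mx scaler0 add0r QQb mul_scalar_mx scalerA.
by rewrite divfK // pnatr_eq0.
Qed.
Lemma rot_mulQb a : rotQ a *m Qb^T = a^-1 *: Qb^T.
Proof.
rewrite /rotQ mulmxDl -!scalemxAl -!mulmxA QbQb mulmx0 scaler0 add0r QQb mul_mx_scalar scalerA.
by rewrite divfK // pnatr_eq0.
Qed.

Section Blocks.
Variable K : pzRingType.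
Local Notation n := (m.*2).
(** The sizes [m.*2.+2] and [2 + m.*2] agree by conversion; fixing the type here keeps rewriting
    with block matrices from meeting the second form. *)
Definition dblk (a : 'M[K]_2) (b : 'M[K]_(2, n)) (c : 'M[K]_(n, 2)) (d : 'M[K]_n) : 'M[K]_dim :=
  (block_mx a b c d : 'M_(2 + n)).
Definition dcol k (u : 'M[K]_(2, k)) (v : 'M[K]_(n, k)) : 'M[K]_(dim, k) :=
  (col_mx u v : 'M_(2 + n, k)).
Definition drow k (u : 'M[K]_(k, 2)) (v : 'M[K]_(k, n)) : 'M[K]_(k, dim) :=
  (row_mx u v : 'M_(k, 2 + n)).
Lemma dblk_col k a b c d (u : 'M[K]_(2, k)) v :
  dblk a b c d *m dcol u v = dcol (a *m u + b *m v) (c *m u + d *m v).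
Proof. exact: (@mul_block_col K 2 n 2 n k a b c d u v). Qed.
Lemma drow_blk k a b c d (u : 'M[K]_(k, 2)) v :
  drow u v *m dblk a b c d = drow (u *m a + v *m c) (u *m b + v *m d).
Proof. exact: (@mul_row_block K k 2 n 2 n u v a b c d). Qed.
Lemma drow_col k l (u : 'M[K]_(k, 2)) v (u' : 'M[K]_(2, l)) v' :
  drow u v *m dcol u' v' = u *m u' + v *m v'.
Proof. exact: (@mul_row_col K k 2 n l u v u' v'). Qed.
Lemma dblkM a b c d a' b' c' d' : dblk a b c d *m dblk a' b' c' d' =
  dblk (a *m a' + b *m c') (a *m b' + b *m d') (c *m a' + d *m c') (c *m b' + d *m d').
Proof. exact: (@mulmx_block K 2 n 2 n 2 n a b c d a' b' c' d'). Qed.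
Lemma mul_drow k l (x : 'M[K]_(l, k)) (u : 'M[K]_(k, 2)) v : x *m drow u v = drow (x *m u) (x *m v).
Proof. exact: (@mul_mx_row K l k 2 n x u v). Qed.
Lemma dblk_tr a b c d : (dblk a b c d)^T = dblk a^T c^T b^T d^T.
Proof. exact: (@tr_block_mx K 2 n 2 n a b c d). Qed.
Lemma dcol_tr k (u : 'M[K]_(2, k)) v : (dcol u v)^T = drow u^T v^T.
Proof. exact: (@tr_col_mx K 2 n k u v). Qed.
Lemma dblkD a b c d a' b' c' d' : dblk a b c d + dblk a' b' c' d' =
  dblk (a + a') (b + b') (c + c') (d + d').
Proof. exact: (@add_block_mx K 2 n 2 n a b c d a' b' c' d'). Qed.
Lemma dblkZ x a b c d : x *: dblk a b c d = dblk (x *: a) (x *: b) (x *: c) (x *: d).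
Proof. exact: (@scale_block_mx K 2 n 2 n x a b c d). Qed.
Lemma dcolZ x k (u : 'M[K]_(2, k)) v : x *: dcol u v = dcol (x *: u) (x *: v).
Proof. exact: (@scale_col_mx K 2 n k x u v). Qed.
Lemma dblk0 : dblk 0 0 0 0 = 0. Proof. exact: (@block_mx0 K 2 n 2 n). Qed.
Lemma dblk1 : dblk 1%:M 0 0 1%:M = 1%:M. Proof. by rewrite /dblk -scalar_mx_block. Qed.
End Blocks.

Definition rot mu : 'M[C]_dim := dblk 1%:M 0 0 (rotQ mu).
Definition N0 : 'M[C]_(dim, m) := dcol 0 Qb^T.
Definition E0 : 'M[C]_(2, dim) := drow 1%:M 0.
Definition K1 : 'M[C]_2 := mink R 1.

Lemma J_block : J = dblk K1 0 0 1%:M.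
Proof.
rewrite /dblk -diag_const_mx /K1 /mink -diag_mx_row; congr diag_mx; apply/rowP => j; rewrite !mxE.
case: splitP => k jk; rewrite !mxE -!val_eqE /= jk //.
Qed.
Lemma rotM a b : rot a *m rot b = rot (a * b).
Proof. by rewrite /rot dblkM rotQM !mulmx0 !mul0mx mulmx1 !addr0 add0r. Qed.
Lemma rot1 : rot 1 = 1%:M.
Proof. by rewrite /rot rotQ1 dblk1. Qed.
Lemma rot_conj a : circle a -> mxconj (rot a) = rot a.
Proof.
move=> ha; rewrite /rot; have rr := rotQ_conj ha; move: (rotQ a) rr => r rr.
apply/matrixP => i j; rewrite mxconjE /dblk !mxE; case: splitP => k _; rewrite !mxE;
  case: splitP => l _; rewrite ?mxE ?rmorph0 ?rmorph_nat //.
by rewrite -[in RHS]rr mxconjE.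
Qed.
Lemma rot_N0 a : rot a *m N0 = a^-1 *: N0.
Proof. by rewrite /rot /N0 dblk_col !mulmx0 !mul0mx addr0 add0r rot_mulQb dcolZ scaler0. Qed.
Lemma E0_rot a : E0 *m rot a = E0.
Proof. by rewrite /E0 /rot drow_blk !mulmx0 !mul0mx mulmx1 !addr0. Qed.
Lemma E0_mul k (M : 'M[C]_(dim, k)) (i : 'I_2) (i' : 'I_dim) j : i = i' :> nat ->
  (E0 *m M) i j = M i' j.
Proof.
move=> e; have ME : M = dcol (@usubmx _ 2 m.*2 k M) (@dsubmx _ 2 m.*2 k M) by rewrite /dcol vsubmxK.
rewrite {1}ME /E0 drow_col mul1mx mul0mx addr0 mxE; congr (M _ _).
by apply: val_inj; rewrite /= e.
Qed.
Lemma E0_dblk (a : 'M[C]_2) b : E0 *m dblk a 0 0 b = a *m E0.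
Proof. by rewrite /E0 drow_blk mul_drow !mulmx0 !mul0mx mul1mx mulmx1 addr0 add0r. Qed.
Lemma N0JN0 : N0^T *m J *m N0 = 0.
Proof.
rewrite J_block /N0 dcol_tr drow_blk drow_col !mulmx0 trmxK mulmx1 !add0r.
exact: QbQb.
Qed.
Lemma N0_free (c : 'cV[C]_m) : N0 *m c = 0 -> c = 0.
Proof.
have h : drow 0 Q *m N0 = 2%:M :> 'M_m by rewrite /N0 drow_col mul0mx add0r QQb.
move=> e; have := congr1 (mulmx (drow 0 Q)) e.
by rewrite mulmxA h mulmx0 mul_scalar_mx => /eqP; rewrite scaler_eq0 pnatr_eq0 /= => /eqP.
Qed.

Section Potential.
Variables (h hh : 'I_m -> C -> C) (z : C).
Definition coefH : 'M[C]_(2, m) := \matrix_(r < 2, j < m) (if r == ord0 then h else hh) j z.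
Lemma B1E : B1 h hh z = coefH *m Q.
Proof.
apply/matrixP => r k; rewrite !mxE (bigD1 (pair_index k)) //= big1 => [|j jk].
  by rewrite !mxE eqxx addr0 mulrC.
rewrite !mxE (_ : (k./2 == j) = false) ?mulr0 //.
by apply: contraNF jk => /eqP e; apply/eqP; apply: val_inj.
Qed.
Local Notation et := (eta_m1 h hh z).
Lemma etaE : et = dblk 0 (coefH *m Q) (- (Q^T *m coefH^T *m K1)) 0.
Proof. by rewrite /eta_m1 B1E trmx_mul. Qed.
Lemma eta_skew : et^T *m J + J *m et = 0.
Proof.
have KK : K1^T = K1 by rewrite /K1 tr_diag_mx.
rewrite etaE J_block dblk_tr !trmx0 !dblkM dblkD !mulmx0 !mul0mx !mulmx1 !mul1mx !addr0 !add0r.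
by rewrite linearN /= !trmx_mul !trmxK KK addNr subrr dblk0.
Qed.
Lemma rot_eta a : a != 0 -> rot a *m et = a *: (et *m rot a).
Proof.
move=> a0; rewrite etaE /rot !dblkM !mulmx0 !mul0mx !mulmx1 !mul1mx !addr0 !add0r dblkZ !scaler0.
have e : rotQ a *m Q^T = a *: Q^T.
  by rewrite -[rotQ a]trmxK rotQ_tr -trmx_mul mulQ_rot invrK linearZ.
rewrite -(mulmxA coefH) mulQ_rot -scalemxAr scalerA mulfV // scale1r.
by rewrite mulmxN !mulmxA e -!scalemxAl scalerN.
Qed.
(** The potential is off-diagonal, so [et *m N0] lives in the first two rows, where [N0] vanishes.
    This is the algebraic source of the orthogonality of V to its derivative. *)
Lemma N0Jeta : N0^T *m J *m (et *m N0) = 0.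
Proof.
rewrite etaE J_block /N0 dblk_col dcol_tr drow_blk drow_col trmx0.
by rewrite !(mulmx0, mul0mx, addr0, add0r).
Qed.
End Potential.
End Rotations.

(** * Meromorphic functions near a point *)

Section Meromorphic.
Variable R : realType.
Local Notation C := (Cx R).
Implicit Types (f g : C -> C) (U D : set C).

Lemma holomorphic_at_near f p : holomorphic_at f p -> \forall w \near p, holomorphic_at f w.
Proof.
move=> [U [oU Up hf]]; apply: filterS (near_open oU Up) => w Uw.
by exists U; split; [exact: oU|exact: Uw|exact: hf].
Qed.

(** Off [p] the function is a smooth quotient; its zbar-derivative is found from the product of [f]
    with the power of [w - p], which equals the holomorphic [g]. *)
Lemma pole_punctured f p : pole_at f p -> \forall w \near p, w != p -> holomorphic_at f w.
Proof.
move=> [n [g [_ [U [oU Up [sg hg]]] _ fg]]].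
have H : \forall w \near p, U w /\ (w != p -> f w = g w / (w - p) ^+ n).
  exact: (filterI (near_open oU Up) fg).
case/nbhs_ballP: H => e e0 he.
have oB : open (ball p e : set C) by exact: ball_open.
have oO : open ((ball p e : set C) `&` [set w | w != p]).
  apply: openI; first exact: oB.
  rewrite openE => w /= wp; have wp0 : 0 < `|w - p| by rewrite normr_gt0 subr_eq0.
  apply/nbhs_ballP; exists `|w - p| => //= u; rewrite -ball_normE /ball_ /=.
  by apply: contraTneq => ->; rewrite ltxx.
pose O := (ball p e : set C) `&` [set w | w != p].
have OU w : O w -> U w by case=> /he [].
have nz w : O w -> (w - p) ^+ n != 0 by case=> _ /= wp; rewrite expf_neq0 // subr_eq0.
have sn : smooth O (fun w => (w - p) ^+ n).
  exact: (smoothX oO n (smoothB oO (smooth_id oO) (smooth_cst oO p))).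
have sgO := smooth_sub OU sg.
have sf : smooth O f.
  apply: (smooth_ext oO _ (smoothM oO sgO (smoothV oO nz sn))) => w [/he [_ h] wp].
  by rewrite h.
have hn k w : wirt 'i (fun w => (w - p) ^+ k) w = 0.
  have r1 u : rdiff (fun w : C => w - p) u.
    exact: (smooth_rdiff (smoothB openT (smooth_id openT) (smooth_cst openT p)) I).
  have rk j u : rdiff (fun w : C => (w - p) ^+ j) u.
    exact: (smooth_rdiff (smoothX openT j (smoothB openT (smooth_id openT) (smooth_cst openT p))) I).
  have h1 : wirt 'i (fun w : C => w - p) w = 0.
    have c1 := rdiff_cst (- p) w.
    have ri : rdiff (id : C -> C) w := smooth_rdiff (smooth_id openT) I.
    rewrite (wirtD 'i ri c1) wirt_cst addr0 (wirt_val _ (is_ddir_id _ _) (is_ddir_id _ _)).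
    by rewrite -expr2 sqrCi subrr mul0r.
  elim: k => [|k IH].
    by rewrite (eq_wirt 'i w (fun u => expr0 (u - p))) wirt_cst.
  rewrite (eq_wirt 'i w (fun u => exprS (u - p) k)) (wirtM 'i (r1 w) (rk k w)) h1 IH.
  by rewrite mul0r mulr0 addr0.
apply/nbhs_ballP; exists e => // w we wp; exists O; split; [exact: oO|by split|split=> // u Ou].
have rf := smooth_rdiff sf Ou; have rn := smooth_rdiff sn Ou.
have Uu := OU u Ou; have h0 := hg u Uu; rewrite dzbE in h0.
have : wirt 'i (fun w => f w * (w - p) ^+ n) u = wirt 'i g u.
  apply: (wirt_eq oO 'i (smoothM oO sf sn) _ Ou) => v Ov; have [/he [_ h] vp] := Ov.
  by rewrite (h vp) divfK // nz.
rewrite h0 (wirtM 'i rf rn) hn mulr0 addr0 dzbE => /eqP; rewrite mulf_eq0 (negbTE (nz u Ou)) orbF.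
by move/eqP.
Qed.

Lemma meromorphic_punctured D f p : meromorphic D f -> D p ->
  \forall w \near p, w != p -> holomorphic_at f w.
Proof.
move=> mf Dp; case: (mf p Dp) => [/holomorphic_at_near h|]; last exact: pole_punctured.
by apply: filterS h => w h _.
Qed.

Section Matrices.
Variables k l : nat.
Implicit Type M : C -> 'M[C]_(k, l).
Lemma near_entries (p : C) (P : 'I_k -> 'I_l -> C -> Prop) : (forall i j, \forall w \near p, P i j w) ->
  \forall w \near p, forall i j, P i j w.
Proof.
move=> h; have h1 i : nbhs p [set w | forall j, P i j w].
  exact: (@filter_forall C _ (P i) (nbhs p) _ (h i)).
exact: (@filter_forall C _ (fun i => [set w | forall j, P i j w]) (nbhs p) _ h1).
Qed.
Lemma mxmeromorphic_punctured D M p : mxmeromorphic D M -> D p ->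
  \forall w \near p, w != p -> mxholomorphic_at M w.
Proof.
move=> mM Dp; apply: filterS (near_entries (fun i j => meromorphic_punctured (mM i j) Dp)) => w h wp i j.
exact: h.
Qed.
Lemma mxholomorphic_at_open M p : mxholomorphic_at M p ->
  exists O : set C, [/\ open O, O p & mxholomorphic O M].
Proof.
move=> hM.
have : forall ij : 'I_k * 'I_l, exists V : set C,
    [/\ open V, V p & holomorphic V (fun w => M w ij.1 ij.2)] by move=> ij; exact: hM.
move=> /choice [U hU].
have nU : \forall w \near p, forall i j, U (i, j) w.
  by apply: near_entries => i j; case: (hU (i, j)) => oU Up _; exact: near_open.
have [O [oO Op OU]] : exists O : set C, [/\ open O, O p & forall w, O w -> forall i j, U (i, j) w].
  have : nbhs p [set w | forall i j, U (i, j) w] := nU.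
  by rewrite nbhsE => -[O [oO Op] OU]; exists O; split.
exists O; split=> // i j; have [oU Up [s0 h0]] := hU (i, j).
have sO : O `<=` U (i, j) by move=> w /OU.
by split=> [|w /sO]; [exact: (smooth_sub sO s0)|exact: h0].
Qed.
Lemma mxholomorphic_at_sub (U : set C) M p : open U -> U p -> mxholomorphic U M -> mxholomorphic_at M p.
Proof. by move=> oU Up hM i j; exists U; split; [exact: oU|exact: Up|exact: hM]. Qed.
Lemma mxholomorphic_smooth (U : set C) M : mxholomorphic U M -> mxsmooth U M.
Proof. by move=> h i j; case: (h i j). Qed.
Lemma mxholomorphic_dB (U : set C) M z : mxholomorphic U M -> U z -> mxwirt 'i M z = 0.
Proof. by move=> h Uz; apply/matrixP => i j; rewrite mxwirtE mxE -dzbE; case: (h i j) => _; exact. Qed.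
End Matrices.
End Meromorphic.

(** * Rotation symmetry of the meromorphic frame *)

Section Loops.
Variables (R : realType) (m : nat).
Local Notation C := (Cx R).
Local Notation dim := (m.*2.+2).
Local Notation J := (mink R m.*2.+1).
Local Notation dZ := (mxwirt (- 'i)).
Local Notation dB := (mxwirt 'i).
Local Notation rot := (@rot R m).
Variables (D DI : set C) (h hh : 'I_m -> C -> C) (Fm : C -> C -> 'M[C]_dim).
Local Notation et := (eta_m1 h hh).
Hypotheses (np : normalized_potential D et Fm) (oD : open D) (D0 : D 0) (sDI : DI `<=` D)
  (oDI : open DI) (DI0 : DI 0)
  (starD : forall z (t : R), D z -> 0 <= t <= 1 -> D ((t%:C)%C * z))
  (holo : forall lam, circle lam -> mxholomorphic DI (Fm^~ lam)).

Lemma circle1 : circle (1 : C).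
Proof. by rewrite /circle /= normr1. Qed.

Definition mero_good lam (O : set C) : Prop :=
  [/\ open O, mxholomorphic O (Fm^~ lam) &
    forall w, O w -> dZ (Fm^~ lam) w = lam^-1 *: (Fm w lam *m et w)].

Lemma mero_good_near lam p : circle lam -> D p ->
  \forall w \near p, w != p -> exists O : set C, O w /\ mero_good lam O.
Proof.
move=> hl Dp; have [me /(_ lam hl) [mF _ dF]] := np.
have n1 := mxmeromorphic_punctured mF Dp; have n2 := mxmeromorphic_punctured me Dp.
apply: filterS (filterI (near_open oD Dp) (filterI n1 n2)) => w [Dw [h1 h2]] wp.
have [O1 [oO1 O1w hO1]] := mxholomorphic_at_open (h1 wp).
have [O2 [oO2 O2w hO2]] := mxholomorphic_at_open (h2 wp).
have oO : open ((O1 `&` O2) `&` D) by apply: openI; [exact: openI|exact: oD].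
exists ((O1 `&` O2) `&` D); split; first by [].
split.
- exact: oO.
- by move=> i j; case: (hO1 i j) => s e; split=> [|u [[/e]]//]; apply: (smooth_sub _ s) => u [[]].
- move=> u [[u1 u2] Du]; rewrite -mxdzE; apply: (dF u Du).
    exact: (mxholomorphic_at_sub oO1 u1 hO1).
  exact: (mxholomorphic_at_sub oO2 u2 hO2).
Qed.

(* [rot(lam) Fm(z, lam) rot(lam)^-1 Fm(z, 1)^-1]: both frames satisfy the same
   linear equation, so this is locally constant off the poles. *)
Definition loop_def lam z : 'M[C]_dim := rot lam *m Fm z lam *m rot lam^-1 *m (J *m (Fm z 1)^T *m J).

Lemma loop_def_flat lam O w i j : circle lam -> O w -> mero_good lam O -> mero_good 1 O ->
  flat (fun z => loop_def lam z i j) w.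
Proof.
move=> hl Ow [oO hF dF] [_ hX dX]; have [l0 _] := circle_inv hl.
have sF := mxholomorphic_smooth hF; have sX := mxholomorphic_smooth hX.
have sc (A : 'M[C]_dim) := mxsmooth_cst oO A.
have s1 := mxsmoothM oO (mxsmoothM oO (sc (rot lam)) sF) (sc (rot lam^-1)).
have s2 := mxsmoothM oO (mxsmoothM oO (sc J) (mxsmooth_tr oO sX)) (sc J).
have sM : mxsmooth O (loop_def lam) := mxsmoothM oO s1 s2.
have rF := mxsmooth_rdiff sF Ow; have rX := mxsmooth_rdiff sX Ow.
have dM c : mxwirt c (loop_def lam) w =
    rot lam *m mxwirt c (Fm^~ lam) w *m rot lam^-1 *m (J *m (Fm w 1)^T *m J) +
    rot lam *m Fm w lam *m rot lam^-1 *m (J *m (mxwirt c (Fm^~ 1) w)^T *m J).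
  have r1 := mxrdiffM (mxrdiff_cst (rot lam) w) rF.
  have r2 := mxrdiffM (mxrdiff_cst J w) (mxrdiff_tr rX).
  rewrite (mxwirtM c (mxsmooth_rdiff s1 Ow) (mxsmooth_rdiff s2 Ow)).
  by rewrite (mxwirtMr _ _ r1) (mxwirtMl _ _ rF) (mxwirtMr _ _ r2) (mxwirtMl _ _ (mxrdiff_tr rX)) mxwirt_tr.
apply: (smooth_flat oO (sM i j) Ow); rewrite -mxwirtE dM.
  rewrite (dF w Ow) (dX w Ow) invr1 scale1r.
  (* The symmetry of the potential absorbs the factor [lam^-1], and its skewness turns the
     derivative of the transposed frame into the same term with the opposite sign. *)
  have e1 : et w *m rot lam^-1 = lam *: (rot lam^-1 *m et w).
    by rewrite (rot_eta _ _ _ (invr_neq0 l0)) scalerA mulfV // scale1r.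
  have e2 : J *m (et w)^T = - (et w *m J).
    have e := eta_skew h hh w.
    have := congr1 (fun A => J *m A *m J) e; rewrite /= mulmxDr mulmxDl mulmx0 mul0mx.
    rewrite (mulmxA J J) (JJ R _) mul1mx -!mulmxA (JJ R _) mulmx1 => /eqP.
    by rewrite addr_eq0 => /eqP.
  move: (rot lam) (rot lam^-1) (Fm w lam) (Fm w 1) (et w) e1 e2 => A A' M X N e1 e2.
  have t1 : A *m (lam^-1 *: (M *m N)) *m A' = A *m M *m A' *m N.
    by rewrite -scalemxAr -scalemxAl -!mulmxA e1 -!scalemxAr scalerA mulVf // scale1r.
  have t2 : J *m (X *m N)^T *m J = - (N *m (J *m X^T *m J)).
    by rewrite trmx_mul (mulmxA J) e2 !mulNmx !mulmxA.
  rewrite t1 t2 mulmxN -!mulmxA addrN.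
  by rewrite mxE.
by rewrite (mxholomorphic_dB hF Ow) (mxholomorphic_dB hX Ow) trmx0 !mulmx0 !mul0mx mulmx0 addr0 mxE.
Qed.

(** The segment from 0 to [z] stays in the star-shaped [D], but it may leave [DI] and meet poles of
    the frames; only its ends, both in [DI], have to be points of continuity. *)
Lemma loop_def_1 lam z : circle lam -> DI z -> loop_def lam z = 1%:M.
Proof.
move=> hl DIz; have [l0 _] := circle_inv hl.
have c1 := circle1.
have F0 k : circle k -> Fm 0 k = 1%:M by move=> hk; case: np => _ /(_ k hk) [].
have M0 : loop_def lam 0 = 1%:M.
  by rewrite /loop_def !F0 // trmx1 !mulmx1 (JJ R _) rotM mulfV // rot1 mulmx1.
apply/matrixP => i j; rewrite -M0.
have sM : mxsmooth DI (loop_def lam).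
  have sc (A : 'M[C]_dim) := mxsmooth_cst oDI A.
  have sF := mxholomorphic_smooth (holo hl); have sX := mxholomorphic_smooth (holo c1).
  exact: (mxsmoothM oDI (mxsmoothM oDI (mxsmoothM oDI (sc (rot lam)) sF) (sc (rot lam^-1)))
    (mxsmoothM oDI (mxsmoothM oDI (sc J) (mxsmooth_tr oDI sX)) (sc J))).
apply: (@punctured_const_eq R D (fun z => loop_def lam z i j) z oD D0).
- by move=> t ht; apply: starD => //; exact: sDI.
- move=> p Dp; apply: flat_punctured_const.
  apply: filterS (filterI (mero_good_near hl Dp) (mero_good_near c1 Dp)) => w [h1 h2] wp.
  have [O1 [O1w [oO1 hF1 dF1]]] := h1 wp; have [O2 [O2w [oO2 hF2 dF2]]] := h2 wp.
  have oO : open (O1 `&` O2) by exact: openI.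
  apply: (@loop_def_flat lam (O1 `&` O2) w i j hl).
  + by split.
  + split; [exact: oO| |by move=> u [/dF1]].
    by move=> a b; case: (hF1 a b) => s e; split=> [|u [/e]//]; apply: (smooth_sub _ s) => u [].
  + split; [exact: oO| |by move=> u [_ /dF2]].
    by move=> a b; case: (hF2 a b) => s e; split=> [|u [_ /e]//]; apply: (smooth_sub _ s) => u [].
- exact: (smooth_cont (sM i j) DIz).
- exact: (smooth_cont (sM i j) DI0).
Qed.

(** The product [loop_def] contains the adjoint [J X^T J] where an inverse is expected, so its value
    1 at [lam = 1] is the orthogonality of [X]. *)
Lemma X_orth z : DI z -> (Fm z 1)^T *m J *m Fm z 1 = J.
Proof.
move=> DIz; have := loop_def_1 circle1 DIz; rewrite /loop_def invr1 rot1 mul1mx mulmx1.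
move=> /mulmx1C e; have := congr1 (mulmx J) e.
by rewrite mulmx1 !mulmxA (JJ R _) mul1mx.
Qed.

Lemma X_gram k l z (A : 'M[C]_(dim, k)) (A' : 'M[C]_(dim, l)) : DI z ->
  (Fm z 1 *m A)^T *m J *m (Fm z 1 *m A') = A^T *m J *m A'.
Proof.
move=> DIz; have e := X_orth DIz; move: (Fm z 1) e => X e.
by rewrite trmx_mul !mulmxA -(mulmxA _ J X) -[in LHS](mulmxA A^T) (mulmxA X^T J) e.
Qed.

Lemma Fm_rot lam z : circle lam -> DI z -> Fm z lam = rot lam^-1 *m Fm z 1 *m rot lam.
Proof.
move=> hl DIz; have [l0 _] := circle_inv hl.
have e := loop_def_1 hl DIz; have iX := orth_inv (X_orth DIz); have uX := orth_unit (X_orth DIz).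
have e1 : rot lam *m Fm z lam *m rot lam^-1 = Fm z 1.
  rewrite /loop_def in e; by rewrite -[LHS]mulmx1 -(mulVmx uX) iX mulmxA e mul1mx.
by rewrite -e1 !mulmxA rotM mulVf // rot1 mul1mx -mulmxA rotM mulVf // rot1 mulmx1.
Qed.

Definition Vfield z : 'M[C]_(dim, m) := Fm z 1 *m N0 R m.
Lemma Vfield_smooth : mxsmooth DI Vfield.
Proof. exact: (mxsmoothM oDI (mxholomorphic_smooth (holo circle1)) (mxsmooth_cst oDI _)). Qed.
Lemma Vfield_dB z : DI z -> dB Vfield z = 0.
Proof.
move=> DIz; have sX := mxholomorphic_smooth (holo circle1).
rewrite (mxwirtMr _ _ (mxsmooth_rdiff sX DIz)) (mxholomorphic_dB (holo circle1) DIz).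
exact: mul0mx.
Qed.
Lemma Vfield_isotropic z : DI z -> (Vfield z)^T *m J *m Vfield z = 0.
Proof.
move=> DIz; rewrite /Vfield (X_gram _ _ DIz); exact: N0JN0.
Qed.
(** The differential equation is available only where the potential is holomorphic. The identity is
    thus proved in a punctured neighbourhood and extended by continuity of the left side. *)
Lemma Vfield_dZ z : DI z -> (Vfield z)^T *m J *m dZ Vfield z = 0.
Proof.
move=> DIz; have sV := Vfield_smooth.
have sg : mxsmooth DI (fun z => (Vfield z)^T *m J *m dZ Vfield z).
  exact: (mxsmoothM oDI (mxsmoothM oDI (mxsmooth_tr oDI sV) (mxsmooth_cst oDI J)) (mxsmooth_wirt oDI _ sV)).
apply/matrixP => i j; rewrite [RHS]mxE.
apply: (@punctured_const_cont R (fun z => ((Vfield z)^T *m J *m dZ Vfield z) i j) z).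
  have c1 := circle1; have Dz := sDI DIz.
  apply: filterS (filterI (near_open oDI DIz) (mero_good_near c1 Dz)) => w [DIw hw] wp.
  have [O [Ow [oO hX dX]]] := hw wp.
  have rX := mxsmooth_rdiff (mxholomorphic_smooth hX) Ow.
  have -> : dZ Vfield w = Fm w 1 *m (et w *m N0 R m).
    by rewrite (mxwirtMr _ _ rX) (dX w Ow) invr1 scale1r mulmxA.
  by rewrite /Vfield (X_gram _ _ DIw) N0Jeta mxE.
exact: (smooth_cont (sg i j) DIz).
Qed.
Lemma Vfield_free z (c : 'cV[C]_m) : DI z -> Vfield z *m c = 0 -> c = 0.
Proof.
move=> DIz; rewrite /Vfield -mulmxA => e; apply: (@N0_free R).
by rewrite -[LHS](mulKmx (orth_unit (X_orth DIz))) e mulmx0.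
Qed.
End Loops.

(** * The Iwasawa factor *)

Section Iwasawa.
Variables (R : realType) (m : nat).
Local Notation C := (Cx R).
Local Notation dim := (m.*2.+2).
Local Notation J := (mink R m.*2.+1).
Local Notation rot := (@rot R m).
Local Notation E0 := (E0 R m).
Local Notation N0 := (N0 R m).

Definition mx_disc_alg p q (M : C -> 'M[C]_(p, q)) := forall i j, disc_alg (fun lam => M lam i j).
Lemma mx_disc_alg_cst p q (A : 'M[C]_(p, q)) : mx_disc_alg (fun=> A).
Proof. by move=> i j; exact: disc_alg_cst. Qed.
Lemma mx_disc_algM p q r (A : C -> 'M[C]_(p, q)) (B : C -> 'M[C]_(q, r)) :
  mx_disc_alg A -> mx_disc_alg B -> mx_disc_alg (fun lam => A lam *m B lam).
Proof.
move=> dA dB i j; have := @disc_alg_sum R _ (index_enum 'I_q) (fun k lam => A lam i k * B lam k j)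
  (fun k => disc_algM (dA i k) (dB k j)).
by apply: disc_alg_ext => lam; rewrite mxE.
Qed.
Lemma mx_disc_alg_tr p q (A : C -> 'M[C]_(p, q)) : mx_disc_alg A -> mx_disc_alg (fun lam => (A lam)^T).
Proof. by move=> dA i j; apply: disc_alg_ext (dA j i) => lam; rewrite mxE. Qed.
Lemma mx_disc_alg_rot p q mu (A : C -> 'M[C]_(p, q)) : circle mu -> mx_disc_alg A ->
  mx_disc_alg (fun lam => A (mu * lam)).
Proof. by move=> hm dA i j; exact: (disc_alg_rot hm (dA i j)). Qed.
Lemma mx_disc_alg_real p q (A : C -> 'M[C]_(p, q)) : mx_disc_alg A ->
  (forall lam, circle lam -> mxconj (A lam) = A lam) -> forall lam, cdisc lam -> A lam = A 0.
Proof.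
move=> dA rA lam hl; apply/matrixP => i j.
apply: (disc_alg_real_cst (dA i j)) hl => u /rA /(congr1 (fun M : 'M_(p, q) => M i j)).
by rewrite mxconjE => h; apply: Im_real; apply/CrealP.
Qed.

Lemma circleM (a b : C) : circle a -> circle b -> circle (a * b).
Proof. by rewrite /circle /= normrM => -> ->; rewrite mulr1. Qed.
Lemma circleV (a : C) : circle a -> circle a^-1.
Proof. by rewrite /circle /= normfV => ->; rewrite invr1. Qed.
Lemma circle_cdisc (a : C) : circle a -> cdisc a.
Proof. by rewrite /circle /cdisc /= => ->. Qed.

Variables (F Fp : C -> 'M[C]_dim) (X : 'M[C]_dim).
Hypotheses (SF : forall lam, circle lam -> SOp (F lam))
  (XF : forall lam, circle lam -> rot lam^-1 *m X *m rot lam = F lam *m Fp lam)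
  (oX : X^T *m J *m X = J)
  (oFp : forall lam, cdisc lam -> (Fp lam)^T *m J *m Fp lam = J)
  (dFp : mx_disc_alg Fp) (Fp0 : exists a b, Fp 0 = dblk a 0 0 b).

(* [F(mu lam)^-1 rot(mu)^-1 F(lam) rot(mu)], written with [Fp] only: it is real on
   the circle and lies in the disc algebra, hence does not depend on [lam]. *)
Definition kmap mu lam := Fp (mu * lam) *m rot mu^-1 *m (J *m (Fp lam)^T *m J) *m rot mu.

Lemma kmap_disc_alg mu : circle mu -> mx_disc_alg (kmap mu).
Proof.
move=> hm; have c (A : 'M[C]_dim) := mx_disc_alg_cst A.
exact: (mx_disc_algM (mx_disc_algM (mx_disc_algM (mx_disc_alg_rot hm dFp) (c _))
  (mx_disc_algM (mx_disc_algM (c _) (mx_disc_alg_tr dFp)) (c _))) (c _)).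
Qed.

(** The factorization is inserted at [mu * lam] and at [lam]; the rotations between the two copies
    of [X] multiply to 1 and [X] cancels. Every remaining factor is real on the circle. *)
Lemma kmap_circle mu lam : circle mu -> circle lam ->
  kmap mu lam = invmx (F (mu * lam)) *m rot mu^-1 *m F lam *m rot mu.
Proof.
move=> hm hl; have [m0 _] := circle_inv hm; have [l0 _] := circle_inv hl.
have hml := circleM hm hl.
have o1 := oFp (circle_cdisc hl); have iF := orth_inv o1; have uFp := orth_unit o1.
have [_ oF1 _ _] := SF hl; have [_ oF2 _ _] := SF hml.
have uF1 := orth_unit oF1; have uF2 := orth_unit oF2; have uX := orth_unit oX.
rewrite /kmap -iF; congr (_ *m _).
have e2 : Fp (mu * lam) = invmx (F (mu * lam)) *m (rot (mu * lam)^-1 *m X *m rot (mu * lam)).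
  by rewrite (XF hml) mulKmx.
have e1 : rot lam^-1 *m X *m rot lam *m invmx (Fp lam) = F lam.
  by rewrite (XF hl) mulmxK.
rewrite e2; move: (invmx (F (mu * lam))) => Fi; rewrite -e1.
have eq : mu * lam * mu^-1 = lam by rewrite mulrAC mulfV // mul1r.
have r1 : rot (mu * lam) *m rot mu^-1 = rot lam by rewrite rotM eq.
have r2 : rot mu^-1 *m rot lam^-1 = rot (mu * lam)^-1 by rewrite rotM invfM.
move: (rot (mu * lam)^-1) (rot (mu * lam)) (rot mu^-1) (rot lam^-1) (rot lam) r1 r2 => a b c d e r1 r2.
by move: (invmx (Fp lam)) => G; rewrite -r1 -r2 !mulmxA.
Qed.

Lemma kmap_const mu lam : circle mu -> cdisc lam -> kmap mu lam = kmap mu 0.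
Proof.
move=> hm; apply: (mx_disc_alg_real (kmap_disc_alg hm)) => u hu.
have h1 : mxconj (F u) = F u by case: (SF hu) => r _ _ _; apply/eqP; rewrite -mxconj_real.
have [rF oF _ _] := SF (circleM hm hu).
have h2 : mxconj (F (mu * u)) = F (mu * u) by apply/eqP; rewrite -mxconj_real.
rewrite (kmap_circle hm hu) !mxconjM (mxconj_inv (orth_unit oF)) h1 h2.
by rewrite (rot_conj _ hm) (rot_conj _ (circleV hm)).
Qed.

(** [Fp 0] is block diagonal and the rotations act on the second block only, so in the first block
    [Fp 0] meets its own inverse. *)
Lemma E0_kmap0 mu : circle mu -> E0 *m kmap mu 0 = E0.
Proof.
move=> hm; have c0 : cdisc (0 : C) by rewrite /cdisc /= normr0.
have o1 := oFp c0; have iF := orth_inv o1; have uF := orth_unit o1.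
case: Fp0 => a [b e]; rewrite /kmap mulr0 -iF !mulmxA.
rewrite {1}e E0_dblk -(mulmxA a) E0_rot.
have h : a *m E0 *m invmx (Fp 0) = E0 by rewrite -(E0_dblk a b) -e mulmxK.
by rewrite h E0_rot.
Qed.

(** The values of [kmap] at 1 and at 0 agree, and the first two rows of the latter are known;
    solving for [Fp mu] gives the formula. *)
Lemma E0_Fp mu : circle mu -> E0 *m Fp mu = E0 *m Fp 1 *m rot mu.
Proof.
move=> hm; have [m0 _] := circle_inv hm; have c1 := circle1 R.
have := E0_kmap0 hm; rewrite -(kmap_const hm (circle_cdisc c1)) /kmap mulr1.
have o1 := oFp (circle_cdisc c1); rewrite -(orth_inv o1); have uF := orth_unit o1.
move=> h; have := congr1 (fun A => A *m rot mu^-1 *m Fp 1 *m rot mu) h.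
rewrite /= E0_rot.
have rc : rot mu *m rot mu^-1 = 1%:M by rewrite rotM mulfV // rot1.
have cr : rot mu^-1 *m rot mu = 1%:M by rewrite rotM mulVf // rot1.
have GP := mulVmx uF.
move: (rot mu) (rot mu^-1) (Fp 1) (Fp mu) E0 rc cr GP => r c P M E rc cr GP <-.
by rewrite !mulmxA -(mulmxA _ r c) rc mulmx1 -(mulmxA _ (invmx P) P) GP mulmx1 -(mulmxA _ c r) cr mulmx1.
Qed.

(* [lam * E0 Fp(lam) N0] is constant on the circle, hence on the disc, and it
   vanishes at [lam = 0]. *)
Lemma E0_Fp1_N0 : E0 *m Fp 1 *m N0 = 0.
Proof.
pose c := E0 *m Fp 1 *m N0.
pose G lam : 'M[C]_(2, m) := lam%:M *m (E0 *m Fp lam *m N0) - c.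
have dG : mx_disc_alg G.
  have d1 : mx_disc_alg (fun lam => E0 *m Fp lam *m N0).
    exact: (mx_disc_algM (mx_disc_algM (mx_disc_alg_cst E0) dFp) (mx_disc_alg_cst N0)).
  move=> i j; apply: disc_alg_ext (disc_algD (disc_algM (@disc_alg_id R) (d1 i j)) (disc_alg_cst (- c i j))).
  by move=> lam; rewrite /G mul_scalar_mx !mxlinE.
have G0 lam : circle lam -> G lam = 0.
  move=> hl; have [l0 _] := circle_inv hl.
  rewrite /G (E0_Fp hl) -mulmxA rot_N0 -scalemxAr mul_scalar_mx scalerA mulfV // scale1r.
  exact: subrr.
have z0 : cdisc (0 : C) by rewrite /cdisc /= normr0.
have z1 := circle_cdisc (circle1 R).
have e : G 1 = G 0.
  by apply: (mx_disc_alg_real dG) z1 => u hu; rewrite G0 // mxconj0.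
have := G0 1 (circle1 R); rewrite e /G raddf0 mul0mx sub0r => /eqP; rewrite oppr_eq0 => /eqP.
by [].
Qed.
End Iwasawa.

(** * From an adapted pair to the surfaces *)

Section Surfaces.
Variables (R : realType) (m : nat).
Local Notation C := (Cx R).
Local Notation dim := (m.*2.+2).

Lemma sphere_pointZ n (k : C) (x : 'cV[C]_n.+2) : k != 0 -> sphere_point (k *: x) = sphere_point x.
Proof.
move=> k0; apply/matrixP => i j; rewrite !mxE invfM.
by rewrite mulrACA mulfV // mul1r.
Qed.

(** On [U] the component [isoW] has no zero, so the normalizing factor exists there. The normalized
    lift is canonical, and the inverse factor on [Yh] keeps the pair adapted without changing the
    two maps to the sphere. *)
Lemma adapted_surfaces (D : set C) (Y Yh : C -> 'cV[C]_dim) (V : C -> 'M[C]_(dim, m)) :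
  (0 < m)%N -> open D -> adapted D Y Yh V ->
  let y := fun z => sphere_point (Y z) in
  let yh := fun z => sphere_point (Yh z) in
  let U := [set z | D z /\ immersed_at y z] in
  [/\ willmore_surface U y, H_totally_isotropic m U y & adjoint_transform U y yh].
Proof.
move=> m0 oD ad y yh U.
have UE : U = [set z | D z /\ isoW Y Yh z != 0].
  by apply/seteqP; split=> z [Dz h]; split=> //; apply/(immersed_iff oD ad Dz).
have UD : U `<=` D by move=> z [].
have oU : open U.
  rewrite UE openE => z [Dz pz].
  have [i hi] : exists i, isoW Y Yh z i ord0 != 0.
    apply/existsP; apply: contraT; rewrite negb_exists => /forallP h; move: pz.
    case/eqP; apply/matrixP => i j; rewrite ord1 mxE; apply/eqP; have := h i; by rewrite negbK.
  have sp := smooth_isoW oD ad.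
  have nf : \forall w \near z, isoW Y Yh w i ord0 != 0.
    by apply: (cvgr_neq0 _ (smooth_cont (sp i ord0) Dz) hi).
  apply: filterS (filterI (near_open oD Dz) nf) => w [Dw pw].
  split; first exact: Dw.
  by move: pw; apply: contraNneq => h; rewrite h mxE.
have adU : adapted U Y Yh V := adapted_sub UD ad.
have ne z : U z -> isoW Y Yh z != 0 by rewrite UE => -[].
pose f := normf Y Yh.
have sf : smooth U f := smooth_normf oU adU ne.
have f0 z : U z -> 0 < f z := normf_gt0 oU adU ne (z := z).
have fn z : U z -> f z != 0 by move=> /f0; exact: lt0r_neq0.
have adL := adapted_scale oU adU sf f0.
pose L z := f z *: Y z; pose Lh z := (f z)^-1 *: Yh z.
have qq z : U z -> ip (isoW L Lh z) (mxconj (isoW L Lh z)) = 1 / 2.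
  by move=> Uz; rewrite (isoW_scale adU sf f0 Uz); exact: (normf_half oU adU ne Uz).
have hy z : U z -> sphere_point (L z) = y z by move=> Uz; exact: (sphere_pointZ _ (fn z Uz)).
have hyh z : U z -> sphere_point (Lh z) = yh z.
  by move=> Uz; apply: (sphere_pointZ _ (invr_neq0 (fn z Uz))).
have ci : conformal_immersion U y.
  split; first exact: (smooth_sphere oU adU).
  by move=> z [Dz iz]; split; [exact: iz|exact: (sphere_conformal oD ad Dz)].
split.
- exact: (willmore_liftP oU adL qq ci hy).
- exact: (H_totally_isotropicP oU adL qq m0 hy).
- exact: (adjoint_liftP oU adL qq hy hyh).
Qed.
End Surfaces.

(** * Adapted pairs from Lorentz frames *)

Section LorentzFrame.
Variables (R : realType) (m : nat).
Local Notation C := (Cx R).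
Local Notation dim := (m.*2.+2).
Local Notation J := (mink R m.*2.+1).
Local Notation E0 := (E0 R m).
Local Notation o1 := (lift ord0 ord0 : 'I_dim).

Variables (A : 'M[C]_dim) (V : 'M[C]_(dim, m)).
Hypotheses (SA : SOp A) (EV : E0 *m invmx A *m V = 0) (VV : V^T *m J *m V = 0)
  (Vf : forall c : 'cV[C]_m, V *m c = 0 -> c = 0).
Let rA : mxconj A = A. Proof. by case: SA => r _ _ _; apply/eqP; rewrite -mxconj_real. Qed.
Let oA : A^T *m J *m A = J. Proof. by case: SA. Qed.
Let A0 : 0 < A ord0 ord0. Proof. by case: SA. Qed.

Lemma ip_cols i j : ip (col i A) (col j A) = J i j.
Proof. by rewrite -ipE !colE mulmxA -colE oA mxE. Qed.
Lemma conj_col i : mxconj (col i A) = col i A.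
Proof. by apply/matrixP => a b; rewrite mxconjE !mxE -[in RHS]rA mxconjE. Qed.

Let k2 : (sqrtC 2 / 2 : C) * (sqrtC 2 / 2) = 1 / 2.
Proof.
have := sqrtCK (2 : C); move: (sqrtC 2) => s; rewrite expr2 => e.
by transitivity (s * s / 4); [field|rewrite e; field].
Qed.
Let kpos : 0 < (sqrtC 2 / 2 : C).
Proof. by rewrite divr_gt0 // ?sqrtC_gt0 ltr0n. Qed.
Let kr : (sqrtC 2 / 2 : C)^* = sqrtC 2 / 2.
Proof. by apply: conj_Creal; apply: gtr0_real. Qed.
Let J00 : J ord0 ord0 = -1. Proof. by rewrite !mxE. Qed.
Let J11 : J o1 o1 = 1. Proof. by rewrite !mxE. Qed.
Let J01 : J ord0 o1 = 0. Proof. by rewrite !mxE. Qed.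

(** The hypothesis [EV] says that [V] has no coordinates along the first two columns of [A]; since
    the inverse of [A] is [J A^T J], this is orthogonality. *)
Lemma frame_VJ (i : 'I_dim) : (i < 2)%N -> V^T *m J *m col i A = 0.
Proof.
move=> i2; pose M := A^T *m J *m V.
have e : E0 *m M = 0.
  have h : K1 R *m E0 = E0 *m J.
    by rewrite J_block mul_drow drow_blk !mulmx0 !mul0mx mulmx1 mul1mx addr0 add0r.
  have KK : K1 R *m K1 R = 1%:M := JJ R 0.
  have := congr1 (mulmx (K1 R)) EV; rewrite (orth_inv oA) !mulmxA h mulmx0.
  by rewrite -(mulmxA _ J J) (JJ R _) mulmx1.
apply/matrixP => a b; rewrite ord1 ipE [RHS]mxE.
have := @E0_mul R m m M (Ordinal i2) i a erefl.
rewrite e mxE => /esym; rewrite ipC -ipE => <-.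
by rewrite /M !colE mulmxA -colE mxE.
Qed.

Lemma frame_adapted_at : adapted_at (Y_of A) (Yhat_of A) V.
Proof.
pose e0 := col ord0 A; pose e1 := col o1 A.
have i00 : ip e0 e0 = -1 by rewrite ip_cols J00.
have i11 : ip e1 e1 = 1 by rewrite ip_cols J11.
have i01 : ip e0 e1 = 0 by rewrite ip_cols J01.
have i10 : ip e1 e0 = 0 by rewrite ipC.
rewrite /Y_of /Yhat_of /Defs.col0 /Defs.col1 -/e0 -/e1; move: kr k2 kpos; set k := sqrtC 2 / 2 => hr hk hp.
have kn : k != 0 by exact: lt0r_neq0.
have c0 : mxconj e0 = e0 := conj_col _; have c1 : mxconj e1 = e1 := conj_col _.
have v0 : V^T *m J *m e0 = 0 by exact: frame_VJ.
have v1 : V^T *m J *m e1 = 0 by exact: frame_VJ.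
split; split.
- by rewrite mxconjZ mxconjB hr c0 c1.
- by rewrite mxconjZ mxconjD hr c0 c1.
- by rewrite !(ipE2, i00, i11, i01, i10); ring.
- by rewrite !(ipE2, i00, i11, i01, i10); ring.
- by rewrite !(ipE2, i00, i11, i01, i10); transitivity (-2 * (k * k)); [ring|rewrite hk; field].
- exact: VV.
- by rewrite -scalemxAr mulmxBr v0 v1 subr0 scaler0.
- by rewrite -scalemxAr mulmxDr v0 v1 addr0 scaler0.
- exact: Vf.
- move=> x; rewrite !ipE2 => /eqP; rewrite mulf_eq0 (negbTE kn) /= subr_eq0 => /eqP h1.
  move=> /eqP; rewrite mulf_eq0 (negbTE kn) /= h1 -mulr2n mulrn_eq0 /= => /eqP x1.
  have x0 : ip x e0 = 0 by rewrite h1.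
  (* Coordinates of [x] in the Lorentz frame: orthogonality to the time-like column kills the first
     one, and the form becomes a sum of squared moduli. *)
  have [c [xE c00]] : exists c, x = A *m J *m c /\ c ord0 ord0 = 0.
    exists (A^T *m J *m x); split; last by rewrite ipE ipC.
    by rewrite !mulmxA (orth_tr oA) (JJ R _) mul1mx.
  have E : ip (mxconj x) x = ip (mxconj c) c.
    have g (u v : 'cV[C]_dim) : ip (A *m u) (A *m v) = ip u v.
      by rewrite !ip_def trmx_mul -!mulmxA (mulmxA J A) (mulmxA A^T) (mulmxA A^T) oA.
    rewrite xE !mxconjM rA conjJ -!(mulmxA A) g !ip_def trmx_mul trJ -!mulmxA.
    by rewrite (mulmxA J J) (JJ R _) mul1mx.
  have S : ip (mxconj c) c = \sum_j `|c (lift ord0 j) ord0| ^+ 2.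
    rewrite ip_tl c00 mulr0 oppr0 add0r mxE; apply: eq_bigr => j _.
    by rewrite !mxE normCK mulrC.
  rewrite E S; split; first by rewrite sumr_ge0 // => j _; rewrite exprn_ge0.
  move/eqP; rewrite psumr_eq0 => [/allP h|j _]; last by rewrite exprn_ge0.
  rewrite xE; suff -> : c = 0 by rewrite mulmx0.
  apply/matrixP => i j; rewrite ord1 mxE; case: (unliftP ord0 i) => [l ->|-> //].
  by have := h l (mem_index_enum l); rewrite expf_eq0 /= normr_eq0 => /eqP.
Qed.

(** The first row of [A] has Lorentz square -1, which bounds the modulus of its second entry
    strictly by the positive corner; sum and difference of the two are therefore positive. *)
Lemma frame_pos : 0 < Y_of A ord0 ord0 /\ 0 < Yhat_of A ord0 ord0.
Proof.
have /mxOverP r : A \is a mxOver Num.real by case: SA.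
have sq : A ord0 o1 ^+ 2 <= A ord0 ord0 ^+ 2 - 1.
  rewrite -(orth_row oA) (bigD1 ord0) //= lerDl sumr_ge0 // => i _.
  by apply: real_sqr_ge0; exact: r.
have lt : `|A ord0 o1| < A ord0 ord0.
  rewrite -(ltr_pXn2r (n := 2)) ?nnegrE ?normr_ge0 ?ltW //.
  by rewrite real_normK ?r //; apply: le_lt_trans sq _; rewrite ltrBlDr ltrDl ltr01.
move: lt; rewrite real_ltr_norml ?r // => /andP [h1 h2].
rewrite /Y_of /Yhat_of /Defs.col0 /Defs.col1 !mxE; split; apply: mulr_gt0 => //; first by rewrite subr_gt0.
by rewrite -(opprK (A ord0 o1)) subr_gt0 ltrNl.
Qed.
End LorentzFrame.

(** * The harmonic map of the normalized potential *)

Section Main.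
Variables (R : realType) (m : nat).
Local Notation C := (Cx R).
Local Notation dim := (m.*2.+2).
Local Notation J := (mink R m.*2.+1).
Variables (D DI : set C) (h hh : 'I_m -> C -> C) (Fm F Fp : C -> C -> 'M[C]_dim)
  (B : set 'M[C]_dim).
Hypotheses (hD : D = [set z | `|z| < 1] \/ D = setT)
  (np : normalized_potential D (eta_m1 h hh) Fm)
  (oDI : open DI) (DI0 : DI 0) (sDI : DI `<=` D)
  (iB : iwasawa_subgroup B) (iw : iwasawa_decomposition B DI Fm F Fp).

Let oD : open D.
Proof. by case: hD => ->; [exact: open_disc|exact: openT]. Qed.
Let starD z (t : R) : D z -> 0 <= t <= 1 -> D ((t%:C)%C * z).
Proof.
case: hD => ->; last by [].
move=> /= hz /andP [t0 t1]; rewrite normrM.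
have t0' : 0 <= (t%:C)%C :> C by rewrite -[0]/((0%:C)%C) lecRE.
have t1' : (t%:C)%C <= 1 :> C by rewrite -[1]/((1%:C)%C) lecRE.
by rewrite ger0_norm //; apply: le_lt_trans hz; rewrite ler_piMl.
Qed.

Lemma iwasawa_adapted : adapted DI (fun z => Y_of (F z 1)) (fun z => Yhat_of (F z 1)) (Vfield Fm).
Proof.
have c1 := circle1 R; have D0 : D 0 := sDI DI0.
case: iw => iw1 iw2 iw3 iw4 iw5.
have holo lam : circle lam -> mxholomorphic DI (Fm^~ lam) by move=> /iw1 [].
have sF : mxsmooth DI (F^~ 1) by case: (iw1 1 c1).
have sc j : mxsmooth DI (fun z => col j (F z 1)) := mxsmooth_col oDI j sF.
have SF z : DI z -> SOp (F z 1) by move=> /iw2 /(_ c1) [].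
split.
  split.
  - exact: (mxsmoothZ oDI (smooth_cst oDI _) (mxsmoothB oDI (sc _) (sc _))).
  - exact: (mxsmoothZ oDI (smooth_cst oDI _) (mxsmoothD oDI (sc _) (sc _))).
  - exact: (Vfield_smooth oDI holo).
move=> z Dz.
have oX := X_orth np oD D0 sDI oDI DI0 starD holo Dz.
have [p1 p2] := frame_pos (SF z Dz).
split.
- apply: (frame_adapted_at (SF z Dz)).
  + have XF lam : circle lam -> rot m lam^-1 *m Fm z 1 *m rot m lam = F z lam *m Fp z lam.
      move=> hl; rewrite -(Fm_rot np oD D0 sDI oDI DI0 starD holo hl Dz).
      by case: (iw2 z lam Dz hl).
    have SFl lam : circle lam -> SOp (F z lam) by move=> hl; case: (iw2 z lam Dz hl).
    have oFp lam : cdisc lam -> (Fp z lam)^T *m J *m Fp z lam = J.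
      by move=> hl; case: (iw3 z lam Dz hl) => -[].
    have dFp : mx_disc_alg (Fp z).
      by move=> i j; have [hp cp] := iw4 z Dz; split; [exact: hp|exact: cp].
    have Fp0 : exists a b, Fp z 0 = dblk a 0 0 b.
      case: iB => BK _ _ _ _; have [_ [a [b [e _]]]] := BK _ (iw5 z Dz).
      by exists a, b; rewrite e.
    (* At [lam = 1] the rotations are trivial, and the factorization identifies the inverse of [F]
       applied to [Vfield] with [Fp 1 *m N0]. *)
    have := E0_Fp1_N0 SFl XF oX oFp dFp Fp0.
    have := XF 1 c1; rewrite invr1 rot1 mul1mx mulmx1 => e.
    have [_ oF _ _] := SF z Dz; have uF := orth_unit oF.
    by rewrite /Vfield e !mulmxA (mulmxKV uF).
  + exact: (Vfield_isotropic np oD D0 sDI oDI DI0 starD holo Dz).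
  + by move=> c; exact: (Vfield_free np oD D0 sDI oDI DI0 starD holo Dz).
- exact: (Vfield_dB holo Dz).
- exact: (Vfield_dZ np oD D0 sDI oDI DI0 starD holo Dz).
- exact: p1.
- exact: p2.
Qed.

Lemma iwasawa_uniton : finite_uniton_number_at_most 2 DI (fun z => F z 1).
Proof.
apply: (finite_uniton oDI iwasawa_adapted).
by move=> z Dz; case: iw => _ /(_ z 1 Dz (circle1 R)) [].
Qed.
End Main.

Theorem theorem5p1 (R : realType) (m : nat) (D DI : set (Cx R))
    (h hh : 'I_m -> Cx R -> Cx R)
    (Fm F Fp : Cx R -> Cx R -> 'M[Cx R]_(m.*2.+2)) (B : set 'M[Cx R]_(m.*2.+2)) :
  (0 < m)%N ->
  D = [set z | `|z| < 1] \/ D = setT ->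
  (forall j, meromorphic D (h j)) ->
  (forall j, meromorphic D (hh j)) ->
  normalized_potential D (eta_m1 h hh) Fm ->
  open DI -> DI 0 -> DI `<=` D ->
  iwasawa_subgroup B ->
  iwasawa_decomposition B DI Fm F Fp ->
  let y := fun z => sphere_point (Y_of (F z 1)) in
  let yh := fun z => sphere_point (Yhat_of (F z 1)) in
  let U := [set z | DI z /\ immersed_at y z] in
  let Uh := [set z | DI z /\ immersed_at yh z] in
  [/\ [/\ willmore_surface U y, H_totally_isotropic m U y
        & adjoint_transform U y yh],
      [/\ willmore_surface Uh yh, H_totally_isotropic m Uh yh
        & adjoint_transform Uh yh y]
    & finite_uniton_number_at_most 2 DI (fun z => F z 1)].
Proof.
move=> m0 hD _ _ np oDI DI0 sDI iB iw y yh U Uh.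
have ad := iwasawa_adapted hD np oDI DI0 sDI iB iw.
split.
- exact: (adapted_surfaces m0 oDI ad).
- exact: (adapted_surfaces m0 oDI (adapted_sym ad)).
- exact: (iwasawa_uniton hD np oDI DI0 sDI iB iw).
Qed.
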